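(* Let $G$ be any one of the twenty (pairwise non-isomorphic) non-trivial snarks on $22$ vertices (these include the two Loupekine snarks). Then a $G$ design of order $n$ exists if and only if $n \equiv 1$ or $22 \pmod{33}$.
   Context: All graphs are simple. A snark is a connected, bridgeless 3-regular graph with chromatic index 4. A snark is non-trivial if it has girth at least 5 and there are no three edges whose deletion yields a disconnected graph each of whose components is non-trivial (has at least one edge). Up to isomorphism there are exactly twenty non-trivial snarks on 22 vertices. For a graph $G$, a $G$ design of order $n$ is a partition of the edge set of the complete graph $K_n$ into edge sets of subgraphs each isomorphic to $G$. By convention the empty set is a $G$ design of order $1$. *)

(* Defs.v *)
From mathcomp Require Import all_boot.

Set Implicit Arguments.
Unset Strict Implicit.
Unset Printing Implicit Defensive.

Section Graphs.
Variables (T : finType) (e : rel T).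

Definition simple_graph : Prop := symmetric e /\ irreflexive e.

Definition edges : {set {set T}} := [set [set p.1; p.2] | p : T * T & e p.1 p.2].

Definition del_edges (F : {set {set T}}) : rel T :=
  [rel x y | e x y && ([set x; y] \notin F)].

Definition regular (d : nat) : Prop := forall x, #|[set y | e x y]| = d.

Definition connected : Prop := 0 < #|T| /\ forall x y, connect e x y.

(* Colours are natural numbers below k rather than elements of 'I_k, so that
   an edgeless graph is 0-edge-colourable. *)
Definition edge_colorable (k : nat) : Prop :=
  exists c : {set T} -> nat,
    (forall E, E \in edges -> c E < k) /\
    (forall E E', E \in edges -> E' \in edges -> E != E' ->
       E :&: E' != set0 -> c E != c E').

Definition has_chromatic_index (k : nat) : Prop :=
  edge_colorable k /\ forall j, edge_colorable j -> k <= j.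

Definition girth_at_least (g : nat) : Prop :=
  forall c : seq T, 3 <= size c -> ucycle e c -> g <= size c.

(* The set of vertices of the component of x is [set y | connect e x y]. *)
Definition components_nontrivial : Prop :=
  forall x, exists y z, connect e x y /\ e y z.

End Graphs.

Definition bridge (T : finType) (e : rel T) (E : {set T}) : Prop :=
  E \in edges e /\ n_comp e T < n_comp (del_edges e [set E]) T.

Definition bridgeless (T : finType) (e : rel T) : Prop :=
  forall E, ~ bridge e E.

Definition snark (T : finType) (e : rel T) : Prop :=
  [/\ simple_graph e, connected e, bridgeless e, regular e 3
    & has_chromatic_index e 4].

Definition nontrivial_snark (T : finType) (e : rel T) : Prop :=
  [/\ snark e, girth_at_least e 5
    & ~ exists F : {set {set T}},
        [/\ F \subset edges e, #|F| = 3, ~ connected (del_edges e F)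
          & components_nontrivial (del_edges e F)]].

Definition complete_graph (n : nat) : rel 'I_n := [rel i j | i != j].

(* A subgraph is given by its vertex set V and its edge set B. *)
Definition is_subgraph (U : finType) (k : rel U)
    (V : {set U}) (B : {set {set U}}) : Prop :=
  B \subset edges k /\ forall E, E \in B -> E \subset V.

Definition isomorphic_to (T : finType) (e : rel T) (U : finType)
    (V : {set U}) (B : {set {set U}}) : Prop :=
  exists f : T -> U,
    [/\ injective f, f @: [set: T] = V
      & forall x y, ([set f x; f y] \in B) = e x y].

Definition is_design (T : finType) (e : rel T) (n : nat)
    (D : {set {set {set 'I_n}}}) : Prop :=
  partition D (edges (@complete_graph n)) /\
  forall B, B \in D ->
    exists V : {set 'I_n}, is_subgraph (@complete_graph n) V B /\
                           isomorphic_to e V B.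

Definition design_exists (T : finType) (e : rel T) (n : nat) : Prop :=
  exists D : {set {set {set 'I_n}}}, is_design e D.

(* Main.v *)
Require Import Defs.
From Stdlib Require Import NArith.
From mathcomp Require Import all_boot zify.

Set Implicit Arguments.
Unset Strict Implicit.
Unset Printing Implicit Defensive.

(** Each block of a design has 66 ordered edges and meets each of its points in
    three of them, so 66 divides n (n - 1) and 3 divides n - 1.

    Conversely, the snark is first identified with one of twenty explicit
    graphs. A set of vertices is k-dense when its cyclomatic excess is at least
    k. A cubic graph of girth at least 5 on 22 vertices contains small dense
    sets, and a minimal dense set grows ear by ear; this yields a cut of the
    graph into two halves taken from short lists of poles. All gluings of two
    poles are enumerated, discarding those to which a 3-edge-colouring extends;
    every gluing that is left is one of the twenty graphs or has a nontrivial
    cut of at most three edges.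

    For each of the twenty graphs, base blocks developed under cyclic groups
    decompose K_22, K_34, K_55, K_67, K_121 and some complete multipartite
    graphs. Writing n = 33 t + 1 or n = 66 t + 22 or n = 66 t + 55 and giving
    weight 33 or 66 to the points of a transversal design (whose groups are
    filled recursively) produces all the other orders. *)

(** In a cubic graph a set with s vertices and s + k inner edges is left by s - 2k edges, so density
    on few vertices means a small cut. The halves that occur have cuts of five edges (11 + 11
    vertices), six (10 + 12) or seven (11 + 11 or 9 + 13), which keeps both the lists of halves and
    the matchings of dangling edges small enough to enumerate. The first dense set exists because no
    cubic graph on 22 vertices has girth 7.

    The exhaustive steps (ears, gluings, girth search) are proved complete. Isomorphisms,
    colourings, dense subsets, small cuts and base blocks come from unverified searches, and only
    their output is checked by computation.

    The base blocks depend on the graph, the recursion does not. One recursion, with a weight for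
    ordinary points, a weight for the last point and a hole size, serves all orders, with parameters
    (33, 33, 1) and (66, 33, 22). *)

(** * Dense vertex sets in a cubic graph *)

Section Density.

Variables (T : finType) (e : rel T).
Hypothesis esym : symmetric e.
Hypothesis eirr : irreflexive e.
Hypothesis cubic : forall x, #|[set y | e x y]| = 3.

Implicit Types (X Y Z : {set T}) (x y z : T).

Definition deg_in (X : {set T}) (x : T) : nat := #|[set y in X | e x y]|.

Definition degsum (X : {set T}) : nat := \sum_(x in X) deg_in X x.

(** [degsum X] is twice the number of inner edges, so the edges exceed the vertices by at least [k];
    when connected, such a set has more than [k] independent cycles. *)
Definition dense (k : nat) (X : {set T}) : bool :=
  2 * #|X| + 2 * k <= degsum X.

Lemma deg_inE X x : deg_in X x = \sum_(y in X) e x y.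
Proof.
rewrite /deg_in -sum1_card (eq_bigl (fun y => (y \in X) && e x y)).
  by rewrite big_mkcondr; apply: eq_bigr => y _; case: (e x y).
by move=> y; rewrite inE.
Qed.

Lemma deg_inS X Y x : X \subset Y -> deg_in X x <= deg_in Y x.
Proof.
by move=> /subsetP s; apply/subset_leq_card/subsetP => y; rewrite !inE => /andP[/s -> ->].
Qed.

Lemma deg_in_le3 X x : deg_in X x <= 3.
Proof. by rewrite -(cubic x); apply/subset_leq_card/subsetP => y; rewrite !inE => /andP[]. Qed.

Lemma deg_inT x : deg_in setT x = 3.
Proof. by rewrite -(cubic x); apply: eq_card => y; rewrite !inE. Qed.

Lemma deg_inU1 X x y : y \notin X -> deg_in (y |: X) x = e x y + deg_in X x.
Proof. by move=> yX; rewrite !deg_inE big_setU1. Qed.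

Lemma deg_inC X x : deg_in X x + deg_in (~: X) x = 3.
Proof.
rewrite -[RHS](deg_inT x) /deg_in -(cardsID X [set y in setT | e x y]).
by congr (_ + _); apply: eq_card => y; rewrite !inE /= 1?andbC // andbT.
Qed.

Lemma deg_in_gt0 X x y : y \in X -> e x y -> 0 < deg_in X x.
Proof. by move=> yX exy; apply/card_gt0P; exists y; rewrite inE yX. Qed.

Lemma deg_in_gt0P X x : 0 < deg_in X x -> exists2 y, y \in X & e x y.
Proof. by move=> /card_gt0P[y]; rewrite inE => /andP[yX exy]; exists y. Qed.

Lemma deg_in_gt1 X x y z :
  y \in X -> z \in X -> y != z -> e x y -> e x z -> 1 < deg_in X x.
Proof.
move=> yX zX yz exy exz; apply/card_gt1P; exists y, z.
by rewrite !inE yX zX exy exz.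
Qed.

Lemma deg_in_gt1P X x (y : T) :
  1 < deg_in X x -> exists z, [/\ z \in X, e x z & z != y].
Proof.
move=> /card_gt1P[a [b]]; rewrite !inE => -[/andP[aX xa] /andP[bX xb] ab].
have [ay|ay] := eqVneq a y; last by exists a.
by exists b; split=> //; rewrite -ay eq_sym.
Qed.

Lemma degsumU1 X y : y \notin X -> degsum (y |: X) = degsum X + 2 * deg_in X y.
Proof.
move=> yX; rewrite /degsum big_setU1 //= deg_inU1 // eirr add0n.
rewrite (eq_bigr (fun x => e x y + deg_in X x)); last by move=> x _; rewrite deg_inU1.
rewrite big_split /= (eq_bigr (fun x => nat_of_bool (e y x))); last by move=> x _; rewrite esym.
by rewrite -deg_inE; lia.
Qed.

Lemma degsumD1 X y : y \in X -> degsum X = degsum (X :\ y) + 2 * deg_in (X :\ y) y.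
Proof. by move=> yX; rewrite -degsumU1 ?setD1K // !inE eqxx. Qed.

Lemma deg_inD1 X y : deg_in (X :\ y) y = deg_in X y.
Proof.
by apply: eq_card => z; rewrite !inE; have [->|//] := eqVneq z y; rewrite eirr !andbF.
Qed.

Lemma degsum0 : degsum set0 = 0.
Proof. by rewrite /degsum big_set0. Qed.

Lemma degsum_even X : ~~ odd (degsum X).
Proof.
elim: #|X| {-2}X (erefl #|X|) => [Y /cards0_eq ->|n IH Y cY]; first by rewrite degsum0.
have [y yY] : exists y, y \in Y by apply/set0Pn; rewrite -card_gt0 cY.
rewrite (degsumD1 yY) oddD mul2n odd_double addbF IH //.
by move: cY; rewrite (cardsD1 y) yY => -[].
Qed.

Lemma degsumU X Y : [disjoint X & Y] ->
  degsum (X :|: Y) = degsum X + degsum Y + 2 * \sum_(x in X) deg_in Y x.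
Proof.
elim: #|Y| {-2}Y (erefl #|Y|) => [Z /cards0_eq -> _|n IH Z cZ dXZ].
  rewrite setU0 degsum0 big1 ?addn0 // => x _.
  by rewrite deg_inE big_set0.
have [y yZ] : exists y, y \in Z by apply/set0Pn; rewrite -card_gt0 cZ.
have yX : y \notin X by rewrite disjoint_sym in dXZ; rewrite (disjointFr dXZ).
have ZE : Z = y |: Z :\ y by rewrite setD1K.
have yW : y \notin Z :\ y by rewrite !inE eqxx.
have cW : #|Z :\ y| = n by move: cZ; rewrite (cardsD1 y) yZ => -[].
have dW : [disjoint X & Z :\ y] by apply: disjointWr dXZ; apply: subsetDl.
move: (Z :\ y) ZE yW cW dW => W ZE yW cW dW; rewrite {}ZE.
rewrite setUCA degsumU1; last by rewrite !inE negb_or yX yW.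
rewrite (IH _ cW dW) degsumU1 //.
have -> : deg_in (X :|: W) y = deg_in X y + deg_in W y.
  by rewrite !deg_inE -bigU //=; apply: eq_bigl => z; rewrite inE.
have -> : \sum_(x in X) deg_in (y |: W) x = deg_in X y + \sum_(x in X) deg_in W x.
  by rewrite deg_inE -big_split; apply: eq_bigr => x _ /=; rewrite deg_inU1 // esym.
lia.
Qed.

Lemma degsumT : degsum setT = 3 * #|T|.
Proof.
rewrite /degsum (eq_bigr (fun=> 3)); last by move=> x _; rewrite deg_inT.
by rewrite sum_nat_const cardsT mulnC.
Qed.

Lemma degsum_bound X : degsum X + \sum_(x in X) deg_in (~: X) x = 3 * #|X|.
Proof.
rewrite -big_split /= (eq_bigr (fun=> 3)); last by move=> x _; rewrite deg_inC.
by rewrite sum_nat_const mulnC.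
Qed.

(** Both sides of the cut count the same edges: [3 * #|X| - degsum X] from [X], and the analogous
    number from the complement. *)
Lemma degsumC X : degsum (~: X) + 6 * #|X| = 3 * #|T| + degsum X.
Proof.
have d : [disjoint X & ~: X] by rewrite -setI_eq0 setICr.
move: (degsumU d) (degsum_bound X); rewrite setUCr degsumT; lia.
Qed.

Lemma dense_sub1 k X y : dense k X -> y \in X -> deg_in X y <= 1 -> dense k (X :\ y).
Proof.
rewrite /dense => dX yX dy; rewrite (degsumD1 yX) deg_inD1 in dX.
by move: (cardsD1 y X); rewrite yX; lia.
Qed.

Lemma dense_add k X y j : dense k X -> y \notin X -> j.+1 <= deg_in X y ->
  dense (k + j) (y |: X).
Proof. by rewrite /dense => dX yX dy; rewrite degsumU1 // cardsU1 yX; lia. Qed.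

(** The [3 * #|X| - degsum X] edges leaving [X] end at distinct outer vertices. *)
Lemma spread_bound X : (forall y, y \notin X -> deg_in X y <= 1) ->
  4 * #|X| <= #|T| + degsum X.
Proof.
move=> h; have := degsum_bound X.
have -> : \sum_(x in X) deg_in (~: X) x = \sum_(y in ~: X) deg_in X y.
  rewrite (eq_bigr (fun x => \sum_(y in ~: X) e x y)); last by move=> x _; rewrite deg_inE.
  rewrite exchange_big /=; apply: eq_bigr => y _; rewrite deg_inE.
  by apply: eq_bigr => x _; rewrite esym.
have : \sum_(y in ~: X) deg_in X y <= #|~: X|.
  by rewrite -sum1_card; apply: leq_sum => y; rewrite inE => /h.
move: (cardsC X); lia.
Qed.

Definition minimal k X : Prop :=
  [/\ X != set0, dense k X &
      forall Y, Y \proper X -> Y != set0 -> ~~ dense k Y].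

Lemma ex_minimal k X : X != set0 -> dense k X ->
  exists2 Y : {set T}, Y \subset X & minimal k Y.
Proof.
move=> X0 dX; have pX : (X != set0) && dense k X by rewrite X0.
have [Y /minsetP[/andP[Y0 dY] mY] sYX] :=
  minset_exists (P := fun Y : {set T} => (Y != set0) && dense k Y) pX.
exists Y => //; split=> // Z /andP[sZY nZY] Z0; apply/negP => dZ.
by move: nZY; rewrite (mY Z) ?subxx ?Z0.
Qed.

Lemma dense_neq1 k X x : dense k X -> x \in X -> X :\ x != set0.
Proof.
move=> dX xX; apply/eqP => X1; move: dX; rewrite /dense (degsumD1 xX) (cardsD1 x) xX X1.
by rewrite degsum0 cards0 deg_inE big_set0; lia.
Qed.

Hypothesis conn : forall x y, connect e x y.

Lemma boundary_edge (X : {set T}) : X != set0 -> X != setT ->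
  exists x y, [/\ x \in X, y \notin X & e x y].
Proof.
move=> /set0Pn[x xX]; rewrite -subTset => /subsetPn[y _ yX].
have [/existsP[u /existsP[v /and3P[uX vX uv]]]|no] :=
  boolP [exists u, exists v, [&& u \in X, v \notin X & e u v]]; first by exists u, v.
have cl : closed e (mem X).
  apply: intro_closed => [|u v uv uX]; first exact: sym_connect_sym.
  apply: contraNT no => vX; apply/existsP; exists u; apply/existsP; exists v.
  by rewrite uX uv vX.
by move: yX; rewrite -(closed_connect cl (conn x y)) xX.
Qed.

(** Adding a neighbour costs one vertex and gains at least one edge, so the excess never drops;
    connectedness supplies a neighbour until the graph is exhausted. *)
Lemma dense_extend k X m : dense k X -> X != set0 -> #|X| <= m <= #|T| ->
  exists2 Y : {set T}, #|Y| = m & dense k Y.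
Proof.
move=> dX X0 /andP[]; elim: m => [|m IH] le1 le2.
  by move: le1; rewrite leqn0 cards_eq0 (negPf X0).
move: le1; rewrite leq_eqVlt => /orP[/eqP <-|le1]; first by exists X.
have [Y cY dY] := IH le1 (ltnW le2).
have [x [y [xY yY xy]]] : exists x y, [/\ x \in Y, y \notin Y & e x y].
  apply: boundary_edge; last by apply: contraTneq le2 => YT; rewrite -cY YT cardsT ltnn.
  by move: X0; rewrite -!card_gt0 cY => X0; apply: leq_trans X0 le1.
exists (y |: Y); first by rewrite cardsU1 yY cY.
rewrite -[k]addn0; apply: dense_add => //; apply: deg_in_gt0 xY _; by rewrite esym.
Qed.

Lemma minimal_deg k X x : minimal k X -> x \in X -> 2 <= deg_in X x.
Proof.
move=> [X0 dX mX] xX; rewrite ltnNge; apply/negP => dx.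
by have := mX _ (properD1 xX) (dense_neq1 dX xX); rewrite dense_sub1.
Qed.

(** By parity a surplus in [degsum] is at least two. A boundary vertex has at most two inner
    neighbours, so with a surplus it could be deleted without losing density. *)
Lemma minimal_exact k X : minimal k X -> X != setT ->
  degsum X = 2 * #|X| + 2 * k.
Proof.
move=> mX XT; have [X0 dX nX] := mX.
apply/eqP; rewrite eqn_leq; apply/andP; split; last exact: dX.
rewrite leqNgt; apply/negP => lt.
have [x [y [xX yX xy]]] := boundary_edge X0 XT.
have /negP := nX _ (properD1 xX) (dense_neq1 dX xX); apply; rewrite /dense.
have := deg_inC X x; have := deg_in_gt0 (X := ~: X) (y := y) _ xy.
rewrite inE yX => /(_ isT) => d0 dC.
have ev : ~~ odd (degsum X) := degsum_even X.
move: (cardsD1 x X) (degsumD1 xX); rewrite xX deg_inD1.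
by move: ev lt dC d0; lia.
Qed.

(** Deleting such a vertex lowers the excess by exactly one; this drives the induction on [k] in
    [ear_step]. *)
Lemma minimal_deg2 k X : minimal k X -> X != setT ->
  exists2 x, x \in X & deg_in X x = 2.
Proof.
move=> mX XT; have [X0 _ _] := mX; have [x [y [xX yX xy]]] := boundary_edge X0 XT.
exists x => //; have := deg_inC X x; have := deg_in_gt0 (X := ~: X) (y := y) _ xy.
rewrite inE yX => /(_ isT); have := minimal_deg mX xX; lia.
Qed.

End Density.

(** * Labelled graphs and their embeddings *)

Definition graph := seq (seq nat).

Notation nb g u := (nth [::] g u).

Fixpoint upd (u v : nat) (g : graph) : graph :=
  match g, u with
  | [::], _ => [::]
  | l :: g', 0 => (v :: l) :: g'
  | l :: g', u'.+1 => l :: upd u' v g'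
  end.

Definition adde (g : graph) (u v : nat) : graph := upd u v (upd v u g).

Definition addv (g : graph) (u : nat) : graph := rcons (upd u (size g) g) [:: u].

Fixpoint chain (m : nat) (g : graph) (x : nat) : graph :=
  if m is m'.+1 then chain m' (addv g x) (size g) else g.

Arguments adde : simpl never.
Arguments addv : simpl never.

Definition esum (g : graph) : nat := sumn (map size g).

Definition memn (w : nat) (l : seq nat) : bool := has (eqn w) l.

(** An edge from a neighbour of [p] to one of these labels would close a cycle of length at most
    four, or be a loop or a repeated edge. *)
Definition near (g : graph) (p : nat) : seq nat :=
  nb g p ++ flatten [seq nb g b | b <- nb g p].

(** An ear leaves [g] at [x], runs through the new labels up to [s.-1] and ends at [w]. The only
    neighbour of [s.-1] before closing is its predecessor on the ear, and [near] of it rules out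
    short cycles. *)
Definition ears (s : nat) (g : graph) : seq graph :=
  flatten [seq (let h := chain (s - size g) g x in
                let l := near h (head 0 (nb h s.-1)) in
                [seq adde h s.-1 w | w <- iota 0 s & (size (nb h w) < 3) && ~~ memn w l])
          | x <- iota 0 (size g) & size (nb g x) < 3].

(** An injective homomorphism from [r] into [h], the certificate produced by all isomorphism
    searches below. Where a true isomorphism is wanted, equal [size] and [esum] are compared as
    well. *)
Definition check_map (r h : graph) (m : seq nat) : bool :=
  [&& eqn (size m) (size r), uniq m, all (fun v => v < size h) m &
      all2 (fun l c => all (fun v => memn (nth 0 m v) (nb h c)) l) r m].

Lemma memnE w l : memn w l = (w \in l).
Proof. by rewrite /memn; apply/hasP/idP => [[x xl /eqnP ->]|wl]; [|exists w => //; apply/eqnP]. Qed.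

Lemma size_upd u v g : size (upd u v g) = size g.
Proof. by elim: g u => [|l g IH] [|u] //=; rewrite IH. Qed.

Lemma nb_upd u v g w : u < size g ->
  nb (upd u v g) w = if w == u then v :: nb g u else nb g w.
Proof. by elim: g u w => [|l g IH] [|u] [|w] //= ult; rewrite IH. Qed.

Lemma size_adde g u v : size (adde g u v) = size g.
Proof. by rewrite !size_upd. Qed.

Lemma size_addv g u : size (addv g u) = (size g).+1.
Proof. by rewrite size_rcons size_upd. Qed.

Lemma nb_adde g u v w : u < size g -> v < size g -> u != v ->
  nb (adde g u v) w = if w == u then v :: nb g u else if w == v then u :: nb g v else nb g w.
Proof.
move=> ug vg uv; rewrite /adde nb_upd ?size_upd // !nb_upd //.
by rewrite (negPf uv).
Qed.

Lemma nb_addv g u w : u < size g ->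
  nb (addv g u) w = if w == size g then [:: u] else if w == u then size g :: nb g u else nb g w.
Proof.
move=> ug; rewrite nth_rcons size_upd.
case: ltngtP => [wg|wg|wg] //; first by rewrite nb_upd.
have wu : w != u by rewrite neq_ltn (ltn_trans ug wg) orbT.
by rewrite (negPf wu) nth_default // ltnW.
Qed.

Lemma esum_upd u v g : u < size g -> esum (upd u v g) = (esum g).+1.
Proof. by elim: g u => [|l g IH] [|u] //= ult; rewrite /esum /= -/(esum _) ?IH // addnS. Qed.

Lemma esum_adde u v g : u < size g -> v < size g -> esum (adde g u v) = (esum g).+2.
Proof. by move=> ug vg; rewrite !esum_upd // size_upd. Qed.

Lemma esum_addv u g : u < size g -> esum (addv g u) = (esum g).+2.
Proof.
by move=> ug; rewrite /esum map_rcons sumn_rcons -/(esum _) esum_upd //= addn1.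
Qed.

Lemma esumE g : esum g = \sum_(i < size g) size (nb g i).
Proof. by rewrite /esum sumnE big_map (big_nth [::]) big_mkord. Qed.

Lemma size_chain m g x : size (chain m g x) = size g + m.
Proof. by elim: m g x => [|m IH] g x //=; rewrite ?addn0 // IH size_addv addSnnS. Qed.

Lemma esum_chain m g x : x < size g -> esum (chain m g x) = esum g + 2 * m.
Proof.
elim: m g x => [|m IH] g x xg; rewrite ?addn0 //= IH ?size_addv // esum_addv //; lia.
Qed.

Definition wf (g : graph) : Prop := forall u, u < size g ->
  uniq (nb g u) /\ forall v, v \in nb g u -> v < size g /\ u \in nb g v.

Definition wfb (g : graph) : bool :=
  all (fun u => uniq (nb g u) && all (fun v => (v < size g) && memn u (nb g v)) (nb g u))
      (iota 0 (size g)).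

Lemma wfP g : wfb g -> wf g.
Proof.
move=> /allP h u ug.
by move: (h u); rewrite mem_iota ug => /(_ isT)/andP[un /allP a];
   split=> // v /a; rewrite memnE => /andP[].
Qed.

Lemma wf_adde g u w : wf g -> u < size g -> w < size g -> u != w -> w \notin nb g u ->
  wf (adde g u w).
Proof.
move=> wg ug wlt uw wu v; rewrite size_adde => vg.
have uw' : u \notin nb g w by apply: contraNN wu => /(wg w wlt).2[].
have [un nbv] := wg v vg; rewrite nb_adde //; case: eqP => [vu|/eqP vu].
  subst v; rewrite /= wu un; split=> // v'; rewrite inE.
  have [-> _|v'w /= /nbv[v'g uv']] := eqVneq v' w; split=> //.
    by rewrite nb_adde // eq_sym (negPf uw) eqxx mem_head.
  by rewrite nb_adde // (negPf v'w); case: eqP => [E|_] //; rewrite E in uv'; rewrite inE uv' orbT.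
case: eqP => [vw|/eqP vw].
  subst v; rewrite /= uw' un; split=> // v'; rewrite inE.
  have [-> _|v'u /= /nbv[v'g uv']] := eqVneq v' u; split=> //.
    by rewrite nb_adde // eqxx mem_head.
  by rewrite nb_adde // (negPf v'u); case: eqP => [E|_] //; rewrite E in uv'; rewrite inE uv' orbT.
split=> // v' /nbv[v'g uv']; split=> //.
by rewrite nb_adde //; case: eqP => [<-|_]; [|case: eqP => [<-|_]]; rewrite ?inE ?uv' ?orbT.
Qed.

Lemma wf_addv g u : wf g -> u < size g -> wf (addv g u).
Proof.
move=> wg ug v; rewrite size_addv ltnS leq_eqVlt.
have notin w : w < size g -> size g \notin nb g w.
  by move=> wlt; apply/negP => /(wg w wlt).2[]; rewrite ltnn.
have ne w : w < size g -> (w == size g) = false by case: ltngtP.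
move=> /orP[/eqP ->|vg].
  rewrite nb_addv // eqxx; split=> // v'; rewrite inE => /eqP ->.
  by rewrite ltnS ltnW // nb_addv // ne // eqxx mem_head.
have [un nbv] := wg v vg; rewrite nb_addv // ne //; case: eqP => [vu|/eqP vu].
  subst v; rewrite /= notin // un; split=> // v'; rewrite inE.
  have [-> _|v'n /= /nbv[v'g uv']] := eqVneq v' (size g).
    by rewrite ltnS leqnn nb_addv // eqxx mem_head.
  by rewrite ltnS ltnW // nb_addv // ne //; case: eqP => [E|_] //; rewrite E in uv'; rewrite inE uv' orbT.
split=> // v' /nbv[v'g uv']; rewrite ltnS ltnW // nb_addv // ne //.
by case: eqP => [<-|_]; rewrite ?inE ?uv' ?orbT.
Qed.

Section Embeddings.

Variables (T : finType) (e : rel T).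
Hypothesis esym : symmetric e.
Hypothesis eirr : irreflexive e.
Hypothesis cubic : forall x, #|[set y | e x y]| = 3.
Hypothesis no3 : forall x y z, e x y -> e y z -> e z x -> False.
Hypothesis no4 : forall x y z w, e x y -> e y z -> e z w -> e w x ->
  x != z -> y != w -> False.

(** The copy may fail to be induced: while a graph is grown, edges between labelled vertices can
    still be unrecorded. Equality of [esum] with the [degsum] of the image makes it induced, as
    [emb_adj] shows. *)
Definition emb (g : graph) (f : nat -> T) : Prop :=
  [/\ wf g, forall u v, u < size g -> v \in nb g u -> e (f u) (f v) &
      forall u v, u < size g -> v < size g -> f u = f v -> u = v].

Definition img (g : graph) (f : nat -> T) : {set T} := [set f i | i : 'I_(size g)].

Lemma imgP g f x : reflect (exists2 i, i < size g & x = f i) (x \in img g f).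
Proof.
apply: (iffP imsetP) => [[i _ ->]|[i ig ->]]; first by exists i.
by exists (Ordinal ig).
Qed.

Lemma mem_img g f i : i < size g -> f i \in img g f.
Proof. by move=> ig; apply/imgP; exists i. Qed.

Lemma emb_inj g f : emb g f -> injective (fun i : 'I_(size g) => f i).
Proof. by move=> [_ _ inj] i j /inj h; apply/val_inj/h. Qed.

Lemma card_img g f : emb g f -> #|img g f| = size g.
Proof. by move=> /emb_inj inj; rewrite card_imset // card_ord. Qed.

Lemma emb_nb g f u v : emb g f -> u < size g -> v \in nb g u -> v < size g.
Proof. by move=> [w _ _] ug /(w u ug).2[]. Qed.

Lemma emb_e g f u v : emb g f -> u < size g -> v \in nb g u -> e (f u) (f v).
Proof. by move=> [_ h _] ug /h; apply. Qed.

Lemma emb_map_uniq g f u : emb g f -> u < size g -> uniq (map f (nb g u)).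
Proof.
move=> em ug; have [w _ inj] := em; rewrite map_inj_in_uniq ?(w u ug).1 // => a b au bu.
by apply: inj; apply: emb_nb em ug _.
Qed.

Lemma emb_deg g f u : emb g f -> u < size g -> size (nb g u) <= deg_in e (img g f) (f u).
Proof.
move=> em ug; rewrite -(size_map f) -(card_uniqP (emb_map_uniq em ug)).
apply/subset_leq_card/subsetP => _ /mapP[v vu ->].
by rewrite inE (emb_e em ug vu) mem_img // (emb_nb em ug vu).
Qed.

Lemma degsum_img g f : emb g f -> degsum e (img g f) = \sum_(i < size g) deg_in e (img g f) (f i).
Proof.
by move=> em; rewrite /degsum big_imset //= => i j _ _; apply: emb_inj em i j.
Qed.

Lemma emb_degsum g f : emb g f -> esum g <= degsum e (img g f).
Proof.
move=> em; rewrite degsum_img // esumE; apply: leq_sum => i _; exact: emb_deg.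
Qed.

Lemma emb_exact g f : emb g f -> esum g = degsum e (img g f) ->
  forall u, u < size g -> size (nb g u) = deg_in e (img g f) (f u).
Proof.
move=> em ex u ug; apply/eqP; move: ex => /eqP; rewrite degsum_img // esumE.
have le : forall i : 'I_(size g), true -> size (nb g i) <= deg_in e (img g f) (f i)
  ?= iff (size (nb g i) == deg_in e (img g f) (f i)).
  by move=> i _; split=> //; apply: emb_deg.
by rewrite (leqif_sum le) => /forallP/(_ (Ordinal ug)).
Qed.

Lemma emb_adj g f : emb g f -> esum g = degsum e (img g f) ->
  forall u v, u < size g -> v < size g -> e (f u) (f v) -> v \in nb g u.
Proof.
move=> em ex u v ug vg uv.
have sz := emb_exact em ex ug.
have : f v \in map f (nb g u).
  have sub : map f (nb g u) \subset [set y in img g f | e (f u) y].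
    apply/subsetP => _ /mapP[w wu ->].
    by rewrite inE (emb_e em ug wu) mem_img // (emb_nb em ug wu).
  have c : #|map f (nb g u)| = #|[set y in img g f | e (f u) y]|.
    by rewrite (card_uniqP (emb_map_uniq em ug)) size_map sz.
  by rewrite (subset_cardP c sub) inE uv mem_img.
move=> /mapP[w wu fvw]; have [_ _ inj] := em.
by rewrite (inj _ _ vg _ fvw) // (emb_nb em ug wu).
Qed.

Lemma emb_adde g f u w : emb g f -> u < size g -> w < size g -> e (f u) (f w) ->
  w \notin nb g u -> emb (adde g u w) f.
Proof.
move=> [wg eg inj] ug wlt uw wu.
have nuw : u != w by apply: contraTneq uw => ->; rewrite eirr.
split; first exact: wf_adde.
- move=> v v'; rewrite size_adde nb_adde // => vg; case: eqP => [->|_]; [|case: eqP => [->|_]].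
  + by rewrite inE => /orP[/eqP ->|/(eg _ _ ug)].
  + by rewrite inE => /orP[/eqP ->|/(eg _ _ wlt)] //; rewrite esym.
  + exact: eg.
- by move=> v v'; rewrite size_adde; apply: inj.
Qed.

Definition ext (g : graph) (f : nat -> T) (t : T) : nat -> T :=
  fun i => if i == size g then t else f i.

Lemma emb_addv g f u t : emb g f -> u < size g -> e (f u) t -> t \notin img g f ->
  emb (addv g u) (ext g f t).
Proof.
move=> em ug ut tg; have [wg eg inj] := em.
have fE i : i < size g -> ext g f t i = f i by rewrite /ext; case: ltngtP.
have fT : ext g f t (size g) = t by rewrite /ext eqxx.
split=> [|v v'|v v']; first exact: wf_addv.
- rewrite size_addv nb_addv // => vg; case: eqP => [->|/eqP nv]; [|case: eqP => [->|_]].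
  + by rewrite inE => /eqP ->; rewrite fT fE // esym.
  + rewrite inE => /orP[/eqP ->|h]; first by rewrite fT fE.
    by rewrite !fE //; [apply: eg|apply: emb_nb em ug h].
  + have vg' : v < size g by lia.
    by move=> h; rewrite !fE //; [apply: eg|apply: emb_nb em vg' h].
- rewrite size_addv !ltnS leq_eqVlt => /orP[/eqP ->|vg];
    rewrite leq_eqVlt => /orP[/eqP ->|v'g]; rewrite ?fT ?fE //.
  + by move=> h; case/negP: tg; rewrite h mem_img.
  + by move=> h; case/negP: tg; rewrite -h mem_img.
  + exact: inj.
Qed.

Lemma img_adde g f u v : img (adde g u v) f = img g f.
Proof. by apply/setP => x; apply/imgP/imgP => -[i]; rewrite size_adde; exists i. Qed.

Lemma img_addv g f u t : img (addv g u) (ext g f t) = t |: img g f.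
Proof.
apply/setP => x; rewrite in_setU1; apply/imgP/orP => [[i]|].
  rewrite size_addv /ext ltnS leq_eqVlt => /orP[/eqP -> ->|ig ->].
    by rewrite eqxx; left.
  by right; rewrite ifN ?mem_img // neq_ltn ig.
move=> [/eqP ->|/imgP[i ig ->]].
  by exists (size g); rewrite ?size_addv // /ext eqxx.
by exists i; rewrite ?size_addv ?ltnS 1?ltnW // /ext ifN // neq_ltn ig.
Qed.

Lemma emb_map (r h : graph) m f : emb h f -> wf r -> check_map r h m ->
  emb r (fun i => f (nth 0 m i)).
Proof.
move=> [wh eh inj] wr /and4P[/eqnP sm um /allP am a2].
have sz u : u < size r -> nth 0 m u < size h by move=> ur; apply: am; rewrite mem_nth ?sm.
split=> // [u v ur vu|u v ur vr].
- move: a2; rewrite all2E sm eqxx /= => /allP/(_ (nb r u, nth 0 m u)).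
  rewrite -nth_zip ?sm // mem_nth ?size_zip ?sm ?minnn // => /(_ isT).
  rewrite nth_zip ?sm //= => /allP/(_ v vu).
  by rewrite memnE; apply: eh; apply: sz.
- by move=> /(inj _ _ (sz _ ur) (sz _ vr)) /eqP; rewrite nth_uniq ?sm // => /eqP.
Qed.

Hypothesis conn : forall x y, connect e x y.

Definition covered (l : seq graph) (S : {set T}) : Prop :=
  exists g f, [/\ g \in l, emb g f, img g f = S & esum g = degsum e S].

Lemma covered_size l S : covered l S -> exists2 g, g \in l & size g = #|S|.
Proof. by move=> [g [f [gl em <- _]]]; exists g; rewrite ?(card_img em). Qed.

(* Inside a set of minimum degree at least two, a pending path can always be
   prolonged until it meets the part already labelled. *)
Lemma walk_closes (S : {set T}) g f u p :
  (forall x, x \in S -> 2 <= deg_in e S x) -> emb g f -> img g f \subset S ->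
  size g = u.+1 -> nb g u = [:: p] ->
  exists m w f', let h := chain m g u in let u' := u + m in
    [/\ emb (adde h u' w) f', img h f' \subset S, u' != w /\ w < size h, size (nb h w) < 3 &
        exists p', [/\ nb h u' = [:: p'], p' < size h & ~~ memn w (near h p')]].
Proof.
move=> dS; move: {2}(#|S| - u) (leqnn (#|S| - u)) => k.
elim: k g f u p => [|k IH] g f u p le em sub sg nu.
  have := subset_leq_card sub; rewrite (card_img em) sg; lia.
have ug : u < size g by rewrite sg.
have pg : p < size g by apply: emb_nb em ug _; rewrite nu inE.
have fuS : f u \in S by rewrite (subsetP sub) // mem_img.
have [t [tS ut tp]] := deg_in_gt1P (f p) (dS _ fuS).
(* An unlabelled neighbour prolongs the path; a labelled one closes it, and the absence of triangles
   and 4-cycles keeps it away from the predecessor [p]. *)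
have [/imgP[w wg tw]|tg] := boolP (t \in img g f); last first.
  have em' := emb_addv em ug ut tg.
  have [||||m [w [f' [em1 sub1 wh dw near1]]]] := IH _ _ (size g) u _ em'.
  - lia.
  - by rewrite img_addv subUset sub1set tS.
  - by rewrite size_addv.
  - by rewrite nb_addv // eqxx.
  exists m.+1, w, f'; rewrite /= addnS -addSn -sg; split=> //.
have wp : w != p by apply: contraNneq tp => wp; rewrite tw wp.
have uw : u != w by apply: contraTneq ut => uw; rewrite tw -uw eirr.
have wu : w \notin nb g u by rewrite nu inE.
have upg : u \in nb g p by have [wfg _ _] := em; have [_ /(_ p)] := wfg u ug; rewrite nu mem_head => /(_ isT)[].
have em1 : emb (adde g u w) f by apply: emb_adde em ug wg _ wu; rewrite -tw.
exists 0, w, f; rewrite /= addn0; split=> //.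
  have := emb_deg em1 (u := w); rewrite size_adde => /(_ wg).
  rewrite nb_adde // eq_sym (negPf uw) eqxx /= => h.
  exact: leq_trans h (deg_in_le3 cubic _ _).
exists p; split=> //; rewrite memnE mem_cat negb_or; apply/andP; split.
  apply/negP => wpg; apply: (no3 (x := f u) (y := f p) (z := f w)).
  - by rewrite esym (emb_e em pg).
  - exact: emb_e em pg wpg.
  - by rewrite esym -tw.
apply/flattenP => -[_ /mapP[b bp ->] wb].
have bg := emb_nb em pg bp.
have [bu|bu] := eqVneq b u; first by move: wb; rewrite bu nu inE (negPf wp).
have [_ _ inj] := em.
apply: (no4 (x := f u) (y := f p) (z := f b) (w := f w)).
- by rewrite esym (emb_e em pg).
- exact: emb_e em pg bp.
- exact: emb_e em bg wb.
- by rewrite esym -tw.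
- by apply: contraNneq bu => /(inj _ _ ug bg) ->.
- by apply: contraNneq wp => /(inj _ _ pg wg) ->.
Qed.

Lemma covered_sub l l' S : {subset l <= l'} -> covered l S -> covered l' S.
Proof. by move=> sub [g [f [/sub ? ? ? ?]]]; exists g, f. Qed.

Definition cyc (s : nat) : graph := adde (chain (s - 2) [:: [:: 1]; [:: 0]] 1) s.-1 0.

(** The two facts that force a closing path to return to its start and to have five vertices: inner
    labels already have two neighbours, and on at most four labels the label 0 fails the test of
    [walk_closes]. *)
Definition cyc_ok (s : nat) : bool :=
  all (fun w => size (nb (chain (s - 2) [:: [:: 1]; [:: 0]] 1) w) == 2) (iota 1 (s - 2)) &&
  ((4 < s) || let h := chain (s - 2) [:: [:: 1]; [:: 0]] 1 in
    memn 0 (near h (head 0 (nb h s.-1)))).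

Lemma cyc_okP s : 1 < s -> s <= 13 -> cyc_ok s.
Proof. by do 14!case: s => [//|s]. Qed.

(** Minimum degree two and [degsum] equal to twice the size make [S] 2-regular. A walk in [S] closes
    into a 0-dense subset, which is all of [S] by minimality. *)
Lemma cycle_covered S : minimal e 0 S -> S != setT -> #|S| <= 13 ->
  covered [:: cyc #|S|] S /\ 4 < #|S|.
Proof.
move=> mS ST le; have [S0 dS mn] := mS.
have md x : x \in S -> 2 <= deg_in e S x by apply: minimal_deg mS.
have dE : degsum e S = 2 * #|S| + 2 * 0 := minimal_exact esym eirr cubic conn mS ST.
have d2 x : x \in S -> deg_in e S x = 2.
  move=> xS; apply/eqP; rewrite eqn_leq md // andbT leqNgt; apply/negP => lt.
  have : \sum_(y in S :\ x) 2 <= \sum_(y in S :\ x) deg_in e S y.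
    by apply: leq_sum => y; rewrite !inE => /andP[_ /md].
  rewrite sum_nat_const; move: dE lt; rewrite /degsum (big_setD1 x) //=.
  rewrite (cardsD1 x S) xS; lia.
have [x xS] : exists x, x \in S by apply/set0Pn.
have [y yS xy] : exists2 y, y \in S & e x y.
  by apply: deg_in_gt0P; rewrite d2.
pose f i := if i == 0 then x else y.
have nxy : x != y by apply: contraTneq xy => ->; rewrite eirr.
have em : emb [:: [:: 1]; [:: 0]] f.
  split; first exact: wfP.
    by move=> [|[|u]] // v _; rewrite inE => /eqP -> //=; rewrite /f /= esym.
  move=> [|[|u]] // [|[|v]] // _ _; rewrite /f /= => /eqP; first by rewrite (negPf nxy).
  by rewrite eq_sym (negPf nxy).
have sub : img [:: [:: 1]; [:: 0]] f \subset S.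
  by apply/subsetP => _ /imgP[i _ ->]; rewrite /f; case: ifP.
have [m [w [f' [em' sub' [w1 wh] dw [p' [nup ph np]]]]]] := walk_closes md em sub erefl erefl.
set h := chain m _ _ in em' sub' wh dw nup ph np *; rewrite add1n in w1 nup.
have sh : size h = m.+2 by rewrite size_chain.
have uh : 1 + m < size h by rewrite sh.
have es : esum (adde h (1 + m) w) = 2 * m.+2.
  by rewrite esum_adde // esum_chain // /esum /=; clear; lia.
have ch : #|img h f'| = m.+2 by rewrite -(img_adde _ _ (1 + m) w) (card_img em') size_adde sh.
have imE : img h f' = S.
  apply/eqP; rewrite eqEproper sub' /=; apply/negP => pr.
  have im0 : img h f' != set0 by rewrite -card_gt0 ch.
  have /negP := mn _ pr im0; apply; rewrite /dense ch muln0 addn0 -es.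
  by rewrite -(img_adde _ _ (1 + m) w) emb_degsum.
have cS : #|S| = m.+2 by rewrite -imE.
have /andP[/allP ok1 ok2] : cyc_ok m.+2.
  by apply: cyc_okP => //; rewrite -cS.
rewrite subn2 /= -/h in ok1 ok2.
have w0 : w = 0.
  apply/eqP/contraT => wn0.
  have h1 : deg_in e S (f' w) = 2 by apply: d2; rewrite -imE mem_img.
  have := emb_deg em' (u := w); rewrite size_adde img_adde imE => /(_ wh).
  rewrite h1 nb_adde // eq_sym (negPf w1) eqxx /=.
  have -> : size (nb h w) = 2 by apply/eqP/ok1; rewrite mem_iota lt0n wn0 add1n; move: wh w1; rewrite sh; clear; lia.
  by [].
have c4 : 4 < m.+2.
  by case/orP: ok2 => //; rewrite nup -w0 (negPf np).
split; last by rewrite cS.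
exists (adde h (1 + m) w), f'; rewrite img_adde imE inE; split=> //.
  by rewrite w0 cS /cyc subn2.
by rewrite es dE cS addn0.
Qed.

Definition nexts (l : nat -> seq graph) (s : nat) : seq graph :=
  flatten [seq flatten [seq ears s g | g <- l s'] | s' <- iota 0 s].

(** Deleting a vertex of degree two leaves a [k]-dense set, which contains a minimal one [S']. A
    walk that leaves [S'] inside [S] closes up and raises the excess by one, so by minimality [S] is
    [S'] with this ear attached. *)
Lemma ear_step k (l : nat -> seq graph) S :
  minimal e k.+1 S -> #|S| <= 13 -> 13 < #|T| ->
  (0 < k -> forall Z : {set T}, Z != set0 -> dense e 1 Z -> 7 <= #|Z|) ->
  (forall S', minimal e k S' -> #|S'| < #|S| -> covered (l #|S'|) S') ->
  (forall s g, s < #|S| -> g \in l s -> esum g = 2 * size g + 2 * k) ->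
  covered (nexts l #|S|) S.
Proof.
move=> mS le13 lt13 big IH es; have [S0 dS mn] := mS.
have notT (X : {set T}) : #|X| <= 13 -> X != setT.
  by move=> c; apply: contraTneq lt13 => XT; rewrite -cardsT -XT -leqNgt.
have ST := notT _ le13.
have dE := minimal_exact esym eirr cubic conn mS ST.
have [v vS dv] := minimal_deg2 esym eirr cubic conn mS ST.
have Sv0 := dense_neq1 esym eirr dS vS.
have cSv : #|S| = (#|S :\ v|).+1 by rewrite (cardsD1 v) vS.
have dSv : dense e k (S :\ v).
  have := degsumD1 esym eirr vS; rewrite deg_inD1 // dv dE cSv /dense.
  by clear; lia.
have [S' sS' mS'] := ex_minimal Sv0 dSv.
have lt : #|S'| < #|S| by rewrite cSv ltnS subset_leq_card.
have sS : S' \subset S := subset_trans sS' (subsetDl _ _).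
have dE' := minimal_exact esym eirr cubic conn mS' (notT _ (leq_trans (ltnW lt) le13)).
have [g [f [gl em imS' _]]] := IH _ mS' lt.
have [x [t [xS' tS' xt]]] : exists x t, [/\ x \in S', t \in S :\: S' & e x t].
  have [/existsP[x /existsP[t /and3P[? ? ?]]]|no] :=
    boolP [exists x, exists t, [&& x \in S', t \in S :\: S' & e x t]]; first by exists x, t.
  (* With no edge between [S'] and [Z], the set [Z] has excess one. For [k = 0] this contradicts
     minimality of [S]; for larger [k] both parts are 1-dense and have at least seven vertices each,
     against [#|S| <= 13]. *)
  exfalso; pose Z := S :\: S'.
  have SE : S = S' :|: Z by rewrite -{1}(setID S S') (setIidPr sS).
  have dis : [disjoint S' & Z] by rewrite -setI_eq0 setIDA setDIl setDv set0I.
  have z0 : \sum_(x in S') deg_in e Z x = 0.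
    rewrite big1 // => x xS'; apply/eqP; rewrite -leqn0 leqNgt; apply/negP => /deg_in_gt0P[y yZ xy].
    case/negP: no; apply/existsP; exists x; apply/existsP; exists y.
    by rewrite xS' yZ.
  have cZ : #|S| = #|S'| + #|Z| by rewrite (cardsD S S') (setIidPr sS) subnKC // ltnW.
  have Z0 : Z != set0 by rewrite -card_gt0; move: lt; rewrite cZ; clear; lia.
  have dZ : dense e 1 Z.
    move: (degsumU esym eirr dis); rewrite z0 -SE dE dE' cZ /dense; clear; lia.
  have [k0|k0] := posnP k.
    have pZ : Z \proper S.
      rewrite properEcard subsetDl cZ -[X in X < _]add0n ltn_add2r card_gt0.
      by have [] := mS'.
    by have := mn _ pZ Z0; rewrite k0 dZ.
  have [S'0 dS' _] := mS'.
  have d1 : dense e 1 S' by apply: leq_trans dS'; rewrite leq_add2l leq_mul2l.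
  have := big k0 _ Z0 dZ; have := big k0 _ S'0 d1.
  by move: le13; rewrite cZ; clear; lia.
rewrite -imS' in xS'; have [i ig xi] := imgP _ _ _ xS'.
have [tnS' tS] : t \notin S' /\ t \in S by move: tS'; rewrite !inE => /andP[].
rewrite xi in xt; rewrite -imS' in tnS'.
have em1 := emb_addv em ig xt tnS'.
have sub1 : img (addv g i) (ext g f t) \subset S.
  by rewrite img_addv imS' subUset sub1set tS sS.
have dg : size (nb g i) < 3.
  have ig' : i < size (addv g i) by rewrite size_addv ltnS ltnW.
  have := leq_trans (emb_deg em1 ig') (deg_in_le3 cubic _ _).
  by rewrite nb_addv // ltn_eqF // eqxx.
have nbu : nb (addv g i) (size g) = [:: i] by rewrite nb_addv // eqxx.
have [m [w [f' [em' sub' [w1 wh] dw [p' [nup ph np]]]]]] :=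
  walk_closes (fun x => minimal_deg esym eirr mS (x := x)) em1 sub1 (size_addv _ _) nbu.
set h := chain m _ _ in em' sub' wh dw nup ph np *.
have hE : h = chain m.+1 g i by [].
have sh : size h = (size g + m).+1 by rewrite hE size_chain addnS.
have uh : size g + m < size h by rewrite sh.
have esH : esum (adde h (size g + m) w) = 2 * (size g + m).+1 + 2 * k.+1.
  by rewrite esum_adde // hE esum_chain // (es _ _ lt gl); clear; lia.
have ch : #|img h f'| = (size g + m).+1.
  by rewrite -(img_adde _ _ (size g + m) w) (card_img em') size_adde sh.
have imE : img h f' = S.
  apply/eqP; rewrite eqEproper sub' /=; apply/negP => pr.
  have im0 : img h f' != set0 by rewrite -card_gt0 ch.
  have /negP := mn _ pr im0; apply; rewrite /dense ch -esH.
  by rewrite -(img_adde _ _ (size g + m) w) emb_degsum.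
have cS : #|S| = (size g + m).+1 by rewrite -imE.
have sg : size g = #|S'| by rewrite -imS' (card_img em).
exists (adde h (size g + m) w), f'; rewrite img_adde imE; split=> //; last by rewrite esH dE cS.
apply/flattenP; exists (flatten [seq ears #|S| g | g <- l #|S'|]).
  by apply/mapP; exists #|S'|; rewrite ?mem_iota.
apply/flattenP; exists (ears #|S| g); first exact: map_f.
have iI : i \in [seq x <- iota 0 (size g) | size (nb g x) < 3].
  by rewrite mem_filter dg mem_iota.
apply/flattenP; rewrite cS; eexists; first exact: (map_f _ iI).
cbv zeta beta; rewrite -[(size g + m).+1.-1]/(size g + m).
have -> : (size g + m).+1 - size g = m.+1 by clear; lia.
rewrite -hE nup -[head _ _]/p'; apply: map_f.
by rewrite mem_filter dw np mem_iota -sh.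
Qed.

(** [m] gives for each graph of [l] the index of a representative and a map of it into that graph.
    Equal size makes the copy of the representative fill [S], and equal [esum] makes it induced. *)
Lemma covered_dedup (l r : seq graph) (m : seq (nat * seq nat)) S :
  all wfb r ->
  all2 (fun h c => [&& c.1 < size r, eqn (size h) (size (nth [::] r c.1)),
                       eqn (esum h) (esum (nth [::] r c.1)) &
                       check_map (nth [::] r c.1) h c.2]) l m ->
  covered l S -> covered r S.
Proof.
move=> wr a2 [h [f [hl em imS es]]]; move: a2; rewrite all2E => /andP[/eqP sz /allP a].
have ih : index h l < size l by rewrite index_mem.
have := a (nth ([::], (0, [::])) (zip l m) (index h l)).
rewrite mem_nth ?size_zip -?sz ?minnn // => /(_ isT); rewrite nth_zip //= nth_index //.
case: (nth _ m _) => j c /= /and4P[jr /eqnP szh /eqnP esh ck].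
have wr' : wf (nth [::] r j) by apply/wfP/(allP wr)/mem_nth.
have em' := emb_map em wr' ck.
exists (nth [::] r j), (fun i => f (nth 0 c i)); split=> //; [exact: mem_nth| |by rewrite -esh].
apply/eqP; rewrite -imS eqEcard; apply/andP; split.
  apply/subsetP => _ /imgP[i ir ->]; apply: mem_img.
  case/and4P: ck => /eqnP sc _ /allP ac _; apply: ac; apply: mem_nth; by rewrite sc.
by rewrite (card_img em) (card_img em') szh.
Qed.

End Embeddings.

(** * Enumeration of the minimal dense graphs *)

Fixpoint pick_some (A : Type) (f : nat -> option A) (l : seq nat) : option A :=
  if l is x :: l' then (if f x is Some y then Some y else pick_some f l') else None.

(* [m] lists the images of the labels below [v]; every later label of the
   pattern is adjacent to a smaller one. *)
Fixpoint extend_map (rs : seq (seq nat)) (h : graph) (v : nat) (m : seq nat) :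
    option (seq nat) :=
  if rs is l :: rs' then
    if [seq p <- l | p < v] is p :: ps then
      pick_some (fun c =>
        if memn c m || ~~ eqn (size (nb h c)) (size l) then None
        else if all (fun q => memn c (nb h (nth 0 m q))) ps
        then extend_map rs' h v.+1 (rcons m c) else None) (nb h (nth 0 m p))
    else None
  else Some m.

Definition find_map (r h : graph) : option (seq nat) :=
  pick_some (fun c => if eqn (size (nb h c)) (size (nb r 0))
                      then extend_map (behead r) h 1 [:: c] else None)
            (iota 0 (size h)).

Fixpoint find_rep (reps : seq graph) (j : nat) (h : graph) : option (nat * seq nat) :=
  if reps is r :: reps' then
    if find_map r h is Some m then Some (j, m) else find_rep reps' j.+1 h
  else None.

Fixpoint dedup (raw reps : seq graph) (acc : seq (nat * seq nat)) :
    seq graph * seq (nat * seq nat) :=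
  if raw is h :: raw' then
    if find_rep reps 0 h is Some c then dedup raw' reps (c :: acc)
    else dedup raw' (rcons reps h) ((size reps, iota 0 (size h)) :: acc)
  else (reps, rev acc).

Definition dedup_ok (raw : seq graph) (d : seq graph * seq (nat * seq nat)) : bool :=
  all wfb d.1 &&
  all2 (fun h c => [&& c.1 < size d.1, eqn (size h) (size (nth [::] d.1 c.1)),
                       eqn (esum h) (esum (nth [::] d.1 c.1)) &
                       check_map (nth [::] d.1 c.1) h c.2]) raw d.2.

Definition lookup (t : seq (seq graph * seq (nat * seq nat))) (s : nat) : seq graph :=
  (nth ([::], [::]) t s).1.

Definition cycles (s : nat) : seq graph := if 4 < s then [:: cyc s] else [::].

(** No two vertices of degree below three are adjacent. In the only case with 13-vertex halves this
    can be assumed, and it keeps their list short. *)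
Definition isolated (g : graph) : bool :=
  all (fun l => (2 < size l) || all (fun v => 2 < size (nb g v)) l) g.

(** The prefixes count independent cycles: two, three or four for excess 1, 2 or 3. A minimal set of
    the next excess is strictly larger than the one it grows from, so the size bounds 11, 12 and 13
    fit together. *)
Definition bi_tab := Eval vm_compute in
  [seq dedup (nexts cycles s) [::] [::] | s <- iota 0 12].
Definition tri_tab := Eval vm_compute in
  [seq dedup (nexts (lookup bi_tab) s) [::] [::] | s <- iota 0 13].
Definition tetra_tab := Eval vm_compute in
  [seq dedup (nexts (lookup tri_tab) s) [::] [::] | s <- iota 0 13].
Definition tetra13_tab := Eval vm_compute in
  dedup [seq g <- nexts (lookup tri_tab) 13 | isolated g] [::] [::].

Lemma bi_tab_ok :
  all (fun s => dedup_ok (nexts cycles s) (nth ([::], [::]) bi_tab s)) (iota 0 12).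
Proof. by vm_compute. Qed.

Lemma tri_tab_ok :
  all (fun s => dedup_ok (nexts (lookup bi_tab) s) (nth ([::], [::]) tri_tab s)) (iota 0 13).
Proof. by vm_compute. Qed.

Lemma tetra_tab_ok :
  all (fun s => dedup_ok (nexts (lookup tri_tab) s) (nth ([::], [::]) tetra_tab s)) (iota 0 13).
Proof. by vm_compute. Qed.

Lemma tetra13_tab_ok :
  dedup_ok [seq g <- nexts (lookup tri_tab) 13 | isolated g] tetra13_tab.
Proof. by vm_compute. Qed.

Definition tab_esum (k : nat) (t : seq (seq graph * seq (nat * seq nat))) : bool :=
  all (fun d => all (fun g => esum g == 2 * size g + 2 * k) d.1) t.

Lemma tab_esumP k t s g : tab_esum k t -> g \in lookup t s -> esum g = 2 * size g + 2 * k.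
Proof.
move=> /allP h; rewrite /lookup; have [st|st] := ltnP s (size t); last by rewrite nth_default.
by move=> gl; apply/eqP; move: g gl; apply/allP/h/mem_nth.
Qed.

Lemma bi_tab_esum : tab_esum 1 bi_tab. Proof. by vm_compute. Qed.
Lemma tri_tab_esum : tab_esum 2 tri_tab. Proof. by vm_compute. Qed.
Lemma cycles_esum s g : s <= 13 -> g \in cycles s -> esum g = 2 * size g + 2 * 0.
Proof.
rewrite /cycles; case: ltnP => // s4 le; rewrite inE => /eqP ->; move: s4 le.
by do 14!case: s => [//|s].
Qed.

Section Enumeration.

Variables (T : finType) (e : rel T).
Hypothesis esym : symmetric e.
Hypothesis eirr : irreflexive e.
Hypothesis cubic : forall x, #|[set y | e x y]| = 3.
Hypothesis no3 : forall x y z, e x y -> e y z -> e z x -> False.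
Hypothesis no4 : forall x y z w, e x y -> e y z -> e z w -> e w x ->
  x != z -> y != w -> False.
Hypothesis conn : forall x y, connect e x y.
Hypothesis big : 13 < #|T|.

Let notT (X : {set T}) : #|X| <= 13 -> X != setT.
Proof. by move=> c; apply: contraTneq big => XT; rewrite -cardsT -XT -leqNgt. Qed.

Lemma covered_tab (raw : nat -> seq graph) t n (S : {set T}) :
  all (fun s => dedup_ok (raw s) (nth ([::], [::]) t s)) (iota 0 n) -> #|S| < n ->
  covered e (raw #|S|) S -> covered e (lookup t #|S|) S.
Proof.
move=> /allP/(_ #|S|) ok lt; move: ok; rewrite mem_iota lt => /(_ isT)/andP[w a2].
exact: covered_dedup w a2.
Qed.

Lemma minimal0_covered S : minimal e 0 S -> #|S| <= 13 -> covered e (cycles #|S|) S.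
Proof.
move=> mS le; have [c s4] := cycle_covered esym eirr cubic no3 no4 conn mS (notT le) le.
by rewrite /cycles s4.
Qed.

Lemma minimal1_covered S : minimal e 1 S -> #|S| <= 11 -> covered e (lookup bi_tab #|S|) S.
Proof.
move=> mS le; have le13 : #|S| <= 13 by apply: leq_trans le _.
apply: (covered_tab bi_tab_ok) => //.
apply: (ear_step esym eirr cubic no3 no4 conn mS) => // [S' mS' lt|s g lt].
  by apply: minimal0_covered => //; apply: leq_trans (ltnW lt) _.
by apply: cycles_esum; apply: leq_trans (ltnW lt) _.
Qed.

(** The table of minimal 1-dense graphs has no entry below seven vertices. This feeds the
    connectedness argument in [ear_step]. *)
Lemma dense1_ge7 (Z : {set T}) : Z != set0 -> dense e 1 Z -> 7 <= #|Z|.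
Proof.
move=> Z0 dZ; rewrite leqNgt; apply/negP => lt.
have [Y sY mY] := ex_minimal Z0 dZ.
have cY : #|Y| < 7 := leq_ltn_trans (subset_leq_card sY) lt.
have [|g] := covered_size (minimal1_covered mY _); first exact: leq_trans (ltnW cY) _.
by move: #|Y| cY => n; do 7!case: n => [//|n].
Qed.

Lemma minimal2_covered S : minimal e 2 S -> #|S| <= 12 -> covered e (lookup tri_tab #|S|) S.
Proof.
move=> mS le; have le13 : #|S| <= 13 by apply: leq_trans le _.
apply: (covered_tab tri_tab_ok) => //.
apply: (ear_step esym eirr cubic no3 no4 conn mS) => // [_|S' mS' lt|s g lt].
- exact: dense1_ge7.
- by apply: minimal1_covered => //; rewrite -ltnS (leq_trans lt).
- exact: tab_esumP bi_tab_esum.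
Qed.

Lemma minimal3_covered_raw S : minimal e 3 S -> #|S| <= 13 ->
  covered e (nexts (lookup tri_tab) #|S|) S.
Proof.
move=> mS le.
apply: (ear_step esym eirr cubic no3 no4 conn mS) => // [_|S' mS' lt|s g lt].
- exact: dense1_ge7.
- by apply: minimal2_covered => //; rewrite -ltnS (leq_trans lt).
- exact: tab_esumP tri_tab_esum.
Qed.

Lemma minimal3_covered S : minimal e 3 S -> #|S| <= 12 ->
  covered e (lookup tetra_tab #|S|) S.
Proof.
move=> mS le; apply: (covered_tab tetra_tab_ok) => //.
by apply: minimal3_covered_raw => //; apply: leq_trans le _.
Qed.

Lemma minimal3_covered13 S : minimal e 3 S -> #|S| = 13 ->
  (forall x y, x \in S -> y \in S -> e x y -> deg_in e S x = 2 -> deg_in e S y = 2 -> False) ->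
  covered e tetra13_tab.1 S.
Proof.
move=> mS c13 ind; have /andP[w a2] := tetra13_tab_ok.
apply: covered_dedup w a2 _.
have le13 : #|S| <= 13 by rewrite c13.
have [g [f [gl em imS es]]] := minimal3_covered_raw mS le13.
exists g, f; split=> //; rewrite mem_filter -{1}c13 gl andbT.
have deg u : u < size g -> size (nb g u) = deg_in e S (f u).
  by rewrite -imS; apply: emb_exact; rewrite ?imS.
have deg2 u : u < size g -> size (nb g u) <= 2 -> deg_in e S (f u) = 2.
  move=> ug; rewrite deg // => le2; apply/eqP; rewrite eqn_leq le2.
  by apply: minimal_deg mS _ => //; rewrite -imS mem_img.
apply/(all_nthP [::]) => u ug; apply: contraT; rewrite negb_or -leqNgt => /andP[du].
move=> /allPn[v vu]; rewrite -leqNgt => dv; have vg := emb_nb em ug vu.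
case: (ind (f u) (f v)); rewrite ?deg2 -?imS ?mem_img //.
exact: emb_e em ug vu.
Qed.

End Enumeration.

(** * Every cubic graph of girth at least 5 on 22 vertices has a short dense part *)

Fixpoint fan (k : nat) (g : graph) (front : seq (nat * nat)) : seq nat :=
  map snd front ++
  (if k is k'.+1 then
     fan k' g (flatten [seq [seq (a.2, v) | v <- nb g a.2 & ~~ eqn v a.1] | a <- front])
   else [::]).

(* Labels reachable from [u] in at most 5 steps (possibly among others, when
   the walk turns back at 22). *)
Definition within5 (g : graph) (u : nat) : seq nat := fan 5 g [:: (22, u)].

Definition open_labels (g : graph) : seq nat :=
  [seq u <- iota 0 (size g) | size (nb g u) < 3].

Definition candidates (g : graph) (u : nat) : seq nat :=
  let l := within5 g u in [seq w <- open_labels g | ~~ memn w l].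

Fixpoint best_label (g : graph) (us : seq nat) (m b : nat) : nat :=
  if us is u :: us' then
    let c := size (candidates g u) in
    if c < m then best_label g us' c u else best_label g us' m b
  else b.

(* Preorder list of the labels on which the search below branches. *)
Fixpoint plan (fuel : nat) (g : graph) : seq nat :=
  if fuel is n.+1 then
    let us := open_labels g in
    let u := if size g < 22 then head 0 us else best_label g us 100 0 in
    u :: flatten [seq plan n (adde g u w) | w <- candidates g u]
      ++ (if size g < 22 then plan n (addv g u) else [::])
  else [::].

(* Exhaustive search for a cubic extension of [g] on 22 labels in which no
   new edge closes a cycle of length at most 6. *)
Fixpoint refute (fuel : nat) (g : graph) (hs : seq nat) : option (seq nat) :=
  if fuel is n.+1 then
    if hs is u :: hs' then
      if (u < size g) && (size (nb g u) < 3) then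
        let r := foldl (fun acc w => if acc is Some hs then refute n (adde g u w) hs else None)
                       (Some hs') (candidates g u) in
        if r is Some hs'' then
          (if size g < 22 then refute n (addv g u) hs'' else Some hs'')
        else None
      else None
    else None
  else None.

(** The smallest cubic graph of girth 7 has 24 vertices, so on 22 labels every branch of the search
    dies. The branching labels are chosen beforehand, so that [refute] only has to follow them. *)
Definition girth7_plan : seq nat := Eval vm_compute in plan 40 [:: [::]].

Lemma girth7_refuted : refute 40 [:: [::]] girth7_plan = Some [::].
Proof. by vm_compute. Qed.

(** A listed label really is close; hence an edge to a label that [candidates] rejects as listed
    closes a short cycle. *)
Lemma fanP k g front w : w \in fan k g front ->
  exists a p, [/\ a \in front, path (fun x y => y \in nb g x) a.2 p,
                 last a.2 p = w & size p <= k].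
Proof.
elim: k front => [|k IH] front; rewrite /= mem_cat => /orP[/mapP[a af ->]|] //.
- by exists a, [::].
- by exists a, [::].
move=> /IH[b [p [/flattenP[_ /mapP[a af ->] /mapP[v]]]]].
rewrite mem_filter => /andP[_ va] -> /= pp lp le.
by exists a, (v :: p); rewrite /= va.
Qed.

Definition pendants (g : graph) : seq graph := [seq addv g u | u <- open_labels g].

Definition pendant (g : graph) : graph := addv g (head 0 (open_labels g)).

Definition has_open (g : graph) : bool := ~~ nilp (open_labels g).

(** The number in [poles5], [poles6], [poles6'] and [poles7] counts dangling edges; the vertices and
    excess are 11 and 3, 10 and 2, 12 and 3, 11 and 2. In [thetas9] and [poles13] it counts
    vertices, and both kinds have seven dangling edges. *)
Definition poles5 : seq graph := Eval vm_compute in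
  lookup tetra_tab 11 ++ flatten [seq pendants g | g <- lookup tetra_tab 10].

(** One pendant at a fixed open label is enough here, because [split6] is free to choose the vertex
    by which it enlarges a half. For [poles5] the half is prescribed, so all attachments are
    listed. *)
Definition poles6 : seq graph := Eval vm_compute in
  lookup tri_tab 10 ++ [seq pendant g | g <- lookup tri_tab 9]
    ++ [seq pendant (pendant g) | g <- lookup tri_tab 8].

Lemma poles5E : poles5 =
  lookup tetra_tab 11 ++ flatten [seq pendants g | g <- lookup tetra_tab 10].
Proof. by vm_compute. Qed.

Lemma poles6E : poles6 =
  lookup tri_tab 10 ++ [seq pendant g | g <- lookup tri_tab 9]
    ++ [seq pendant (pendant g) | g <- lookup tri_tab 8].
Proof. by vm_compute. Qed.

Definition poles6' : seq graph := Eval vm_compute in lookup tetra_tab 12.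

Definition poles7 : seq graph := Eval vm_compute in lookup tri_tab 11.

Definition thetas9 : seq graph := Eval vm_compute in lookup bi_tab 9.

Definition poles13 : seq graph := Eval vm_compute in tetra13_tab.1.

(** * Small dense sets and the division of the graph into two poles *)

Section Existence.

Variables (T : finType) (e : rel T).
Hypothesis esym : symmetric e.
Hypothesis eirr : irreflexive e.
Hypothesis cubic : forall x, #|[set y | e x y]| = 3.
Hypothesis no3 : forall x y z, e x y -> e y z -> e z x -> False.
Hypothesis no4 : forall x y z w, e x y -> e y z -> e z w -> e w x ->
  x != z -> y != w -> False.
Hypothesis conn : forall x y, connect e x y.
Hypothesis card22 : #|T| = 22.

Let big : 13 < #|T|. Proof. by rewrite card22. Qed.

Implicit Types (A B S W X Y Z : {set T}) (x y z : T).

Lemma path_degsum x p : path e x p -> uniq (x :: p) ->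
  2 * size p <= degsum e [set z in x :: p].
Proof.
elim/last_ind: p => [|p y IH]; first by rewrite muln0.
rewrite rcons_path -rcons_cons rcons_uniq size_rcons => /andP[pp ly] /andP[yp up].
have -> : [set z in rcons (x :: p) y] = y |: [set z in x :: p].
  by apply/setP => z; rewrite inE mem_rcons in_setU1 !inE.
have d : 0 < deg_in e [set z in x :: p] y.
  apply: (deg_in_gt0 (y := last x p)); last by rewrite esym.
  by rewrite inE mem_last.
rewrite degsumU1 //; last by rewrite inE.
by have := IH pp up; move: d; clear; lia.
Qed.

Lemma short_cycle_dense x p : path e x p -> uniq (x :: p) -> 1 < size p ->
  e (last x p) x -> dense e 0 [set z in x :: p].
Proof.
case/lastP: p => [//|p y]; rewrite rcons_path -rcons_cons rcons_uniq size_rcons last_rcons.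
move=> /andP[pp ly] /andP[yp up] sp yx.
have -> : [set z in rcons (x :: p) y] = y |: [set z in x :: p].
  by apply/setP => z; rewrite inE mem_rcons in_setU1 !inE.
have nx : x != last x p.
  case: p {pp ly yp} up sp => [//|z p] /= /andP[xp _] _.
  by apply: contraNneq xp => ->; rewrite mem_last.
have d2 : 1 < deg_in e [set z in x :: p] y.
  have xX : x \in [set z in x :: p] by rewrite inE mem_head.
  have lX : last x p \in [set z in x :: p] by rewrite inE mem_last.
  by apply: deg_in_gt1 xX lX nx yx _; rewrite esym.
have yX : y \notin [set z in x :: p] by rewrite inE.
have cX : #|[set z in x :: p]| = (size p).+1 by rewrite cardsE (card_uniqP up).
move: (path_degsum pp up) d2; rewrite /dense degsumU1 // cardsU1 yX cX.
by move: (degsum e _) (deg_in e _ _) (size p) => a b c; lia.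
Qed.

Lemma grow g f u : emb e g f -> u < size g -> size (nb g u) < 3 ->
  (exists t, [/\ t \notin img g f & e (f u) t]) \/
  (exists w, [/\ w < size g, w \notin nb g u & e (f u) (f w)]).
Proof.
move=> em ug du.
have [t ut tn] : exists2 t, e (f u) t & t \notin map f (nb g u).
  have : ~~ ([set y | e (f u) y] \subset map f (nb g u)).
    apply/negP => /subset_leq_card; rewrite cubic (card_uniqP (emb_map_uniq em ug)) size_map.
    by rewrite leqNgt du.
  by move=> /subsetPn[t]; rewrite inE; exists t.
have [/imgP[w wg tw]|tg] := boolP (t \in img g f); last by left; exists t.
right; exists w; rewrite -tw; split=> //.
by apply: contra tn => wu; rewrite tw map_f.
Qed.

(** The actual graph survives every step of the search: an edge at [u] that [g] does not record
    leads to a new label or to a candidate, since any other end would close a cycle on at most six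
    vertices. *)
Lemma refuteP fuel g f hs hs' :
  (forall Z, Z != set0 -> #|Z| <= 6 -> ~~ dense e 0 Z) ->
  emb e g f -> refute fuel g hs = Some hs' -> False.
Proof.
move=> no; elim: fuel g f hs hs' => [//|n IH] g f [//|u hs] hs' em /=.
case: ifP => // /andP[ug du].
case E: (foldl _ _ _) => [hs1|//] fin.
have none w : w \in candidates g u -> emb e (adde g u w) f -> False.
  move=> wc emw; move: hs hs1 E {fin}; elim: (candidates g u) wc => [//|v l IHl].
  rewrite inE => /orP[/eqP <-|wl] hs hs1 /=.
    case Er: (refute n (adde g u w) hs) => [hs2|]; first by have := IH _ _ _ _ emw Er.
    by move=> E; exfalso; elim: (l) E.
  case Er: (refute n (adde g u v) hs) => [hs2|]; first exact: IHl wl hs2 hs1.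
  by move=> E; exfalso; elim: (l) E.
have [[t [tg ut]]|[w [wg wu uw]]] := grow em ug du.
  have em' := emb_addv esym em ug ut tg.
  (* The enlarged copy has [(size g).+1] distinct vertices among 22, so the branch [addv g u] was
     searched. *)
  have := subset_leq_card (subsetT (img (addv g u) (ext g f t))).
  rewrite (card_img em') size_addv cardsT card22 => le.
  by move: fin; rewrite le; apply: IH em'.
have em' := emb_adde esym eirr em ug wg uw wu.
apply: (none w _ em'); rewrite mem_filter.
have nuw : w != u by apply: contraTneq uw => ->; rewrite eirr.
have dw : size (nb g w) < 3.
  have wg' : w < size (adde g u w) by rewrite size_adde.
  have := leq_trans (emb_deg em' wg') (deg_in_le3 cubic _ _).
  have nuw' : u != w by rewrite eq_sym.
  by rewrite nb_adde // (negPf nuw) eqxx.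
(* If [w] were within five steps of [u], the walk would shorten to a simple path with at most five
   edges, and the edge from [u] to [w] would complete its image to a 0-dense set of at most six
   vertices. *)
rewrite mem_filter dw mem_iota wg leq0n !andbT memnE; apply/negP => /fanP[_ [p [/[!inE]/eqP -> /= pp lp le]]].
case/shortenP: pp lp => q pq uq subq lq.
have szq : size q <= 5.
  by apply: leq_trans le; apply: uniq_leq_size => //; case/andP: uq.
have qg v : v \in u :: q -> v < size g.
  rewrite inE => /orP[/eqP -> //|]; elim: q u ug pq {E du em' nuw wu uw uq lq szq subq none fin} => //= v' q IHq u ug.
  move=> /andP[v'u pq]; have v'g := emb_nb em ug v'u.
  by rewrite inE => /orP[/eqP -> //|]; apply: IHq pq.
have fq : path e (f u) (map f q).
  elim: q u ug pq {E du em' nuw wu uw uq lq szq subq none fin qg} => //= v q IHq u ug /andP[vu pq].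
  by rewrite (emb_e em ug vu) IHq // (emb_nb em ug vu).
have [_ _ inj] := em.
have ufq : uniq (f u :: map f q).
  by rewrite -map_cons map_inj_in_uniq // => a b /qg ? /qg ?; apply: inj.
have sz : 1 < size (map f q).
  rewrite size_map; case: q pq lq {uq subq szq qg fq ufq} => [|v [|]] //=.
    by move=> _ E1; rewrite E1 eqxx in nuw.
  by rewrite andbT => vu vw; rewrite vw (negPf wu) in vu.
have := no [set z in f u :: map f q]; rewrite short_cycle_dense //; last first.
  by rewrite last_map lq esym.
move=> h; suff: ~~ true by []. apply: h.
  by apply/set0Pn; exists (f u); rewrite !inE eqxx.
by rewrite cardsE (card_uniqP ufq) /= size_map.
Qed.

Lemma ex_dense0 : exists Z, [/\ Z != set0, #|Z| <= 6 & dense e 0 Z].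
Proof.
have [/existsP[Z /and3P[? ? ?]]|no] := boolP [exists Z, [&& Z != set0, #|Z| <= 6 & dense e 0 Z]].
  by exists Z.
have [x _] : exists x : T, x \in setT by apply/set0Pn; rewrite -card_gt0 cardsT card22.
have em : emb e [:: [::]] (fun=> x).
  split; first exact: wfP.
    by move=> [|u] // v _; rewrite inE.
  by move=> [|u] // [|v].
exfalso; apply: refuteP em girth7_refuted => Z Z0 cZ.
apply: contraNN no => dZ; apply/existsP; exists Z; by rewrite Z0 cZ.
Qed.

Definition layer Z : {set T} := [set y | y \notin Z & 0 < deg_in e Z y].

(** Each edge leaving [Z] has its own end in the layer, and by independence the layer contributes
    these edges only. *)
Lemma layer_grow Z : (forall y, y \notin Z -> deg_in e Z y <= 1) ->
  (forall a b, a \in layer Z -> b \in layer Z -> ~~ e a b) ->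
  #|layer Z| + degsum e Z = 3 * #|Z| /\
  (#|Z :|: layer Z| = #|Z| + #|layer Z| /\
  degsum e (Z :|: layer Z) = degsum e Z + 2 * #|layer Z|).
Proof.
move=> le1 ind.
have dis : [disjoint Z & layer Z].
  by rewrite disjoint_sym disjoints_subset; apply/subsetP => y; rewrite !inE => /andP[].
have sumL : \sum_(x in Z) deg_in e (layer Z) x = #|layer Z|.
  rewrite (eq_bigr (fun x => \sum_(y in layer Z) e x y)); last by move=> x _; rewrite deg_inE.
  rewrite exchange_big /= -sum1_card; apply: eq_bigr => y yL.
  rewrite (eq_bigr (fun x => nat_of_bool (e y x))); last by move=> x _; rewrite esym.
  rewrite -deg_inE; move: yL; rewrite inE => /andP[yZ d0].
  by apply/eqP; rewrite eqn_leq le1.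
have sumC : \sum_(x in Z) deg_in e (~: Z) x = \sum_(x in Z) deg_in e (layer Z) x.
  apply: eq_bigr => x xZ; apply: eq_card => y; rewrite !inE.
  have [yZ|yZ] //= := boolP (y \in Z).
  by case xy: (e x y); rewrite ?andbF // (deg_in_gt0 xZ) // esym.
have := degsum_bound cubic Z; rewrite sumC sumL addnC => ->; split=> //; split.
  by rewrite cardsU (disjoint_setI0 dis) cards0 subn0.
rewrite degsumU // sumL.
have -> : degsum e (layer Z) = 0; last by rewrite addn0.
rewrite /degsum big1 // => x xL; apply/eqP; rewrite -leqn0 leqNgt; apply/negP.
by move=> /deg_in_gt0P[y yL xy]; have := ind _ _ xL yL; rewrite xy.
Qed.

(** Two new vertices bring three edges. *)
Lemma dense_add2 k X y z : dense e k X -> y \notin X -> z \notin X -> e y z ->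
  0 < deg_in e X y -> 0 < deg_in e X z ->
  #|[set y; z] :|: X| = #|X|.+2 /\ dense e k.+1 ([set y; z] :|: X).
Proof.
move=> dX yX zX yz dy dz; have nyz : y != z by apply: contraTneq yz => ->; rewrite eirr.
have zyX : z \notin y |: X by rewrite !inE negb_or eq_sym nyz.
have -> : [set y; z] :|: X = z |: (y |: X) by rewrite setUCA setUA.
split; first by rewrite !cardsU1 yX zyX.
rewrite -addn1; apply: dense_add => //; first by rewrite -[k]addn0; apply: dense_add.
have [a aX za] := deg_in_gt0P dz.
have ya : y != a by apply: contraNneq yX => ->.
by apply: deg_in_gt1 ya _ _; rewrite ?inE ?aX ?eqxx ?orbT // esym.
Qed.

(** Three new vertices bring four edges. *)
Lemma dense_add3 k X y z w : dense e k X -> y \notin X -> z \notin X -> y != z ->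
  w \notin [set y; z] :|: X -> e w y -> e w z ->
  0 < deg_in e X y -> 0 < deg_in e X z ->
  #|w |: ([set y; z] :|: X)| = #|X| + 3 /\ dense e k.+1 (w |: ([set y; z] :|: X)).
Proof.
move=> dX yX zX nyz wX wy wz dy dz.
have zyX : z \notin y |: X by rewrite !inE negb_or eq_sym nyz.
have E : [set y; z] :|: X = z |: (y |: X) by rewrite setUCA setUA.
split; first by rewrite cardsU1 wX E !cardsU1 yX zyX addn3.
rewrite -addn1; apply: dense_add => //; last first.
  by apply: deg_in_gt1 nyz _ _; rewrite ?inE ?eqxx ?orbT.
rewrite E -[k]addn0; apply: dense_add => //; first by rewrite -[k]addn0; apply: dense_add.
by apply: leq_trans dz _; apply: deg_inS; apply: subsetUr.
Qed.

(* Two outer layers around an exactly k-dense set, unless a denser set shows up nearby. *)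
Lemma two_layers k X : degsum e X = 2 * #|X| + 2 * k -> X != set0 ->
  (forall Z, Z != set0 -> #|Z| <= #|X| + 3 -> ~~ dense e k.+1 Z) ->
  let X1 := X :|: layer X in
  [/\ #|layer X| + 2 * k = #|X|, #|X1| = #|X| + #|layer X|,
      degsum e X1 = degsum e X + 2 * #|layer X| &
      forall y, y \notin X1 -> deg_in e X1 y <= 1].
Proof.
move=> dE X0 no X1; have dX : dense e k X by rewrite /dense dE.
have ne x Y : x |: Y != set0 by apply/set0Pn; exists x; rewrite setU11.
have le1 y : y \notin X -> deg_in e X y <= 1.
  move=> yX; rewrite leqNgt; apply/negP => d2.
  have c : #|y |: X| <= #|X| + 3 by rewrite cardsU1 yX addnC leq_add2l.
  by have := no _ (ne y X) c; rewrite -addn1 dense_add.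
have ind a b : a \in layer X -> b \in layer X -> ~~ e a b.
  rewrite !inE => /andP[aX da] /andP[bX db]; apply/negP => ab.
  have [c d] := dense_add2 dX aX bX ab da db.
  have ne' : [set a; b] :|: X != set0 by apply/set0Pn; exists a; rewrite !inE eqxx.
  by have := no _ ne'; rewrite c d addn3 leqW // => /(_ isT).
have [c1 [c2 c3]] := layer_grow le1 ind; split=> //; first by move: c1; rewrite dE; clear; lia.
move=> y yX1; rewrite leqNgt; apply/negP => /card_gt1P[a [b]].
rewrite !inE => -[/andP[aX1 ya] /andP[bX1 yb] nab].
have yX : y \notin X by apply: contra yX1; rewrite inE => ->.
have dy0 : deg_in e X y = 0.
  by apply/eqP; move: yX1; rewrite !inE negb_or yX /= -eqn0Ngt.
have notX c : e y c -> c \notin X.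
  by move=> yc; apply/negP => cX; have := deg_in_gt0 cX yc; rewrite dy0.
have aX := notX _ ya; have bX := notX _ yb.
move: aX1 bX1; rewrite (negPf aX) (negPf bX) /= => da db.
have yabX : y \notin [set a; b] :|: X.
  rewrite !inE !negb_or yX andbT; apply/andP; split.
    by apply: contraTneq ya => ->; rewrite eirr.
  by apply: contraTneq yb => ->; rewrite eirr.
have [c d] := dense_add3 dX aX bX nab yabX ya yb da db.
by have := no _ (ne y _) (eq_leq c); rewrite d.
Qed.

(** Without triangles the adjacent vertices [a] and [b] reach [X] through distinct vertices of the
    first layer; the four vertices bring five edges. *)
Lemma second_layer k X a b : dense e k X -> let X1 := X :|: layer X in
  a \in layer X1 -> b \in layer X1 -> e a b ->
  exists Z, [/\ Z != set0, #|Z| <= #|X| + 4 & dense e k.+1 Z].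
Proof.
move=> dX X1; rewrite !inE => /andP[aX1 /deg_in_gt0P[a' a'X1 aa']].
move=> /andP[bX1 /deg_in_gt0P[b' b'X1 bb']] ab.
have inL c c' : ~~ ((c \in X) || (c \notin X) && (0 < deg_in e X c)) -> c' \in X1 -> e c c' ->
    [/\ c \notin X, c' \notin X & 0 < deg_in e X c'].
  rewrite negb_or => /andP[cX]; rewrite cX /= => dc c'X1 cc'.
  have c'X : c' \notin X by apply: contra dc => c'X; apply: deg_in_gt0 c'X cc'.
  by move: c'X1; rewrite !inE (negPf c'X) /= => ->.
have [aX a'X da'] := inL _ _ aX1 a'X1 aa'.
have [bX b'X db'] := inL _ _ bX1 b'X1 bb'.
have nab' : a' != b'.
  by apply/eqP => E; apply: (no3 ab bb'); rewrite -E esym.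
have b'X' : b' \notin a' |: X by rewrite !inE negb_or eq_sym nab'.
pose W := b' |: (a' |: X).
have dW : dense e k W.
  rewrite -[k]addn0; apply: dense_add => //; first by rewrite -[k]addn0; apply: dense_add.
  by apply: leq_trans db' _; apply: deg_inS; apply: subsetUr.
have notW c : ~~ ((c \in X) || (c \notin X) && (0 < deg_in e X c)) -> c \notin W.
  move=> h; have cX : c \notin X by move: h; rewrite negb_or => /andP[].
  by rewrite !inE !negb_or cX andbT; apply/andP; split; apply: contraNneq h => ->;
     rewrite ?b'X ?db' ?a'X ?da' orbT.
have [||c d] := dense_add2 dW (notW _ aX1) (notW _ bX1) ab.
- by apply: (deg_in_gt0 (y := a')) => //; rewrite !inE eqxx orbT.
- by apply: (deg_in_gt0 (y := b')) => //; rewrite !inE eqxx.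
exists ([set a; b] :|: W); split=> //; last by rewrite c !cardsU1 a'X b'X' !add1n addn4.
by apply/set0Pn; exists a; rewrite !inE eqxx.
Qed.

(** Otherwise [spread_bound] excludes a shortest cycle of length six, and a 5-cycle is surrounded by
    independent layers of 5 and 10 vertices. The 20 edges leaving the outer layer would have to end
    in the two remaining vertices. *)
Lemma ex_dense1 : exists X, [/\ X != set0, #|X| <= 9 & dense e 1 X].
Proof.
have [/existsP[Z /and3P[? ? ?]]|no] := boolP [exists Z, [&& Z != set0, #|Z| <= 9 & dense e 1 Z]].
  by exists Z.
have {}no Z : Z != set0 -> #|Z| <= 9 -> ~~ dense e 1 Z.
  move=> Z0 cZ; apply: contraNN no => dZ; apply/existsP; exists Z.
  by rewrite Z0 cZ.
have [Z [Z0 cZ dZ]] := ex_dense0; have [X sX mX] := ex_minimal Z0 dZ.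
have cX : #|X| <= 6 := leq_trans (subset_leq_card sX) cZ.
have le13 : #|X| <= 13 by apply: leq_trans cX _.
have XT : X != setT by apply: contraTneq le13 => ->; rewrite cardsT card22.
have [_ c4] := cycle_covered esym eirr cubic no3 no4 conn mX XT le13.
have dE := minimal_exact esym eirr cubic conn mX XT.
have [X0 dX _] := mX.
have no' Y : Y != set0 -> #|Y| <= #|X| + 3 -> ~~ dense e 1 Y.
  by move=> Y0 cY; apply: no => //; apply: leq_trans cY _; move: cX; clear; lia.
have [l1 l2 l3 le1] := two_layers dE X0 no'.
have sb := spread_bound esym cubic le1; rewrite card22 l3 l2 dE in sb.
have X5 : #|X| = 5 by move: sb l1 cX c4; clear; lia.
set X1 := X :|: layer X in l2 l3 le1.
have ind2 a b : a \in layer X1 -> b \in layer X1 -> ~~ e a b.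
  move=> aL bL; apply/negP => ab.
  have [Y [Y0 cY dY]] := second_layer dX aL bL ab.
  by rewrite X5 in cY; have := no Y Y0 cY; rewrite dY.
have [m1 [m2 m3]] := layer_grow le1 ind2.
have := degsumC esym eirr cubic (X1 :|: layer X1).
rewrite m2 m3 l2 l3 dE card22; move: m1 l1; rewrite l2 l3 dE X5; clear; lia.
Qed.

(** Otherwise [spread_bound] leaves only [#|X| = 7], with independent layers of 5 and 10 vertices.
    These exhaust the graph while the outer layer still has 20 edges to send elsewhere. *)
Lemma ex_dense2 X : minimal e 1 X -> #|X| <= 8 ->
  exists Z, [/\ Z != set0, #|Z| <= 11 & dense e 2 Z].
Proof.
move=> mX cX.
have [/existsP[Z /and3P[? ? ?]]|no] := boolP [exists Z, [&& Z != set0, #|Z| <= 11 & dense e 2 Z]].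
  by exists Z.
have {}no Z : Z != set0 -> #|Z| <= 11 -> ~~ dense e 2 Z.
  move=> Z0 cZ; apply: contraNN no => dZ; apply/existsP; exists Z.
  by rewrite Z0 cZ.
have [X0 dX _] := mX.
have c7 := dense1_ge7 esym eirr cubic no3 no4 conn big X0 dX.
have le13 : #|X| <= 13 by apply: leq_trans cX _.
have XT : X != setT by apply: contraTneq le13 => ->; rewrite cardsT card22.
have dE := minimal_exact esym eirr cubic conn mX XT.
have no' Y : Y != set0 -> #|Y| <= #|X| + 3 -> ~~ dense e 2 Y.
  by move=> Y0 cY; apply: no => //; apply: leq_trans cY _; move: cX; clear; lia.
have [l1 l2 l3 le1] := two_layers dE X0 no'.
have sb := spread_bound esym cubic le1; rewrite card22 l3 l2 dE in sb.
have X7 : #|X| = 7 by move: sb l1 cX c7; clear; lia.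
set X1 := X :|: layer X in l2 l3 le1.
have ind2 a b : a \in layer X1 -> b \in layer X1 -> ~~ e a b.
  move=> aL bL; apply/negP => ab.
  have [Y [Y0 cY dY]] := second_layer dX aL bL ab.
  by rewrite X7 in cY; have := no Y Y0 cY; rewrite dY.
have [m1 [m2 m3]] := layer_grow le1 ind2.
have := degsumC esym eirr cubic (X1 :|: layer X1).
rewrite m2 m3 l2 l3 dE card22; move: m1 l1; rewrite l2 l3 dE X7; clear; lia.
Qed.

(** At least four edges leave [W]; this is what nontriviality of the snark provides, by
    [snark_cut4]. *)
Hypothesis cut4 : forall W, 2 <= #|W| <= 20 -> degsum e W + 4 <= 3 * #|W|.

Let notT X : #|X| <= 13 -> X != setT.
Proof. by move=> c; apply: contraTneq c => ->; rewrite cardsT card22. Qed.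

Lemma card_dense2 k X : X != set0 -> dense e k.+1 X -> 2 <= #|X|.
Proof.
move=> X0 dX; apply: (@leq_trans 7) => //.
apply: (dense1_ge7 esym eirr cubic no3 no4 conn big X0).
by apply: leq_trans dX; rewrite leq_add2l leq_mul2l.
Qed.

Lemma pendants_covered l S y : covered e l S -> y \notin S -> deg_in e S y = 1 ->
  covered e (flatten [seq pendants g | g <- l]) (y |: S).
Proof.
move=> [g [f [gl em imS es]]] yS d1.
have [x xS yx] : exists2 x, x \in S & e y x by apply: deg_in_gt0P; rewrite d1.
rewrite -imS in xS; have [u ug xu] := imgP _ _ _ xS.
have uy : e (f u) y by rewrite -xu esym.
have yg : y \notin img g f by rewrite imS.
have em' := emb_addv esym em ug uy yg.
exists (addv g u), (ext g f y); split=> //; last 2 first.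
- by rewrite img_addv imS.
- by rewrite esum_addv // es degsumU1 // d1 addn2.
apply/flattenP; exists (pendants g); first exact: map_f.
apply: map_f; rewrite mem_filter mem_iota leq0n add0n ug !andbT.
have ug' : u < size (addv g u) by rewrite size_addv ltnW.
have := leq_trans (emb_deg em' ug') (deg_in_le3 cubic _ _).
by rewrite nb_addv // ltn_eqF // eqxx.
Qed.

Lemma pendant_covered l S : covered e l S -> all has_open l ->
  exists y, [/\ y \notin S, 0 < deg_in e S y &
    deg_in e S y = 1 -> covered e [seq pendant g | g <- l] (y |: S)].
Proof.
move=> [g [f [gl em imS es]]] /allP/(_ g gl) op.
have : head 0 (open_labels g) \in open_labels g.
  by move: op; rewrite /has_open; case: (open_labels g) => //= u us; rewrite mem_head.
rewrite mem_filter mem_iota => /andP[du ug].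
have [u uE] : exists u, u = head 0 (open_labels g) by eexists.
rewrite -uE in du ug; rewrite add0n in ug.
have dE : size (nb g u) = deg_in e S (f u) by rewrite -imS; apply: emb_exact; rewrite ?imS.
have [y yS uy] : exists2 y, y \in ~: S & e (f u) y.
  by apply: deg_in_gt0P; rewrite dE in du; move: (deg_inC cubic S (f u)) du; clear; lia.
rewrite inE in yS; exists y; split=> //.
  by apply: (deg_in_gt0 (y := f u)); rewrite -?imS ?mem_img // esym.
move=> d1; have yg : y \notin img g f by rewrite imS.
have em' := emb_addv esym em ug uy yg.
exists (addv g u), (ext g f y); split=> //.
- by apply/mapP; exists g => //; rewrite /pendant -uE.
- by rewrite img_addv imS.
- by rewrite esum_addv // es degsumU1 // d1 addn2.
Qed.

Lemma poles5_covered A : #|A| = 11 -> dense e 3 A -> covered e poles5 A.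
Proof.
move=> cA dA; have A0 : A != set0 by rewrite -card_gt0 cA.
have [S sS mS] := ex_minimal A0 dA; have [S0 dS _] := mS.
have le : #|S| <= 11 by rewrite -cA subset_leq_card.
have le13 : #|S| <= 13 by apply: leq_trans le _.
have dE := minimal_exact esym eirr cubic conn mS (notT le13).
(* With excess 3 the cut of [S] has [#|S| - 6] edges, and these are at least four. *)
have c4 : 10 <= #|S|.
  have := @cut4 S; rewrite (card_dense2 S0 dS) (leq_trans le) // dE => /(_ isT).
  by clear; lia.
have cov := minimal3_covered esym eirr cubic no3 no4 conn big mS (leq_trans le (leqnSn _)).
have [S11|S10] : #|S| = 11 \/ #|S| = 10 by move: le c4; clear; lia.
  have <- : S = A by apply/eqP; rewrite eqEcard sS cA S11.
  by rewrite S11 in cov; apply: covered_sub cov => g gl; rewrite poles5E mem_cat gl.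
have [y yA yS] : exists2 y, y \in A & y \notin S.
  by apply/subsetPn; apply: contraTN isT => /subset_leq_card; rewrite cA S10.
have AE : A = y |: S.
  by apply/eqP; rewrite eq_sym eqEcard subUset sub1set yA sS cA cardsU1 yS S10.
(* The density of [A] requires one edge from [y] into [S]; a second one would leave [A] with a cut
   of three edges. *)
have d1 : deg_in e S y = 1.
  have := @cut4 A; rewrite cA => /(_ isT); move: dA; rewrite /dense cA AE degsumU1 // dE S10.
  by clear; lia.
rewrite AE; rewrite S10 in cov.
by apply: covered_sub (pendants_covered cov yS d1) => g gl; rewrite poles5E mem_cat gl orbT.
Qed.

Definition split_in (la lb : seq graph) : Prop :=
  exists2 A, covered e la A & covered e lb (~: A).

Lemma no_dense k m : (forall A, #|A| = m -> ~~ dense e k A) -> m <= 22 ->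
  forall Z, Z != set0 -> #|Z| <= m -> ~~ dense e k Z.
Proof.
move=> no le Z Z0 cZ; apply/negP => dZ.
have [|Y cY dY] := dense_extend esym eirr conn (m := m) dZ Z0; first by rewrite cZ card22.
by have := no _ cY; rewrite dY.
Qed.

(** The absence of 3-dense sets up to 11 vertices makes the 12-vertex complement minimal, and forces
    each vertex added to [S] to bring exactly one edge. *)
Lemma split6 A0 : (forall A, #|A| = 11 -> ~~ dense e 3 A) ->
  #|A0| = 10 -> dense e 2 A0 -> split_in poles6 poles6'.
Proof.
move=> no3d cA0 dA0; have {}no3d := no_dense no3d isT.
suff [A [cA dE covA]] : exists A, [/\ #|A| = 10, degsum e A = 24 & covered e poles6 A].
  exists A => //.
  have cB : #|~: A| = 12 by move: (cardsC A); rewrite cA card22; clear; lia.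
  have dB : degsum e (~: A) = 30.
    by have := degsumC esym eirr cubic A; rewrite cA dE card22; clear; lia.
  have mB : minimal e 3 (~: A).
    split; first by rewrite -card_gt0 cB.
      by rewrite /dense cB dB.
    move=> Y /proper_card; rewrite cB => cY Y0; exact: no3d.
  have le : #|~: A| <= 12 by rewrite cB.
  by have := minimal3_covered esym eirr cubic no3 no4 conn big mB le; rewrite cB.
have A00 : A0 != set0 by rewrite -card_gt0 cA0.
have [S sS mS] := ex_minimal A00 dA0; have [S0 dS _] := mS.
have le : #|S| <= 10 by rewrite -cA0 subset_leq_card.
have le12 : #|S| <= 12 by apply: leq_trans le _.
have dE := minimal_exact esym eirr cubic conn mS (notT (leqW le12)).
have c4 : 8 <= #|S|.
  have := @cut4 S; rewrite (card_dense2 S0 dS) (leq_trans le) // dE => /(_ isT).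
  by clear; lia.
have cov := minimal2_covered esym eirr cubic no3 no4 conn big mS le12.
have one Y y : Y != set0 -> #|Y| <= 10 -> dense e 2 Y -> y \notin Y -> 0 < deg_in e Y y ->
    deg_in e Y y = 1.
  move=> Y0 cY dY yY d0; apply/eqP; rewrite eqn_leq d0 andbT leqNgt; apply/negP => d2.
  have := no3d (y |: Y); rewrite -card_gt0 cardsU1 yY add1n => /(_ isT cY).
  by rewrite -[3]/(2 + 1) dense_add.
have [S10|[S9|S8]] : #|S| = 10 \/ #|S| = 9 \/ #|S| = 8 by move: le c4; clear; lia.
- exists S; split=> //; first by rewrite dE S10.
  by rewrite S10 in cov; apply: covered_sub cov => g gl; rewrite poles6E mem_cat gl.
- rewrite S9 in cov; have [|y [yS d0 cov1]] := pendant_covered cov; first by vm_compute.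
  have d1 := one _ _ S0 le dS yS d0.
  exists (y |: S); split; first by rewrite cardsU1 yS S9.
    by rewrite degsumU1 // dE S9 d1.
  by apply: covered_sub (cov1 d1) => g gl; rewrite poles6E !mem_cat gl orbT.
- rewrite S8 in cov; have [|y [yS d0 cov1]] := pendant_covered cov; first by vm_compute.
  have d1 := one _ _ S0 le dS yS d0.
  have c1 : #|y |: S| = 9 by rewrite cardsU1 yS S8.
  have dE1 : degsum e (y |: S) = 22 by rewrite degsumU1 // dE S8 d1.
  have [|z [zS e0 cov2]] := pendant_covered (cov1 d1); first by vm_compute.
  have e1 : deg_in e (y |: S) z = 1.
    apply: one => //; first by rewrite -card_gt0 c1.
      by rewrite c1.
    by rewrite /dense c1 dE1.
  exists (z |: (y |: S)); split; first by rewrite cardsU1 zS c1.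
    by rewrite degsumU1 // dE1 e1.
  apply: covered_sub (cov2 e1) => g; rewrite -map_comp => gl.
  by rewrite poles6E !mem_cat gl !orbT.
Qed.

(** An 11-set and its complement have equal [degsum], so both are 2-dense; both are minimal because
    smaller 2-dense sets are excluded. *)
Lemma split7 Z : (forall A, #|A| = 10 -> ~~ dense e 2 A) ->
  Z != set0 -> #|Z| <= 11 -> dense e 2 Z -> split_in poles7 poles7.
Proof.
move=> no2 Z0 cZ dZ; have {}no2 := no_dense no2 isT.
have [|A cA dA] := dense_extend esym eirr conn (m := 11) dZ Z0; first by rewrite cZ card22.
have mA B : #|B| = 11 -> dense e 2 B -> minimal e 2 B.
  move=> cB dB; split=> //; first by rewrite -card_gt0 cB.
  by move=> Y /proper_card; rewrite cB => cY Y0; apply: no2.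
have cov B : #|B| = 11 -> dense e 2 B -> covered e poles7 B.
  move=> cB dB; have le : #|B| <= 12 by rewrite cB.
  by have := minimal2_covered esym eirr cubic no3 no4 conn big (mA _ cB dB) le; rewrite cB.
exists A; first exact: cov.
have cC : #|~: A| = 11 by move: (cardsC A); rewrite cA card22; clear; lia.
apply: cov => //; rewrite /dense cC.
have := degsumC esym eirr cubic A; rewrite cA card22; move: dA; rewrite /dense cA.
by clear; lia.
Qed.

(** By [ex_dense2] the minimal 1-dense set has exactly nine vertices. Its complement is minimal: a
    smaller 3-dense set could only have 12 vertices, and then its own complement would be a 2-dense
    10-set. *)
Lemma split9 : (forall Z, Z != set0 -> #|Z| <= 11 -> ~~ dense e 2 Z) ->
  split_in thetas9 poles13.
Proof.
move=> no2; have [Z [Z0 cZ dZ]] := ex_dense1; have [X sX mX] := ex_minimal Z0 dZ.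
have le9 : #|X| <= 9 := leq_trans (subset_leq_card sX) cZ.
have c9 : #|X| = 9.
  apply/eqP; rewrite eqn_leq le9 leqNgt; apply/negP => lt.
  by have [Y [Y0 cY dY]] := ex_dense2 mX lt; have := no2 _ Y0 cY; rewrite dY.
have le11 : #|X| <= 11 by rewrite c9.
have le13 : #|X| <= 13 by rewrite c9.
have dE := minimal_exact esym eirr cubic conn mX (notT le13).
have [X0 dX _] := mX.
exists X.
  by have := minimal1_covered esym eirr cubic no3 no4 conn big mX le11; rewrite c9.
have cY : #|~: X| = 13 by move: (cardsC X); rewrite c9 card22; clear; lia.
have dY : degsum e (~: X) = 32.
  by have := degsumC esym eirr cubic X; rewrite c9 dE c9 card22; clear; lia.
have mY : minimal e 3 (~: X).
  split; first by rewrite -card_gt0 cY.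
    by rewrite /dense cY dY.
  move=> W /proper_card; rewrite cY => cW W0; apply/negP => dW.
  have d2 : dense e 2 W by apply: leq_trans dW; rewrite leq_add2l leq_mul2l.
  have [le|gt] := leqP #|W| 11; first by have := no2 _ W0 le; rewrite d2.
  have c12 : #|W| = 12 by move: gt cW; clear; lia.
  have cC : #|~: W| = 10 by move: (cardsC W); rewrite c12 card22; clear; lia.
  have := no2 (~: W); rewrite -card_gt0 cC => /(_ isT isT)/negP; apply.
  have := degsumC esym eirr cubic W; rewrite /dense cC c12 card22; move: dW.
  by rewrite /dense c12; clear; lia.
(* Adjacent vertices of degree two in the complement both touch [X] and would enlarge it to a
   2-dense 11-set. *)
apply: (minimal3_covered13 esym eirr cubic no3 no4 conn big mY cY) => x y xX yX xy dx dy.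
rewrite !inE in xX yX.
have d1 z : deg_in e (~: X) z = 2 -> 0 < deg_in e X z.
  by have := deg_inC cubic X z; clear; lia.
have [c d] := dense_add2 dX xX yX xy (d1 _ dx) (d1 _ dy).
have := no2 ([set x; y] :|: X); rewrite c d c9 => /(_ _ isT); suff -> : [set x; y] :|: X != set0 by move=> /(_ isT).
by rewrite -card_gt0 c.
Qed.

(** The density bounds recorded in the last two cases serve, through [thin], to discard further
    gluings. *)
Theorem cut_cases :
  [\/ split_in poles5 poles5, split_in poles6 poles6',
      split_in poles7 poles7 /\ (forall Z, Z != set0 -> #|Z| <= 10 -> ~~ dense e 2 Z)
    | split_in thetas9 poles13 /\ (forall Z, Z != set0 -> #|Z| <= 11 -> ~~ dense e 2 Z)].
Proof.
have [/existsP[A /andP[/eqP cA dA]]|n3] := boolP [exists A : {set T}, (#|A| == 11) && dense e 3 A].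
  apply: Or41; exists A; first exact: poles5_covered.
  have cC : #|~: A| = 11 by move: (cardsC A); rewrite cA card22; clear; lia.
  apply: poles5_covered => //; rewrite /dense cC.
  have := degsumC esym eirr cubic A; rewrite cA card22; move: dA; rewrite /dense cA.
  by clear; lia.
have {}n3 A : #|A| = 11 -> ~~ dense e 3 A.
  by move=> cA; apply: contra n3 => dA; apply/existsP; exists A; rewrite cA eqxx.
have [/existsP[A /andP[/eqP cA dA]]|n2] := boolP [exists A : {set T}, (#|A| == 10) && dense e 2 A].
  by apply: Or42; apply: split6 cA dA.
have {}n2 A : #|A| = 10 -> ~~ dense e 2 A.
  by move=> cA; apply: contra n2 => dA; apply/existsP; exists A; rewrite cA eqxx.
have [/existsP[Z /and3P[Z0 cZ dZ]]|no] := boolP [exists Z, [&& Z != set0, #|Z| <= 11 & dense e 2 Z]].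
  by apply: Or43; split; [apply: split7 Z0 cZ dZ|apply: no_dense].
have {}no Z : Z != set0 -> #|Z| <= 11 -> ~~ dense e 2 Z.
  by move=> Z0 cZ; apply: contraNN no => dZ; apply/existsP; exists Z; rewrite Z0 cZ.
by apply: Or44; split; first exact: split9.
Qed.

End Existence.

(** * Gluing two poles along their dangling edges *)

Definition dangles (g : graph) : seq nat :=
  flatten [seq nseq (3 - size (nb g u)) u | u <- iota 0 (size g)].

(* A coloured pole lists a colour for every entry of the adjacency lists, and
   one for every dangling edge. *)
Definition colouring := (seq (seq nat) * seq nat)%type.

Definition at_vertex (g : graph) (cs : seq nat) (u : nat) : seq nat :=
  [seq x.2 | x <- zip (dangles g) cs & eqn x.1 u].

Definition edge_colour (g : graph) (cg : seq (seq nat)) (u v : nat) : nat :=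
  nth 0 (nb cg u) (find (eqn v) (nb g u)).

Definition check_colouring (g : graph) (c : colouring) : bool :=
  [&& eqn (size c.2) (size (dangles g)), all (fun k => k < 3) c.2 &
      all (fun u =>
        [&& all (fun v => (edge_colour g c.1 u v < 3) &&
                          eqn (edge_colour g c.1 u v) (edge_colour g c.1 v u)) (nb g u) &
            uniq ([seq edge_colour g c.1 u v | v <- nb g u] ++ at_vertex g c.2 u)])
      (iota 0 (size g))].

(** Sets of colour sequences; matching one more dangling edge of the other pole means descending one
    level. *)
Inductive trie := Empty | Leaf | Node of trie & trie & trie.

Definition child (t : trie) (k : nat) : trie :=
  if t is Node t0 t1 t2 then
    match k with 0 => t0 | 1 => t1 | 2 => t2 | _ => Empty end
  else Empty.

Fixpoint insert (c : seq nat) (t : trie) : trie :=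
  if c is k :: c' then
    match k with
    | 0 => Node (insert c' (child t 0)) (child t 1) (child t 2)
    | 1 => Node (child t 0) (insert c' (child t 1)) (child t 2)
    | _ => Node (child t 0) (child t 1) (insert c' (child t 2))
    end
  else Leaf.

Fixpoint stored (t : trie) (c : seq nat) : bool :=
  if c is k :: c' then stored (child t k) c' else if t is Leaf then true else false.

Definition perms3 : seq (seq nat) :=
  [:: [:: 0; 1; 2]; [:: 0; 2; 1]; [:: 1; 0; 2]; [:: 1; 2; 0]; [:: 2; 0; 1]; [:: 2; 1; 0]].

(** Storing one side under all six renamings of the colours allows the other side to be listed in a
    single normal form. *)
Definition insert_perms (c : seq nat) (ps : seq (seq nat)) (t : trie) : trie :=
  foldr (fun p t => insert [seq nth 0 p k | k <- c] t) t ps.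

Definition colour_trie (cs : seq (seq nat)) : trie :=
  foldr (fun c => insert_perms c perms3) Empty cs.

Definition dist3 (g : graph) (u v : nat) : nat :=
  if eqn u v then 0 else if memn v (nb g u) then 1
  else if has (fun w => memn v (nb g w)) (nb g u) then 2 else 3.

Definition distances (g : graph) : seq (seq nat) :=
  [seq [seq dist3 g u v | v <- iota 0 (size g)] | u <- iota 0 (size g)].

Definition closer (k : nat) (g : graph) : seq (seq (nat * nat)) :=
  [seq [seq (v, dist3 g u v) | v <- iota 0 (size g) & dist3 g u v < k] | u <- iota 0 (size g)].

Definition inner_esum (g : graph) (s : seq nat) : nat :=
  sumn [seq count (fun v => memn v s) (nb g u) | u <- s].

Definition is_theta (m : nat) (g : graph) (s : seq nat) : bool :=
  [&& size s <= m, uniq s, all (fun v => v < size g) s &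
      2 * size s + 2 <= inner_esum g s].

(** One or two labels are deleted and then labels with at most one remaining neighbour are pruned
    away. Only results that pass [is_theta] are kept; a set that is missed merely weakens the test
    in [clash]. *)
Definition theta_sets (m : nat) (g : graph) : seq (seq nat) :=
  let prune s := [seq v <- s | 1 < count (fun w => memn w s) (nb g v)] in
  let del s u := iter 6 prune [seq v <- s | ~~ eqn u v] in
  let l := iota 0 (size g) in
  undup [seq s <- [seq del l u | u <- l] ++ [seq del (del l u) v | u <- l, v <- l] | is_theta m g s].

Definition joint_theta (g : graph) (ts : seq (seq nat)) : seq (seq bool) :=
  [seq [seq has (fun s => memn u s && memn v s) ts | v <- iota 0 (size g)] | u <- iota 0 (size g)].

Record pole := Pole {
  pgraph : graph;
  pdangles : seq nat;
  pcolours : seq (seq nat);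
  ptrie : trie;
  pdist : seq (seq nat);
  pclose1 : seq (seq (nat * nat));
  pclose2 : seq (seq (nat * nat));
  ptheta : seq (seq bool) }.

Definition make_pole (m : nat) (gc : graph * seq colouring) : pole :=
  let g := gc.1 in
  let cs := [seq c.2 | c <- gc.2] in
  Pole g (dangles g) cs (colour_trie cs) (distances g) (closer 2 g) (closer 3 g)
       (joint_theta g (if m is 0 then [::] else theta_sets m g)).

(** The pairs [(p, q)] and [(p', x.1)] conflict when they close a cycle shorter than five, or when
    one pole has a theta through both of its ends and the other joins its two ends by an edge: that
    makes a 2-dense set with two vertices more than the theta. *)
Definition clash (a b : pole) (p q p' : nat) (x : nat * nat) : bool :=
  let da := nth 0 (nth [::] (pdist a) p) p' in
  [|| da + x.2 < 3, eqn x.2 1 && nth false (nth [::] (ptheta a) p) p' |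
      eqn da 1 && nth false (nth [::] (ptheta b) q) x.1].

(* [cl] is the list of close labels of [q]. *)
Definition fits (a b : pole) (cl : seq (nat * nat)) (p q : nat) (asg : seq (nat * nat)) : bool :=
  if cl is [::] then true
  else all (fun y => all (fun x => ~~ (eqn x.1 y.2 && clash a b p q y.1 x)) cl) asg.

Fixpoint drop_at (A : Type) (i : nat) (s : seq A) : seq A :=
  match s, i with
  | [::], _ => [::]
  | _ :: s', 0 => s'
  | x :: s', i'.+1 => x :: drop_at i' s'
  end.

(** An entry holds the colours of the still unmatched dangling edges of [a] and the colourings of
    [b] that agree so far; entries with an empty trie are dropped. *)
Fixpoint follow (i : nat) (l : seq (seq nat * trie)) : seq (seq nat * trie) :=
  if l is (c, t) :: l' then
    match child t (nth 0 c i) with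
    | Empty => follow i l'
    | t' => (drop_at i c, t') :: follow i l'
    end
  else [::].

Definition index_perms : seq (seq (seq nat)) := Eval vm_compute in
  [seq permutations (iota 0 n) | n <- iota 0 4].

(* The index permutations under which no entry of [l] is a stored colouring. *)
Fixpoint unmatched (l : seq (seq nat * trie)) (todo : seq (seq nat)) : seq (seq nat) :=
  match todo, l with
  | [::], _ => [::]
  | _, (c, t) :: l' =>
      unmatched l' [seq ix <- todo | ~~ stored t [seq nth 0 c i | i <- ix]]
  | _, [::] => todo
  end.

(* All ways [asg] to match the dangling edges of [a] and [b] for which no
   stored colouring of [a] extends to [b]. *)
Fixpoint glue (n : nat) (a b : pole) (close : seq (seq (nat * nat)))
    (qs rem : seq nat) (asg : seq (nat * nat)) (l : seq (seq nat * trie)) :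
    seq (seq (nat * nat)) :=
  match n, qs with
  | n'.+1, q :: qs' =>
    let cl := nth [::] close q in
    flatten [seq (let p := nth 0 rem i in
                  if fits a b cl p q asg
                  then glue n' a b close qs' (drop_at i rem) ((p, q) :: asg) (follow i l)
                  else [::]) | i <- iota 0 (size rem)]
  | _, _ => [seq catrev (zip [seq nth 0 rem i | i <- ix] qs) asg
            | ix <- unmatched l (nth [::] index_perms (size rem))]
  end.

Fixpoint consistent (a b : pole) (asg : seq (nat * nat)) : bool :=
  if asg is (p, q) :: asg' then
    fits a b (nth [::] (pclose2 b) q) p q asg' && consistent a b asg'
  else true.

(** If no vertex of [a] has two dangling edges, two ends there are at distance at least one, so only
    ends of [b] at distance at most one can close a short cycle; [consistent] finally applies the
    wider lists. The last three dangling edges are matched at once through [index_perms]. *)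
Definition glues (a b : pole) : seq (seq (nat * nat)) :=
  [seq asg <- glue (size (pdangles b) - 3) a b (if uniq (pdangles a) then pclose1 b else pclose2 b)
                (pdangles b) (pdangles a) [::] [seq (c, ptrie b) | c <- pcolours a]
  | consistent a b asg].

Definition join_graphs (g h : graph) (asg : seq (nat * nat)) : graph :=
  foldr (fun x r => adde r x.1 (size g + x.2))
        (g ++ [seq [seq size g + v | v <- l] | l <- h]) asg.

Fixpoint suffix_pairs (A : Type) (s : seq A) : seq (A * A) :=
  if s is x :: s' then [seq (x, y) | y <- s] ++ suffix_pairs s' else [::].

Lemma stored_Empty x : stored Empty x = false.
Proof. by elim: x => [|[|[|[|k]]] x]. Qed.

Lemma stored_insert c t x : all (fun k => k < 3) c -> stored (insert c t) x ->
  x = c \/ stored t x.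
Proof.
elim: c t x => [|k c IH] t x /=; first by case: x => [|y x] /=; [left|rewrite stored_Empty].
move=> /andP[k3 c3]; case: x => [|y x]; first by case: k k3 => [|[|[|]]].
case: k k3 => [|[|[|k]]] // _; case: y => [|[|[|y]]] /= h; try by [right | rewrite stored_Empty in h].
all: by case: (IH _ _ c3 h) => [->|]; [left|right].
Qed.

Lemma perms3P p : p \in perms3 ->
  (forall k, k < 3 -> nth 0 p k < 3) /\ {in gtn 3 &, injective (nth 0 p)}.
Proof.
by rewrite !inE => /or4P[/eqP->|/eqP->|/eqP->|/or3P[/eqP->|/eqP->|/eqP->]];
  split=> [[|[|[|k]]]|[|[|[|k]]] [|[|[|k']]]].
Qed.

Lemma stored_insert_perms c ps t x : all (fun k => k < 3) c -> {subset ps <= perms3} ->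
  stored (insert_perms c ps t) x ->
  (exists2 p, p \in perms3 & x = [seq nth 0 p k | k <- c]) \/ stored t x.
Proof.
move=> c3; elim: ps => [_ st|p ps IH sub] /=; first by right.
have pp : p \in perms3 by apply: sub; rewrite mem_head.
have [lt3 _] := perms3P pp.
move=> /stored_insert[||] //; first by rewrite all_map; apply: sub_all c3 => k /= /lt3.
  by left; exists p.
by apply: IH => q qps; apply: sub; rewrite inE qps orbT.
Qed.

Lemma stored_trie cs x : all (all (fun k => k < 3)) cs -> stored (colour_trie cs) x ->
  exists c p, [/\ c \in cs, p \in perms3 & x = [seq nth 0 p k | k <- c]].
Proof.
elim: cs => [|c cs IH]; first by rewrite stored_Empty.
move=> /andP[c3 cs3]; move=> st; case: (@stored_insert_perms c perms3 (colour_trie cs) x c3 (fun _ => id) st) => [[p pp ->]|/(IH cs3)[c' [p [c'cs pp ->]]]].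
  by exists c, p; rewrite mem_head.
by exists c', p; rewrite inE c'cs orbT.
Qed.

Definition boundary (g : graph) (cs : seq nat) : Prop :=
  [/\ size cs = size (dangles g), all (fun k => k < 3) cs &
      exists c : nat -> nat -> nat, forall u, u < size g ->
        (forall v, v \in nb g u -> c u v < 3 /\ c u v = c v u) /\
        uniq ([seq c u v | v <- nb g u] ++ at_vertex g cs u)].

Lemma mem_iota0 u n : u < n -> u \in iota 0 n.
Proof. by rewrite mem_iota. Qed.

Lemma check_colouringP g c : check_colouring g c -> boundary g c.2.
Proof.
move=> /and3P[/eqnP sz c3 /allP h]; split=> //; exists (edge_colour g c.1) => u ug.
have /andP[/allP a un] := h u (mem_iota0 ug).
by split=> // v /a /andP[-> /eqnP].
Qed.

Lemma at_vertex_map g h cs u : at_vertex g (map h cs) u = map h (at_vertex g cs u).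
Proof.
rewrite /at_vertex; elim: (dangles g) cs => [|d ds IH] [|c cs] //=.
by case: ifP => _ /=; rewrite IH.
Qed.

Lemma boundary_perm g cs p : p \in perms3 -> boundary g cs ->
  boundary g [seq nth 0 p k | k <- cs].
Proof.
move=> pp [sz c3 [c h]]; have [lt3 inj] := perms3P pp.
split; first by rewrite size_map.
  by rewrite all_map; apply: sub_all c3 => k /= /lt3.
exists (fun u v => nth 0 p (c u v)) => u ug; have [a un] := h u ug; split.
  by move=> v /a[lt <-]; rewrite lt3.
rewrite at_vertex_map (map_comp (nth 0 p) (c u)) -map_cat map_inj_in_uniq //.
have all3 k : k \in [seq c u v | v <- nb g u] ++ at_vertex g cs u -> k < 3.
  rewrite mem_cat => /orP[/mapP[v /a[lt _] -> //]|].
  move=> /mapP[[d k'] /=]; rewrite mem_filter => /andP[_ dk] ->.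
  by move/allP: c3; apply; move: (map_f snd dk); rewrite -/(unzip2 _) unzip2_zip // sz.
by move=> k k' /all3 ? /all3 ?; apply: inj.
Qed.

Lemma drop_at_perm (A : eqType) (x0 : A) i s : i < size s ->
  perm_eq (nth x0 s i :: drop_at i s) s.
Proof.
elim: s i => [//|x s IH] [|i] //= ilt.
have := IH i ilt; rewrite -(perm_cons x) => h; apply: perm_trans h.
by apply/permP => P /=; rewrite addnCA.
Qed.

Lemma size_drop_at (A : Type) i (s : seq A) : i < size s -> size (drop_at i s) = (size s).-1.
Proof. by elim: s i => [//|x s IH] [|i] //= ilt; rewrite IH //; case: s ilt {IH}. Qed.

Lemma zip_drop_at (A B : Type) i (s : seq A) (t : seq B) :
  zip (drop_at i s) (drop_at i t) = drop_at i (zip s t).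
Proof.
elim: s t i => [|x s IH] [|y t] [|i] //=; rewrite ?IH //.
all: by [case: t | case: s {IH} | case: (drop_at i t) | case: (drop_at i s)].
Qed.

Fixpoint some_match (Q : seq nat -> trie -> Prop) (l : seq (seq nat * trie)) : Prop :=
  if l is (c, t) :: l' then Q c t \/ some_match Q l' else False.

Lemma some_match_impl Q Q' l : (forall c t, Q c t -> Q' c t) ->
  some_match Q l -> some_match Q' l.
Proof. by move=> h; elim: l => [//|[c t] l IH] /= [/h|/IH]; [left|right]. Qed.

Lemma some_match_sized k Q l : all (fun ct => size ct.1 == k) l -> some_match Q l ->
  some_match (fun c t => size c = k /\ Q c t) l.
Proof. by elim: l => [//|[c t] l IH] /= /andP[/eqP s /IH{}IH] [q|/IH]; [left|right]. Qed.

Lemma some_match_map (t : trie) Q cs : some_match Q [seq (c, t) | c <- cs] ->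
  exists2 c, c \in cs & Q c t.
Proof.
elim: cs => [//|c cs IH] /= [q|/IH[c' cs' q]]; first by exists c; rewrite ?mem_head.
by exists c'; rewrite ?inE ?cs' ?orbT.
Qed.

Lemma follow_match i Q l : some_match Q (follow i l) ->
  some_match (fun c t => Q (drop_at i c) (child t (nth 0 c i))) l.
Proof.
elim: l => [//|[c t] l IH] /=; case: (child _ _) => [/IH|[q|/IH]|? ? ? [q|/IH]];
  by [left|right].
Qed.

Lemma follow_sized k i l : i < k.+1 -> all (fun ct => size ct.1 == k.+1) l ->
  all (fun ct => size ct.1 == k) (follow i l).
Proof.
move=> ik; elim: l => [//|[c t] l IH] /= /andP[/eqP s /IH{}IH].
by case: (child _ _) => //= *; rewrite size_drop_at s ?eqxx.
Qed.

Lemma unmatched_match l todo ix : ix \in todo -> ix \in unmatched l todo \/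
  some_match (fun c t => stored t [seq nth 0 c i | i <- ix]) l.
Proof.
elim: l todo => [|[c t] l IH] [|jx todo] ixt //=; first by left.
case st : (stored t [seq nth 0 c i | i <- ix]); first by right; left.
set td := (X in unmatched l X).
have ixtd : ix \in td.
  move: ixt; rewrite /td inE => /predU1P[<-|m]; first by rewrite st /= mem_head.
  by case: ifP => _; rewrite ?inE mem_filter st m ?orbT.
by have [?|?] := IH _ ixtd; [left|right; right].
Qed.

Definition fine (a b : pole) (y z : nat * nat) : bool :=
  ~~ clash a b z.1 z.2 y.1 (y.2, dist3 (pgraph b) z.2 y.2).

Definition graded (g : graph) (close : seq (seq (nat * nat))) : Prop :=
  forall q x, x \in nth [::] close q -> x.2 = dist3 g q x.1.

Lemma closer_graded k g : graded g (closer k g).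
Proof.
move=> q x; have [lt|ge] := ltnP q (size g); last by rewrite nth_default ?size_map ?size_iota.
by rewrite (nth_map 0) ?size_iota // nth_iota // => /mapP[v _ ->].
Qed.

Lemma fits_fine a b close p q asg : graded (pgraph b) close ->
  all (fun y => fine a b y (p, q)) asg -> fits a b (nth [::] close q) p q asg.
Proof.
move=> gr ok; have {}gr := gr q.
suff h : all (fun y => all (fun x => ~~ (eqn x.1 y.2 && clash a b p q y.1 x)) (nth [::] close q)) asg.
  by rewrite /fits; case: (nth _ _ _) h.
apply: sub_all ok => y ok; apply/allP => x xin; apply/negP => /andP[/eqnP e1].
move: ok; rewrite /fine /= -e1 -(gr _ xin).
by case: x {e1 xin} => ? ? /negP.
Qed.

Lemma consistent_fine a b zs asg : graded (pgraph b) (pclose2 b) -> consistent a b asg ->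
  all (fun y => all (fine a b y) zs) asg -> pairwise (fine a b) zs ->
  consistent a b (catrev zs asg).
Proof.
move=> gr; elim: zs asg => [//|[p q] zs IH] asg con /= al /andP[hz pw].
apply: IH => //=; last first.
  by rewrite hz; apply: sub_all al => y /= /andP[].
by rewrite con andbT; apply: fits_fine => //; apply: sub_all al => y /= /andP[].
Qed.

(** [s] is the true matching in the order of [qs]. The search loses it only to a colouring of [a]
    whose transport along [s] is stored for [b]. *)
Lemma glueP n a b close qs rem asg l s : graded (pgraph b) close ->
  size qs = size rem -> size rem <= n + 3 ->
  all (fun ct => size ct.1 == size rem) l -> perm_eq s rem ->
  all (fun y => all (fine a b y) (zip s qs)) asg -> pairwise (fine a b) (zip s qs) ->
  catrev (zip s qs) asg \in glue n a b close qs rem asg l \/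
  some_match (fun c t => exists c', [/\ size c' = size s, stored t c' &
    perm_eq (zip s c') (zip rem c)]) l.
Proof.
move=> gr.
(* The final stage of [glue]: the remaining part of the matching is an index permutation of
   [rem']. *)
have base qs' rem' asg' l' s' : size qs' = size rem' -> size rem' <= 3 ->
  all (fun ct => size ct.1 == size rem') l' -> perm_eq s' rem' ->
  catrev (zip s' qs') asg' \in [seq catrev (zip [seq nth 0 rem' i | i <- ix] qs') asg'
            | ix <- unmatched l' (nth [::] index_perms (size rem'))] \/
  some_match (fun c t => exists c', [/\ size c' = size s', stored t c' &
    perm_eq (zip s' c') (zip rem' c)]) l'.
  move=> sq le3 sl /perm_iotaP-/(_ 0)[ix px ->].
  have ixin : ix \in nth [::] index_perms (size rem').
    suff -> : nth [::] index_perms (size rem') = permutations (iota 0 (size rem')).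
      by rewrite mem_permutations.
    by case: (size rem') le3 => [|[|[|[|k]]]].
  have [un|] := unmatched_match l' ixin; first by left; apply/mapP; exists ix.
  move=> /(some_match_sized sl) m; right; apply: some_match_impl m => c t [sc st].
  exists [seq nth 0 c i | i <- ix]; split=> //; first by rewrite !size_map.
  have -> : zip [seq nth 0 rem' i | i <- ix] [seq nth 0 c i | i <- ix] =
            [seq nth (0, 0) (zip rem' c) i | i <- ix].
    by rewrite zip_map; apply: eq_map => i /=; rewrite nth_zip.
  apply: perm_trans (perm_map _ px) _.
  by rewrite (_ : size rem' = size (zip rem' c)) ?map_nth_iota0 ?take_size // size_zip sc minnn.
elim: n qs rem asg l s => [|n IH] qs rem asg l s sq le sl ps al pw; first exact: base.
case: qs sq al pw => [|q qs] sq al pw.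
  by apply: base => //; rewrite -sq.
case: s ps al pw => [|p s] ps al pw.
  by move: (perm_size ps); rewrite -sq.
have pin : p \in rem by rewrite -(perm_mem ps) mem_head.
have ilt : index p rem < size rem by rewrite index_mem.
have nthp : nth 0 rem (index p rem) = p by rewrite nth_index.
have [k sk] : exists k, size rem = k.+1 by exists (size qs); rewrite -sq.
have sd : size (drop_at (index p rem) rem) = k by rewrite size_drop_at // sk.
have ps' : perm_eq s (drop_at (index p rem) rem).
  rewrite -(perm_cons p); apply: perm_trans ps _.
  by rewrite perm_sym -{1}nthp; apply: drop_at_perm.
move: al pw => /= al /andP[hz pw].
have [||||||inn|m] := IH qs (drop_at (index p rem) rem) ((p, q) :: asg) (follow (index p rem) l) s => //.
- by move: sq; rewrite sd sk /= => -[].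
- by rewrite sd; move: le; rewrite sk addSn.
- by rewrite sd; apply: follow_sized; rewrite -?sk.
- by rewrite /= hz; apply: sub_all al => y /= /andP[].
- left; apply/flatten_mapP; exists (index p rem); first by rewrite mem_iota.
  rewrite /= nthp fits_fine //; apply: sub_all al => y /= /andP[] //.
right; apply: some_match_impl (some_match_sized sl (follow_match m)) => c t [sc [c' [s' st pz]]].
exists (nth 0 c (index p rem) :: c'); split=> //=; first by rewrite s'.
have := pz; rewrite -(perm_cons (p, nth 0 c (index p rem))) => h; apply: perm_trans h _.
rewrite zip_drop_at -{1}nthp -nth_zip // .
by apply: drop_at_perm; rewrite size_zip sc minnn.
Qed.

Lemma glues_complete m m' ga gb s : let a := make_pole m ga in let b := make_pole m' gb in
  size (dangles gb.1) = size (dangles ga.1) ->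
  all (fun c => size c.2 == size (dangles ga.1)) ga.2 ->
  perm_eq s (dangles ga.1) -> pairwise (fine a b) (zip s (dangles gb.1)) ->
  rev (zip s (dangles gb.1)) \in glues a b \/
  exists c c', [/\ c \in [seq d.2 | d <- ga.2], size c' = size s,
    stored (ptrie b) c' & perm_eq (zip s c') (zip (dangles ga.1) c)].
Proof.
move=> a b sz sc ps pw.
have gr : graded (pgraph b) (if uniq (pdangles a) then pclose1 b else pclose2 b).
  by case: ifP => _; apply: closer_graded.
have le : size (pdangles a) <= size (pdangles b) - 3 + 3.
  by rewrite /= -sz; clear; lia.
have al : all (fun ct => size ct.1 == size (pdangles a)) [seq (c, ptrie b) | c <- pcolours a].
  by rewrite all_map /= all_map; apply: sub_all sc.
have [inn|/some_match_map[c cin [c' [s' st pz]]]] := glueP (asg := [::]) gr sz le al ps isT pw.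
  left; rewrite mem_filter inn andbT; apply: consistent_fine => //.
  exact: closer_graded.
by right; exists c, c'.
Qed.

Lemma dist3P g u v : match dist3 g u v with
  | 0 => u = v | 1 => v \in nb g u | 2 => exists2 w, w \in nb g u & v \in nb g w
  | _ => True end.
Proof.
rewrite /dist3; case: eqnP => // _; case: ifP => [|_]; first by rewrite memnE.
by case: ifP => // /hasP[w wu]; rewrite memnE; exists w.
Qed.

Lemma nth_distances g u v : u < size g -> v < size g ->
  nth 0 (nth [::] (distances g) u) v = dist3 g u v.
Proof. by move=> ug vg; rewrite !(nth_map 0) ?size_iota // !nth_iota. Qed.

Lemma nth_joint_theta g ts u v : nth false (nth [::] (joint_theta g ts) u) v ->
  exists s, [/\ s \in ts, u \in s & v \in s].
Proof.
have [ug|ge] := ltnP u (size g); last by rewrite [nth [::] _ _]nth_default ?size_map ?size_iota // nth_nil.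
have [vg|ge] := ltnP v (size g); last first.
  by rewrite (nth_map 0) ?size_iota // nth_default // size_map size_iota.
rewrite !(nth_map 0) ?size_iota // !nth_iota // => /hasP[s sts].
by rewrite !memnE => /andP[]; exists s.
Qed.

Lemma uniq_map_inj (A B : eqType) (f : A -> B) s x y :
  uniq (map f s) -> x \in s -> y \in s -> f x = f y -> x = y.
Proof.
elim: s => [//|z s IH] /= /andP[nz un]; rewrite !inE => /predU1P[->|xs] /predU1P[->|ys] // e.
- by case/negP: nz; rewrite e map_f.
- by case/negP: nz; rewrite -e map_f.
- exact: IH.
Qed.

(** * The cut edges between two complementary embedded poles *)

Section Gluing.

Variables (T : finType) (e : rel T).
Hypothesis esym : symmetric e.
Hypothesis eirr : irreflexive e.
Hypothesis cubic : forall x, #|[set y | e x y]| = 3.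
Hypothesis no3 : forall x y z, e x y -> e y z -> e z x -> False.
Hypothesis no4 : forall x y z w, e x y -> e y z -> e z w -> e w x ->
  x != z -> y != w -> False.

Lemma count_img g f (P : pred T) : emb e g f ->
  count (fun p => P (f p)) (iota 0 (size g)) = #|[set y in img g f | P y]|.
Proof.
move=> [_ _ inj]; set s := [seq p <- iota 0 (size g) | P (f p)].
have un : uniq (map f s).
  rewrite map_inj_in_uniq ?filter_uniq ?iota_uniq // => p q.
  by rewrite !mem_filter !mem_iota => /and3P[_ _ pg] /and3P[_ _ qg]; apply: inj.
rewrite -size_filter -/s -(size_map f) -(card_uniqP un); apply: eq_card => y; rewrite !inE.
apply/mapP/andP => [[p]|[/imgP[p pg ->] Pp]].
  by rewrite mem_filter mem_iota => /and3P[Pp _ pg] ->; rewrite mem_img.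
by exists p; rewrite // mem_filter mem_iota Pp.
Qed.

Lemma exact_missing g f q : emb e g f -> esum g = degsum e (img g f) -> q < size g ->
  3 - size (nb g q) = deg_in e (~: img g f) (f q).
Proof.
move=> em ex qg; rewrite (emb_exact em ex qg).
by have := deg_inC cubic (img g f) (f q); clear; lia.
Qed.

Variables (ga gb : graph) (fa fb : nat -> T).
Hypothesis ema : emb e ga fa.
Hypothesis emb_b : emb e gb fb.
Hypothesis imgb : img gb fb = ~: img ga fa.
Hypothesis exa : esum ga = degsum e (img ga fa).
Hypothesis exb : esum gb = degsum e (img gb fb).

(** Sorted by the second label, the cut is listed in the order of [dangles gb]; [crossing'] lists it
    in the order of [dangles ga]. *)
Definition crossing : seq (nat * nat) :=
  flatten [seq [seq (p, q) | p <- iota 0 (size ga) & e (fa p) (fb q)] | q <- iota 0 (size gb)].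

Definition crossing' : seq (nat * nat) :=
  flatten [seq [seq (p, q) | q <- iota 0 (size gb) & e (fa p) (fb q)] | p <- iota 0 (size ga)].

Lemma mem_crossing p q :
  ((p, q) \in crossing) = [&& p < size ga, q < size gb & e (fa p) (fb q)].
Proof.
apply/flatten_mapP/and3P => [[q']|[pg qg pq]].
  rewrite mem_iota => /= qg /mapP[p'].
  by rewrite mem_filter mem_iota => /and3P[pq _ pg] [-> ->].
exists q; first by rewrite mem_iota.
by apply/mapP; exists p; rewrite // mem_filter mem_iota pq.
Qed.

Lemma uniq_flatten_pairs (A : eqType) (F : nat -> seq A) (pr : A -> nat) s : uniq s ->
  (forall i, uniq (F i)) -> (forall i x, x \in F i -> pr x = i) ->
  uniq (flatten [seq F i | i <- s]).
Proof.
move=> + uF pF; elim: s => [//|i s IH] /= /andP[ni /IH{}IH]; rewrite cat_uniq uF IH andbT /=.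
by apply/hasPn => x /flatten_mapP[j js xj]; apply: contra ni => /pF <-; rewrite (pF _ _ xj).
Qed.

Lemma uniq_crossing : uniq crossing.
Proof.
apply: (@uniq_flatten_pairs _ _ snd) => [|q|q x /mapP[? _ ->]] //; first exact: iota_uniq.
by rewrite map_inj_uniq ?filter_uniq ?iota_uniq // => ? ? [].
Qed.

Lemma crossing_perm : perm_eq crossing crossing'.
Proof.
apply: uniq_perm; first exact: uniq_crossing.
  apply: (@uniq_flatten_pairs _ _ fst) => [|q|q x /mapP[? _ ->]] //; first exact: iota_uniq.
  by rewrite map_inj_uniq ?filter_uniq ?iota_uniq // => ? ? [].
move=> [p q]; rewrite mem_crossing; apply/and3P/flatten_mapP => [[pg qg pq]|[p']].
  exists p; first by rewrite mem_iota.
  by apply/mapP; exists q; rewrite // mem_filter mem_iota pq.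
rewrite mem_iota => /= pg /mapP[q'].
by rewrite mem_filter mem_iota => /and3P[pq _ qg] [-> ->].
Qed.

Lemma unzip_blocks (A : Type) (F : nat -> seq A) (pr : A -> nat) (g : graph) :
  (forall i, i < size g -> map pr (F i) = nseq (3 - size (nb g i)) i) ->
  map pr (flatten [seq F i | i <- iota 0 (size g)]) = dangles g.
Proof.
move=> h; rewrite map_flatten -map_comp; congr flatten.
by apply/eq_in_map => i; rewrite mem_iota => ig; apply: h.
Qed.

Lemma map_const (A : Type) (k : nat) (s : seq A) : map (fun=> k) s = nseq (size s) k.
Proof. by elim: s => //= x s ->. Qed.

Lemma unzip2_crossing : unzip2 crossing = dangles gb.
Proof.
apply: unzip_blocks => q qg; rewrite -map_comp map_const; congr nseq.
rewrite size_filter (count_img (fun y => e y (fb q)) ema) (exact_missing emb_b exb qg).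
by rewrite imgb setCK /deg_in; apply: eq_card => y; rewrite !inE esym.
Qed.

Lemma unzip1_crossing : perm_eq (unzip1 crossing) (dangles ga).
Proof.
suff <- : unzip1 crossing' = dangles ga by apply: perm_map; apply: crossing_perm.
apply: unzip_blocks => p pg; rewrite -map_comp map_const; congr nseq.
rewrite size_filter (count_img (e (fa p)) emb_b) (exact_missing ema exa pg).
by rewrite imgb /deg_in.
Qed.

Lemma sides_disjoint p q : p < size ga -> q < size gb -> fa p != fb q.
Proof.
move=> pg qg; have := mem_img fb qg; rewrite imgb inE; apply: contraNneq => <-.
exact: mem_img.
Qed.

Lemma inner_esum_degsum g f (s : seq nat) : emb e g f -> uniq s -> {in s, forall v, v < size g} ->
  #|[set:: map f s]| = size s /\ inner_esum g s <= degsum e [set:: map f s].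
Proof.
move=> em us sg; have [wg eg inj] := em.
have uf : uniq (map f s) by rewrite map_inj_in_uniq // => i j /sg ig /sg jg; apply: inj.
split; first by rewrite cardsE (card_uniqP uf) size_map.
rewrite /degsum /inner_esum sumnE big_map.
rewrite [X in _ <= X](eq_bigl (fun x => x \in map f s)); last by move=> x; rewrite inE.
rewrite -(big_uniq _ uf) big_map /= !big_seq; apply: leq_sum => w ws.
rewrite -size_filter -(size_map f) -(card_uniqP _); last first.
  rewrite map_inj_in_uniq ?filter_uniq ?(wg w (sg _ ws)).1 //.
  move=> i j; rewrite !mem_filter => /andP[_ iw] /andP[_ jw].
  by apply: inj; apply: emb_nb em (sg _ ws) _.
apply: subset_leq_card; apply/subsetP => x /mapP[i + ->].
rewrite mem_filter memnE => /andP[is_ iw].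
by rewrite !inE map_f // (eg w) // sg.
Qed.

(** The value 0 switches the theta test off. The summand 2 stands for the two vertices of the other
    pole that enlarge a theta of at most [m] vertices. *)
Definition thin (m : nat) : Prop :=
  if m is 0 then True else forall Z : {set T}, Z != set0 -> #|Z| <= m + 2 -> ~~ dense e 2 Z.

(** The edge [y z] and its two links to the theta form an ear that raises the excess to two. *)
Lemma theta_clash m g f s u v y z : thin m -> emb e g f ->
  s \in (if m is 0 then [::] else theta_sets m g) -> u \in s -> v \in s ->
  y \notin img g f -> z \notin img g f -> e y z -> e (f u) y -> e (f v) z -> False.
Proof.
case: m => [//|m] th em; rewrite mem_undup mem_filter => /andP[/and4P[sm us /allP sg dn] _].
move=> su sv yn zn yz uy vz; have [_ eg inj] := em.
set Z : {set T} := [set:: map f s].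
have memZ w : w \in s -> f w \in Z by move=> ws; rewrite inE map_f.
have ZP x : reflect (exists2 w, w \in s & x = f w) (x \in Z) by rewrite inE; apply: mapP.
have [cZ le] := inner_esum_degsum em us sg.
have dZ : dense e 1 Z by rewrite /dense cZ muln1; apply: leq_trans dn le.
have nZ x : x \notin img g f -> x \notin Z.
  by apply: contra => /ZP[w ws ->]; apply: mem_img; apply: sg.
have dg w x : w \in s -> e (f w) x -> 0 < deg_in e Z x.
  by move=> ws wx; apply: (@deg_in_gt0 _ _ _ _ (f w)); rewrite ?memZ // esym.
have [c d] := dense_add2 esym eirr dZ (nZ _ yn) (nZ _ zn) yz (dg _ _ su uy) (dg _ _ sv vz).
have := th ([set y; z] :|: Z); rewrite d -card_gt0 c cZ => /(_ isT); rewrite addn2 !ltnS.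
by move=> /(_ sm).
Qed.

(** Two cut edges whose ends are at total distance at most two lie on a triangle or a 4-cycle, or
    coincide; the theta clashes are excluded by [theta_clash] on either side. *)
Lemma crossing_fine m m' ca cb : thin m -> thin m' ->
  pairwise (fine (make_pole m (ga, ca)) (make_pole m' (gb, cb))) crossing.
Proof.
move=> th th'; have := uniq_crossing; rewrite uniq_pairwise.
have [wa ea ia] := ema; have [wb eb ib] := emb_b.
suff h : {in crossing &, forall y z, y != z ->
    fine (make_pole m (ga, ca)) (make_pole m' (gb, cb)) y z}.
  exact: (@sub_in_pairwise _ (mem crossing) _ _ h crossing (allss _)).
move=> [p q] [p' q'] /=; rewrite !mem_crossing => /and3P[pg qg pq] /and3P[pg' qg' pq'].
have qp := pq; have qp' := pq'; rewrite esym in qp; rewrite esym in qp'.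
move=> ne; rewrite /fine /clash /=; rewrite nth_distances //; apply/or3P => -[].
- have := dist3P ga p' p; have := dist3P gb q' q.
  case: (dist3 ga p' p) => [|[|[|?]]]; case: (dist3 gb q' q) => [|[|[|?]]] //.
  + by move=> e1 e2; move: ne; rewrite e1 e2 eqxx.
  + move=> qq e1 _; rewrite e1 in pq'; apply: (no3 pq' (eb _ _ qg' qq)).
    by rewrite esym.
  + move=> [w wq qw] e1 _; rewrite e1 in pq'.
    have wlt := emb_nb emb_b qg' wq.
    apply: (no4 pq' (eb _ _ qg' wq) (eb _ _ wlt qw)) => //.
      exact: sides_disjoint.
    apply: contra ne => /eqP/(ib _ _ qg' qg) ->; by rewrite e1.
  + move=> e1 pp _; rewrite e1 in qp'; apply: (no3 (ea _ _ pg' pp) pq).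
    by rewrite esym -e1 esym in qp' *.
  + move=> qq pp _; apply: (no4 (ea _ _ pg' pp) pq (y := fa p) (w := fb q')).
    * by rewrite esym; apply: eb.
    * by [].
    * exact: sides_disjoint.
    * exact: sides_disjoint.
  + move=> e1 [w wp pw] _; rewrite -e1 in pq qp.
    have wlt := emb_nb ema pg' wp.
    apply: (no4 (ea _ _ pg' wp) (ea _ _ wlt pw) pq) => //.
      apply: contra ne => /eqP/(ia _ _ pg' pg) ->; by rewrite e1.
    exact: sides_disjoint.
- move=> /andP[/eqnP d1 /nth_joint_theta[s [st sp' sp]]].
  have := dist3P gb q' q; rewrite d1 => qq.
  apply: (theta_clash th ema st sp' sp _ _ (eb _ _ qg' qq) pq' pq);
  by rewrite -in_setC -imgb mem_img.
- move=> /andP[/eqnP d1 /nth_joint_theta[s [st sq' sq]]].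
  have := dist3P ga p' p; rewrite d1 => pp.
  apply: (theta_clash th' emb_b st sq' sq _ _ (ea _ _ pg' pp) qp' qp);
  by rewrite imgb inE negbK mem_img.
Qed.

(** Colours on ordered pairs pass to edges by picking an orientation, which is immaterial by
    symmetry of [c]. *)
Lemma colorable_of (c : T -> T -> nat) k : (forall x y, e x y -> c x y < k /\ c x y = c y x) ->
  (forall x y z, e x y -> e x z -> c x y = c x z -> y = z) -> edge_colorable e k.
Proof.
move=> lt pr.
pose col (E : {set T}) := if [pick p : T * T | e p.1 p.2 && (E == [set p.1; p.2])] is Some p
  then c p.1 p.2 else 0.
have colE x y : e x y -> col [set x; y] = c x y.
  move=> xy; rewrite /col; case: pickP => [[u v] /= /andP[uv /eqP eq]|/(_ (x, y))]; last first.
    by rewrite /= xy eqxx.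
  have [_ sym] := lt _ _ uv.
  have : x \in [set u; v] by rewrite -eq set21.
  have : y \in [set u; v] by rewrite -eq set22.
  rewrite !inE => /orP[]/eqP ey /orP[]/eqP ex; move: xy; rewrite ex ey ?eirr //.
exists col; split=> [E /imsetP[[x y] /= xy ->]|E E' /imsetP[[x y] + ->] /imsetP[[u v] + ->]].
  by rewrite inE /= in xy; rewrite colE //; have [] := lt _ _ xy.
rewrite !inE /= => xy uv ne /set0Pn[w]; rewrite !colE // => /setIP[w1 w2].
have nrm x' y' : e x' y' -> w \in [set x'; y'] -> exists z,
    [/\ e w z, [set x'; y'] = [set w; z] & c x' y' = c w z].
  move=> xy'; have [_ sy] := lt _ _ xy'; rewrite !inE => /orP[/eqP->|/eqP->].
    by exists y'.
  by exists x'; rewrite esym setUC.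
have [z [wz eE ->]] := nrm _ _ xy w1; have [z' [wz' eE' ->]] := nrm _ _ uv w2.
by apply: contra ne => /eqP/(pr _ _ _ wz wz') zz; rewrite eE eE' zz.
Qed.

Definition place (g : graph) (f : nat -> T) (x : T) : nat := index x (map f (iota 0 (size g))).

Lemma placeP g f x : x \in img g f -> place g f x < size g /\ f (place g f x) = x.
Proof.
move=> /imgP[i ig ->]; have h : f i \in map f (iota 0 (size g)) by rewrite map_f ?mem_iota.
have lt : place g f (f i) < size g by move: h; rewrite -index_mem size_map size_iota.
by split=> //; rewrite -{2}(nth_index (f 0) h) (nth_map 0) ?size_iota // nth_iota.
Qed.

(** [dk] reads the colour of a cut edge off [cb]. By the permutation hypothesis [ca] puts the same
    colours on the cut edges at every label of [ga], so both inner colourings fit. *)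
Lemma glued_colouring ca cb : boundary ga ca -> boundary gb cb ->
  perm_eq (zip (unzip1 crossing) cb) (zip (dangles ga) ca) -> edge_colorable e 3.
Proof.
move=> [sa a3 [c ha]] [sb b3 [d hb]] pz.
have szc : size crossing = size cb by rewrite sb -unzip2_crossing size_map.
pose dk p q := nth 0 cb (index (p, q) crossing).
pose W := zip crossing cb.
have WP p q : (p, q) \in crossing -> ((p, q), dk p q) \in W.
  move=> pq; have lt : index (p, q) crossing < size crossing by rewrite index_mem.
  rewrite -{1}(nth_index (0, 0) pq) -nth_zip //.
  by apply: mem_nth; rewrite size_zip -szc minnn.
have dk3 p q : (p, q) \in crossing -> dk p q < 3.
  by move=> pq; apply: (allP b3); apply: mem_nth; rewrite -szc index_mem.
have Wa u : perm_eq (at_vertex ga ca u) [seq w.2 | w <- W & eqn w.1.1 u].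
  rewrite perm_sym /at_vertex.
  have -> : [seq w.2 | w <- W & eqn w.1.1 u] =
            [seq x.2 | x <- zip (unzip1 crossing) cb & eqn x.1 u].
    rewrite /W; elim: crossing cb {szc pz dk WP dk3 W b3 sb hb} => [|x s IH] [|y t] //=.
    by case: ifP => _ /=; rewrite IH.
  by apply: perm_map; apply: perm_filter.
have Wb u : at_vertex gb cb u = [seq w.2 | w <- W & eqn w.1.2 u].
  rewrite /at_vertex -unzip2_crossing /W.
  elim: crossing cb {szc pz dk WP dk3 W b3 sb hb Wa} => [|x s IH] [|y t] //=.
  by case: ifP => _ /=; rewrite IH.
have dka u q q' : (u, q) \in crossing -> (u, q') \in crossing -> dk u q = dk u q' -> q = q'.
  move=> uq uq' eqd; have ug : u < size ga by move: uq; rewrite mem_crossing => /andP[].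
  have [_] := ha u ug; rewrite cat_uniq (perm_uniq (Wa u)) => /and3P[_ _ un].
  have [] // : ((u, q), dk u q) = ((u, q'), dk u q').
  by apply: (uniq_map_inj un) => //; rewrite mem_filter WP //= andbT; apply/eqnP.
have dkb u p p' : (p, u) \in crossing -> (p', u) \in crossing -> dk p u = dk p' u -> p = p'.
  move=> uq uq' eqd; have ug : u < size gb by move: uq; rewrite mem_crossing => /and3P[].
  have [_] := hb u ug; rewrite cat_uniq Wb => /and3P[_ _ un].
  have [] // : ((p, u), dk p u) = ((p', u), dk p' u).
  by apply: (uniq_map_inj un) => //; rewrite mem_filter WP //= andbT; apply/eqnP.
have mixa u v q : u < size ga -> v \in nb ga u -> (u, q) \in crossing -> c u v <> dk u q.
  move=> ug vu uq eqd; have [_] := ha u ug; rewrite cat_uniq => /and3P[_ /hasPn + _].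
  move=> /(_ (dk u q)); rewrite (perm_mem (Wa u)) => /(_ _)/negP; apply.
    by apply/mapP; exists ((u, q), dk u q) => //; rewrite mem_filter WP // andbT; apply/eqnP.
  by rewrite -eqd; apply: map_f.
have mixb u v p : u < size gb -> v \in nb gb u -> (p, u) \in crossing -> d u v <> dk p u.
  move=> ug vu uq eqd; have [_] := hb u ug; rewrite cat_uniq => /and3P[_ /hasPn + _].
  move=> /(_ (dk p u)); rewrite Wb => /(_ _)/negP; apply.
    by apply/mapP; exists ((p, u), dk p u) => //; rewrite mem_filter WP // andbT; apply/eqnP.
  by rewrite -eqd; apply: map_f.
have ina u v w : u < size ga -> v \in nb ga u -> w \in nb ga u -> c u v = c u w -> v = w.
  by move=> ug vu wu; have [_] := ha u ug; rewrite cat_uniq => /andP[un _]; apply: (uniq_map_inj un).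
have inb u v w : u < size gb -> v \in nb gb u -> w \in nb gb u -> d u v = d u w -> v = w.
  by move=> ug vu wu; have [_] := hb u ug; rewrite cat_uniq => /andP[un _]; apply: (uniq_map_inj un).
pose A := img ga fa; pose ia := place ga fa; pose ib := place gb fb.
have iaP x : x \in A -> ia x < size ga /\ fa (ia x) = x by apply: placeP.
have ibP x : x \notin A -> ib x < size gb /\ fb (ib x) = x.
  by move=> xA; apply: placeP; rewrite imgb inE.
pose col x y := if x \in A then if y \in A then c (ia x) (ia y) else dk (ia x) (ib y)
                else if y \in A then dk (ia y) (ib x) else d (ib x) (ib y).
have crs x y : x \in A -> y \notin A -> e x y -> (ia x, ib y) \in crossing.
  move=> xA yA xy; have [lx ex] := iaP x xA; have [ly ey] := ibP y yA.
  by rewrite mem_crossing lx ly ex ey.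
have adja x y : x \in A -> y \in A -> e x y -> ia y \in nb ga (ia x).
  move=> xA yA xy; have [lx ex] := iaP x xA; have [ly ey] := iaP y yA.
  by apply: (emb_adj ema exa) => //; rewrite ex ey.
have adjb x y : x \notin A -> y \notin A -> e x y -> ib y \in nb gb (ib x).
  move=> xA yA xy; have [lx ex] := ibP x xA; have [ly ey] := ibP y yA.
  by apply: (emb_adj emb_b exb) => //; rewrite ex ey.
have fia x y : x \in A -> y \in A -> ia x = ia y -> x = y.
  by move=> /iaP[_ {2}<-] /iaP[_ {2}<-] ->.
have fib x y : x \notin A -> y \notin A -> ib x = ib y -> x = y.
  by move=> /ibP[_ {2}<-] /ibP[_ {2}<-] ->.
apply: (@colorable_of col) => [x y xy|x y z xy xz]; rewrite /col.
  have yx : e y x by rewrite esym.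
  have [xA|xA] := boolP (x \in A); have [yA|yA] := boolP (y \in A).
  - by have [h _] := ha _ (iaP x xA).1; apply: h; apply: adja.
  - by split=> //; apply: dk3; apply: crs.
  - by split=> //; apply: dk3; apply: crs.
  - by have [h _] := hb _ (ibP x xA).1; apply: h; apply: adjb.
have yx : e y x by rewrite esym.
have zx : e z x by rewrite esym.
have [xA|xA] := boolP (x \in A); have [yA|yA] := boolP (y \in A);
  have [zA|zA] := boolP (z \in A) => eqc.
- by apply: fia => //; apply: (ina (ia x)) => //; [case: (iaP x xA)|apply: adja|apply: adja].
- by case: (mixa (ia x) (ia y) (ib z)); [case: (iaP x xA)|apply: adja|apply: crs|].
- by case: (mixa (ia x) (ia z) (ib y)); [case: (iaP x xA)|apply: adja|apply: crs|].
- by apply: fib => //; apply: (dka (ia x)) => //; apply: crs.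
- by apply: fia => //; apply: (dkb (ib x)) => //; apply: crs.
- by case: (mixb (ib x) (ib z) (ia y)); [case: (ibP x xA)|apply: adjb|apply: crs|].
- by case: (mixb (ib x) (ib y) (ia z)); [case: (ibP x xA)|apply: adjb|apply: crs|].
- by apply: fib => //; apply: (inb (ib x)) => //; [case: (ibP x xA)|apply: adjb|apply: adjb].
Qed.

Definition join_map (i : nat) : T := if i < size ga then fa i else fb (i - size ga).

Lemma size_join asg : size (join_graphs ga gb asg) = size ga + size gb.
Proof. by elim: asg => [|x asg IH] /=; rewrite ?size_adde // size_cat size_map. Qed.

Lemma join_emb asg : {subset asg <= crossing} -> wfb (join_graphs ga gb asg) ->
  emb e (join_graphs ga gb asg) join_map.
Proof.
move=> sub /wfP wj; split=> //; rewrite size_join; last first.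
  have [_ _ ia] := ema; have [_ _ ib] := emb_b.
  have half i : i < size ga + size gb -> ~~ (i < size ga) -> i - size ga < size gb.
    by clear; lia.
  move=> u v ug vg; rewrite /join_map; case: ifPn => ua; case: ifPn => va eqf.
  - exact: ia.
  - by move: (sides_disjoint ua (half _ vg va)); rewrite eqf eqxx.
  - by move: (sides_disjoint va (half _ ug ua)); rewrite eqf eqxx.
  - have := ib _ _ (half _ ug ua) (half _ vg va) eqf; move: ua va; clear; lia.
elim: asg sub {wj} => [|[p q] asg IH] sub u v ug.
  rewrite /= nth_cat /join_map; case: ifPn => ua.
    move=> vu; rewrite (emb_nb ema ua vu); exact: emb_e ema ua vu.
  have ub : u - size ga < size gb by move: ua ug; clear; lia.
  rewrite (nth_map [::]) // => /mapP[w wu ->].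
  by rewrite ltnNge leq_addr /= addKn; apply: emb_e emb_b ub wu.
have := sub (p, q) (mem_head _ _); rewrite mem_crossing => /and3P[pg qg pq].
have {}IH := IH (fun x xs => sub x (mem_behead (s := _ :: _) xs)).
have jp : join_map p = fa p by rewrite /join_map pg.
have jq : join_map (size ga + q) = fb q by rewrite /join_map ltnNge leq_addr /= addKn.
have ne : p != size ga + q by move: pg; clear; lia.
rewrite /= nb_adde ?size_join ?ltn_add2l ?(ltn_addr _ pg) //.
case: eqP => [->|_]; last case: eqP => [->|_]; last by apply: IH.
  rewrite inE => /predU1P[->|]; first by rewrite jp jq.
  by apply: IH; rewrite ltn_addr.
rewrite inE => /predU1P[->|]; first by rewrite jp jq esym.
by apply: IH; rewrite ltn_add2l.
Qed.

End Gluing.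

Definition checked_pole (gc : graph * seq colouring) : bool := all (check_colouring gc.1) gc.2.

Section Pair.

Variables (T : finType) (e : rel T).
Hypothesis esym : symmetric e.
Hypothesis eirr : irreflexive e.
Hypothesis cubic : forall x, #|[set y | e x y]| = 3.
Hypothesis no3 : forall x y z, e x y -> e y z -> e z x -> False.
Hypothesis no4 : forall x y z w, e x y -> e y z -> e z w -> e w x ->
  x != z -> y != w -> False.
Hypothesis uncol : ~ edge_colorable e 3.

(** If the cut were missing from [glues], [glues_complete] would give agreeing colourings of the two
    poles and hence a 3-edge-colouring of [e]. *)
Lemma pair_glued m m' xa xb fa fb :
  emb e xa.1 fa -> emb e xb.1 fb -> img xb.1 fb = ~: img xa.1 fa ->
  esum xa.1 = degsum e (img xa.1 fa) -> esum xb.1 = degsum e (img xb.1 fb) ->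
  checked_pole xa -> checked_pole xb -> thin e m -> thin e m' ->
  exists2 asg, asg \in glues (make_pole m xa) (make_pole m' xb) &
    wfb (join_graphs xa.1 xb.1 asg) -> exists f, emb e (join_graphs xa.1 xb.1 asg) f.
Proof.
case: xa xb => [ga ca] [gb cb] /= ema emb_b imgb exa exb /allP cka /allP ckb th th'.
have z2 := unzip2_crossing esym cubic ema emb_b imgb exb.
have z1 := unzip1_crossing cubic ema emb_b imgb exa.
have zz : zip (unzip1 (crossing e ga gb fa fb)) (dangles gb) = crossing e ga gb fa fb.
  by rewrite -z2 zip_unzip.
have pw := crossing_fine esym eirr no3 no4 ema emb_b imgb ca cb th th'.
have [|||inn|[c [c' [cin sc' st pz]]]] := @glues_complete m m' (ga, ca) (gb, cb) _ _ _ z1 _.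
- by rewrite /= -z2 size_map -(perm_size z1) size_map.
- by apply/allP => c /cka /check_colouringP[-> _ _].
- by rewrite zz.
- rewrite zz in inn; exists (rev (crossing e ga gb fa fb)) => // wfj.
  exists (join_map ga fa fb); apply: (join_emb esym ema emb_b imgb) => // x.
  by rewrite mem_rev.
case: uncol; move: cin => /mapP[d din ed].
have [|d' [p [/mapP[b bin ->] pp ec']]] := stored_trie _ st.
  by rewrite all_map; apply/allP => b /ckb /check_colouringP[_ + _].
apply: (glued_colouring esym eirr cubic ema emb_b imgb exa exb _ _ pz).
  by rewrite ed; apply: check_colouringP; apply: cka.
by rewrite ec'; apply: boundary_perm => //; apply: check_colouringP; apply: ckb.
Qed.

End Pair.

(** * The twenty snarks *)

Definition label_edges (g : graph) : seq (nat * nat) :=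
  flatten [seq [seq (v, u) | v <- nb g u & v < u] | u <- iota 0 (size g)].

Definition seen_colour (acc : seq (nat * nat * nat)) (u k : nat) : bool :=
  has (fun x => eqn x.2 k && (eqn x.1.1 u || eqn x.1.2 u)) acc.

Fixpoint edge_colourings (es : seq (nat * nat)) (acc : seq (nat * nat * nat)) :
    seq (seq (nat * nat * nat)) :=
  if es is (u, v) :: es' then
    flatten [seq (if seen_colour acc u k || seen_colour acc v k then [::]
                  else edge_colourings es' ((u, v, k) :: acc)) | k <- [:: 0; 1; 2]]
  else [:: acc].

Definition colour_of (acc : seq (nat * nat * nat)) (u v : nat) : nat :=
  head 0 [seq x.2 | x <- acc & (eqn x.1.1 u && eqn x.1.2 v) || (eqn x.1.1 v && eqn x.1.2 u)].

Definition dangle_colours (g : graph) (acc : seq (nat * nat * nat)) : seq (seq nat) :=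
  foldr (fun u r =>
    let ks := [seq k <- [:: 0; 1; 2] | ~~ seen_colour acc u k] in
    match 3 - size (nb g u) with
    | 0 => r
    | 1 => [seq head 0 ks :: c | c <- r]
    | _ => [seq ks ++ c | c <- r] ++ [seq rev ks ++ c | c <- r]
    end) [:: [::]] (iota 0 (size g)).

(** Colours are renamed by first appearance on the dangling edges. As [undup] keeps last
    occurrences, the list is reversed before and after. *)
Definition raw_colourings (g : graph) : seq colouring :=
  flatten [seq (let cg := [seq [seq colour_of acc u v | v <- nb g u] | u <- iota 0 (size g)] in
    [seq (let p := rev (undup (rev c)) in
          let q := p ++ [seq k <- [:: 0; 1; 2] | ~~ memn k p] in
          let ren k := find (eqn k) q in
          ([seq map ren l | l <- cg], map ren c)) | c <- dangle_colours g acc])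
    | acc <- edge_colourings (label_edges g) [::]].

Fixpoint distinct_boundary (cs : seq colouring) (acc : seq colouring) : seq colouring :=
  if cs is c :: cs' then
    if has (fun d => d.2 == c.2) acc then distinct_boundary cs' acc
    else distinct_boundary cs' (c :: acc)
  else acc.

Definition coloured (g : graph) : graph * seq colouring :=
  (g, distinct_boundary (raw_colourings g) [::]).

Definition col5 := Eval vm_compute in map coloured poles5.
Definition col6 := Eval vm_compute in map coloured poles6.
Definition col6' := Eval vm_compute in map coloured poles6'.
Definition col7 := Eval vm_compute in map coloured poles7.
Definition col9 := Eval vm_compute in map coloured thetas9.
Definition col13 := Eval vm_compute in map coloured poles13.

Definition mp5 := Eval vm_compute in map (make_pole 0) col5.
Definition mp6 := Eval vm_compute in map (make_pole 0) col6.
Definition mp6' := Eval vm_compute in map (make_pole 0) col6'.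
Definition mp7 := Eval vm_compute in map (make_pole 8) col7.
Definition mp9 := Eval vm_compute in map (make_pole 9) col9.
Definition mp13 := Eval vm_compute in map (make_pole 9) col13.

Definition all_glues (l : seq (pole * pole)) : seq graph :=
  flatten [seq [seq join_graphs (pgraph x.1) (pgraph x.2) asg | asg <- glues x.1 x.2] | x <- l].

Definition survivors1 := all_glues (suffix_pairs mp5).
Definition survivors2 := all_glues [seq (x, y) | x <- mp6, y <- mp6'].
Definition survivors3 := all_glues (suffix_pairs mp7).
Definition survivors4 := all_glues [seq (x, y) | x <- mp9, y <- mp13].

(** The order matters: the lists of base blocks below are aligned with it. *)
Definition snarks : seq graph :=
  [:: [:: [:: 1; 2; 3]; [:: 0; 4; 5]; [:: 0; 6; 7]; [:: 0; 8; 9]; [:: 1; 9; 10]; [:: 1; 7; 11];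
        [:: 2; 10; 12]; [:: 2; 5; 9]; [:: 3; 11; 13]; [:: 3; 4; 7]; [:: 4; 6; 14]; [:: 5; 8; 15];
        [:: 6; 16; 17]; [:: 8; 17; 18]; [:: 10; 18; 19]; [:: 11; 16; 19]; [:: 12; 15; 20];
        [:: 12; 13; 21]; [:: 13; 14; 20]; [:: 14; 15; 21]; [:: 16; 18; 21]; [:: 17; 19; 20]];
      [:: [:: 1; 2; 3]; [:: 0; 4; 5]; [:: 0; 6; 7]; [:: 0; 8; 9]; [:: 1; 9; 10]; [:: 1; 7; 11];
        [:: 2; 12; 13]; [:: 2; 5; 9]; [:: 3; 11; 14]; [:: 3; 4; 7]; [:: 4; 13; 14]; [:: 5; 8; 15];
        [:: 6; 16; 17]; [:: 6; 10; 18]; [:: 8; 10; 19]; [:: 11; 17; 20]; [:: 12; 19; 20];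
        [:: 12; 15; 21]; [:: 13; 20; 21]; [:: 14; 16; 21]; [:: 15; 16; 18]; [:: 17; 18; 19]];
      [:: [:: 1; 2; 3]; [:: 0; 4; 5]; [:: 0; 6; 7]; [:: 0; 8; 9]; [:: 1; 9; 10]; [:: 1; 7; 11];
        [:: 2; 12; 13]; [:: 2; 5; 9]; [:: 3; 11; 14]; [:: 3; 4; 7]; [:: 4; 15; 16]; [:: 5; 8; 12];
        [:: 6; 11; 17]; [:: 6; 18; 19]; [:: 8; 17; 20]; [:: 10; 18; 20]; [:: 10; 19; 21];
        [:: 12; 14; 21]; [:: 13; 15; 21]; [:: 13; 16; 20]; [:: 14; 15; 19]; [:: 16; 17; 18]];
      [:: [:: 1; 2; 3]; [:: 0; 4; 5]; [:: 0; 6; 7]; [:: 0; 8; 9]; [:: 1; 10; 11]; [:: 1; 12; 13];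
        [:: 2; 14; 15]; [:: 2; 16; 17]; [:: 3; 16; 18]; [:: 3; 17; 19]; [:: 4; 12; 20];
        [:: 4; 13; 14]; [:: 5; 10; 14]; [:: 5; 11; 21]; [:: 6; 11; 12]; [:: 6; 18; 19];
        [:: 7; 8; 21]; [:: 7; 9; 18]; [:: 8; 15; 17]; [:: 9; 15; 20]; [:: 10; 19; 21]; [:: 13; 16; 20]];
      [:: [:: 1; 2; 3]; [:: 0; 4; 5]; [:: 0; 6; 7]; [:: 0; 8; 9]; [:: 1; 10; 11]; [:: 1; 7; 8];
        [:: 2; 12; 13]; [:: 2; 5; 9]; [:: 3; 5; 13]; [:: 3; 7; 14]; [:: 4; 12; 15]; [:: 4; 14; 16];
        [:: 6; 10; 17]; [:: 6; 8; 18]; [:: 9; 11; 19]; [:: 10; 20; 21]; [:: 11; 17; 20];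
        [:: 12; 16; 21]; [:: 13; 19; 20]; [:: 14; 18; 21]; [:: 15; 16; 18]; [:: 15; 17; 19]];
      [:: [:: 1; 2; 3]; [:: 0; 4; 5]; [:: 0; 6; 7]; [:: 0; 8; 9]; [:: 1; 10; 11]; [:: 1; 7; 8];
        [:: 2; 10; 12]; [:: 2; 5; 9]; [:: 3; 5; 13]; [:: 3; 7; 14]; [:: 4; 6; 13]; [:: 4; 14; 15];
        [:: 6; 16; 17]; [:: 8; 10; 18]; [:: 9; 11; 19]; [:: 11; 17; 20]; [:: 12; 19; 20];
        [:: 12; 15; 21]; [:: 13; 20; 21]; [:: 14; 16; 21]; [:: 15; 16; 18]; [:: 17; 18; 19]];
      [:: [:: 1; 2; 3]; [:: 0; 4; 5]; [:: 0; 6; 7]; [:: 0; 8; 9]; [:: 1; 10; 11]; [:: 1; 7; 8];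
        [:: 2; 12; 13]; [:: 2; 5; 9]; [:: 3; 5; 14]; [:: 3; 7; 15]; [:: 4; 13; 15]; [:: 4; 16; 17];
        [:: 6; 17; 18]; [:: 6; 10; 14]; [:: 8; 13; 19]; [:: 9; 10; 20]; [:: 11; 18; 19];
        [:: 11; 12; 21]; [:: 12; 16; 20]; [:: 14; 16; 21]; [:: 15; 18; 21]; [:: 17; 19; 20]];
      [:: [:: 1; 2; 3]; [:: 0; 4; 5]; [:: 0; 6; 7]; [:: 0; 8; 9]; [:: 1; 10; 11]; [:: 1; 7; 8];
        [:: 2; 12; 13]; [:: 2; 5; 9]; [:: 3; 5; 10]; [:: 3; 7; 14]; [:: 4; 8; 13]; [:: 4; 14; 15];
        [:: 6; 16; 17]; [:: 6; 10; 18]; [:: 9; 11; 19]; [:: 11; 17; 20]; [:: 12; 19; 20];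
        [:: 12; 15; 21]; [:: 13; 20; 21]; [:: 14; 16; 21]; [:: 15; 16; 18]; [:: 17; 18; 19]];
      [:: [:: 1; 2; 3]; [:: 0; 4; 5]; [:: 0; 6; 7]; [:: 0; 8; 9]; [:: 1; 10; 11]; [:: 1; 7; 8];
        [:: 2; 12; 13]; [:: 2; 5; 9]; [:: 3; 5; 14]; [:: 3; 7; 15]; [:: 4; 15; 16]; [:: 4; 12; 17];
        [:: 6; 11; 18]; [:: 6; 19; 20]; [:: 8; 16; 21]; [:: 9; 10; 17]; [:: 10; 14; 20];
        [:: 11; 15; 19]; [:: 12; 20; 21]; [:: 13; 17; 21]; [:: 13; 16; 18]; [:: 14; 18; 19]];
      [:: [:: 1; 2; 3]; [:: 0; 4; 5]; [:: 0; 6; 7]; [:: 0; 8; 9]; [:: 1; 10; 11]; [:: 1; 7; 8];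
        [:: 2; 12; 13]; [:: 2; 5; 9]; [:: 3; 5; 14]; [:: 3; 7; 15]; [:: 4; 12; 16]; [:: 4; 17; 18];
        [:: 6; 10; 19]; [:: 6; 14; 17]; [:: 8; 13; 19]; [:: 9; 20; 21]; [:: 10; 18; 21];
        [:: 11; 13; 21]; [:: 11; 16; 20]; [:: 12; 14; 20]; [:: 15; 18; 19]; [:: 15; 16; 17]];
      [:: [:: 1; 2; 3]; [:: 0; 4; 5]; [:: 0; 6; 7]; [:: 0; 8; 9]; [:: 1; 10; 11]; [:: 1; 7; 8];
        [:: 2; 12; 13]; [:: 2; 5; 9]; [:: 3; 5; 14]; [:: 3; 7; 15]; [:: 4; 16; 17]; [:: 4; 12; 14];
        [:: 6; 11; 18]; [:: 6; 14; 19]; [:: 8; 11; 13]; [:: 9; 20; 21]; [:: 10; 18; 21];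
        [:: 10; 19; 20]; [:: 12; 16; 20]; [:: 13; 17; 21]; [:: 15; 17; 18]; [:: 15; 16; 19]];
      [:: [:: 1; 2; 3]; [:: 0; 4; 5]; [:: 0; 6; 7]; [:: 0; 8; 9]; [:: 1; 10; 11]; [:: 1; 7; 8];
        [:: 2; 12; 13]; [:: 2; 5; 9]; [:: 3; 5; 14]; [:: 3; 7; 15]; [:: 4; 13; 16]; [:: 4; 15; 17];
        [:: 6; 17; 18]; [:: 6; 10; 14]; [:: 8; 13; 19]; [:: 9; 11; 20]; [:: 10; 18; 21];
        [:: 11; 12; 21]; [:: 12; 16; 20]; [:: 14; 20; 21]; [:: 15; 18; 19]; [:: 16; 17; 19]];
      [:: [:: 1; 2; 3]; [:: 0; 4; 5]; [:: 0; 6; 7]; [:: 0; 8; 9]; [:: 1; 10; 11]; [:: 1; 7; 8];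
        [:: 2; 12; 13]; [:: 2; 5; 9]; [:: 3; 5; 14]; [:: 3; 7; 15]; [:: 4; 15; 16]; [:: 4; 12; 17];
        [:: 6; 11; 18]; [:: 6; 14; 16]; [:: 8; 13; 19]; [:: 9; 10; 20]; [:: 10; 13; 21];
        [:: 11; 19; 21]; [:: 12; 20; 21]; [:: 14; 17; 20]; [:: 15; 18; 19]; [:: 16; 17; 18]];
      [:: [:: 1; 2; 3]; [:: 0; 4; 5]; [:: 0; 6; 7]; [:: 0; 8; 9]; [:: 1; 10; 11]; [:: 1; 7; 8];
        [:: 2; 12; 13]; [:: 2; 5; 9]; [:: 3; 5; 14]; [:: 3; 7; 15]; [:: 4; 14; 16]; [:: 4; 15; 17];
        [:: 6; 17; 18]; [:: 6; 14; 19]; [:: 8; 10; 13]; [:: 9; 11; 20]; [:: 10; 18; 21];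
        [:: 11; 12; 21]; [:: 12; 16; 20]; [:: 13; 20; 21]; [:: 15; 18; 19]; [:: 16; 17; 19]];
      [:: [:: 1; 2; 3]; [:: 0; 4; 5]; [:: 0; 6; 7]; [:: 0; 8; 9]; [:: 1; 10; 11]; [:: 1; 7; 8];
        [:: 2; 10; 12]; [:: 2; 5; 9]; [:: 3; 5; 13]; [:: 3; 7; 14]; [:: 4; 6; 15]; [:: 4; 14; 16];
        [:: 6; 13; 17]; [:: 8; 12; 18]; [:: 9; 11; 19]; [:: 10; 20; 21]; [:: 11; 17; 21];
        [:: 12; 16; 20]; [:: 13; 19; 21]; [:: 14; 18; 20]; [:: 15; 17; 19]; [:: 15; 16; 18]];
      [:: [:: 1; 2; 3]; [:: 0; 4; 5]; [:: 0; 6; 7]; [:: 0; 8; 9]; [:: 1; 10; 11]; [:: 1; 7; 8];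
        [:: 2; 12; 13]; [:: 2; 5; 9]; [:: 3; 5; 14]; [:: 3; 7; 15]; [:: 4; 14; 15]; [:: 4; 16; 17];
        [:: 6; 18; 19]; [:: 6; 16; 20]; [:: 8; 10; 21]; [:: 9; 10; 17]; [:: 11; 13; 19];
        [:: 11; 15; 18]; [:: 12; 17; 20]; [:: 12; 16; 21]; [:: 13; 18; 21]; [:: 14; 19; 20]];
      [:: [:: 1; 2; 3]; [:: 0; 4; 5]; [:: 0; 6; 7]; [:: 0; 8; 9]; [:: 1; 10; 11]; [:: 1; 12; 13];
        [:: 2; 14; 15]; [:: 2; 8; 16]; [:: 3; 7; 17]; [:: 3; 15; 16]; [:: 4; 13; 18];
        [:: 4; 12; 19]; [:: 5; 11; 18]; [:: 5; 10; 14]; [:: 6; 13; 19]; [:: 6; 9; 20];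
        [:: 7; 9; 21]; [:: 8; 20; 21]; [:: 10; 12; 21]; [:: 11; 14; 20]; [:: 15; 17; 19];
        [:: 16; 17; 18]];
      [:: [:: 1; 2; 3]; [:: 0; 4; 5]; [:: 0; 6; 7]; [:: 0; 8; 9]; [:: 1; 10; 11]; [:: 1; 12; 13];
        [:: 2; 14; 15]; [:: 2; 8; 16]; [:: 3; 7; 17]; [:: 3; 16; 18]; [:: 4; 13; 19];
        [:: 4; 12; 20]; [:: 5; 11; 19]; [:: 5; 10; 14]; [:: 6; 13; 20]; [:: 6; 17; 18];
        [:: 7; 9; 21]; [:: 8; 15; 21]; [:: 9; 15; 20]; [:: 10; 12; 21]; [:: 11; 14; 18];
        [:: 16; 17; 19]];
      [:: [:: 1; 2; 3]; [:: 0; 4; 5]; [:: 0; 6; 7]; [:: 0; 8; 9]; [:: 1; 10; 11]; [:: 1; 12; 13];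
        [:: 2; 14; 15]; [:: 2; 9; 16]; [:: 3; 10; 17]; [:: 3; 7; 14]; [:: 4; 8; 18];
        [:: 4; 12; 19]; [:: 5; 11; 16]; [:: 5; 19; 20]; [:: 6; 9; 19]; [:: 6; 18; 20];
        [:: 7; 12; 21]; [:: 8; 20; 21]; [:: 10; 15; 21]; [:: 11; 13; 14]; [:: 13; 15; 17];
        [:: 16; 17; 18]];
      [:: [:: 1; 2; 3]; [:: 0; 4; 5]; [:: 0; 6; 7]; [:: 0; 8; 9]; [:: 1; 10; 11]; [:: 1; 12; 13];
        [:: 2; 14; 15]; [:: 2; 9; 16]; [:: 3; 17; 18]; [:: 3; 7; 14]; [:: 4; 15; 17];
        [:: 4; 12; 19]; [:: 5; 11; 16]; [:: 5; 18; 19]; [:: 6; 9; 19]; [:: 6; 10; 20];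
        [:: 7; 12; 21]; [:: 8; 10; 21]; [:: 8; 13; 20]; [:: 11; 13; 14]; [:: 15; 18; 21];
        [:: 16; 17; 20]]].

(** * Matching the surviving gluings with representatives *)

Definition sphere_step (g : graph) (s : seq nat * seq nat) : seq nat * seq nat :=
  let next := undup [seq v <- flatten [seq nb g u | u <- s.2] | ~~ memn v s.1] in
  (s.1 ++ next, next).

Definition profile (g : graph) (u : nat) : N :=
  let s2 := iter 2 (sphere_step g) ([:: u], [:: u]) in
  let s3 := sphere_step g s2 in let s4 := sphere_step g s3 in
  (N.of_nat (size s3.2) + 32 * N.of_nat (size s4.2))%num.

(** Vertex invariants built from the sizes of the spheres of radius three and four, refined twice by
    sums over neighbours. They only guide the search; the maps found are validated by
    [check_map]. *)
Definition hashes (g : graph) : seq N :=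
  let step (h : seq N) := [seq (((nth 0 h u + 7) * 31 +
      foldr (fun v r => r + nth 0 h v * nth 0 h v) 0 (nb g u)) mod 65521)%num
    | u <- iota 0 (size g)] in
  step (step [seq profile g u | u <- iota 0 (size g)]).

Definition hash_sum (h : seq N) : N := (foldr (fun x r => r + x * x) 0 h)%num.

Fixpoint guided (rs : seq (seq nat)) (hr : seq N) (h : graph) (hh : seq N) (v : nat) (m : seq nat) :
    option (seq nat) :=
  if rs is l :: rs' then
    let back := [seq w <- l | w < v] in
    let cands := if back is w :: _ then nb h (nth 0 m w) else iota 0 (size h) in
    pick_some (fun c =>
      if [&& N.eqb (head 0%num hr) (nth 0%num hh c), ~~ memn c m &
             all (fun w => memn (nth 0 m w) (nb h c)) back]
      then guided rs' (behead hr) h hh v.+1 (rcons m c) else None) cands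
  else Some m.

Fixpoint guided_rep (reps : seq (graph * (N * seq N))) (j : nat) (h : graph) (hh : seq N) (k : N) :
    option (nat * seq nat) :=
  if reps is (r, (kr, hr)) :: reps' then
    if (if N.eqb k kr then guided r hr h hh 0 [::] else None) is Some m then Some (j, m)
    else guided_rep reps' j.+1 h hh k
  else None.

Definition with_hash (g : graph) : graph * (N * seq N) :=
  let h := hashes g in (g, (hash_sum h, h)).

(** Breadth-first numbering puts next to each later label an earlier one, so that [guided] tries
    only the neighbours of one known image. *)
Definition relabelled (g : graph) : graph :=
  let s := (iter 12 (sphere_step g) ([:: 0], [:: 0])).1 in
  [seq [seq find (eqn v) s | v <- nb g u] | u <- s].

Fixpoint guided_dedup (raw : seq graph) (reps : seq (graph * (N * seq N)))
    (acc : seq (nat * seq nat)) : seq (graph * (N * seq N)) * seq (nat * seq nat) :=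
  if raw is h :: raw' then
    let: (_, (k, hh)) := with_hash h in
    if guided_rep reps 0 h hh k is Some c then guided_dedup raw' reps (c :: acc)
    else let r := with_hash (relabelled h) in
         guided_dedup raw' (rcons reps r)
           ((size reps, odflt [::] (guided r.1 r.2.2 h hh 0 [::])) :: acc)
  else (reps, rev acc).

(** The representatives start with the twenty snarks; a graph that matches none of them opens a new
    one, and the new ones form [others]. *)
Definition matched : seq (graph * (N * seq N)) * seq (nat * seq nat) := Eval vm_compute in
  guided_dedup (survivors1 ++ survivors2 ++ survivors3) (map with_hash snarks) [::].

Definition hints : seq (nat * seq nat) := Eval vm_compute in matched.2.

Definition others : seq graph := Eval vm_compute in drop 20 [seq x.1 | x <- matched.1].

(** One vertex set for each graph in [others], left by at most three edges: these gluings are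
    uncolourable but trivial. *)
Definition cuts : seq (seq nat) :=
  [:: [:: 0; 1; 2; 3; 4; 5; 6; 7; 9];
      [:: 0; 1; 2; 3; 4; 5; 6; 7; 9];
      [:: 0; 1; 2; 3; 4; 5; 6; 7; 9];
      [:: 0; 1; 2; 3; 4; 5; 6; 7; 9];
      [:: 0; 1; 2; 3; 4; 5; 6; 7; 9];
      [:: 0; 1; 2; 3; 4; 5; 6; 7; 9];
      [:: 0; 1; 2; 3; 4; 5; 6; 7; 9];
      [:: 0; 1; 2; 3; 4; 5; 6; 7; 9];
      [:: 0; 1; 2; 3; 4; 5; 6; 7; 9];
      [:: 0; 1; 2; 3; 4; 5; 6; 7; 9];
      [:: 0; 1; 2; 3; 4; 5; 6; 7; 9];
      [:: 0; 1; 2; 3; 4; 5; 6; 7; 9];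
      [:: 0; 1; 2; 3; 4; 5; 6; 7; 9];
      [:: 0; 1; 2; 3; 4; 5; 6; 7; 9];
      [:: 0; 1; 2; 3; 4; 5; 6; 7; 9];
      [:: 0; 1; 2; 3; 4; 5; 6; 7; 9];
      [:: 0; 1; 2; 3; 4; 5; 6; 7; 9];
      [:: 0; 1; 2; 3; 4; 5; 6; 7; 9];
      [:: 0; 1; 2; 3; 4; 5; 6; 7; 9];
      [:: 0; 1; 2; 3; 4; 5; 6; 7; 9];
      [:: 0; 1; 2; 3; 4; 5; 6; 7; 9];
      [:: 0; 1; 2; 3; 4; 5; 6; 7; 9];
      [:: 0; 1; 2; 3; 4; 5; 6; 7; 9];
      [:: 0; 1; 2; 3; 4; 5; 6; 7; 9];
      [:: 0; 1; 2; 3; 4; 5; 6; 7; 9];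
      [:: 0; 1; 2; 3; 4; 5; 6; 7; 9];
      [:: 0; 1; 2; 3; 4; 5; 6; 7; 9];
      [:: 0; 1; 2; 3; 4; 5; 6; 7; 9];
      [:: 10; 13; 14; 15; 17; 18; 19; 20; 21];
      [:: 10; 13; 14; 15; 17; 18; 19; 20; 21];
      [:: 12; 13; 15; 16; 17; 18; 19; 20; 21];
      [:: 12; 13; 15; 16; 17; 18; 19; 20; 21];
      [:: 0; 1; 2; 3; 4; 5; 6; 7; 9];
      [:: 0; 1; 2; 3; 4; 5; 6; 7; 9];
      [:: 0; 1; 2; 3; 4; 5; 6; 7; 9];
      [:: 0; 1; 2; 3; 4; 5; 6; 7; 9];
      [:: 0; 1; 2; 3; 4; 5; 6; 7; 9];
      [:: 0; 1; 2; 3; 4; 5; 6; 7; 9];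
      [:: 0; 1; 2; 3; 4; 5; 6; 7; 9];
      [:: 0; 1; 2; 3; 4; 5; 6; 7; 9];
      [:: 0; 1; 2; 3; 4; 5; 6; 7; 9];
      [:: 6; 10; 12; 13; 16; 17; 18; 19; 21];
      [:: 6; 11; 13; 14; 17; 18; 19; 20; 21];
      [:: 6; 12; 13; 16; 17; 18; 19; 20; 21];
      [:: 8; 13; 15; 16; 17; 18; 19; 20; 21];
      [:: 8; 12; 14; 15; 17; 18; 19; 20; 21];
      [:: 8; 13; 14; 15; 17; 18; 19; 20; 21];
      [:: 8; 14; 15; 16; 17; 18; 19; 20; 21];
      [:: 8; 13; 15; 16; 17; 18; 19; 20; 21];
      [:: 8; 13; 15; 16; 17; 18; 19; 20; 21];
      [:: 8; 14; 15; 16; 17; 18; 19; 20; 21];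
      [:: 8; 14; 15; 16; 17; 18; 19; 20; 21];
      [:: 11; 14; 15; 16; 17; 18; 19; 20; 21];
      [:: 10; 13; 14; 15; 17; 18; 19; 20; 21];
      [:: 11; 14; 15; 16; 17; 18; 19; 20; 21];
      [:: 10; 12; 15; 16; 17; 18; 19; 20; 21];
      [:: 10; 14; 15; 16; 17; 18; 19; 20; 21];
      [:: 10; 13; 14; 15; 17; 18; 19; 20; 21];
      [:: 10; 14; 15; 16; 17; 18; 19; 20; 21];
      [:: 10; 14; 15; 16; 17; 18; 19; 20; 21];
      [:: 13; 14; 15; 16; 17; 18; 19; 20; 21]].

Definition small_cut (g : graph) (s : seq nat) : bool :=
  [&& 1 < size s, size s <= 20, uniq s, all (fun v => v < size g) s &
      3 * size s < inner_esum g s + 4].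

Lemma others_cut : all2 small_cut others cuts.
Proof. by vm_cast_no_check (erefl true). Qed.

Lemma reps_wf : all wfb (snarks ++ others).
Proof. by vm_cast_no_check (erefl true). Qed.

Definition matched_by (h : graph) (c : nat * seq nat) : bool :=
  [&& wfb h, c.1 < size (snarks ++ others) & check_map (nth [::] (snarks ++ others) c.1) h c.2].

(** [hints] was computed from the first three families. As [all2] also compares lengths, the check
    shows that the fourth family is empty. *)
Lemma survivors_matched : all2 matched_by (survivors1 ++ survivors2 ++ survivors3 ++ survivors4) hints.
Proof. by vm_cast_no_check (erefl true). Qed.

Definition col_ok (l : seq graph) (cl : seq (graph * seq colouring)) : bool :=
  ([seq x.1 | x <- cl] == l) && all checked_pole cl.

Lemma cols_ok : [&& col_ok poles5 col5, col_ok poles6 col6, col_ok poles6' col6', col_ok poles7 col7,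
  col_ok thetas9 col9 & col_ok poles13 col13].
Proof. by vm_cast_no_check (erefl true). Qed.

Lemma mp5E : mp5 = map (make_pole 0) col5. Proof. by vm_cast_no_check (erefl mp5). Qed.
Lemma mp6E : mp6 = map (make_pole 0) col6. Proof. by vm_cast_no_check (erefl mp6). Qed.
Lemma mp6'E : mp6' = map (make_pole 0) col6'. Proof. by vm_cast_no_check (erefl mp6'). Qed.
Lemma mp7E : mp7 = map (make_pole 8) col7. Proof. by vm_cast_no_check (erefl mp7). Qed.
Lemma mp9E : mp9 = map (make_pole 9) col9. Proof. by vm_cast_no_check (erefl mp9). Qed.
Lemma mp13E : mp13 = map (make_pole 9) col13. Proof. by vm_cast_no_check (erefl mp13). Qed.

Lemma suffix_pairs_map (A B : Type) (F : A -> B) s :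
  suffix_pairs (map F s) = [seq (F x.1, F x.2) | x <- suffix_pairs s].
Proof. by elim: s => //= x s ->; rewrite map_cat -!map_comp. Qed.

Lemma mem_suffix_pairs (A : eqType) (s : seq A) x y : x \in s -> y \in s ->
  (x, y) \in suffix_pairs s \/ (y, x) \in suffix_pairs s.
Proof.
elim: s => [//|z s IH].
have E : suffix_pairs (z :: s) = [seq (z, t) | t <- z :: s] ++ suffix_pairs s by [].
rewrite E !mem_cat ![_ \in z :: s]in_cons => /predU1P[->|xs] /predU1P[->|ys].
- by left; rewrite (map_f (pair z)) ?mem_head.
- by left; rewrite (map_f (pair z)) // inE ys orbT.
- by right; rewrite (map_f (pair z)) // inE xs orbT.
- by have [->|->] := IH xs ys; rewrite orbT; [left|right].
Qed.

Lemma mem_all_glues (A : eqType) (F : A -> pole * pole) (l : seq A) x asg : x \in l ->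
  asg \in glues (F x).1 (F x).2 ->
  join_graphs (pgraph (F x).1) (pgraph (F x).2) asg \in all_glues (map F l).
Proof.
move=> xl al; rewrite /all_glues -map_comp; apply/flatten_mapP; exists x => //=.
by apply/mapP; exists asg.
Qed.

Lemma all2_mem (A B : eqType) (r : A -> B -> bool) s t x : all2 r s t -> x \in s ->
  exists2 y, y \in t & r x y.
Proof.
elim: s t => [//|z s IH] [//|y t] /= /andP[zy /IH{}IH]; rewrite inE => /predU1P[->|/IH[w wt xw]].
  by exists y; rewrite ?mem_head.
by exists w; rewrite ?inE ?wt ?orbT.
Qed.

Lemma all2_nth (A B : Type) (r : A -> B -> bool) a b s t i : all2 r s t -> i < size s ->
  r (nth a s i) (nth b t i).
Proof. by elim: s t i => [//|z s IH] [//|y t] [|i] /= /andP[zy /IH]; last apply. Qed.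

Lemma sub_cat4 (A : eqType) (s1 s2 s3 s4 : seq A) : let s := s1 ++ s2 ++ s3 ++ s4 in
  [/\ {subset s1 <= s}, {subset s2 <= s}, {subset s3 <= s} & {subset s4 <= s}].
Proof. by split=> x xs; rewrite !mem_cat xs ?orbT. Qed.

Definition poles_of m m' (x : (graph * seq colouring) * (graph * seq colouring)) : pole * pole :=
  (make_pole m x.1, make_pole m' x.2).

Lemma pairs_poles m m' (s t : seq (graph * seq colouring)) :
  [seq (x, y) | x <- map (make_pole m) s, y <- map (make_pole m') t] =
  map (poles_of m m') [seq (x, y) | x <- s, y <- t].
Proof. by rewrite map_allpairs allpairs_mapl allpairs_mapr. Qed.

Lemma survivors1E : survivors1 = all_glues (map (poles_of 0 0) (suffix_pairs col5)).
Proof. by rewrite /survivors1 mp5E suffix_pairs_map. Qed.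

Lemma survivors2E : survivors2 = all_glues (map (poles_of 0 0) [seq (x, y) | x <- col6, y <- col6']).
Proof. by rewrite /survivors2 mp6E mp6'E pairs_poles. Qed.

Lemma survivors3E : survivors3 = all_glues (map (poles_of 8 8) (suffix_pairs col7)).
Proof. by rewrite /survivors3 mp7E suffix_pairs_map. Qed.

Lemma survivors4E : survivors4 = all_glues (map (poles_of 9 9) [seq (x, y) | x <- col9, y <- col13]).
Proof. by rewrite /survivors4 mp9E mp13E pairs_poles. Qed.

Lemma size_snarks : size snarks = 20. Proof. by []. Qed.

Opaque snarks others hints cuts survivors1 survivors2 survivors3 survivors4.
Opaque mp5 mp6 mp6' mp7 mp9 mp13 col5 col6 col6' col7 col9 col13.

(** * Identification with one of the twenty graphs *)

Section Classification.

Variables (T : finType) (e : rel T).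
Hypothesis esym : symmetric e.
Hypothesis eirr : irreflexive e.
Hypothesis cubic : forall x, #|[set y | e x y]| = 3.
Hypothesis no3 : forall x y z, e x y -> e y z -> e z x -> False.
Hypothesis no4 : forall x y z w, e x y -> e y z -> e z w -> e w x ->
  x != z -> y != w -> False.
Hypothesis conn : forall x y, connect e x y.
Hypothesis card22 : #|T| = 22.
Hypothesis uncol : ~ edge_colorable e 3.
Hypothesis cut4 : forall W : {set T}, 2 <= #|W| <= 20 -> degsum e W + 4 <= 3 * #|W|.

Definition is_known : Prop := exists2 j, j < 20 & exists f, emb e (nth [::] snarks j) f.

(** A match with a graph in [others] would carry a cut of at most three edges over to [e], against
    [cut4]. *)
Lemma survivor_known h : h \in survivors1 ++ survivors2 ++ survivors3 ++ survivors4 ->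
  (wfb h -> exists f, emb e h f) -> is_known.
Proof.
move=> hin ex; have [c cin /and3P[wh cl ck]] := all2_mem survivors_matched hin.
have [f em] := ex wh.
have wr : wf (nth [::] (snarks ++ others) c.1).
  by apply: wfP; apply: (allP reps_wf); apply: mem_nth.
have {}em := emb_map em wr ck; set f' := (fun i => _) in em.
have sz20 := size_snarks.
have [lt|ge] := ltnP c.1 20.
  by exists c.1 => //; exists f'; move: em; rewrite nth_cat sz20 lt.
move: em; rewrite nth_cat sz20 ltnNge ge /= => em.
have lt : c.1 - 20 < size others by rewrite -(ltn_add2l 20) subnKC // -sz20 -size_cat.
have := all2_nth [::] [::] others_cut lt.
move=> /and5P[s1 s20 us /allP sg big].
have [cZ le] := inner_esum_degsum em us sg.
have := @cut4 [set:: map f' (nth [::] cuts (c.1 - 20))]; rewrite cZ s1 s20 => /(_ isT) d4.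
by move: (leq_trans (leq_add le (leqnn 4)) d4); rewrite leqNgt big.
Qed.

Lemma covered_col l cl (S : {set T}) : col_ok l cl -> covered e l S -> exists x f,
  [/\ x \in cl, emb e x.1 f, img x.1 f = S, esum x.1 = degsum e S & checked_pole x].
Proof.
move=> /andP[/eqP <- /allP ck] [g [f [/mapP[x xl ->] em im ex]]].
by exists x, f; split=> //; apply: ck.
Qed.

Lemma pair_known m m' (l : seq ((graph * seq colouring) * (graph * seq colouring))) xa xb fa fb
    (S : {set T}) :
  {subset all_glues (map (poles_of m m') l) <=
          survivors1 ++ survivors2 ++ survivors3 ++ survivors4} ->
  (xa, xb) \in l -> thin e m -> thin e m' ->
  emb e xa.1 fa -> img xa.1 fa = S -> esum xa.1 = degsum e S -> checked_pole xa ->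
  emb e xb.1 fb -> img xb.1 fb = ~: S -> esum xb.1 = degsum e (~: S) -> checked_pole xb ->
  is_known.
Proof.
move=> sub xl th th' ema ia exa cka emb_b ib exb ckb.
have [|||asg asgin ex] := pair_glued esym eirr cubic no3 no4 uncol ema emb_b _ _ _ cka ckb th th'.
- by rewrite ib ia.
- by rewrite ia.
- by rewrite ib.
apply: survivor_known ex; apply: sub.
exact: (mem_all_glues (F := poles_of m m') xl).
Qed.

Theorem known_snark : is_known.
Proof.
have [sub1 sub2 sub3 sub4] := sub_cat4 survivors1 survivors2 survivors3 survivors4.
have /and5P[ok5 ok6 ok6' ok7 /andP[ok9 ok13]] := cols_ok.
have := cut_cases esym eirr cubic no3 no4 conn card22 cut4.
case=> [[A cA cB]|[A cA cB]|[[A cA cB] no2]|[[A cA cB] no2]].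
- have [xa [fa [xal ema ia exa cka]]] := covered_col ok5 cA.
  have [xb [fb [xbl emb_b ib exb ckb]]] := covered_col ok5 cB.
  have sub : {subset all_glues (map (poles_of 0 0) (suffix_pairs col5)) <=
              survivors1 ++ survivors2 ++ survivors3 ++ survivors4}.
    by rewrite -survivors1E; exact: sub1.
  have [lx|lx] := mem_suffix_pairs xal xbl.
    exact: (pair_known sub lx I I ema ia exa cka emb_b ib exb ckb).
  (* Only one order of each pair of poles was glued; in the other order the two halves are
     exchanged. *)
  have ia' : img xa.1 fa = ~: ~: A by rewrite setCK.
  have exa' : esum xa.1 = degsum e (~: ~: A) by rewrite setCK.
  exact: (pair_known sub lx I I emb_b ib exb ckb ema ia' exa' cka).
- have [xa [fa [xal ema ia exa cka]]] := covered_col ok6 cA.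
  have [xb [fb [xbl emb_b ib exb ckb]]] := covered_col ok6' cB.
  have sub : {subset all_glues (map (poles_of 0 0) [seq (x, y) | x <- col6, y <- col6']) <=
              survivors1 ++ survivors2 ++ survivors3 ++ survivors4}.
    by rewrite -survivors2E; exact: sub2.
  have lx : (xa, xb) \in [seq (x, y) | x <- col6, y <- col6'] by exact: allpairs_f.
  exact: (pair_known sub lx I I ema ia exa cka emb_b ib exb ckb).
- have [xa [fa [xal ema ia exa cka]]] := covered_col ok7 cA.
  have [xb [fb [xbl emb_b ib exb ckb]]] := covered_col ok7 cB.
  have sub : {subset all_glues (map (poles_of 8 8) (suffix_pairs col7)) <=
              survivors1 ++ survivors2 ++ survivors3 ++ survivors4}.
    by rewrite -survivors3E; exact: sub3.
  have [lx|lx] := mem_suffix_pairs xal xbl.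
    exact: (pair_known sub lx no2 no2 ema ia exa cka emb_b ib exb ckb).
  have ia' : img xa.1 fa = ~: ~: A by rewrite setCK.
  have exa' : esum xa.1 = degsum e (~: ~: A) by rewrite setCK.
  exact: (pair_known sub lx no2 no2 emb_b ib exb ckb ema ia' exa' cka).
- have [xa [fa [xal ema ia exa cka]]] := covered_col ok9 cA.
  have [xb [fb [xbl emb_b ib exb ckb]]] := covered_col ok13 cB.
  have sub : {subset all_glues (map (poles_of 9 9) [seq (x, y) | x <- col9, y <- col13]) <=
              survivors1 ++ survivors2 ++ survivors3 ++ survivors4}.
    by rewrite -survivors4E; exact: sub4.
  have lx : (xa, xb) \in [seq (x, y) | x <- col9, y <- col13] by exact: allpairs_f.
  exact: (pair_known sub lx no2 no2 ema ia exa cka emb_b ib exb ckb).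
Qed.

End Classification.

Lemma ex_mid_subset (U : finType) (X Y : {set U}) n : X \subset Y -> #|X| <= n <= #|Y| ->
  exists Z : {set U}, [/\ X \subset Z, Z \subset Y & #|Z| = n].
Proof.
move=> sXY; elim: n => [|n IH] /andP[Xn nY].
  by exists X; split=> //; apply/eqP; rewrite -leqn0.
have [eq|lt] := leqP #|X| n; last by exists X; split=> //; apply/eqP; rewrite eqn_leq Xn.
have [|Z [XZ ZY cZ]] := IH; first by rewrite eq ltnW.
have : Z \proper Y by rewrite properEcard ZY cZ.
move=> /properP[_ [y yY yZ]]; exists (y |: Z); split.
- exact: subset_trans XZ (subsetUr _ _).
- by rewrite subUset sub1set yY.
- by rewrite cardsU1 yZ cZ.
Qed.

(** * Girth and edge cuts of a nontrivial snark *)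

Section Snark.

Variables (T : finType) (e : rel T).
Hypothesis card22 : #|T| = 22.
Hypothesis he : nontrivial_snark e.

Let esym : symmetric e. Proof. by case: he => -[[? ?] _ _ _ _] _ _. Qed.
Let eirr : irreflexive e. Proof. by case: he => -[[? ?] _ _ _ _] _ _. Qed.
Let cubic x : #|[set y | e x y]| = 3. Proof. by case: he => -[_ _ _ h _] _ _; apply: h. Qed.
Let conn x y : connect e x y. Proof. by case: he => -[_ [_ h] _ _ _] _ _. Qed.

Lemma snark_uncolorable : ~ edge_colorable e 3.
Proof. by case: he => -[_ _ _ _ [_ h]] _ _ /h. Qed.

Let neq x y : e x y -> x != y.
Proof. by apply: contraTneq => ->; rewrite eirr. Qed.

Lemma snark_no3 x y z : e x y -> e y z -> e z x -> False.
Proof.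
case: he => _ g5 _ xy yz zx; have := g5 [:: x; y; z] isT.
have xz : x != z by rewrite eq_sym; apply: neq.
by rewrite /ucycle /= xy yz zx !inE !negb_or (neq xy) (neq yz) xz; move=> /(_ isT).
Qed.

Lemma snark_no4 x y z w : e x y -> e y z -> e z w -> e w x -> x != z -> y != w -> False.
Proof.
case: he => _ g5 _ xy yz zw wx xz yw; have := g5 [:: x; y; z; w] isT.
have xw : x != w by rewrite eq_sym; apply: neq.
by rewrite /ucycle /= xy yz zw wx !inE !negb_or (neq xy) (neq yz) (neq zw) xz xw yw; move=> /(_ isT).
Qed.

Definition coboundary (W : {set T}) : {set {set T}} :=
  [set [set p.1; p.2] | p : T * T & [&& p.1 \in W, p.2 \notin W & e p.1 p.2]].

Lemma mem_coboundary W x y : e x y -> ([set x; y] \in coboundary W) = ((x \in W) != (y \in W)).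
Proof.
move=> xy; apply/imsetP/idP => [[[u v]]|].
  rewrite inE /= => /and3P[uW vW uv] eq.
  have xin : x \in [set u; v] by rewrite -eq set21.
  have yin : y \in [set u; v] by rewrite -eq set22.
  move: xy; move: xin yin; rewrite !inE => /orP[]/eqP-> /orP[]/eqP->; rewrite ?eirr //.
    by rewrite uW (negbTE vW).
  by rewrite uW (negbTE vW).
case xW : (x \in W); case yW : (y \in W) => // _.
  by exists (x, y); rewrite // inE /= xW yW.
by exists (y, x); rewrite ?inE /= ?xW ?yW 1?esym // setUC.
Qed.

Lemma card_coboundary W : #|coboundary W| <= \sum_(x in W) deg_in e (~: W) x.
Proof.
apply: leq_trans (leq_imset_card _ _) _; rewrite -sum1dep_card.
rewrite -(pair_big_dep (fun x => x \in W) (fun x y => (y \notin W) && e x y) (fun _ _ => 1)) /=.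
apply: leq_sum => x _; rewrite sum1dep_card /deg_in.
by apply: subset_leq_card; apply/subsetP => y; rewrite !inE.
Qed.

Lemma coboundary_edges W : coboundary W \subset edges e.
Proof.
apply/subsetP => _ /imsetP[[x y] + ->]; rewrite inE => /and3P[_ _ xy].
by apply/imsetP; exists (x, y); rewrite // inE.
Qed.

(** If the cut were the star of [x], some edge would still leave [W :\ x] by connectedness. Ending
    at [x], it is an edge of the star inside [W]; ending outside [W], it is a cut edge that misses
    [x]. *)
Lemma not_star (W : {set T}) x : 2 <= #|W| <= 20 -> x \in W -> #|coboundary W| = 3 ->
  ~ (forall y, e x y -> [set x; y] \in coboundary W).
Proof.
move=> /andP[W2 W20] xW c3 st.
pose S := [set [set x; y] | y in [set y | e x y]].
have SE : S = coboundary W.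
  apply/eqP; rewrite eqEcard c3; apply/andP; split.
    by apply/subsetP => _ /imsetP[y + ->]; rewrite inE; apply: st.
  rewrite card_in_imset ?cubic // => y z; rewrite !inE => xy xz eq.
  have : y \in [set x; z] by rewrite -eq set22.
  by rewrite !inE eq_sym (negbTE (neq xy)) => /eqP.
have X0 : W :\ x != set0 by rewrite -card_gt0; have := cardsD1 x W; rewrite xW; move: W2; clear; lia.
have XT : W :\ x != setT by apply/eqP => /setP/(_ x); rewrite !inE eqxx.
have [u [v [uX vX uv]]] : exists u v, [/\ u \in W :\ x, v \notin W :\ x & e u v].
  by have := boundary_edge esym conn X0 XT; case=> u [v]; exists u, v.
move: uX vX; rewrite !inE => /andP[ux uW]; rewrite negb_and negbK => /orP[/eqP vx|vW].
  rewrite vx in uv; have xu : e x u by rewrite esym.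
  by have := st u xu; rewrite mem_coboundary // xW uW.
have : [set u; v] \in coboundary W by rewrite mem_coboundary // uW (negbTE vW).
rewrite -SE => /imsetP[y _ eq]; have : x \in [set u; v] by rewrite eq set21.
by rewrite !inE eq_sym (negbTE ux) => /eqP xv; move: vW; rewrite -xv xW.
Qed.

Lemma coboundaryC W : coboundary (~: W) = coboundary W.
Proof.
apply/setP => E; apply/idP/idP => Ein.
  have /imsetP[[x y] + eq] := subsetP (coboundary_edges _) _ Ein.
  rewrite inE /= => xy; move: Ein; rewrite eq /= !mem_coboundary // !inE.
  by case: (x \in W); case: (y \in W).
have /imsetP[[x y] + eq] := subsetP (coboundary_edges _) _ Ein.
rewrite inE /= => xy; move: Ein; rewrite eq /= !mem_coboundary // !inE.
by case: (x \in W); case: (y \in W).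
Qed.

(** At most eight vertices are [a], [b] or neighbours of these; any edge at another vertex avoids
    both. *)
Lemma far_edge a b : exists u y, [/\ e u y, u \notin [set a; b] & y \notin [set a; b]].
Proof.
pose N := [set a; b] :|: ([set y | e a y] :|: [set y | e b y]).
have cN : #|N| <= 8.
  apply: leq_trans (leq_card_setU _ _) _; rewrite -[8]/(2 + 6); apply: leq_add.
    by rewrite cards2; case: (a != b).
  by apply: leq_trans (leq_card_setU _ _) _; rewrite !cubic.
have [u uN] : exists u, u \notin N.
  apply/existsP; rewrite -negb_forall; apply/negP => /forallP al.
  have : #|T| <= #|N| by apply: subset_leq_card; apply/subsetP => x _; apply: al.
  by rewrite card22; move: cN; clear; lia.
have : 0 < #|[set y | e u y]| by rewrite cubic.
move=> /card_gt0P[y]; rewrite inE => uy; exists u, y; split=> //.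
  by apply: contra uN => h; rewrite inE h.
by apply: contra uN; rewrite !inE => /orP[]/eqP <-; rewrite [e y u]esym uy ?orbT.
Qed.

(** A smaller cut lies in a set of exactly three edges whose deletion isolates no vertex, which
    nontriviality forbids. *)
Lemma snark_cut4 (W : {set T}) : 2 <= #|W| <= 20 -> degsum e W + 4 <= 3 * #|W|.
Proof.
move=> Wb; have bd := degsum_bound cubic W.
rewrite leqNgt; apply/negP => lt; have cB := card_coboundary W.
have {cB lt bd}B3 : #|coboundary W| <= 3 by move: cB bd lt; clear; lia.
have [W2 W20] := andP Wb.
have W0 : W != set0 by rewrite -card_gt0; move: W2; clear; lia.
have WT : W != setT by apply/eqP => eq; move: W20; rewrite eq cardsT card22.
have [a [b [aW bW ab]]] : exists u v, [/\ u \in W, v \notin W & e u v].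
  by have := boundary_edge esym conn W0 WT; case=> u [v]; exists u, v.
have abB : [set a; b] \in coboundary W by rewrite mem_coboundary // aW (negbTE bW).
have [F [BF FE cF noiso]] : exists F : {set {set T}}, [/\ coboundary W \subset F,
    F \subset edges e, #|F| = 3 & forall x, exists2 y, e x y & [set x; y] \notin F].
  move: B3; rewrite leq_eqVlt => /orP[/eqP B3|B2].
    exists (coboundary W); split=> //; first exact: coboundary_edges.
    move=> x; have [/existsP[y /andP[xy yn]]|no] :=
      boolP [exists y, e x y && ([set x; y] \notin coboundary W)]; first by exists y.
    have st y : e x y -> [set x; y] \in coboundary W.
      by move=> xy; apply: contraNT no => h; apply/existsP; exists y; rewrite xy.
    have [xW|xW] := boolP (x \in W); first by case: (not_star Wb xW B3 st).
    case: (@not_star (~: W) x); rewrite ?inE ?coboundaryC //.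
    by have := cardsC W; rewrite card22; move: W2 W20; clear; lia.
  (* A cut of fewer than three edges is padded with an edge disjoint from the cut edge [a b], so the
     three edges have no common vertex and cannot be the star of any vertex. *)
  have [u [y [uy un yn]]] := far_edge a b.
  have E1 : [set u; y] \in edges e by apply/imsetP; exists (u, y); rewrite // inE.
  have [||F [sF FE cF]] := @ex_mid_subset _ ([set u; y] |: coboundary W) (edges e) 3.
  - by rewrite subUset sub1set E1 coboundary_edges.
  - apply/andP; split.
      rewrite cardsU1; apply: leq_trans (leq_add (leq_b1 _) (leqnn _)) _.
      by rewrite add1n.
    have <- : #|[set [set u; z] | z in [set z | e u z]]| = 3.
      rewrite card_in_imset ?cubic // => v z; rewrite !inE => uv uz eq.
      have : v \in [set u; z] by rewrite -eq set22.
      by rewrite !inE eq_sym (negbTE (neq uv)) => /eqP.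
    apply: subset_leq_card; apply/subsetP => _ /imsetP[z + ->]; rewrite inE => uz.
    by apply/imsetP; exists (u, z); rewrite // inE.
  exists F; split=> //; first by apply: subset_trans sF; apply: subsetUr.
  move=> x; have [/existsP[z /andP[xz zn]]|no] := boolP [exists z, e x z && ([set x; z] \notin F)].
    by exists z.
  have st z : e x z -> [set x; z] \in F.
    by move=> xz; apply: contraNT no => h; apply/existsP; exists z; rewrite xz.
  have SF : [set [set x; z] | z in [set z | e x z]] = F.
    apply/eqP; rewrite eqEcard cF; apply/andP; split.
      by apply/subsetP => _ /imsetP[z + ->]; rewrite inE; apply: st.
    rewrite card_in_imset ?cubic // => v z; rewrite !inE => uv uz eq.
    have : v \in [set x; z] by rewrite -eq set22.
    by rewrite !inE eq_sym (negbTE (neq uv)) => /eqP.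
  have inx E : E \in F -> x \in E by rewrite -SF => /imsetP[z _ ->]; rewrite set21.
  have xab : x \in [set a; b].
    by apply: inx; apply: (subsetP sF); rewrite inE abB orbT.
  have : x \in [set u; y] by apply: inx; apply: (subsetP sF); rewrite inE set11.
  by rewrite !inE => /orP[]/eqP xe; move: xab; rewrite xe ?(negbTE un) ?(negbTE yn).
case: he => _ _ []; exists F; split=> //.
  move=> [_ /(_ a b)/connectP[p pth lst]].
  suff : b \in W by rewrite (negbTE bW).
  rewrite lst; elim: p a aW pth {lst ab abB} => [//|c p IH] x xW /= /andP[/andP[xc cn] pth].
  apply: IH pth; apply: contraNT cn => cW; apply: (subsetP BF).
  by rewrite mem_coboundary // xW (negbTE cW).
by move=> x; have [y xy yn] := noiso x; exists x, y; rewrite connect0 /del_edges /= xy.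
Qed.

Theorem snark_known : is_known e.
Proof.
exact: (known_snark esym eirr cubic snark_no3 snark_no4 conn card22 snark_uncolorable snark_cut4).
Qed.

End Snark.

(** * Decompositions into copies of a graph *)

Notation point := (nat * nat)%type.

Definition half_edges (g : graph) : seq (nat * nat) :=
  flatten [seq [seq (u, v) | v <- nb g u] | u <- iota 0 (size g)].

(** A block lists the images of the 22 labels. Edges are counted as ordered pairs throughout, so a
    block of a cubic [g] contributes 66. *)
Definition trace (g : graph) (b : seq point) : seq (point * point) :=
  [seq (nth (0, 0) b x.1, nth (0, 0) b x.2) | x <- half_edges g].

Definition traces (g : graph) (B : seq (seq point)) := flatten (map (trace g) B).

Definition is_block (b : seq point) : bool := (size b == 22) && uniq b.

Definition dec (g : graph) (R : rel point) : Prop := exists B,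
  [/\ all is_block B, uniq (traces g B) & forall u v, ((u, v) \in traces g B) = R u v].

(* The complete multipartite graph with part sizes [s]. *)
Definition parts (s : seq nat) : rel point := fun u v =>
  [&& u.1 < size s, u.2 < nth 0 s u.1, v.1 < size s, v.2 < nth 0 s v.1 & u.1 != v.1].

Definition holed (P H : seq point) : rel point := fun u v =>
  [&& u \in P, v \in P, u != v & ~~ ((u \in H) && (v \in H))].

Definition MD (g : graph) (s : seq nat) : Prop := dec g (parts s).

(** Quantifying over all point lists makes this a property of the sizes alone, so that it can be
    placed on any points; by [HDI] one instance gives them all. *)
Definition HD (g : graph) (m h : nat) : Prop := forall L H : seq point,
  uniq (L ++ H) -> size L = m -> size H = h -> dec g (holed (L ++ H) H).

Definition KD (g : graph) (n : nat) : Prop := HD g n 0.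

(** A group divisible design whose groups are the fibres of [gr]: two points in different groups
    share exactly one block, two points of one group share none. *)
Definition master (T : nat) (gr : nat -> nat) (bl : seq (seq nat)) : Prop :=
  [/\ uniq bl, forall b, b \in bl -> uniq b /\ all (fun p => p < T) b,
      forall b p q, b \in bl -> p \in b -> q \in b -> p != q -> gr p != gr q,
      forall p q, p < T -> q < T -> gr p != gr q -> exists2 b, b \in bl & (p \in b) && (q \in b) &
      forall b b' p q, b \in bl -> b' \in bl -> p != q ->
        p \in b -> q \in b -> p \in b' -> q \in b' -> b = b'].

Definition masterb (T : nat) (gr : nat -> nat) (bl : seq (seq nat)) : bool :=
  [&& uniq bl, all (fun b => uniq b && all (fun p => p < T) b) bl &
      all (fun p => all (fun q => (p == q) ||
             (count (fun b => (p \in b) && (q \in b)) bl == (gr p != gr q))) (iota 0 T)) (iota 0 T)].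

Lemma masterP T gr bl : masterb T gr bl -> master T gr bl.
Proof.
move=> /and3P[ub /allP al /allP cnt].
have inT b p : b \in bl -> p \in b -> p < T by move=> /al /andP[_ /allP h] /h.
have ct p q : p < T -> q < T -> p != q ->
    count (fun b => (p \in b) && (q \in b)) bl = (gr p != gr q).
  move=> pT qT pq; have := cnt p; rewrite mem_iota => /(_ pT)/allP/(_ q).
  by rewrite mem_iota => /(_ qT); rewrite (negbTE pq) => /eqP.
split=> //.
- by move=> b /al /andP[].
- move=> b p q bb pb qb pq; have := ct p q (inT _ _ bb pb) (inT _ _ bb qb) pq.
  case: (gr p != gr q) => // c0.
  have : 0 < count (fun b => (p \in b) && (q \in b)) bl by rewrite -has_count; apply/hasP; exists b; rewrite ?pb.
  by rewrite c0.
- move=> p q pT qT gpq; have pq : p != q by apply: contraNneq gpq => ->.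
  by have := ct p q pT qT pq; rewrite gpq => c1; apply/hasP; rewrite has_count c1.
- move=> b b' p q bb bb' pq pb qb pb' qb'.
  have := ct p q (inT _ _ bb pb) (inT _ _ bb qb) pq; rewrite -size_filter.
  have : b \in [seq b <- bl | (p \in b) && (q \in b)] by rewrite mem_filter pb qb.
  have : b' \in [seq b <- bl | (p \in b) && (q \in b)] by rewrite mem_filter pb' qb'.
  case: [seq b <- bl | _] => [//|x [|y s]]; last by case: (_ != _).
  by rewrite !inE => /eqP-> /eqP->.
Qed.

Section Decompositions.

Variable g : graph.
Hypothesis wg : wf g.
Hypothesis size22 : size g = 22.
Hypothesis deg3 : forall u, u < 22 -> size (nb g u) = 3.

Lemma mem_half_edges u v : ((u, v) \in half_edges g) = (u < 22) && (v \in nb g u).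
Proof.
rewrite -size22; apply/flatten_mapP/andP => [[w]|[ug vu]].
  by rewrite mem_iota => wlt /mapP[z zw [-> ->]].
by exists u; rewrite ?mem_iota //; apply/mapP; exists v.
Qed.

Lemma half_edges_lt x : x \in half_edges g -> x.1 < 22 /\ x.2 < 22.
Proof.
case: x => u v; rewrite mem_half_edges -size22 => /andP[ug vu]; split=> //.
by have [_ /(_ v vu)[]] := wg ug.
Qed.

Lemma size_half_edges : size (half_edges g) = 66.
Proof.
rewrite size_flatten /shape -map_comp sumnE big_map.
rewrite (eq_big_seq (fun=> 3)); last by move=> u; rewrite mem_iota size22 /= => ?; rewrite size_map deg3.
by rewrite big_const_seq count_predT size_iota size22.
Qed.

Lemma dec_ext R R' : R =2 R' -> dec g R -> dec g R'.
Proof. by move=> eqR [B [? ? h]]; exists B; split=> // u v; rewrite h eqR. Qed.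

Lemma traces_cat B1 B2 : traces g (B1 ++ B2) = traces g B1 ++ traces g B2.
Proof. by rewrite /traces map_cat flatten_cat. Qed.

Lemma dec0 : dec g (fun _ _ => false).
Proof. by exists [::]. Qed.

Lemma decU R1 R2 : dec g R1 -> dec g R2 -> (forall u v, R1 u v -> R2 u v -> False) ->
  dec g (fun u v => R1 u v || R2 u v).
Proof.
move=> [B1 [b1 u1 h1]] [B2 [b2 u2 h2]] dis; exists (B1 ++ B2); rewrite traces_cat.
split; first by rewrite all_cat b1.
  rewrite cat_uniq u1 u2 andbT; apply/hasPn => -[u v]; rewrite h2 /= h1 => r2.
  by apply/negP => /dis/(_ r2).
by move=> u v; rewrite mem_cat h1 h2.
Qed.

Lemma dec_big (I : eqType) (s : seq I) (F : I -> rel point) : uniq s ->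
  {in s, forall i, dec g (F i)} ->
  (forall i j u v, i \in s -> j \in s -> F i u v -> F j u v -> i = j) ->
  dec g (fun u v => has (fun i => F i u v) s).
Proof.
elim: s => [|i s IH] /=; first by move=> *; apply: dec_ext dec0.
move=> /andP[ni us] df dis; apply: decU; first by apply: df; rewrite mem_head.
  apply: IH => // [j js|j k u v js ks]; first by apply: df; rewrite inE js orbT.
  by apply: dis; rewrite inE ?js ?ks orbT.
move=> u v fi /hasP[j js fj]; move: ni; suff -> : i = j by rewrite js.
by apply: dis fi fj; rewrite ?mem_head // inE js orbT.
Qed.

Lemma trace_map f b : size b = 22 ->
  trace g (map f b) = [seq (f x.1, f x.2) | x <- trace g b].
Proof.
move=> sb; rewrite /trace -map_comp; apply/eq_in_map => x /half_edges_lt[lt1 lt2] /=.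
by rewrite !(nth_map (0, 0)) ?sb.
Qed.

Lemma traces_map f B : all is_block B ->
  traces g (map (map f) B) = [seq (f x.1, f x.2) | x <- traces g B].
Proof.
move=> /allP al; rewrite /traces map_flatten -!map_comp; congr flatten.
by apply/eq_in_map => b /al /andP[/eqP sb _] /=; rewrite trace_map.
Qed.

Lemma block_point b x : size b = 22 -> x \in b -> exists y, (x, y) \in trace g b.
Proof.
move=> sb xb; have lt : index x b < 22 by rewrite -sb index_mem.
have : 0 < size (nb g (index x b)) by rewrite deg3.
case E : (nb g (index x b)) => [//|v l] _; exists (nth (0, 0) b v).
apply/mapP; exists (index x b, v); last by rewrite /= nth_index.
by rewrite mem_half_edges lt E mem_head.
Qed.

Lemma dec_map f (P : pred point) (R R' : rel point) : dec g R -> (forall u v, R u v -> P u /\ P v) ->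
  {in P &, injective f} -> (forall u v, R u v -> R' (f u) (f v)) ->
  (forall u v, R' u v -> exists u0 v0, [/\ R u0 v0, u = f u0 & v = f v0]) -> dec g R'.
Proof.
move=> [B [bB uB hB]] RP inj RR' R'R; exists (map (map f) B); rewrite traces_map //; split.
- rewrite all_map; apply/allP => b bb; have /andP[/eqP sb ub] := allP bB _ bb.
  rewrite /= /is_block size_map sb eqxx /= map_inj_in_uniq // => x y xb yb.
  have inP z : z \in b -> z \in P.
    move=> zb; have [w zw] := block_point sb zb.
    have : (z, w) \in traces g B by apply/flatten_mapP; exists b.
    by rewrite hB => /RP[].
  by apply: inj; apply: inP.
- rewrite map_inj_in_uniq // => -[u v] [u' v']; rewrite !hB => /RP[Pu Pv] /RP[Pu' Pv'] [e1 e2].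
  by rewrite (inj _ _ Pu Pu' e1) (inj _ _ Pv Pv' e2).
- move=> u v; apply/mapP/idP => [[[u0 v0]]|].
    by rewrite hB => r [-> ->]; apply: RR'.
  by move=> /R'R[u0 [v0 [r -> ->]]]; exists (u0, v0); rewrite ?hB.
Qed.

Lemma HDI L H : uniq (L ++ H) -> dec g (holed (L ++ H) H) -> HD g (size L) (size H).
Proof.
move=> un d L' H' un' sL sH; pose f u := nth (0, 0) (L' ++ H') (index u (L ++ H)).
have sz : size (L' ++ H') = size (L ++ H) by rewrite !size_cat sL sH.
have ilt u : u \in L ++ H -> index u (L ++ H) < size (L' ++ H') by rewrite sz index_mem.
have fin u : u \in L ++ H -> f u \in L' ++ H' by move=> ui; rewrite mem_nth ?ilt.
have fI u : u \in L ++ H -> index (f u) (L' ++ H') = index u (L ++ H).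
  by move=> ui; rewrite index_uniq ?ilt.
have inH (X Y : seq point) u : uniq (X ++ Y) -> u \in X ++ Y ->
    (u \in Y) = (size X <= index u (X ++ Y)).
  rewrite cat_uniq => /and3P[_ /hasPn dis _]; rewrite mem_cat index_cat.
  have [uX _|uX /= uY] := boolP (u \in X).
    rewrite leqNgt index_mem uX /=; apply/negbTE; apply: contraL uX; apply: dis.
  by rewrite uY leq_addr.
have fH u : u \in L ++ H -> (f u \in H') = (u \in H).
  by move=> ui; rewrite (inH L' H') ?fin // (inH L H) // fI // sL.
have finj : {in mem (L ++ H) &, injective f}.
  move=> u v ui vi eqf; have : index u (L ++ H) = index v (L ++ H) by rewrite -!fI // eqf.
  by move=> eqi; rewrite -(nth_index (0, 0) ui) eqi nth_index.
have surj u : u \in L' ++ H' -> exists2 u0, u0 \in L ++ H & u = f u0.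
  move=> ui; have lt : index u (L' ++ H') < size (L ++ H) by rewrite -sz index_mem.
  exists (nth (0, 0) (L ++ H) (index u (L' ++ H'))); first by rewrite mem_nth.
  by rewrite /f index_uniq // nth_index.
apply: (dec_map (f := f) (P := mem (L ++ H)) d).
- by move=> u v /and4P[].
- exact: finj.
- move=> u v /and4P[ui vi uv uH]; rewrite /holed !fin // !fH // uH andbT.
  by apply: contra uv => /eqP /(finj _ _ ui vi) ->.
- move=> u v /and4P[/surj[u0 ui ->] /surj[v0 vi ->] uv uH]; exists u0, v0; split=> //.
  rewrite /holed ui vi /=; rewrite !fH // in uH; rewrite uH andbT.
  by apply: contra uv => /eqP ->.
Qed.

Lemma MD1_KD n : MD g (nseq n 1) -> KD g n.
Proof.
move=> d; pose L := [seq (i, 0) | i <- iota 0 n].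
have memL u : (u \in L) = (u.1 < n) && (u.2 == 0).
  apply/mapP/andP => [[i + ->]|[un /eqP u0]]; first by rewrite mem_iota.
  by exists u.1; rewrite ?mem_iota //; case: u un u0 => ? ? /= _ ->.
have uL : uniq (L ++ [::]) by rewrite cats0 map_inj_uniq ?iota_uniq // => ? ? [].
have := @HDI L [::] uL; rewrite size_map size_iota; apply.
apply: dec_ext d => u v; rewrite /parts /holed cats0 !memL !size_nseq !nth_nseq !in_nil andbT.
case: u v => [i x] [j y] /=; rewrite xpair_eqE.
case: (ltnP i n) => //= _; case: (ltnP j n) => //= _; rewrite ?andbF // !ltnS !leqn0.
by case: eqP => //= ->; case: eqP => //= ->; rewrite ?eqxx ?andbT.
Qed.

Lemma KD_HD1 m : KD g m.+1 -> HD g m 1.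
Proof.
move=> kd L [|x [|]] // un sL _.
have := kd (L ++ [:: x]) [::]; rewrite cats0 size_cat sL addn1 => /(_ un erefl erefl).
apply: dec_ext => u v; rewrite /holed !in_nil /= !inE andbT.
case: (u \in _) => //=; case: (v \in _) => //=.
have [->|ux] := eqVneq u x; last by rewrite andbT.
by rewrite /= (eq_sym v) andbb.
Qed.

Lemma HD_KD m h : HD g m h -> KD g h -> KD g (m + h).
Proof.
move=> hd kd L [|//]; rewrite cats0 => un sL _.
have szL : size (take m L) = m by rewrite size_takel // sL leq_addr.
have szH : size (drop m L) = h by rewrite size_drop sL addKn.
have un2 : uniq (drop m L) by rewrite drop_uniq.
have := hd (take m L) (drop m L); rewrite cat_take_drop => /(_ un szL szH) d1.
have := kd (drop m L) [::]; rewrite cats0 => /(_ un2 szH erefl) d2.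
apply: dec_ext (decU d1 d2 _) => [u v|u v].
  rewrite /holed !in_nil /= !andbT.
  have sub x : x \in drop m L -> x \in L by apply: mem_drop.
  case uL : (u \in L) => /=; last first.
    by apply/negbTE; apply/negP => /and3P[/sub]; rewrite uL.
  case vL : (v \in L) => /=; last first.
    by apply/negbTE; apply/negP => /and3P[_ /sub]; rewrite vL.
  by case: (u == v) => //=; rewrite ?andbF // !andbT orNb.
by move=> /and4P[_ _ _ /negP h1] /and4P[u1 v1 _ _]; apply: h1; rewrite u1 v1.
Qed.

Lemma HD1_KD m : HD g m 1 -> KD g m.+1.
Proof.
move=> hd; rewrite -addn1; apply: HD_KD => // -[//|x [|//]] [|//] _ _ _.
apply: dec_ext dec0 => u v; rewrite /holed /= !inE andbT.
by case: eqVneq => //= ->; case: eqVneq => //= ->; rewrite eqxx.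
Qed.

(** Wilson's fundamental construction: each point becomes [w p] points, and each block is replaced
    by a decomposition of the multipartite graph on the copies of its points. *)
Lemma dec_blocks T gr w bl : master T gr bl -> {in bl, forall b, MD g (map w b)} ->
  dec g (fun u v => [&& u.1 < T, u.2 < w u.1, v.1 < T, v.2 < w v.1 & gr u.1 != gr v.1]).
Proof.
move=> [ubl inT sep cov uni] md.
pose F (b : seq nat) : rel point := fun u v => [&& u.1 \in b, v.1 \in b, u.1 != v.1, u.2 < w u.1 & v.2 < w v.1].
have dF : {in bl, forall b, dec g (F b)}.
  move=> b bb; have [ub _] := inT b bb.
  apply: (dec_map (f := fun u => (nth 0 b u.1, u.2)) (P := fun u => u.1 < size b) (md b bb)).
  - by move=> u v /and5P[]; rewrite size_map.
  - move=> [i x] [j y] /= ib jb [e1 ->]; congr pair.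
    by apply/eqP; rewrite -(nth_uniq 0 ib jb ub) e1.
  - move=> [i x] [j y] /and5P[/=]; rewrite size_map => ib xw jb yw ij.
    rewrite /F /= !mem_nth //= nth_uniq // ij.
    by rewrite !(nth_map 0) // in xw yw; rewrite xw yw.
  - move=> [p x] [q y] /and5P[/= pb qb pq xw yw].
    exists (index p b, x), (index q b, y); rewrite /= !nth_index //; split=> //.
    rewrite /parts /= size_map !index_mem pb qb /= !(nth_map 0) ?index_mem // !nth_index // xw yw /=.
    by apply: contra pq => /eqP eqi; rewrite -(nth_index 0 pb) eqi nth_index.
have disj b b' u v : b \in bl -> b' \in bl -> F b u v -> F b' u v -> b = b'.
  by move=> bb bb' /and5P[? ? uv _ _] /and5P[? ? _ _ _]; apply: (uni b b' u.1 v.1).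
apply: dec_ext (dec_big ubl dF disj) => u v; apply/hasP/and5P => [[b bb]|[uT uw vT vw guv]].
  move=> /and5P[ub vb uv uw vw]; have [_ /allP aT] := inT b bb.
  by split; rewrite ?aT //; apply: sep bb ub vb uv.
have [b bb /andP[ub vb]] := cov _ _ uT vT guv; exists b; rewrite // /F ub vb uw vw !andbT.
by apply: contraNneq guv => ->.
Qed.

Lemma map_const_nseq (A : Type) (k : nat) (s : seq A) : [seq k | _ <- s] = nseq (size s) k.
Proof. exact: map_const. Qed.

(** The copies of the [s] points of a group are renumbered as a single part of size [s * w]. *)
Lemma inflate k s w bl : 0 < s -> masterb (k * s) (fun p => p %/ s) bl ->
  {in bl, forall b, MD g (nseq (size b) w)} -> MD g (nseq k (s * w)).
Proof.
move=> s0 /masterP ms md.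
have md' : {in bl, forall b, MD g (map (fun=> w) b)} by move=> b bb; rewrite map_const_nseq; apply: md.
have ltk p : p < k * s -> p %/ s < k by move=> lt; rewrite ltn_divLR.
apply: (dec_map (f := fun u => (u.1 %/ s, (u.1 %% s) * w + u.2))
  (P := fun u => (u.1 < k * s) && (u.2 < w)) (dec_blocks ms md')).
- by move=> u v /and5P[-> -> -> ->].
- move=> [p x] [q y] /andP[/= _ xw] /andP[/= _ yw] [e1 e2].
  have w0 : 0 < w by apply: leq_ltn_trans xw.
  have e3 : p %% s = q %% s by have := congr1 (divn^~ w) e2; rewrite !divnMDl // !divn_small // !addn0.
  have e4 : x = y by have := congr1 (modn^~ w) e2; rewrite !modnMDl !modn_small.
  by rewrite (divn_eq p s) (divn_eq q s) e1 e3 e4.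
- move=> [p x] [q y] /and5P[/= pk xw qk yw pq]; rewrite /parts /= size_nseq !nth_nseq !ltk //= pq andbT.
  have h r z : z < w -> r %% s * w + z < s * w.
    move=> zw; apply: (@leq_trans ((r %% s).+1 * w)); first by rewrite mulSn addnC ltn_add2r.
    by rewrite leq_mul2r ltn_mod s0 orbT.
  by rewrite !h.
- move=> [i x] [j y] /and5P[/=]; rewrite size_nseq !nth_nseq => ik xw jk yw ij.
  rewrite ik jk in xw yw.
  have w0 : 0 < w by case: w xw {md md' yw} => //; rewrite muln0.
  have dv z : z < s * w -> z %/ w < s by move=> lt; rewrite ltn_divLR.
  have pk i' z : i' < k -> z < s * w -> i' * s + z %/ w < k * s.
    move=> ik' zs; apply: (@leq_trans (i'.+1 * s)); last by rewrite leq_mul2r ik' orbT.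
    by rewrite mulSn addnC ltn_add2r dv.
  have q1 i' z : z < s * w -> (i' * s + z %/ w) %/ s = i'.
    by move=> zs; rewrite divnMDl // divn_small ?addn0 ?dv.
  have q2 i' z : z < s * w -> (i' * s + z %/ w) %% s = z %/ w.
    by move=> zs; rewrite modnMDl modn_small ?dv.
  exists (i * s + x %/ w, x %% w), (j * s + y %/ w, y %% w) => /=.
  by rewrite !q1 // !q2 // -!divn_eq !pk // !ltn_mod w0 ij; split.
Qed.

(** * Filling the groups of an inflated design *)

Section Filling.

Variables (T : nat) (gr w : nat -> nat) (h k : nat).
Hypothesis grk : forall p, p < T -> gr p < k.

Definition regular_points : seq point := [seq (p, x) | p <- iota 0 T, x <- iota 0 (w p)].

Definition group_points (i : nat) : seq point :=
  [seq (p, x) | p <- [seq p <- iota 0 T | gr p == i], x <- iota 0 (w p)].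

Definition hole_points : seq point := [seq (T, z) | z <- iota 0 h].

Lemma mem_pairs (s : seq nat) u : (u \in [seq (p, x) | p <- s, x <- iota 0 (w p)]) =
  (u.1 \in s) && (u.2 < w u.1).
Proof.
apply/allpairsPdep/andP => [[p [x [ps + ->]]]|[us uw]]; first by rewrite mem_iota.
by exists u.1, u.2; rewrite mem_iota; split=> //; case: u {us uw}.
Qed.

Lemma uniq_pairs (s : seq nat) : uniq s -> uniq [seq (p, x) | p <- s, x <- iota 0 (w p)].
Proof.
move=> us; apply: allpairs_uniq_dep => // [p _|]; first exact: iota_uniq.
by move=> [p x] [q y] _ _ /= [-> ->].
Qed.

Lemma size_pairs (s : seq nat) : size [seq (p, x) | p <- s, x <- iota 0 (w p)] = sumn (map w s).
Proof. by rewrite size_allpairs_dep; congr sumn; apply: eq_map => p; rewrite size_iota. Qed.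

Lemma mem_hole u : (u \in hole_points) = (u.1 == T) && (u.2 < h).
Proof.
apply/mapP/andP => [[z + ->]|[/eqP uT uh]]; first by rewrite mem_iota eqxx.
by exists u.2; rewrite ?mem_iota //; case: u uT {uh} => ? ? /= ->.
Qed.

Lemma uniq_hole (s : seq nat) : uniq s -> all (fun p => p < T) s ->
  uniq ([seq (p, x) | p <- s, x <- iota 0 (w p)] ++ hole_points).
Proof.
move=> us /allP sT; rewrite cat_uniq uniq_pairs //= map_inj_uniq ?iota_uniq ?andbT; last by move=> ? ? [].
apply/hasPn => u; rewrite mem_hole mem_pairs => /andP[/eqP uT _]; apply/negP => /andP[/sT].
by rewrite uT ltnn.
Qed.

(** The hole points are added to every group, and all fillings but the last leave the pairs inside
    the hole uncovered. [H0] decides whether the last one leaves them too or covers them. *)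
Lemma fill (H0 : seq point) : H0 = hole_points \/ H0 = [::] -> 0 < k ->
  dec g (fun u v => [&& u.1 < T, u.2 < w u.1, v.1 < T, v.2 < w v.1 & gr u.1 != gr v.1]) ->
  (forall i, i < k.-1 -> dec g (holed (group_points i ++ hole_points) hole_points)) ->
  dec g (holed (group_points k.-1 ++ hole_points) H0) ->
  dec g (holed (regular_points ++ hole_points) H0).
Proof.
move=> eH0 k0 dM dG dL; pose Hi i := if i == k.-1 then H0 else hole_points.
pose F i : rel point := holed (group_points i ++ hole_points) (Hi i).
pose reg (u : point) := (u.1 < T) && (u.2 < w u.1).
have memG i u : (u \in group_points i ++ hole_points) =
    (reg u && (gr u.1 == i)) || (u \in hole_points).
  rewrite mem_cat mem_pairs mem_filter mem_iota /= /reg.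
  by case: (u.1 < T); case: (gr u.1 == i); case: (u.2 < w u.1).
have memR u : (u \in regular_points ++ hole_points) = reg u || (u \in hole_points).
  by rewrite mem_cat mem_pairs mem_iota.
have regH u : reg u -> (u \in hole_points) = false.
  by move=> /andP[uT _]; rewrite mem_hole; case: eqP uT => // ->; rewrite ltnn.
have subH i u : u \in Hi i -> u \in hole_points.
  by rewrite /Hi; case: eqP => // _; case: eH0 => ->.
have Flast i u v : u \in hole_points -> v \in hole_points -> F i u v -> i = k.-1.
  move=> uh vh /and4P[_ _ _]; rewrite /Hi; case: eqP => // _.
  by rewrite uh vh.
have dF : {in iota 0 k, forall i, dec g (F i)}.
  move=> i; rewrite mem_iota /= => ik; rewrite /F /Hi; case: eqP => [->//|ne]; apply: dG.
  by move: ik ne k0; clear; lia.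
have Fgr i u v : F i u v -> reg u -> gr u.1 = i.
  by move=> /and4P[]; rewrite memG => + _ _ _ ru; rewrite ru (regH u) // orbF => /eqP.
have Fsym i u v : F i u v -> F i v u.
  by move=> /and4P[a b c d]; rewrite /F /holed a b eq_sym c [X in ~~ X]andbC d.
have disF i j u v : i \in iota 0 k -> j \in iota 0 k -> F i u v -> F j u v -> i = j.
  move=> _ _ fi fj; have [ui vi _ _] := and4P fi.
  rewrite memG in ui; rewrite memG in vi.
  have [/andP[ru _]|uh] := orP ui; first by rewrite -(Fgr _ _ _ fi ru) -(Fgr _ _ _ fj ru).
  have [/andP[rv _]|vh] := orP vi.
    by rewrite -(Fgr _ _ _ (Fsym _ _ _ fi) rv) -(Fgr _ _ _ (Fsym _ _ _ fj) rv).
  by rewrite (Flast i u v) // (Flast j u v).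
apply: dec_ext (decU dM (dec_big (iota_uniq 0 k) dF disF) _); last first.
  move=> u v /and5P[uT uw vT vw ne] /hasP[i _ fi]; case/negP: ne.
  have ru : reg u by rewrite /reg uT.
  have rv : reg v by rewrite /reg vT.
  by rewrite (Fgr _ _ _ fi ru) (Fgr _ _ _ (Fsym _ _ _ fi) rv).
have sH0 u : u \in H0 -> u \in hole_points by case: eH0 => ->.
move=> u v; apply/orP/and4P => [[/and5P[uT uw vT vw ne]|/hasP[i + fi]]|[ui vi uv nh]].
- have ru : reg u by rewrite /reg uT.
  rewrite !memR /reg uT uw vT vw; split=> //; first by apply: contraNneq ne => ->.
  by apply/negP => /andP[/sH0]; rewrite regH.
- rewrite mem_iota /= => ik; have [ui vi uv nh] := and4P fi.
  rewrite memG in ui; rewrite memG in vi; rewrite !memR; split=> //.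
  + by case/orP: ui => [/andP[->]|->]; rewrite ?orbT.
  + by case/orP: vi => [/andP[->]|->]; rewrite ?orbT.
  + apply/negP => /andP[u0 v0]; case/negP: nh; rewrite /Hi.
    by case: eqP => _; rewrite ?u0 ?v0 // !sH0.
rewrite memR in ui; rewrite memR in vi.
have mk i : i < k -> F i u v -> has (fun i => F i u v) (iota 0 k).
  by move=> ik fi; apply/hasP; exists i; rewrite // mem_iota.
have nhi i : ~~ ((u \in hole_points) && (v \in hole_points)) -> ~~ ((u \in Hi i) && (v \in Hi i)).
  by apply: contra => /andP[/subH-> /subH->].
have klt : k.-1 < k by rewrite prednK.
case/orP: ui => [ru|uh]; case/orP: vi => [rv|vh].
- have [eqg|neg] := eqVneq (gr u.1) (gr v.1).
    right; apply: (mk (gr u.1)); first by apply: grk; case/andP: ru.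
    rewrite /F /holed !memG ru rv -eqg eqxx uv /=; apply: nhi; by rewrite regH.
  by left; case/andP: ru => -> ->; case/andP: rv => -> ->.
- right; apply: (mk (gr u.1)); first by apply: grk; case/andP: ru.
  by rewrite /F /holed !memG ru vh eqxx orbT uv /=; apply: nhi; rewrite regH.
- right; apply: (mk (gr v.1)); first by apply: grk; case/andP: rv.
  by rewrite /F /holed !memG rv uh eqxx orbT uv /=; apply: nhi; rewrite [X in _ && X]regH ?andbF.
- right; apply: (mk k.-1) => //; rewrite /F /holed !memG uh vh !orbT uv /=.
  by rewrite /Hi eqxx.
Qed.

End Filling.

(** All parts but the last are filled; the last part becomes the hole. *)
Lemma HD_groups k m : MD g (nseq k.+1 m) -> KD g m -> HD g (k * m) m.
Proof.
move=> md kd; pose w (_ : nat) := m.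
have key : dec g (holed (regular_points k w ++ hole_points k m) (hole_points k m)).
  pose F i : rel point := fun u v => [&& u.1 == i, v.1 == i, u.2 < m, v.2 < m & u.2 != v.2].
  have dF : {in iota 0 k, forall i, dec g (F i)}.
    move=> i _; have un : uniq ([seq (i, x) | x <- iota 0 m] ++ [::] : seq point).
      by rewrite cats0 map_inj_uniq ?iota_uniq // => ? ? [].
    have := kd [seq (i, x) | x <- iota 0 m] [::] un; rewrite size_map size_iota => /(_ erefl erefl).
    have mi u : (u \in [seq (i, x) | x <- iota 0 m]) = (u.1 == i) && (u.2 < m).
      apply/mapP/andP => [[x + ->]|[/eqP ui um]]; first by rewrite mem_iota eqxx.
      by exists u.2; rewrite ?mem_iota //; case: u ui {um} => ? ? /= ->.
    apply: dec_ext => -[a x] [b y]; rewrite /holed cats0 !mi /F /= andbT xpair_eqE.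
    case: eqP => //= ->; case: eqP => [->|_] //=; last by rewrite andbF.
    by rewrite eqxx.
  have disF i j u v : i \in iota 0 k -> j \in iota 0 k -> F i u v -> F j u v -> i = j.
    by move=> _ _ /and5P[/eqP <- _ _ _ _] /and5P[/eqP <-].
  apply: dec_ext (decU md (dec_big (iota_uniq 0 k) dF disF) _); last first.
    by move=> u v /and5P[_ _ _ _ ne] /hasP[i _ /and5P[/eqP ui /eqP vi _ _ _]]; move: ne; rewrite ui vi eqxx.
  move=> [a x] [b y]; rewrite /holed !mem_cat !mem_pairs !mem_hole !mem_iota /parts size_nseq !nth_nseq.
  rewrite /= xpair_eqE !ltnS /w.
  have -> : has (fun i => F i (a, x) (b, y)) (iota 0 k) = [&& a < k, a == b, x < m, y < m & x != y].
    apply/hasP/and5P => [[i + /and5P[/= /eqP-> /eqP-> -> -> ->]]|[ak /eqP<- xm ym xy]].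
      by rewrite mem_iota eqxx.
    by exists a; rewrite ?mem_iota // /F /= !eqxx xm ym.
  case: (ltngtP a k) => ak; case: (ltngtP b k) => bk; rewrite ?andbF //=;
    case: (ltnP x m) => xm; case: (ltnP y m) => ym; rewrite ?andbF ?andbT ?orbF //=;
    rewrite ?negb_and; case: (eqVneq a b) => //= ab; case: (eqVneq x y) => //= xy;
    by move: ak bk ab; clear; lia.
have un := @uniq_hole k w m (iota 0 k) (iota_uniq _ _) _.
have /un{}un : all (fun p => p < k) (iota 0 k) by apply/allP => p; rewrite mem_iota.
have := HDI un key; rewrite size_pairs size_map size_iota map_const_nseq size_iota sumn_nseq.
by rewrite mulnC.
Qed.

(** * The recursion on the number of points of the master design *)

Section Tower.

Variables (W wl h : nat).
Hypothesis mdW : forall c, 2 <= c <= 4 -> MD g (rcons (nseq c W) W).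
Hypothesis mdl : forall c, 2 <= c <= 4 -> MD g (rcons (nseq c W) wl).

(** All points have weight [W], except that the last one may have weight [wl]; [h] hole points are
    added. Both halves are carried along: the first fills ordinary groups, the second the group of
    an exceptional last point. *)
Definition level (T : nat) : Prop := HD g (W * T) h /\ KD g (W * T.-1 + wl + h).

(** Blocks have three to five points, and the last point of the design can only stand at the end,
    where [mdl] puts the part of size [wl]. *)
Definition last_ok (T : nat) (b : seq nat) : bool :=
  (2 <= (size b).-1 <= 4) && all (fun p => p < T.-1) (take (size b).-1 b).

Lemma map_last T b v : last_ok T b -> exists c z, 2 <= c <= 4 /\
  [seq (if p == T.-1 then v else W) | p <- b] = rcons (nseq c W) (if z == T.-1 then v else W).
Proof.
case/lastP: b => [|b z] //; rewrite /last_ok size_rcons /= => /andP[c24].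
rewrite -cats1 take_cat ltnn subnn take0 cats0 => /allP lt; exists (size b), z; split=> //.
rewrite map_cat cats1 -(map_const_nseq W b); congr rcons; apply/eq_in_map => p /lt.
by case: eqP => // ->; rewrite ltnn.
Qed.

Lemma sumn_last (s : seq nat) (z v : nat) : uniq s ->
  sumn [seq (if p == z then v else W) | p <- s] =
  if z \in s then W * (size s).-1 + v else W * size s.
Proof.
elim: s => [|p s IH] /=; first by rewrite muln0.
move=> /andP[ps us]; rewrite IH // inE eq_sym.
have [->|pz] := eqVneq z p; last first.
  case zs : (z \in s) => /=; last by rewrite mulnS.
  by rewrite addnA -mulnS prednK //; case: (s) zs.
by rewrite (negbTE ps) addnC.
Qed.

(** Weight [W] everywhere with the hole left open gives the first half of the level; weight [wl] on
    the last point with the hole filled gives the second. *)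
Lemma tower_step T gr bl k : 0 < T -> 0 < k -> master T gr bl -> all (last_ok T) bl ->
  (forall p, p < T -> gr p < k) -> gr T.-1 = k.-1 ->
  (forall i, i < k -> HD g (W * count (fun p => gr p == i) (iota 0 T)) h) ->
  KD g (W * (count (fun p => gr p == k.-1) (iota 0 T)).-1 + wl + h) -> level T.
Proof.
move=> T0 k0 ms /allP lo grk grl hd kd.
have inT (s : seq nat) : {subset s <= iota 0 T} -> all (fun p => p < T) s.
  by move=> sub; apply/allP => p /sub; rewrite mem_iota.
have md v : v = W \/ v = wl -> {in bl, forall b, MD g (map (fun p => if p == T.-1 then v else W) b)}.
  move=> ev b /lo/(map_last v)[c [z [c24 ->]]]; case: ifP => _; last exact: mdW.
  by case: ev => ->; [apply: mdW|apply: mdl].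
have sz v i : size (group_points T gr (fun p => if p == T.-1 then v else W) i) =
    if gr T.-1 == i then W * (count (fun p => gr p == i) (iota 0 T)).-1 + v
    else W * count (fun p => gr p == i) (iota 0 T).
  rewrite size_pairs sumn_last ?filter_uniq ?iota_uniq // mem_filter mem_iota /= size_filter.
  by rewrite prednK // leqnn andbT.
have ug v i := @uniq_hole T (fun p => if p == T.-1 then v else W) h
  [seq p <- iota 0 T | gr p == i] (filter_uniq _ (iota_uniq _ _)) (inT _ (mem_subseq (filter_subseq _ _))).
have ur v := @uniq_hole T (fun p => if p == T.-1 then v else W) h (iota 0 T) (iota_uniq _ _)
  (inT _ (fun _ => id)).
have szh : size (hole_points T h) = h by rewrite size_map size_iota.
have dG v i : i < k.-1 -> dec g (holed (group_points T gr (fun p => if p == T.-1 then v else W) i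
    ++ hole_points T h) (hole_points T h)).
  move=> ik; apply: hd (leq_trans ik (leq_pred _)) _ _ (ug v i) _ szh.
  by rewrite sz grl; case: eqP ik => // ->; rewrite ltnn.
split.
- have lastW : dec g (holed (group_points T gr (fun p => if p == T.-1 then W else W) k.-1
    ++ hole_points T h) (hole_points T h)).
    have klt : k.-1 < k by rewrite prednK.
    apply: hd klt _ _ (ug W k.-1) _ szh; rewrite sz grl eqxx.
    rewrite -{2}[count _ _]prednK; first by rewrite mulnS addnC.
    by rewrite -has_count; apply/hasP; exists T.-1; rewrite ?grl // mem_iota /= prednK.
  have d := fill grk (or_introl erefl) k0 (dec_blocks ms (md W (or_introl erefl))) (dG W) lastW.
  have := HDI (ur W) d; rewrite szh size_pairs sumn_last ?iota_uniq // mem_iota /= prednK // leqnn size_iota.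
  by rewrite -{2}(prednK T0) mulnS addnC.
- have unl := ug wl k.-1.
  have lastl : dec g (holed (group_points T gr (fun p => if p == T.-1 then wl else W) k.-1
    ++ hole_points T h) [::]).
    have := kd (group_points T gr (fun p => if p == T.-1 then wl else W) k.-1 ++ hole_points T h) [::].
    by rewrite cats0 size_cat szh sz grl eqxx => /(_ unl erefl erefl).
  have d := fill grk (or_intror erefl) k0 (dec_blocks ms (md wl (or_intror erefl))) (dG wl) lastl.
  have unr := ur wl; have := @HDI (regular_points T (fun p => if p == T.-1 then wl else W) ++ hole_points T h) [::].
  rewrite cats0 => /(_ unr d); rewrite size_cat szh size_pairs sumn_last ?iota_uniq // mem_iota /=.
  by rewrite prednK // leqnn size_iota.
Qed.

End Tower.

End Decompositions.

(** * Transversal designs *)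

Section Transversal.

Variables (m r : nat).
Hypothesis modd : odd m.
Hypothesis rm : r <= m.

(* The coordinates of the line (x, y): x, y, x + y and x - y modulo m. *)
Definition coord (c x y : nat) : nat :=
  match c with
  | 0 => x
  | 1 => y
  | 2 => if x + y < m then x + y else x + y - m
  | _ => if y <= x then x - y else x + m - y
  end.

(** The fourth group is truncated to [r] points, so a block has three or four points. *)
Definition td_block (x y : nat) : seq nat :=
  [:: x; m + y; 2 * m + coord 2 x y] ++
  (if coord 3 x y < r then [:: 3 * m + coord 3 x y] else [::]).

Definition td_blocks : seq (seq nat) := [seq td_block x y | x <- iota 0 m, y <- iota 0 m].

Let m0 : 0 < m. Proof. by case: m modd. Qed.

Lemma coord_lt c x y : x < m -> y < m -> coord c x y < m.
Proof. by case: c => [|[|[|c]]] /=; do ?case: ifP; lia. Qed.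

Lemma mem_td_block x y p : x < m -> y < m ->
  (p \in td_block x y) = (p < 3 * m + r) && (p %% m == coord (p %/ m) x y).
Proof.
move=> xm ym; have c2 := coord_lt 2 xm ym; have c3 := coord_lt 3 xm ym.
have mE c z : z < m -> (c * m + z) %% m = z by move=> zm; rewrite modnMDl modn_small.
have dE c z : z < m -> (c * m + z) %/ m = c by move=> zm; rewrite divnMDl // divn_small ?addn0.
have inE4 : (p \in td_block x y) = [|| p == x, p == 1 * m + y, p == 2 * m + coord 2 x y |
    (coord 3 x y < r) && (p == 3 * m + coord 3 x y)].
  by rewrite /td_block mem_cat !inE mul1n -!orbA; case: ifP => _; rewrite ?inE.
rewrite inE4; apply/idP/andP => [/or4P[/eqP->|/eqP->|/eqP->|/andP[lt /eqP->]]|[lt /eqP eqc]].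
- by rewrite modn_small // divn_small //; split=> //; move: xm; clear; lia.
- by rewrite mE // dE //; split=> //; move: ym; clear; lia.
- by rewrite mE // dE //; split=> //; move: c2; clear; lia.
- by rewrite mE // dE //; split=> //; move: lt; clear; lia.
have pE := divn_eq p m; rewrite eqc in pE.
have q4 : p %/ m < 4 by rewrite ltn_divLR //; move: lt rm; clear; lia.
case: (p %/ m) q4 pE eqc => [|[|[|[|]]]] // _ pE eqc.
- by rewrite {1}pE mul0n add0n eqxx.
- by rewrite {2}pE eqxx orbT.
- by rewrite {3}pE eqxx !orbT.
- have lt3 : coord 3 x y < r by move: lt; rewrite pE; clear; lia.
  by rewrite lt3 {4}pE eqxx !orbT.
Qed.

(** Any two coordinates determine the line; for sum and difference this uses that 2 is invertible
    modulo the odd [m]. *)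
Lemma coord_inj c d x y x' y' : c < 4 -> d < 4 -> c != d ->
  x < m -> y < m -> x' < m -> y' < m ->
  coord c x y = coord c x' y' -> coord d x y = coord d x' y' -> (x, y) = (x', y').
Proof.
move=> c4 d4 cd xm ym xm' ym'.
have [k mk] : exists k, m = k.*2.+1 by exists m./2; rewrite -[LHS]odd_double_half modd.
suff h : coord c x y = coord c x' y' -> coord d x y = coord d x' y' -> x = x' /\ y = y'.
  by move=> e1 e2; have [-> ->] := h e1 e2.
case: c c4 cd => [|[|[|[|]]]] // _; case: d d4 => [|[|[|[|]]]] // _ _ /=; do ?case: ifP;
  by move: mk xm ym xm' ym'; rewrite -mul2n; clear; lia.
Qed.

(** By [coord_inj] a pair of coordinates is an injective self-map of a finite set, hence
    bijective. *)
Lemma coord_surj c d a b : c < 4 -> d < 4 -> c != d -> a < m -> b < m ->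
  exists x y, [/\ x < m, y < m, coord c x y = a & coord d x y = b].
Proof.
move=> c4 d4 cd am bm.
pose f (p : 'I_m * 'I_m) : 'I_m * 'I_m :=
  (Ordinal (coord_lt c (ltn_ord p.1) (ltn_ord p.2)), Ordinal (coord_lt d (ltn_ord p.1) (ltn_ord p.2))).
have finj : injective f.
  move=> [x y] [x' y'] [e1 e2].
  have [] := coord_inj c4 d4 cd (ltn_ord x) (ltn_ord y) (ltn_ord x') (ltn_ord y') e1 e2.
  by move=> /val_inj -> /val_inj ->.
have [h _ fh] := injF_bij finj.
have := fh (Ordinal am, Ordinal bm); case: (h _) => x y [e1 e2].
by exists x, y; rewrite !ltn_ord.
Qed.

Lemma td_blocksP b : b \in td_blocks -> exists x y, [/\ x < m, y < m & b = td_block x y].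
Proof. by move=> /allpairsP[[x y] /=]; rewrite !mem_iota => -[xm ym ->]; exists x, y. Qed.

Lemma td_master : master (3 * m + r) (fun p => p %/ m) td_blocks.
Proof.
have q4 p : p < 3 * m + r -> p %/ m < 4 by move=> lt; rewrite ltn_divLR //; move: lt rm; clear; lia.
have blk_inj x y x' y' : x < m -> y < m -> x' < m -> y' < m ->
    td_block x y = td_block x' y' -> (x, y) = (x', y').
  by move=> _ _ _ _ [-> /addnI ->].
split.
- apply: allpairs_uniq; rewrite ?iota_uniq // => -[x y] [x' y'] /allpairsP[[? ?] [/= + + [-> ->]]].
  rewrite !mem_iota /= => xm ym /allpairsP[[? ?] [/= + + [-> ->]]].
  by rewrite !mem_iota /= => xm' ym'; apply: blk_inj.
- move=> b /td_blocksP[x [y [xm ym ->]]]; split; last first.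
    by apply/allP => p; rewrite mem_td_block // => /andP[].
  have c2 := coord_lt 2 xm ym; rewrite /td_block; case: ifP => _ /=; rewrite !inE;
    by move: xm ym c2 => /=; clear; lia.
- move=> b p q /td_blocksP[x [y [xm ym ->]]]; rewrite !mem_td_block // => /andP[_ /eqP ep] /andP[_ /eqP eq].
  apply: contra => /eqP e1; rewrite (divn_eq p m) (divn_eq q m) ep eq e1 //.
- move=> p q pT qT ne.
  have [x [y [xm ym e1 e2]]] := coord_surj (q4 _ pT) (q4 _ qT) ne (ltn_pmod p m0) (ltn_pmod q m0).
  exists (td_block x y); first by apply/allpairsP; exists (x, y); rewrite !mem_iota.
  by rewrite !mem_td_block // pT qT e1 e2 !eqxx.
- move=> b b' p q /td_blocksP[x [y [xm ym ->]]] /td_blocksP[x' [y' [xm' ym' ->]]] pq.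
  rewrite !mem_td_block // => /andP[pT /eqP e1] /andP[qT /eqP e2] /andP[_ /eqP e3] /andP[_ /eqP e4].
  have ne : p %/ m != q %/ m.
    by apply: contra pq => /eqP e5; rewrite (divn_eq p m) (divn_eq q m) e1 e2 e5.
  have [] := coord_inj (q4 _ pT) (q4 _ qT) ne xm ym xm' ym' (etrans (Logic.eq_sym e1) e3)
    (etrans (Logic.eq_sym e2) e4).
  by move=> -> ->.
Qed.

Lemma td_last_ok : all (last_ok (3 * m + r)) td_blocks.
Proof.
apply/allP => b /td_blocksP[x [y [xm ym ->]]]; have c2 := coord_lt 2 xm ym.
rewrite /last_ok /td_block; case: ifP => lt /=; rewrite ?take0;
  by move: xm ym c2 lt => /=; clear; lia.
Qed.

Lemma count_td i : count (fun p => p %/ m == i) (iota 0 (3 * m + r)) =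
  if i < 3 then m else if i == 3 then r else 0.
Proof.
have blk a n c : n <= m -> count (fun p => p %/ m == c) (iota (a * m) n) = if a == c then n else 0.
  move=> nm; rewrite (@eq_in_count _ _ (fun=> a == c)); last first.
    move=> p; rewrite mem_iota => /andP[ge lt]; congr (_ == c).
    rewrite -(subnKC ge) divnMDl // divn_small ?addn0 //.
    by move: lt nm ge; clear; lia.
  case: (a == c); last by rewrite count_pred0.
  by rewrite count_predT size_iota.
have := blk 0 m i (leqnn m); have := blk 1 m i (leqnn m); have := blk 2 m i (leqnn m).
have := blk 3 r i rm; rewrite mul0n mul1n (_ : 3 * m + r = m + (m + (m + r))); last by clear; lia.
rewrite !iotaD !count_cat add0n (_ : m + m = 2 * m); last by clear; lia.
rewrite (_ : 2 * m + m = 3 * m); last by clear; lia.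
by move=> -> -> -> ->; case: i => [|[|[|[|i]]]] /=; rewrite ?addn0.
Qed.

End Transversal.

(** Small master designs. [gdd6], [gdd8], [gdd10], [gdd14] and [gdd14_4] have groups of size 2,
    [td12] and [gdd15] groups of size 3; [fano] and [plane13] are the projective planes of orders 2
    and 3. *)
Definition gdd6 : seq (seq nat) := [:: [:: 0; 2; 4]; [:: 0; 3; 5]; [:: 1; 2; 5]; [:: 1; 3; 4]].

Definition gdd8 : seq (seq nat) :=
  [:: [:: 0; 2; 4]; [:: 0; 3; 7]; [:: 0; 5; 6]; [:: 1; 2; 6]; [:: 1; 3; 5]; [:: 1; 4; 7];
    [:: 2; 5; 7]; [:: 3; 4; 6]].

Definition fano : seq (seq nat) :=
  [:: [:: 0; 1; 6]; [:: 0; 2; 3]; [:: 0; 4; 5]; [:: 1; 2; 4]; [:: 1; 3; 5]; [:: 2; 5; 6];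
    [:: 3; 4; 6]].

Definition gdd14 : seq (seq nat) :=
  [:: [:: 0; 2; 4]; [:: 0; 3; 11]; [:: 0; 5; 6]; [:: 0; 7; 9]; [:: 0; 8; 12]; [:: 0; 10; 13];
    [:: 1; 2; 11]; [:: 1; 3; 12]; [:: 1; 4; 9]; [:: 1; 5; 13]; [:: 1; 6; 10]; [:: 1; 7; 8];
    [:: 2; 5; 9]; [:: 2; 6; 12]; [:: 2; 7; 10]; [:: 2; 8; 13]; [:: 3; 4; 7]; [:: 3; 5; 10];
    [:: 3; 6; 8]; [:: 3; 9; 13]; [:: 4; 6; 13]; [:: 4; 8; 10]; [:: 4; 11; 12]; [:: 5; 7; 12];
    [:: 5; 8; 11]; [:: 6; 9; 11]; [:: 7; 11; 13]; [:: 9; 10; 12]].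

Definition plane13 : seq (seq nat) :=
  [:: [:: 0; 1; 3; 9]; [:: 0; 2; 8; 12]; [:: 0; 4; 5; 7]; [:: 0; 6; 10; 11]; [:: 1; 2; 4; 10];
    [:: 1; 5; 6; 8]; [:: 1; 7; 11; 12]; [:: 2; 3; 5; 11]; [:: 2; 6; 7; 9]; [:: 3; 4; 6; 12];
    [:: 3; 7; 8; 10]; [:: 4; 8; 9; 11]; [:: 5; 9; 10; 12]].

Definition gdd10 : seq (seq nat) :=
  [:: [:: 0; 2; 4; 6; 8]; [:: 0; 3; 5]; [:: 0; 7; 9]; [:: 1; 2; 7]; [:: 1; 3; 8]; [:: 1; 4; 9];
    [:: 1; 5; 6]; [:: 2; 5; 9]; [:: 3; 4; 7]; [:: 3; 6; 9]; [:: 5; 7; 8]].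

Definition td12 : seq (seq nat) :=
  [:: [:: 0; 3; 6; 11]; [:: 0; 4; 7; 10]; [:: 0; 5; 8; 9]; [:: 1; 3; 7; 9]; [:: 1; 4; 8; 11];
    [:: 1; 5; 6; 10]; [:: 2; 3; 8; 10]; [:: 2; 4; 6; 9]; [:: 2; 5; 7; 11]].

Definition gdd15 : seq (seq nat) :=
  [:: [:: 0; 3; 10; 14]; [:: 0; 4; 8; 9]; [:: 0; 5; 7; 13]; [:: 0; 6; 11; 12]; [:: 1; 3; 7; 11];
    [:: 1; 4; 6; 14]; [:: 1; 5; 9; 12]; [:: 1; 8; 10; 13]; [:: 2; 3; 8; 12]; [:: 2; 4; 11; 13];
    [:: 2; 5; 6; 10]; [:: 2; 7; 9; 14]; [:: 3; 6; 9; 13]; [:: 4; 7; 10; 12]; [:: 5; 8; 11; 14]].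

Definition gdd14_4 : seq (seq nat) :=
  [:: [:: 0; 2; 8; 12]; [:: 0; 3; 5; 11]; [:: 0; 4; 7; 9]; [:: 0; 6; 10; 13]; [:: 1; 2; 4; 10];
    [:: 1; 3; 9; 13]; [:: 1; 5; 6; 8]; [:: 1; 7; 11; 12]; [:: 2; 5; 7; 13]; [:: 2; 6; 9; 11];
    [:: 3; 4; 6; 12]; [:: 3; 7; 8; 10]; [:: 4; 8; 11; 13]; [:: 5; 9; 10; 12]].

Section Levels.

Variables (g : graph) (W wl h : nat).
Hypothesis wg : wf g.
Hypothesis size22 : size g = 22.
Hypothesis deg3 : forall u, u < 22 -> size (nb g u) = 3.
Hypothesis mdW : forall c, 2 <= c <= 4 -> MD g (rcons (nseq c W) W).
Hypothesis mdl : forall c, 2 <= c <= 4 -> MD g (rcons (nseq c W) wl).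
Hypothesis level1 : level g W wl h 1.
Hypothesis level2 : level g W wl h 2.

Lemma level_td m r : odd m -> r <= m -> level g W wl h m -> (0 < r -> level g W wl h r) ->
  level g W wl h (3 * m + r).
Proof.
move=> mo rm [hdm kdm] lr; have m0 : 0 < m by case: m mo {rm hdm kdm}.
(* With an empty fourth group the last point lies in the third. *)
pose k := if r == 0 then 3 else 4.
have T0 : 0 < 3 * m + r by move: m0; clear; lia.
apply: (tower_step wg size22 deg3 mdW mdl T0 (k := k) _ (td_master mo rm) (td_last_ok mo rm)).
- by rewrite /k; case: ifP.
- move=> p pT; rewrite ltn_divLR // /k; case: eqP => r0; move: pT rm r0; clear; lia.
- rewrite /k; case: eqP => r0.
    rewrite r0 addn0 (_ : (3 * m).-1 = 2 * m + m.-1) ?divnMDl ?divn_small ?addn0 //.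
      by rewrite prednK.
    by move: m0; clear; lia.
  rewrite (_ : (3 * m + r).-1 = 3 * m + r.-1) ?divnMDl ?divn_small ?addn0 //.
    by move: r0 rm; clear; lia.
  by move: r0; clear; lia.
- move=> i ik; rewrite count_td //; case: ifP => // i3.
  have [r0|r0] := posnP r; first by move: ik i3; rewrite /k r0 /= => ->.
  have [hdr _] := lr r0; move: ik; rewrite /k; case: eqP r0 => [->//|_ r0] ik.
  by have -> : i == 3 by move: ik i3; clear; lia.
- rewrite count_td // /k; case: eqP => r0 /=; first by [].
  by case: lr => //; move: r0; clear; lia.
Qed.

Definition gdd_levels : bool :=
  [&& masterb 5 id [:: iota 0 5], masterb 6 (fun p => p %/ 2) gdd6, masterb 7 id fano,
      masterb 8 (fun p => p %/ 2) gdd8, masterb 13 id plane13 & masterb 14 (fun p => p %/ 2) gdd14] &&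
  [&& all (last_ok 5) [:: iota 0 5], all (last_ok 6) gdd6, all (last_ok 7) fano,
      all (last_ok 8) gdd8, all (last_ok 13) plane13 & all (last_ok 14) gdd14].

Lemma gdd_levels_ok : gdd_levels. Proof. by vm_compute. Qed.

Lemma level_id T bl : 0 < T -> masterb T id bl -> all (last_ok T) bl -> level g W wl h T.
Proof.
move=> T0 /masterP ms lo; have [hd1 kd1] := level1.
have ct i : i < T -> count (fun p => p == i) (iota 0 T) = 1.
  by move=> iT; rewrite -/(count_mem i _) count_uniq_mem ?iota_uniq // mem_iota iT.
apply: (tower_step wg size22 deg3 mdW mdl T0 T0 ms lo) => // [i iT|]; rewrite ct //.
by rewrite prednK.
Qed.

Lemma level_pairs k bl : 0 < k -> masterb (2 * k) (fun p => p %/ 2) bl -> all (last_ok (2 * k)) bl ->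
  level g W wl h (2 * k).
Proof.
move=> k0 /masterP ms lo; have [hd2 kd2] := level2; have [hd1 kd1] := level1.
have T0 : 0 < 2 * k by rewrite muln_gt0.
have ct i : i < k -> count (fun p => p %/ 2 == i) (iota 0 (2 * k)) = 2.
  move=> ik; rewrite -size_filter (_ : [seq p <- _ | _] = [:: 2 * i; (2 * i).+1]) //.
  apply: (irr_sorted_eq ltn_trans ltnn); first by apply: sorted_filter (iota_ltn_sorted _ _); apply: ltn_trans.
    by rewrite /= ltnSn.
  by move=> p; rewrite mem_filter mem_iota !inE; move: ik; clear; lia.
apply: (tower_step wg size22 deg3 mdW mdl T0 k0 ms lo).
- by move=> p pT; rewrite ltn_divLR // mulnC.
- by move: k0; clear; lia.
- by move=> i ik; rewrite ct.
- by rewrite ct // prednK.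
Qed.

(** [3 * m + r] with [m] odd and [r <= m] takes every positive value except 1, 2, 5, 6, 7, 8, 13 and
    14. The first two are the base cases, the others have their own master designs. *)
Lemma levels T : 0 < T -> level g W wl h T.
Proof.
have /andP[/and5P[m5 m6 m7 m8 /andP[m13 m14]] /and5P[l5 l6 l7 l8 /andP[l13 l14]]] := gdd_levels_ok.
elim/ltn_ind: T => T IH T0.
have td m r : odd m -> r <= m -> T = 3 * m + r -> level g W wl h T.
  move=> mo rm eqT; have m0 : 0 < m by case: m mo {rm eqT}.
  rewrite eqT; apply: (level_td mo rm) => [|r0]; apply: IH.
  - by rewrite eqT; move: m0; clear; lia.
  - exact: m0.
  - by rewrite eqT; move: m0 rm; clear; lia.
  - exact: r0.
have [T15|T15] := leqP 15 T.
  have [m [r [mo rm eqT]]] : exists m r, [/\ odd m, r <= m & T = 3 * m + r].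
    have [o|o] := boolP (odd (T %/ 3)).
      exists (T %/ 3), (T %% 3); split=> //; last by rewrite mulnC -divn_eq.
      by move: T15; clear; lia.
    exists (T %/ 3).-1, (T %% 3 + 3); split; last by move: T15; clear; lia.
      by move: o T15; case E : (T %/ 3) => [|q] /=; [clear -E; lia|rewrite negbK].
    by move: o T15; clear; lia.
  exact: td eqT.
move: T0 T15 td; clear IH.
case: T => [|[|[|[|[|[|[|[|[|[|[|[|[|[|[|T]]]]]]]]]]]]]]] T0 T15 td.
- by move: T0.
- exact: level1.
- exact: level2.
- exact: (td 1 0).
- exact: (td 1 1).
- exact: level_id m5 l5.
- exact: (@level_pairs 3 _ isT m6 l6).
- exact: level_id m7 l7.
- exact: (@level_pairs 4 _ isT m8 l8).
- exact: (td 3 0).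
- exact: (td 3 1).
- exact: (td 3 2).
- exact: (td 3 3).
- exact: level_id m13 l13.
- exact: (@level_pairs 7 _ isT m14 l14).
- by move: T15.
Qed.

End Levels.

(** * Cyclic decompositions *)

(* A cyclic group acts on points [(j, x)] by rotating each orbit [j]; the entry
   [(m, c)] of [orb] stands for an orbit of length [m] whose points fall into
   [c] parts, according to their residue modulo [c]. *)
Section Cyclic.

Variables (orb : seq (nat * nat)) (N : nat).

Definition len (j : nat) : nat := (nth (1, 1) orb j).1.
Definition res (j : nat) : nat := (nth (1, 1) orb j).2.

Definition shift (t : nat) (u : point) : point := (u.1, (u.2 + t) %% len u.1).

Definition offset (j : nat) : nat := sumn (take j [seq o.2 | o <- orb]).

(** The residue classes of all orbits are numbered consecutively and become the parts of
    [part_sizes]. *)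
Definition canon (u : point) : point := (offset u.1 + u.2 %% res u.1, u.2 %/ res u.1).

Definition part_sizes : seq nat := flatten [seq nseq o.2 (o.1 %/ o.2) | o <- orb].

Definition valid (u : point) : bool := (u.1 < size orb) && (u.2 < len u.1).

(** The invariant of an ordered pair under rotation: between orbits of different lengths the
    difference makes sense only modulo the gcd of the lengths. *)
Definition key (x : point * point) : nat * nat * nat :=
  let d := gcdn (len x.1.1) (len x.2.1) in
  (x.1.1, x.2.1, (x.2.2 + (d - x.1.2 %% d)) %% d).

Definition pair_count (s : seq nat) : nat :=
  sumn [seq sumn [seq (if i == j then 0 else nth 0 s i * nth 0 s j) | j <- iota 0 (size s)]
       | i <- iota 0 (size s)].

(** The lcm condition gives every edge exactly [N] images; an orbit forming a single part contains
    no edge and is exempt. The last condition matches the number of ordered pairs with that of [k]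
    developed base blocks. *)
Definition shape_ok (k : nat) : bool :=
  [&& all (fun o => [&& 0 < o.1, 0 < o.2 & o.2 %| o.1]) orb,
      all (fun i => all (fun j => ((i == j) && (res i == 1)) || (lcmn (len i) (len j) == N))
        (iota 0 (size orb))) (iota 0 (size orb)) &
      pair_count part_sizes == N * (k * 66)].

Definition key_le (a b : nat * nat * nat) : bool :=
  if a.1.1 == b.1.1 then if a.1.2 == b.1.2 then a.2 <= b.2 else a.1.2 < b.1.2 else a.1.1 < b.1.1.

Definition key_lt (a b : nat * nat * nat) : bool :=
  if a.1.1 == b.1.1 then if a.1.2 == b.1.2 then a.2 < b.2 else a.1.2 < b.1.2 else a.1.1 < b.1.1.

(** Strict increase after sorting is a cheap test that all keys are distinct. *)
Definition cyclic_ok (g : graph) (k : nat) (bs : seq (seq point)) : bool :=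
  [&& size bs == k, all (fun b => is_block b && all valid b) bs,
      all (fun x => (x.1.1 != x.2.1) || (x.1.2 %% res x.1.1 != x.2.2 %% res x.2.1)) (traces g bs) &
      sorted key_lt (sort key_le (map key (traces g bs)))].

Lemma key_lt_trans : transitive key_lt.
Proof. by move=> [[a b] c] [[d e] f] [[x y] z]; rewrite /key_lt /=; do ?case: eqP; lia. Qed.

Lemma sorted_keys s : sorted key_lt (sort key_le s) -> uniq s.
Proof.
rewrite -(sort_uniq key_le); apply: sorted_uniq; first exact: key_lt_trans.
by move=> [[a b] c]; rewrite /key_lt /= !eqxx ltnn.
Qed.

Lemma offsetS j : j < size orb -> offset j.+1 = offset j + res j.
Proof.
move=> jo; rewrite /offset (take_nth 0) ?size_map // sumn_rcons; congr addn.
by rewrite (nth_map (1, 1)).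
Qed.

Lemma offset_le i j : i <= j -> j <= size orb -> offset i <= offset j.
Proof.
elim: j => [|j IH]; first by rewrite leqn0 => /eqP->.
rewrite leq_eqVlt => /predU1P[->//|ij jo]; rewrite offsetS //.
by apply: leq_trans (IH ij (ltnW jo)) (leq_addr _ _).
Qed.

Lemma offset_inj i j r r' : i < size orb -> j < size orb -> r < res i -> r' < res j ->
  offset i + r = offset j + r' -> i = j.
Proof.
have lt a b x y : a < b -> b < size orb -> x < res a -> offset a + x < offset b + y.
  move=> ab bo xr; have ao : a < size orb := ltn_trans ab bo.
  have := offset_le ab (ltnW bo); rewrite offsetS //.
  by move: xr; clear; lia.
move=> io jo ri rj eq; case: (ltngtP i j) => // [ij|ji].
  by have := lt i j r r' ij jo ri; rewrite eq ltnn.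
by have := lt j i r' r ji io rj; rewrite eq ltnn.
Qed.

Lemma size_shape : size part_sizes = offset (size orb).
Proof.
rewrite /offset -(size_map snd orb) take_size size_flatten /part_sizes /seq.shape -map_comp.
by congr sumn; apply: eq_map => o /=; rewrite size_nseq.
Qed.

Lemma nth_shape j r : j < size orb -> r < res j ->
  offset j + r < size part_sizes /\ nth 0 part_sizes (offset j + r) = len j %/ res j.
Proof.
move=> jo rj; split.
  rewrite size_shape; have := offset_le jo (leqnn _); rewrite offsetS //.
  by move: rj; clear; lia.
rewrite /part_sizes -(cat_take_drop j orb) map_cat flatten_cat nth_cat.
have -> : size (flatten [seq nseq o.2 (o.1 %/ o.2) | o <- take j orb]) = offset j.
  rewrite size_flatten /seq.shape -map_comp /offset -map_take.
  by congr sumn; apply: eq_map => o /=; rewrite size_nseq.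
rewrite ltnNge leq_addr /= addKn (drop_nth (1, 1) jo) /= nth_cat size_nseq rj nth_nseq rj //.
Qed.

Lemma mem_pair_list s u v : parts s u v -> (u, v) \in
  flatten [seq flatten [seq (if i == j then [::] else
    [seq ((i, x), (j, y)) | x <- iota 0 (nth 0 s i), y <- iota 0 (nth 0 s j)])
    | j <- iota 0 (size s)] | i <- iota 0 (size s)].
Proof.
case: u v => [i x] [j y] /and5P[/= im xm jm ym ij].
apply/flatten_mapP; exists i; first by rewrite mem_iota.
apply/flatten_mapP; exists j; first by rewrite mem_iota.
by rewrite (negbTE ij); apply/allpairsP; exists (x, y); rewrite !mem_iota.
Qed.

Lemma size_pair_list s : size (flatten [seq flatten [seq (if i == j then [::] else
    [seq ((i, x), (j, y)) | x <- iota 0 (nth 0 s i), y <- iota 0 (nth 0 s j)])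
    | j <- iota 0 (size s)] | i <- iota 0 (size s)]) = pair_count s.
Proof.
rewrite size_flatten /seq.shape -map_comp; congr sumn; apply: eq_map => i /=.
rewrite size_flatten /seq.shape -map_comp; congr sumn; apply: eq_map => j /=.
by case: eqP => // _; rewrite size_allpairs !size_iota.
Qed.

Variables (g : graph) (k : nat) (bs : seq (seq point)).
Hypothesis wg : wf g.
Hypothesis size22 : size g = 22.
Hypothesis deg3 : forall u, u < 22 -> size (nb g u) = 3.
Hypothesis orb_ok : shape_ok k.
Hypothesis bs_ok : cyclic_ok g k bs.

Let orbP j : j < size orb -> [/\ 0 < len j, 0 < res j & res j %| len j].
Proof.
by move=> jo; have /and3P[/allP al _ _] := orb_ok; have /and3P[] := al _ (mem_nth (1, 1) jo).
Qed.

Let lcmP i j : i < size orb -> j < size orb -> ~~ ((i == j) && (res i == 1)) ->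
  lcmn (len i) (len j) = N.
Proof.
move=> io jo ne; have /and3P[_ /allP al _] := orb_ok.
have := al i (mem_iota0 io) => /allP/(_ j (mem_iota0 jo)).
by rewrite (negbTE ne) => /eqP.
Qed.

Lemma canon_inj : {in valid &, injective canon}.
Proof.
move=> [i x] [j y] /andP[/= io xi] /andP[/= jo yj] [e1 e2].
have [_ ri _] := orbP io; have [_ rj _] := orbP jo.
have eij := offset_inj io jo (ltn_pmod x ri) (ltn_pmod y rj) e1; move: e1 e2; rewrite eij => /addnI e1 e2.
by rewrite (divn_eq x (res j)) (divn_eq y (res j)) e1 e2.
Qed.

Lemma valid_shift t u : valid u -> valid (shift t u).
Proof.
by move=> /andP[uo _]; rewrite /valid /= uo ltn_pmod //; have [] := orbP uo.
Qed.

Let blocksP b : b \in bs -> is_block b && all valid b.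
Proof. by have /and4P[_ /allP al _ _] := bs_ok; apply: al. Qed.

Lemma trace_valid x : x \in traces g bs -> valid x.1 && valid x.2.
Proof.
move=> /flatten_mapP[b bb /mapP[y yh ->]] /=.
have /andP[/andP[/eqP sb _] /allP va] := blocksP bb.
have [l1 l2] := half_edges_lt wg size22 yh.
by rewrite !va ?mem_nth ?sb.
Qed.

Lemma key_uniq : uniq (map key (traces g bs)).
Proof. by have /and4P[_ _ _ /sorted_keys] := bs_ok. Qed.

Lemma key_shift u v u' v' t t' : 0 < len u.1 -> shift t u = shift t' u' -> shift t v = shift t' v' ->
  key (u, v) = key (u', v').
Proof.
case: u v u' v' => [i x] [j y] [i' x'] [j' y'] /= l0 [<- e1] [<- e2].
rewrite /key /=; set d := gcdn _ _; congr (_, _, _).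
have m1 : (x + t == x' + t' %[mod d]).
  apply/eqP; rewrite -(modn_dvdm (x + t) (dvdn_gcdl (len i) (len j))) e1.
  by rewrite modn_dvdm // dvdn_gcdl.
have m2 : (y + t == y' + t' %[mod d]).
  apply/eqP; rewrite -(modn_dvdm (y + t) (dvdn_gcdr (len i) (len j))) e2.
  by rewrite modn_dvdm // dvdn_gcdr.
have d0 : 0 < d by rewrite gcdn_gt0 l0.
have cancel z : (d - z %% d) + z = 0 %[mod d].
  have lt := ltn_pmod z d0; rewrite {2}(divn_eq z d) addnCA modnMDl subnK ?modnn ?mod0n //; exact: ltnW.
(* Adding a common summand makes the truncated differences cancel modulo [d]. *)
apply/eqP; rewrite -(eqn_modDr (x + x' + t + t')).
have -> : y + (d - x %% d) + (x + x' + t + t') = (y + t) + (x' + t') + ((d - x %% d) + x).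
  by clear; lia.
have -> : y' + (d - x' %% d) + (x + x' + t + t') = (y' + t') + (x + t) + ((d - x' %% d) + x').
  by clear; lia.
rewrite -modnDmr cancel modnDmr addn0 -[X in _ == X]modnDmr cancel modnDmr addn0.
by rewrite -modnDm (eqP m2) -(eqP m1) modnDm.
Qed.

(** The difference of the shifts is divisible by both orbit lengths, hence by their lcm [N]. *)
Lemma shift_once u v t t' : valid u -> valid v -> ~~ ((u.1 == v.1) && (res u.1 == 1)) ->
  t < N -> t' < N -> shift t u = shift t' u -> shift t v = shift t' v -> t = t'.
Proof.
move=> /andP[uo _] /andP[vo _] ne tN tN' [/eqP e1] [/eqP e2].
rewrite eqn_modDl in e1; rewrite eqn_modDl in e2.
have lc := lcmP uo vo ne.
wlog le : t t' tN tN' e1 e2 / t <= t'.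
  move=> h; case: (leqP t t') => [|/ltnW] le; first exact: h.
  by apply/Logic.eq_sym; apply: h => //; rewrite eq_sym.
have : N %| t' - t by rewrite -lc dvdn_lcm -!eqn_mod_dvd // eq_sym e1 eq_sym e2.
move=> dv; apply/eqP; rewrite eqn_leq le /= -subn_eq0; apply/eqP.
have : t' - t < N by apply: leq_ltn_trans tN'; apply: leq_subr.
by case: (posnP (t' - t)) => // p0 lt; have := dvdn_leq p0 dv; rewrite leqNgt lt.
Qed.

Definition developed : seq (seq point) :=
  flatten [seq [seq map (canon \o shift t) b | b <- bs] | t <- iota 0 N].

Lemma traces_developed : traces g developed =
  [seq (canon (shift t x.1), canon (shift t x.2)) | t <- iota 0 N, x <- traces g bs].
Proof.
have bl : all is_block bs by apply/allP => b /blocksP/andP[].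
rewrite /developed; elim: (iota 0 N) => //= t s IH; rewrite traces_cat IH; congr (_ ++ _).
exact: (traces_map wg size22 (canon \o shift t) bl).
Qed.

Lemma classes_differ x t : x \in traces g bs -> (canon (shift t x.1)).1 != (canon (shift t x.2)).1.
Proof.
move=> xt; have /andP[/andP[uo _] /andP[vo _]] := trace_valid xt.
have /and4P[_ _ /allP/(_ x xt) + _] := bs_ok.
have [lu ru du] := orbP uo; have [lv rv dv] := orbP vo.
case: x uo vo lu ru du lv rv dv {xt} => -[i x] [j y] /= io jo li ri di lj rj dj ne.
apply/eqP => eq; have eij := offset_inj io jo (ltn_pmod _ ri) (ltn_pmod _ rj) eq.
move: ne eq; rewrite eij eqxx /= => ne /addnI; rewrite !modn_dvdm // => /eqP.
by rewrite eqn_modDr (negbTE ne).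
Qed.

(** The developed pairs are distinct by [key_shift] and [shift_once], and they join different parts;
    by the count in [shape_ok] they are then all such pairs. *)
Theorem MD_cyclic : MD g part_sizes.
Proof.
have /and4P[/eqP sb _ _ _] := bs_ok; have /and3P[_ _ /eqP cnt] := orb_ok.
have un : uniq (traces g developed).
  rewrite traces_developed; apply: allpairs_uniq; first exact: iota_uniq.
    by have := key_uniq; apply: map_uniq.
  move=> [? [? ?]] [? [? ?]] /allpairsP[[t [u v]] [/= + xt [-> -> ->]]].
  rewrite mem_iota /= add0n => tN /allpairsP[[t' [u' v']] [/= + xt' [-> -> ->]]].
  rewrite mem_iota /= add0n => tN' eqp.
  have e1 : canon (shift t u) = canon (shift t' u') := congr1 fst eqp.
  have e2 : canon (shift t v) = canon (shift t' v') := congr1 snd eqp.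
  have /andP[vu vv] := trace_valid xt; have /andP[vu' vv'] := trace_valid xt'.
  have s1 := canon_inj (valid_shift t vu) (valid_shift t' vu') e1.
  have s2 := canon_inj (valid_shift t vv) (valid_shift t' vv') e2.
  have lu : 0 < len u.1 by case/andP: vu => /orbP[].
  have eqx : (u, v) = (u', v') := uniq_map_inj key_uniq xt xt' (key_shift lu s1 s2).
  have [eu ev] : u = u' /\ v = v' by case: eqx.
  rewrite -{}eu -{}ev in s1 s2 *; congr (_, _).
  apply: (shift_once vu vv _ tN tN' s1 s2).
  apply/negP => /andP[/eqP e3 /eqP l1]; have := classes_differ 0 xt.
  by rewrite /canon /= -e3 l1 !modn1 eqxx.
have sub u v : (u, v) \in traces g developed -> parts part_sizes u v.
  rewrite traces_developed => /allpairsP[[t x] [/= _ xt [-> ->]]].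
  have /andP[v1 v2] := trace_valid xt; have ne := classes_differ t xt.
  have in_ w : valid w -> (canon (shift t w)).1 < size part_sizes /\
      (canon (shift t w)).2 < nth 0 part_sizes (canon (shift t w)).1.
    move=> vw; have /andP[wo wl] := valid_shift t vw; have [l0 r0 dr] := orbP wo.
    have [lt ->] := nth_shape wo (ltn_pmod (shift t w).2 r0); split=> //.
    by rewrite ltn_divLR // divnK.
  by have [a b] := in_ _ v1; have [c d] := in_ _ v2; rewrite /parts a b c d ne.
exists developed; split=> //.
  apply/allP => b /flatten_mapP[t _ /mapP[b0 b0s ->]].
  have /andP[/andP[/eqP s22 ub] /allP va] := blocksP b0s.
  rewrite /is_block size_map s22 eqxx /=.
  have ush : uniq (map (shift t) b0).
    rewrite map_inj_in_uniq // => -[i x] [j y] /va/andP[/= io xi] /va/andP[/= jo yj] [eij /eqP].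
    by rewrite eij in xi *; rewrite eqn_modDr !modn_small // => /eqP ->.
  rewrite map_comp map_inj_in_uniq // => x y /mapP[x0 /va vx ->] /mapP[y0 /va vy ->].
  by apply: canon_inj; apply: valid_shift.
move=> u v; apply/idP/idP; first exact: sub.
move=> /mem_pair_list; set rl := flatten _ => uvr.
have szt : size (traces g developed) = N * (k * 66).
  rewrite traces_developed size_allpairs size_iota; congr muln.
  rewrite /traces size_flatten /seq.shape -map_comp -sb.
  have sz b : size (trace g b) = 66 by rewrite size_map size_half_edges.
  by elim: (bs) => [|b s IH] //; rewrite map_cons [sumn _]/= IH /= sz mulSn.
have sub' : {subset traces g developed <= rl} by move=> [a b] /sub /mem_pair_list.
have le : size rl <= size (traces g developed) by rewrite szt size_pair_list cnt.
by have [_ ->] := uniq_min_size un sub' le.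
Qed.

End Cyclic.

(** * Base blocks *)

(* The points of the orbits are numbered consecutively. *)
Fixpoint locate (orb : seq (nat * nat)) (j p : nat) : point :=
  if orb is o :: orb' then if p < o.1 then (j, p) else locate orb' j.+1 (p - o.1) else (j, p).

Definition locate_blocks (orb : seq (nat * nat)) (d : seq (seq (seq nat))) : seq (seq (seq point)) :=
  [seq [seq [seq locate orb 0 p | p <- b] | b <- bs] | bs <- d].

(* Multiplication of both coordinates by the squares modulo 11. *)
Definition multiples (d : seq (seq (seq point))) : seq (seq (seq point)) :=
  [seq flatten [seq [seq [seq (a * u.1 %% 11, a * u.2 %% 11) | u <- b] | a <- [:: 1; 3; 4; 5; 9]]
               | b <- bs] | bs <- d].

Definition data_ok (orb : seq (nat * nat)) (N k : nat) (d : seq (seq (seq point))) : bool :=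
  shape_ok orb N k && all2 (fun g bs => cyclic_ok orb g k bs) snarks d.

(** Three orbits of length 7 and a fixed point. An entry with equal components makes every point a
    part of its own, which yields a complete graph. *)
Definition orb_k22 : seq (nat * nat) :=
  [:: (7, 7); (7, 7); (7, 7); (1, 1)].

Definition base_k22 : seq (seq (seq point)) := Eval vm_compute in
  let raw := [::
    [:: [:: 2; 10; 13; 15; 4; 14; 11; 9; 7; 19; 18; 16; 12; 20; 0; 17; 5; 21; 3; 1; 8; 6]];
        [:: [:: 12; 6;
    21; 17; 0; 18; 4; 14; 13; 15; 11; 8; 1; 7; 20; 16; 9; 3; 5; 2; 10; 19]];
        [:: [:: 5; 21; 19; 15; 17; 9;
    14; 18; 0; 12; 20; 4; 10; 7; 16; 2; 1; 8; 13; 11; 3; 6]];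
        [:: [:: 2; 8; 6; 13; 11; 1; 0; 15; 4; 3; 17;
    10; 16; 14; 5; 19; 18; 20; 12; 21; 7; 9]]; [:: [:: 11; 4; 14; 13; 1; 21; 20; 19; 10; 3; 7; 12; 2; 9;
    17; 5; 18; 15; 16; 8; 6; 0]];
        [:: [:: 5; 11; 8; 13; 20; 18; 7; 6; 1; 10; 17; 12; 9; 19; 16; 21; 2; 14;
    3; 15; 4; 0]];
        [:: [:: 7; 13; 9; 19; 10; 0; 1; 17; 21; 8; 3; 16; 5; 15; 12; 4; 20; 18; 14; 2; 6; 11]];
    [:: [:: 0; 17; 21; 12; 9; 16; 15; 10; 5; 6; 20; 11; 2; 13; 8; 3; 14; 1; 7; 18; 19; 4]];
        [:: [:: 17; 18;
    0; 14; 2; 9; 11; 7; 19; 21; 5; 20; 12; 8; 4; 6; 13; 1; 16; 15; 3; 10]];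
        [:: [:: 8; 19; 18; 11; 1; 0; 2;
    12; 21; 13; 9; 15; 5; 3; 16; 6; 17; 20; 10; 7; 4; 14]]; [:: [:: 5; 20; 10; 21; 8; 18; 2; 12; 14; 11;
    19; 6; 0; 15; 13; 7; 1; 9; 17; 16; 3; 4]];
        [:: [:: 2; 4; 3; 15; 18; 21; 14; 7; 20; 0; 1; 6; 17; 5; 13;
    12; 10; 9; 16; 8; 11; 19]];
        [:: [:: 10; 8; 5; 14; 17; 12; 1; 4; 20; 11; 19; 3; 18; 7; 21; 16; 13; 15;
    0; 6; 9; 2]];
        [:: [:: 6; 9; 10; 7; 20; 14; 1; 13; 21; 8; 11; 2; 16; 3; 4; 18; 5; 15; 19; 0; 12; 17]];
    [:: [:: 4; 10; 18; 20; 1; 3; 19; 7; 11; 13; 16; 14; 2; 21; 8; 5; 9; 6; 15; 12; 0; 17]];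
        [:: [:: 10; 6;
    17; 7; 9; 18; 3; 2; 0; 8; 11; 20; 4; 5; 21; 16; 15; 19; 13; 12; 1; 14]]; [:: [:: 6; 9; 4; 8; 11; 12;
    19; 3; 16; 21; 0; 20; 17; 13; 1; 5; 15; 10; 7; 18; 2; 14]];
        [:: [:: 17; 13; 5; 7; 2; 18; 11; 19; 15; 8;
    0; 6; 9; 20; 4; 21; 12; 16; 3; 1; 14; 10]];
        [:: [:: 8; 2; 4; 6; 14; 12; 19; 5; 3; 15; 1; 20; 16; 0; 13;
    11; 21; 17; 9; 18; 7; 10]];
        [:: [:: 7; 3; 15; 19; 20; 1; 2; 14; 4; 0; 9; 17; 10; 13; 6; 18; 16; 11; 12;
    21; 8; 5]]] in
  locate_blocks orb_k22 raw.

Lemma base_k22_ok : data_ok orb_k22 7 1 base_k22.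
Proof. by vm_cast_no_check (erefl true). Qed.

Definition orb_k34 : seq (nat * nat) :=
  [:: (17, 17); (17, 17)].

Definition base_k34 : seq (seq (seq point)) := Eval vm_compute in
  let raw := [::
    [:: [:: 26; 17; 10; 1; 21; 2; 3; 29; 5; 27; 14; 22; 25; 33; 0; 23; 11; 28; 15; 30; 16; 7]];
        [:: [:: 2;
    33; 11; 15; 19; 0; 6; 1; 26; 27; 30; 24; 25; 12; 31; 7; 18; 5; 9; 10; 22; 32]];
        [:: [:: 5; 6; 15; 13;
    0; 18; 26; 12; 33; 31; 30; 1; 23; 21; 8; 9; 22; 24; 11; 28; 4; 20]];
        [:: [:: 10; 22; 30; 3; 25; 0; 7;
    16; 4; 29; 8; 33; 21; 15; 32; 12; 13; 27; 31; 19; 24; 9]];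
        [:: [:: 1; 24; 27; 14; 8; 5; 30; 6; 12; 28;
    11; 2; 3; 25; 19; 31; 26; 15; 0; 29; 32; 33]];
        [:: [:: 32; 24; 13; 14; 0; 31; 23; 2; 30; 6; 3; 7; 17;
    15; 28; 18; 9; 20; 16; 11; 22; 25]];
        [:: [:: 11; 7; 8; 19; 22; 16; 13; 15; 14; 26; 4; 12; 29; 25; 28;
    24; 31; 6; 5; 32; 18; 23]];
        [:: [:: 0; 4; 19; 15; 24; 18; 31; 13; 6; 10; 16; 33; 1; 5; 9; 23; 28; 29;
    22; 27; 7; 25]];
        [:: [:: 21; 29; 22; 19; 4; 15; 6; 33; 26; 7; 12; 0; 11; 27; 31; 5; 9; 20; 18; 24; 8;
    1]]; [:: [:: 22; 28; 26; 32; 5; 12; 2; 9; 13; 7; 23; 27; 11; 29; 8; 18; 25; 14; 30; 15; 4; 17]]; [::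
    [:: 27; 12; 0; 6; 4; 25; 14; 24; 29; 2; 15; 33; 16; 22; 13; 21; 10; 26; 9; 17; 23; 28]]; [:: [:: 28;
    27; 33; 31; 17; 2; 25; 18; 13; 9; 23; 7; 1; 8; 5; 21; 19; 11; 0; 26; 15; 6]];
        [:: [:: 20; 14; 31; 24;
    15; 29; 2; 4; 32; 8; 3; 0; 19; 13; 22; 21; 27; 10; 18; 1; 23; 7]];
        [:: [:: 0; 25; 23; 2; 31; 15; 16; 8;
    6; 28; 32; 13; 27; 4; 3; 7; 19; 18; 29; 21; 26; 5]];
        [:: [:: 18; 10; 1; 8; 3; 30; 27; 19; 31; 12; 5; 9;
    14; 33; 0; 4; 21; 29; 23; 28; 25; 7]];
        [:: [:: 11; 4; 16; 19; 10; 24; 1; 17; 9; 15; 13; 32; 2; 14; 26;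
    27; 23; 28; 30; 18; 6; 29]]; [:: [:: 12; 17; 19; 28; 3; 15; 2; 27; 33; 26; 16; 31; 21; 5; 0; 11; 14;
    13; 20; 18; 10; 23]];
        [:: [:: 10; 24; 32; 8; 27; 14; 17; 0; 16; 19; 31; 18; 1; 2; 22; 4; 3; 25; 11; 7;
    29; 26]];
        [:: [:: 6; 23; 18; 0; 33; 26; 7; 3; 5; 2; 21; 20; 1; 4; 10; 28; 27; 19; 29; 14; 17; 9]]; [::
    [:: 29; 33; 21; 22; 4; 8; 18; 11; 27; 20; 32; 5; 28; 24; 13; 1; 15; 26; 9; 3; 12; 7]]] in
  locate_blocks orb_k34 raw.

Lemma base_k34_ok : data_ok orb_k34 17 1 base_k34.
Proof. by vm_cast_no_check (erefl true). Qed.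

Definition orb_k55 : seq (nat * nat) :=
  [:: (9, 9); (9, 9); (9, 9); (9, 9); (9, 9); (9, 9); (1, 1)].

Definition base_k55 : seq (seq (seq point)) := Eval vm_compute in
  let raw := [::
    [:: [:: 4; 13; 41; 50; 23; 30; 2; 21; 8; 45; 37; 33; 44; 42; 19; 31; 12; 49; 11; 32; 17; 16];
        [:: 25;
    11; 53; 48; 51; 36; 18; 23; 31; 4; 30; 54; 21; 47; 43; 26; 27; 7; 41; 24; 44; 19];
        [:: 45; 18; 10; 43;
    26; 15; 54; 36; 29; 46; 0; 7; 51; 11; 38; 4; 6; 52; 39; 31; 30; 2];
        [:: 51; 45; 43; 14; 35; 27; 39; 31;
    34; 41; 18; 4; 7; 10; 5; 9; 2; 25; 48; 16; 50; 30];
        [:: 11; 7; 1; 33; 23; 6; 41; 21; 22; 12; 30; 9; 24;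
    47; 52; 3; 39; 17; 43; 29; 10; 53]];
        [:: [:: 6; 19; 3; 8; 34; 35; 23; 48; 4; 0; 14; 46; 5; 37; 51; 49;
    54; 15; 50; 27; 17; 43];
        [:: 44; 7; 50; 1; 36; 30; 26; 49; 22; 41; 21; 48; 24; 39; 51; 2; 5; 33; 3; 12;
    31; 27];
        [:: 54; 40; 21; 53; 13; 31; 24; 37; 22; 4; 49; 41; 44; 8; 5; 11; 46; 3; 12; 19; 34; 18]; [::
    44; 47; 15; 23; 16; 31; 39; 18; 14; 28; 34; 19; 37; 4; 30; 24; 51; 35; 9; 53; 13; 43];
        [:: 43; 31; 17;
    26; 14; 29; 25; 2; 51; 13; 11; 46; 15; 9; 8; 18; 34; 50; 40; 38; 35; 41]];
        [:: [:: 8; 14; 54; 44; 28;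
    34; 23; 32; 5; 21; 19; 22; 12; 10; 49; 11; 6; 51; 46; 53; 29; 20];
        [:: 39; 53; 10; 38; 52; 49; 27; 35;
    44; 4; 54; 31; 28; 42; 18; 36; 11; 7; 23; 51; 13; 14]; [:: 38; 43; 40; 33; 16; 45; 15; 0; 1; 28; 42;
    13; 17; 39; 25; 21; 30; 50; 51; 24; 48; 22];
        [:: 39; 31; 2; 21; 4; 48; 8; 51; 22; 14; 28; 38; 16; 50;
    24; 3; 53; 5; 29; 7; 19; 40];
        [:: 11; 23; 10; 39; 27; 20; 1; 40; 47; 46; 12; 34; 43; 15; 6; 31; 8; 5;
    21; 28; 38; 3]]; [:: [:: 19; 24; 33; 13; 44; 35; 1; 2; 14; 47; 20; 32; 50; 25; 26; 37; 6; 46; 10; 5;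
    22; 39]; [:: 46; 1; 53; 34; 4; 20; 25; 40; 47; 35; 17; 9; 6; 32; 12; 14; 33; 41; 38; 37; 7; 16]; [::
    40; 52; 31; 47; 10; 3; 16; 35; 25; 0; 29; 30; 37; 43; 9; 45; 1; 54; 19; 44; 46; 21];
        [:: 21; 3; 16; 20;
    31; 30; 38; 46; 33; 36; 23; 28; 32; 4; 42; 19; 52; 54; 11; 51; 14; 2]; [:: 30; 48; 1; 0; 19; 28; 49;
    39; 8; 52; 40; 7; 10; 53; 44; 22; 21; 47; 15; 12; 38; 9]];
        [:: [:: 47; 34; 12; 25; 17; 42; 5; 45; 14;
    41; 43; 30; 37; 6; 22; 13; 31; 15; 46; 23; 0; 51];
        [:: 6; 22; 15; 40; 44; 34; 0; 54; 2; 38; 11; 29; 12;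
    45; 43; 1; 48; 30; 13; 52; 21; 51];
        [:: 11; 16; 18; 34; 19; 43; 17; 3; 25; 21; 54; 7; 48; 51; 42; 5; 2;
    4; 27; 31; 29; 41]; [:: 19; 35; 25; 5; 42; 52; 27; 18; 22; 8; 17; 49; 40; 36; 46; 11; 33; 7; 50; 26;
    13; 32];
        [:: 38; 53; 21; 49; 48; 51; 25; 31; 41; 1; 6; 34; 36; 12; 15; 35; 20; 44; 26; 4; 11; 32]]; [::
    [:: 19; 42; 29; 2; 8; 12; 54; 4; 18; 11; 43; 50; 5; 6; 28; 52; 41; 24; 9; 36; 51; 13];
        [:: 42; 0; 48;
    20; 46; 30; 10; 27; 45; 39; 44; 23; 54; 49; 38; 53; 52; 24; 17; 9; 33; 29];
        [:: 50; 23; 34; 47; 9; 25;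
    27; 41; 12; 44; 36; 26; 18; 43; 52; 38; 31; 0; 17; 16; 7; 15];
        [:: 36; 12; 45; 6; 49; 8; 41; 5; 35; 50;
    31; 18; 48; 24; 33; 21; 0; 7; 27; 28; 14; 9];
        [:: 8; 30; 34; 21; 53; 44; 11; 33; 29; 1; 14; 6; 23; 42;
    2; 4; 18; 47; 25; 26; 36; 16]];
        [:: [:: 28; 25; 40; 2; 18; 35; 47; 22; 46; 4; 39; 10; 0; 20; 27; 23; 9;
    45; 3; 16; 53; 32]; [:: 16; 31; 33; 10; 37; 46; 18; 24; 3; 29; 8; 49; 35; 7; 43; 27; 41; 40; 39; 44;
    32; 11];
        [:: 54; 7; 30; 44; 47; 10; 27; 40; 49; 46; 50; 23; 0; 45; 3; 12; 11; 43; 22; 42; 37; 20]; [::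
    6; 21; 35; 38; 7; 32; 3; 49; 43; 12; 29; 46; 19; 28; 15; 8; 10; 45; 25; 33; 4; 41];
        [:: 7; 12; 17; 24;
    1; 16; 8; 48; 20; 25; 34; 9; 41; 43; 11; 50; 19; 51; 14; 54; 21; 49]];
        [:: [:: 31; 28; 2; 52; 40; 22;
    45; 23; 17; 8; 43; 30; 25; 27; 34; 15; 18; 21; 29; 36; 42; 38];
        [:: 37; 21; 31; 46; 45; 4; 18; 9; 51;
    19; 39; 47; 27; 7; 42; 11; 10; 16; 43; 8; 50; 35];
        [:: 0; 32; 12; 3; 14; 11; 23; 45; 1; 54; 6; 30; 7;
    43; 16; 20; 38; 13; 8; 25; 26; 50];
        [:: 5; 50; 9; 46; 35; 51; 12; 40; 32; 7; 2; 34; 13; 41; 47; 45; 6;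
    26; 49; 15; 19; 36];
        [:: 27; 53; 5; 20; 22; 47; 51; 24; 31; 32; 54; 8; 13; 41; 7; 37; 21; 36; 16; 35;
    9; 40]];
        [:: [:: 34; 51; 38; 46; 44; 54; 16; 5; 37; 43; 52; 11; 45; 8; 50; 6; 23; 4; 14; 40; 49; 20];
    [:: 24; 31; 29; 12; 0; 41; 8; 44; 37; 42; 25; 51; 14; 4; 7; 21; 19; 40; 30; 17; 28; 18];
        [:: 3; 22; 12;
    48; 36; 14; 41; 31; 16; 50; 44; 46; 33; 27; 18; 1; 9; 35; 51; 38; 8; 52];
        [:: 14; 19; 42; 50; 30; 41;
    25; 26; 47; 18; 22; 37; 2; 31; 17; 5; 24; 10; 34; 28; 11; 13];
        [:: 25; 47; 53; 49; 33; 52; 11; 28; 5;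
    1; 42; 54; 12; 17; 34; 2; 24; 26; 0; 30; 6; 35]];
        [:: [:: 12; 24; 11; 22; 35; 43; 52; 17; 42; 37; 36;
    31; 8; 19; 14; 51; 7; 45; 39; 34; 5; 26];
        [:: 43; 51; 34; 47; 42; 14; 26; 39; 16; 36; 49; 10; 13; 24;
    28; 48; 7; 27; 18; 22; 21; 35];
        [:: 43; 54; 41; 7; 50; 10; 1; 34; 28; 3; 2; 44; 16; 18; 39; 46; 23; 22;
    45; 12; 5; 52];
        [:: 6; 20; 9; 39; 2; 43; 0; 28; 4; 15; 1; 29; 3; 11; 26; 50; 34; 49; 24; 54; 33; 31];
    [:: 37; 42; 21; 33; 12; 25; 53; 14; 1; 36; 35; 45; 51; 49; 48; 18; 10; 15; 0; 27; 34; 2]];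
        [:: [:: 4;
    2; 31; 48; 54; 35; 53; 13; 27; 0; 34; 16; 19; 28; 51; 42; 6; 36; 18; 20; 50; 1];
        [:: 39; 48; 4; 33; 19;
    2; 46; 26; 51; 16; 11; 29; 10; 24; 17; 20; 40; 3; 25; 35; 23; 38];
        [:: 37; 14; 40; 48; 12; 30; 21; 32;
    47; 42; 3; 15; 4; 26; 52; 46; 19; 9; 33; 50; 18; 5];
        [:: 36; 15; 31; 12; 40; 48; 28; 17; 50; 39; 44; 1;
    37; 41; 53; 5; 24; 9; 38; 20; 10; 27];
        [:: 6; 5; 43; 9; 30; 52; 53; 54; 13; 23; 35; 10; 34; 33; 3; 40;
    26; 42; 8; 20; 2; 47]];
        [:: [:: 3; 52; 0; 20; 40; 26; 51; 38; 22; 54; 50; 43; 4; 23; 1; 48; 29; 27; 2;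
    15; 44; 45]; [:: 49; 52; 35; 16; 2; 41; 14; 29; 39; 40; 31; 32; 26; 20; 38; 24; 0; 7; 37; 34; 1; 9];
    [:: 14; 21; 10; 15; 45; 5; 7; 40; 20; 47; 49; 9; 3; 41; 16; 32; 4; 2; 44; 31; 22; 48];
        [:: 4; 32; 17;
    54; 41; 25; 48; 19; 16; 34; 33; 22; 10; 14; 6; 35; 38; 45; 28; 49; 30; 24];
        [:: 48; 50; 39; 19; 30; 49;
    22; 12; 18; 43; 52; 25; 2; 4; 10; 15; 37; 28; 41; 13; 35; 11]]; [:: [:: 8; 37; 13; 18; 1; 24; 2; 45;
    36; 9; 48; 0; 41; 11; 28; 27; 43; 52; 40; 17; 7; 34]; [:: 13; 19; 26; 7; 31; 46; 14; 37; 44; 42; 21;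
    34; 12; 30; 11; 40; 4; 39; 20; 8; 15; 22];
        [:: 50; 17; 51; 33; 14; 12; 49; 46; 19; 24; 54; 29; 23; 52;
    30; 20; 39; 53; 1; 41; 44; 25];
        [:: 5; 30; 29; 33; 8; 31; 27; 41; 10; 28; 45; 16; 47; 20; 9; 44; 0; 46;
    24; 40; 14; 32];
        [:: 50; 34; 54; 21; 4; 7; 35; 2; 46; 0; 20; 17; 45; 22; 38; 6; 19; 36; 3; 9; 47; 52]];
    [:: [:: 51; 37; 9; 23; 3; 17; 39; 31; 4; 29; 33; 36; 2; 12; 28; 38; 6; 13; 49; 19; 41; 5];
        [:: 2; 51;
    22; 7; 41; 19; 16; 36; 43; 5; 53; 50; 33; 42; 30; 44; 27; 39; 45; 32; 6; 20];
        [:: 35; 22; 25; 14; 13;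
    23; 18; 20; 45; 34; 38; 24; 15; 47; 51; 10; 26; 11; 16; 49; 7; 4]; [:: 14; 46; 42; 32; 2; 17; 11; 7;
    51; 4; 20; 18; 47; 9; 12; 27; 45; 6; 10; 54; 5; 21];
        [:: 34; 15; 54; 35; 0; 39; 52; 43; 40; 50; 41; 26;
    22; 27; 33; 28; 23; 42; 49; 2; 48; 31]];
        [:: [:: 39; 17; 19; 16; 50; 28; 13; 24; 21; 52; 10; 4; 9; 18;
    45; 51; 36; 33; 47; 0; 14; 29];
        [:: 1; 11; 29; 23; 32; 37; 5; 33; 41; 2; 14; 48; 3; 7; 39; 6; 28; 18;
    36; 9; 35; 27]; [:: 49; 1; 34; 45; 33; 21; 11; 48; 19; 24; 44; 54; 8; 41; 46; 29; 13; 7; 52; 40; 37;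
    20]; [:: 52; 13; 42; 53; 48; 38; 50; 7; 2; 47; 43; 31; 37; 54; 28; 20; 15; 25; 21; 3; 6; 4]; [:: 44;
    42; 16; 43; 28; 18; 24; 14; 33; 26; 25; 2; 40; 11; 15; 30; 46; 21; 10; 53; 32; 3]];
        [:: [:: 49; 33; 36;
    1; 44; 38; 25; 4; 28; 10; 41; 47; 30; 7; 13; 15; 14; 12; 20; 23; 3; 31];
        [:: 8; 24; 51; 50; 0; 11; 5;
    21; 47; 19; 22; 29; 17; 2; 15; 23; 49; 9; 20; 30; 39; 37];
        [:: 3; 26; 29; 5; 54; 35; 37; 30; 4; 28; 42;
    11; 45; 23; 53; 24; 40; 51; 52; 15; 38; 32];
        [:: 5; 41; 46; 49; 6; 40; 36; 28; 24; 12; 16; 11; 9; 51;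
    50; 8; 44; 32; 7; 39; 54; 35];
        [:: 21; 53; 2; 43; 44; 25; 32; 22; 4; 34; 6; 23; 29; 46; 37; 51; 17; 47;
    18; 15; 33; 14]]; [:: [:: 0; 5; 10; 24; 40; 17; 33; 23; 3; 39; 18; 48; 1; 9; 11; 43; 21; 32; 16; 45;
    35; 8];
        [:: 52; 36; 32; 1; 43; 42; 11; 38; 24; 20; 3; 4; 54; 31; 47; 37; 48; 53; 34; 29; 51; 21]; [::
    21; 18; 45; 54; 10; 38; 4; 0; 49; 15; 22; 39; 2; 26; 42; 31; 32; 40; 28; 17; 46; 33];
        [:: 48; 9; 2; 23;
    33; 46; 20; 0; 6; 24; 31; 3; 51; 44; 14; 29; 8; 10; 11; 37; 38; 52]; [:: 53; 27; 18; 32; 25; 39; 17;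
    34; 24; 13; 28; 11; 15; 51; 52; 8; 16; 45; 42; 0; 41; 23]];
        [:: [:: 19; 2; 39; 45; 0; 51; 41; 14; 30;
    16; 33; 23; 8; 5; 47; 29; 20; 25; 54; 38; 46; 26];
        [:: 11; 25; 29; 7; 52; 41; 27; 28; 33; 9; 39; 5; 17;
    32; 38; 37; 15; 14; 36; 26; 42; 51];
        [:: 30; 43; 16; 23; 0; 19; 14; 44; 21; 40; 18; 5; 54; 11; 35; 45;
    47; 25; 10; 36; 15; 53]; [:: 14; 13; 24; 0; 46; 4; 32; 8; 19; 48; 50; 22; 11; 40; 2; 20; 30; 29; 39;
    28; 10; 49]; [:: 8; 28; 5; 31; 3; 1; 36; 6; 39; 34; 24; 38; 16; 45; 4; 10; 19; 53; 51; 46; 49; 30]];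
    [:: [:: 19; 7; 3; 49; 18; 32; 12; 5; 31; 45; 36; 8; 22; 16; 29; 10; 41; 50; 21; 26; 0; 25];
        [:: 26; 20;
    13; 35; 5; 22; 7; 19; 41; 46; 16; 44; 14; 27; 12; 11; 34; 43; 29; 51; 37; 31];
        [:: 0; 3; 53; 28; 8; 40;
    39; 31; 51; 27; 43; 54; 52; 23; 48; 19; 12; 4; 47; 22; 30; 49];
        [:: 23; 52; 37; 45; 16; 19; 47; 9; 8;
    10; 39; 31; 2; 41; 48; 24; 32; 7; 17; 0; 36; 49];
        [:: 3; 27; 36; 15; 0; 40; 34; 28; 42; 24; 43; 52; 46;
    16; 2; 26; 44; 54; 14; 10; 12; 35]];
        [:: [:: 46; 19; 33; 50; 45; 35; 40; 38; 26; 9; 48; 14; 6; 18; 28;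
    32; 17; 0; 36; 7; 34; 22];
        [:: 7; 10; 17; 16; 52; 35; 23; 24; 18; 28; 36; 20; 49; 46; 45; 13; 44; 4; 2;
    5; 40; 39]; [:: 1; 16; 15; 8; 11; 30; 23; 19; 32; 0; 35; 45; 10; 5; 39; 44; 28; 31; 38; 42; 34; 49];
    [:: 9; 18; 47; 48; 21; 0; 5; 11; 42; 37; 19; 25; 40; 27; 1; 54; 23; 20; 14; 46; 17; 34];
        [:: 49; 12; 6;
    47; 36; 13; 3; 32; 48; 22; 38; 53; 44; 15; 50; 24; 1; 54; 2; 40; 30; 33]]] in
  locate_blocks orb_k55 raw.

Lemma base_k55_ok : data_ok orb_k55 9 5 base_k55.
Proof. by vm_cast_no_check (erefl true). Qed.

Definition orb_k67 : seq (nat * nat) :=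
  [:: (67, 67)].

Definition base_k67 : seq (seq (seq point)) := Eval vm_compute in
  let raw := [::
    [:: [:: 29; 24; 8; 16; 14; 32; 26; 61; 56; 55; 58; 57; 6; 53; 21; 59; 28; 2; 10; 4; 43; 62]];
        [:: [::
    44; 65; 14; 30; 4; 64; 25; 57; 3; 38; 20; 47; 61; 35; 23; 12; 19; 66; 9; 41; 21; 37]];
        [:: [:: 65; 34;
    51; 25; 53; 26; 42; 64; 0; 4; 49; 10; 8; 59; 61; 19; 50; 20; 16; 27; 66; 5]];
        [:: [:: 57; 17; 64; 19;
    53; 50; 51; 60; 35; 40; 38; 43; 24; 1; 32; 8; 63; 5; 52; 45; 47; 2]]; [:: [:: 45; 6; 66; 36; 48; 16;
    22; 54; 47; 21; 35; 31; 3; 40; 7; 61; 4; 65; 41; 11; 63; 14]]; [:: [:: 35; 44; 52; 43; 20; 2; 3; 55;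
    65; 42; 14; 8; 60; 37; 10; 34; 45; 0; 56; 15; 5; 36]];
        [:: [:: 59; 65; 10; 26; 6; 19; 5; 61; 2; 7; 51;
    3; 57; 15; 62; 42; 1; 4; 27; 39; 54; 43]];
        [:: [:: 48; 50; 27; 31; 62; 45; 65; 41; 1; 13; 26; 61; 58;
    17; 2; 64; 32; 7; 57; 8; 10; 42]];
        [:: [:: 43; 0; 34; 22; 55; 31; 41; 48; 6; 42; 60; 26; 59; 9; 65; 23;
    20; 49; 3; 10; 7; 13]];
        [:: [:: 66; 58; 46; 22; 32; 9; 21; 47; 26; 59; 56; 48; 54; 49; 40; 24; 50; 3;
    53; 27; 34; 39]];
        [:: [:: 4; 45; 62; 27; 44; 40; 26; 50; 64; 65; 23; 48; 1; 34; 31; 20; 55; 41; 15; 28;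
    13; 39]];
        [:: [:: 53; 46; 58; 2; 26; 3; 49; 13; 16; 43; 32; 29; 7; 5; 24; 12; 34; 41; 6; 56; 27; 52]];
    [:: [:: 18; 30; 60; 47; 44; 53; 57; 10; 49; 32; 24; 23; 51; 46; 12; 40; 6; 22; 3; 48; 35; 13]];
        [:: [::
    62; 14; 30; 2; 37; 39; 47; 60; 35; 49; 46; 61; 52; 45; 32; 33; 38; 0; 16; 44; 6; 26]];
        [:: [:: 38; 64;
    41; 15; 10; 59; 8; 39; 42; 61; 16; 49; 43; 18; 13; 25; 19; 5; 17; 24; 9; 7]];
        [:: [:: 46; 53; 60; 20;
    52; 7; 36; 32; 10; 54; 47; 15; 30; 9; 45; 0; 24; 19; 48; 13; 17; 1]];
        [:: [:: 61; 19; 62; 27; 56; 12;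
    24; 49; 8; 58; 44; 4; 55; 16; 18; 35; 31; 5; 34; 26; 40; 14]];
        [:: [:: 25; 7; 0; 27; 28; 47; 23; 1; 13;
    61; 12; 20; 56; 2; 64; 55; 5; 16; 42; 36; 49; 66]];
        [:: [:: 43; 12; 25; 52; 26; 40; 38; 10; 2; 53; 48;
    7; 42; 29; 63; 5; 22; 61; 8; 3; 0; 45]]; [:: [:: 20; 59; 17; 43; 44; 49; 48; 52; 21; 41; 51; 14; 62;
    25; 1; 56; 36; 33; 4; 39; 65; 32]]] in
  locate_blocks orb_k67 raw.

Lemma base_k67_ok : data_ok orb_k67 67 1 base_k67.
Proof. by vm_cast_no_check (erefl true). Qed.

(** The points are the pairs modulo 11; four listed blocks and five multipliers give the twenty base
    blocks of each snark. *)
Definition orb_k121 : seq (nat * nat) :=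
  [:: (11, 11); (11, 11); (11, 11); (11, 11); (11, 11); (11, 11); (11, 11); (11, 11); (11, 11); (11, 11);
  (11, 11)].

Definition base_k121 : seq (seq (seq point)) := Eval vm_compute in
  let raw := [::
    [:: [:: 11; 92; 118; 73; 79; 91; 100; 24; 104; 31; 27; 3; 88; 36; 48; 2; 81; 109; 42; 33; 83; 94]; [::
    21; 98; 36; 116; 104; 114; 68; 62; 106; 2; 6; 71; 74; 15; 43; 33; 49; 70; 65; 19; 109; 110];
        [:: 3; 16;
    114; 96; 82; 31; 46; 50; 0; 44; 37; 57; 79; 68; 95; 2; 94; 107; 30; 29; 35; 113];
        [:: 119; 88; 79; 83;
    108; 5; 55; 56; 69; 99; 49; 52; 106; 30; 114; 51; 43; 105; 20; 66; 76; 40]];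
        [:: [:: 33; 27; 82; 3; 28;
    2; 114; 95; 101; 97; 25; 29; 69; 51; 106; 22; 62; 42; 107; 44; 36; 39];
        [:: 108; 111; 78; 88; 103; 14;
    116; 5; 67; 110; 8; 25; 56; 70; 39; 57; 43; 104; 49; 102; 10; 89];
        [:: 116; 1; 22; 105; 72; 61; 92; 16;
    88; 111; 37; 26; 33; 41; 36; 7; 56; 117; 107; 42; 5; 30];
        [:: 72; 85; 115; 92; 14; 73; 47; 57; 53; 95;
    94; 117; 16; 23; 70; 83; 93; 45; 54; 48; 56; 109]];
        [:: [:: 106; 11; 52; 89; 33; 86; 72; 48; 88; 113;
    69; 103; 80; 5; 96; 10; 29; 31; 20; 13; 41; 120];
        [:: 64; 81; 118; 40; 38; 16; 54; 105; 49; 101; 2; 39;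
    93; 19; 47; 57; 76; 26; 78; 23; 53; 80];
        [:: 14; 66; 91; 63; 4; 49; 102; 73; 5; 17; 50; 92; 26; 38; 69;
    118; 86; 48; 20; 52; 87; 31];
        [:: 35; 106; 85; 25; 101; 39; 68; 89; 84; 83; 73; 61; 18; 104; 36; 66; 2;
    28; 1; 8; 93; 24]];
        [:: [:: 110; 29; 95; 19; 5; 42; 18; 82; 107; 100; 60; 31; 25; 45; 0; 46; 70; 101;
    28; 62; 1; 38];
        [:: 11; 25; 86; 107; 102; 96; 110; 33; 35; 62; 19; 68; 57; 119; 48; 109; 74; 23; 112;
    106; 20; 116]; [:: 81; 72; 51; 74; 36; 34; 54; 8; 65; 53; 79; 112; 85; 14; 61; 60; 120; 76; 39; 103;
    88; 118];
        [:: 87; 9; 85; 91; 6; 71; 41; 69; 67; 20; 58; 40; 66; 2; 32; 114; 112; 17; 4; 26; 92; 38]];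
    [:: [:: 84; 35; 107; 118; 46; 30; 5; 55; 101; 40; 31; 38; 63; 106; 37; 41; 78; 32; 66; 72; 93; 74]; [::
    63; 7; 100; 109; 70; 106; 24; 40; 53; 93; 98; 26; 85; 21; 72; 45; 55; 4; 12; 42; 92; 35];
        [:: 82; 58;
    11; 94; 19; 16; 56; 4; 43; 98; 74; 31; 110; 29; 92; 1; 49; 75; 72; 25; 79; 99]; [:: 90; 65; 59; 118;
    66; 87; 112; 50; 98; 99; 70; 8; 48; 13; 85; 3; 10; 116; 34; 17; 88; 109]];
        [:: [:: 44; 30; 10; 94; 71;
    21; 17; 12; 40; 88; 64; 31; 33; 43; 89; 7; 119; 69; 107; 118; 34; 55];
        [:: 110; 94; 97; 26; 75; 32; 39;
    111; 56; 68; 63; 34; 38; 41; 116; 108; 66; 44; 93; 1; 43; 115];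
        [:: 84; 5; 49; 57; 10; 75; 106; 68; 95;
    115; 62; 21; 55; 58; 76; 98; 110; 85; 79; 104; 34; 18];
        [:: 21; 2; 46; 113; 18; 51; 79; 31; 49; 69; 81;
    67; 96; 108; 105; 16; 3; 107; 0; 120; 91; 61]];
        [:: [:: 107; 114; 14; 110; 94; 56; 57; 77; 18; 72; 44;
    53; 92; 102; 32; 24; 103; 55; 84; 61; 119; 28]; [:: 118; 84; 52; 95; 64; 115; 68; 53; 43; 57; 46; 5;
    103; 114; 31; 101; 7; 51; 44; 62; 6; 15];
        [:: 110; 1; 115; 118; 36; 69; 63; 93; 7; 57; 89; 71; 24; 61;
    74; 0; 30; 100; 37; 119; 88; 117]; [:: 104; 94; 86; 57; 83; 37; 118; 81; 49; 43; 105; 4; 58; 5; 45;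
    101; 119; 69; 26; 54; 28; 64]];
        [:: [:: 23; 15; 9; 107; 38; 98; 117; 26; 92; 119; 47; 24; 90; 43; 22;
    2; 78; 67; 120; 11; 56; 19];
        [:: 39; 43; 105; 80; 88; 59; 108; 37; 47; 5; 81; 69; 63; 119; 55; 9; 17;
    103; 75; 79; 107; 1];
        [:: 67; 96; 46; 21; 75; 44; 69; 64; 115; 110; 95; 82; 1; 27; 81; 12; 37; 39; 50;
    63; 32; 31];
        [:: 48; 106; 115; 3; 111; 64; 87; 105; 58; 5; 38; 32; 81; 33; 66; 22; 101; 102; 114; 77;
    16; 45]]; [:: [:: 16; 61; 11; 120; 79; 69; 117; 14; 67; 1; 24; 94; 97; 37; 107; 58; 25; 104; 52; 85;
    89; 88];
        [:: 17; 16; 102; 97; 77; 5; 112; 118; 15; 116; 51; 66; 32; 0; 48; 19; 114; 25; 69; 82; 8; 41];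
    [:: 15; 34; 1; 66; 75; 17; 49; 54; 45; 24; 88; 55; 117; 72; 39; 80; 115; 3; 100; 26; 16; 78];
        [:: 41;
    106; 40; 50; 97; 81; 53; 5; 15; 39; 104; 55; 45; 17; 91; 54; 18; 113; 116; 8; 119; 78]]; [:: [:: 74;
    72; 13; 70; 90; 43; 8; 39; 87; 45; 30; 71; 57; 77; 76; 0; 80; 38; 78; 49; 32; 101]; [:: 67; 36; 24;
    106; 64; 47; 110; 51; 101; 77; 17; 82; 84; 46; 31; 94; 89; 22; 33; 98; 9; 2];
        [:: 74; 51; 54; 56; 90;
    68; 91; 105; 67; 110; 50; 22; 88; 38; 107; 66; 27; 43; 102; 9; 7; 92]; [:: 77; 93; 46; 60; 110; 104;
    10; 39; 40; 100; 59; 16; 17; 28; 6; 43; 25; 64; 33; 50; 32; 62]]; [:: [:: 8; 51; 66; 106; 117; 108;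
    114; 92; 22; 98; 85; 107; 60; 113; 73; 111; 32; 119; 100; 44; 46; 2];
        [:: 61; 21; 29; 93; 46; 20; 110;
    42; 39; 26; 31; 54; 106; 107; 66; 10; 43; 62; 78; 119; 113; 98];
        [:: 18; 35; 102; 53; 20; 118; 67; 90;
    13; 48; 110; 5; 16; 38; 68; 8; 31; 98; 28; 91; 116; 25]; [:: 15; 52; 1; 80; 31; 67; 113; 92; 88; 33;
    20; 61; 17; 36; 70; 45; 8; 58; 4; 65; 42; 47]];
        [:: [:: 104; 75; 110; 103; 63; 6; 92; 88; 24; 2; 115;
    56; 89; 119; 17; 38; 47; 12; 67; 0; 30; 43]; [:: 89; 86; 104; 93; 73; 115; 53; 57; 22; 112; 109; 92;
    27; 85; 1; 103; 107; 87; 47; 50; 26; 14]; [:: 44; 103; 102; 96; 27; 91; 50; 3; 104; 65; 43; 90; 115;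
    63; 73; 28; 13; 20; 40; 116; 18; 66];
        [:: 105; 77; 16; 55; 106; 1; 2; 39; 8; 74; 88; 114; 27; 113; 21;
    40; 82; 31; 32; 17; 34; 38]];
        [:: [:: 5; 12; 97; 100; 75; 34; 62; 10; 44; 80; 110; 21; 78; 37; 86; 50;
    7; 40; 102; 22; 116; 87];
        [:: 52; 105; 96; 54; 59; 68; 38; 31; 93; 74; 89; 64; 50; 20; 36; 94; 119; 32;
    14; 30; 8; 87];
        [:: 85; 6; 26; 37; 59; 113; 84; 65; 45; 74; 60; 1; 10; 0; 108; 19; 44; 21; 13; 49; 33;
    30]; [:: 111; 91; 68; 114; 38; 25; 104; 92; 63; 16; 117; 98; 49; 107; 27; 86; 101; 88; 116; 73; 51;
    95]]; [:: [:: 18; 41; 38; 58; 8; 53; 101; 39; 108; 17; 40; 55; 83; 99; 94; 103; 70; 19; 60; 46; 91;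
    30];
        [:: 65; 76; 5; 92; 39; 13; 48; 51; 18; 82; 116; 120; 114; 29; 77; 73; 36; 83; 53; 32; 1; 54]; [::
    42; 76; 83; 95; 106; 1; 86; 15; 118; 17; 39; 72; 100; 82; 25; 14; 60; 84; 112; 2; 49; 31];
        [:: 25; 2;
    107; 45; 1; 112; 98; 58; 31; 83; 114; 119; 36; 74; 82; 116; 72; 19; 23; 62; 111; 9]];
        [:: [:: 105; 78;
    5; 54; 53; 13; 76; 74; 89; 26; 9; 29; 22; 71; 17; 40; 114; 38; 98; 61; 63; 68];
        [:: 117; 91; 113; 75;
    116; 64; 115; 38; 59; 9; 94; 110; 22; 56; 80; 35; 104; 39; 11; 25; 103; 33]; [:: 118; 48; 5; 39; 70;
    13; 99; 29; 119; 51; 24; 40; 25; 44; 35; 114; 31; 61; 56; 50; 106; 111];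
        [:: 109; 8; 73; 3; 20; 61; 28;
    68; 76; 77; 60; 110; 85; 104; 44; 92; 4; 6; 70; 16; 53; 100]];
        [:: [:: 9; 40; 49; 26; 21; 56; 53; 81;
    60; 29; 54; 98; 77; 78; 99; 113; 112; 73; 15; 14; 35; 70]; [:: 118; 22; 91; 12; 94; 28; 17; 83; 102;
    35; 9; 61; 96; 6; 45; 25; 64; 20; 105; 23; 10; 92];
        [:: 38; 2; 57; 74; 100; 81; 68; 0; 22; 69; 41; 12;
    53; 20; 103; 116; 27; 4; 114; 50; 101; 40]; [:: 116; 48; 57; 95; 43; 28; 85; 32; 88; 15; 110; 76; 2;
    35; 23; 19; 117; 37; 104; 84; 93; 53]];
        [:: [:: 95; 34; 63; 61; 117; 24; 106; 14; 113; 96; 94; 100; 89;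
    116; 105; 5; 11; 75; 88; 72; 27; 49];
        [:: 97; 87; 44; 3; 92; 103; 113; 68; 30; 11; 7; 47; 13; 100; 81;
    70; 48; 18; 54; 6; 120; 35];
        [:: 57; 22; 71; 62; 100; 101; 88; 8; 14; 117; 54; 31; 49; 83; 70; 43; 45;
    56; 21; 86; 38; 68];
        [:: 1; 58; 56; 84; 26; 104; 9; 97; 21; 96; 27; 41; 117; 67; 24; 6; 45; 101; 120;
    22; 40; 13]];
        [:: [:: 7; 11; 14; 6; 30; 35; 28; 57; 16; 25; 106; 87; 112; 38; 37; 33; 18; 100; 111; 99;
    76; 47];
        [:: 107; 1; 52; 48; 23; 63; 67; 70; 50; 55; 97; 60; 73; 89; 120; 14; 47; 96; 74; 56; 12; 72];
    [:: 120; 29; 86; 78; 47; 77; 31; 66; 55; 4; 58; 117; 64; 116; 113; 8; 85; 45; 56; 114; 51; 59];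
        [:: 8;
    55; 116; 17; 32; 97; 48; 69; 14; 57; 7; 85; 65; 92; 104; 82; 66; 3; 75; 23; 39; 31]];
        [:: [:: 31; 45;
    104; 2; 74; 59; 79; 26; 75; 39; 113; 60; 4; 9; 16; 69; 81; 67; 109; 8; 90; 41]; [:: 51; 113; 28; 21;
    88; 15; 56; 99; 43; 69; 44; 1; 71; 3; 95; 78; 47; 70; 48; 105; 85; 106];
        [:: 81; 44; 73; 84; 109; 37;
    62; 32; 93; 68; 2; 91; 45; 120; 46; 53; 63; 57; 108; 30; 117; 56];
        [:: 110; 51; 2; 53; 49; 63; 74; 81;
    91; 31; 83; 14; 84; 23; 80; 76; 70; 50; 41; 108; 103; 40]];
        [:: [:: 82; 67; 100; 46; 5; 102; 23; 112;
    90; 87; 49; 44; 116; 51; 62; 34; 101; 117; 80; 75; 57; 71];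
        [:: 49; 97; 19; 46; 4; 60; 43; 70; 8; 101;
    25; 1; 99; 67; 53; 56; 108; 76; 58; 59; 54; 0];
        [:: 16; 96; 29; 99; 4; 83; 52; 26; 40; 6; 93; 43; 114;
    28; 53; 109; 24; 98; 69; 48; 118; 86];
        [:: 80; 120; 108; 69; 46; 63; 42; 93; 53; 111; 20; 60; 110; 11;
    116; 38; 84; 28; 76; 113; 115; 6]]] in
  multiples (locate_blocks orb_k121 raw).

Lemma base_k121_ok : data_ok orb_k121 11 20 base_k121.
Proof. by vm_cast_no_check (erefl true). Qed.

Definition orb_k33_3 : seq (nat * nat) :=
  [:: (99, 3)].

Definition base_k33_3 : seq (seq (seq point)) := Eval vm_compute in
  let raw := [::
    [:: [:: 33; 71; 22; 38; 36; 51; 41; 77; 21; 52; 34; 50; 63; 68; 84; 54; 97; 40; 31; 94; 39; 8]]; [::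
    [:: 30; 82; 5; 38; 83; 14; 76; 16; 28; 42; 37; 90; 9; 81; 87; 26; 47; 43; 11; 4; 33; 24]];
        [:: [:: 23;
    84; 81; 9; 61; 35; 52; 4; 2; 14; 69; 88; 71; 17; 28; 67; 10; 27; 33; 21; 95; 89]];
        [:: [:: 16; 18; 23;
    12; 77; 79; 94; 54; 97; 29; 51; 67; 80; 56; 15; 50; 62; 70; 75; 82; 32; 19]]; [:: [:: 70; 65; 93; 3;
    49; 48; 92; 37; 44; 17; 39; 21; 31; 0; 46; 91; 8; 57; 64; 24; 45; 26]];
        [:: [:: 0; 92; 77; 46; 19; 72;
    91; 88; 47; 75; 83; 53; 89; 15; 4; 12; 13; 52; 97; 51; 17; 8]];
        [:: [:: 76; 12; 32; 80; 17; 49; 58; 39;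
    27; 91; 67; 15; 44; 33; 50; 35; 83; 31; 64; 42; 63; 2]];
        [:: [:: 62; 97; 45; 84; 6; 54; 8; 44; 73; 46;
    29; 74; 3; 15; 33; 49; 86; 98; 68; 7; 21; 39]];
        [:: [:: 59; 15; 42; 25; 82; 23; 14; 58; 63; 38; 26; 32;
    28; 13; 44; 96; 49; 22; 39; 90; 86; 37]];
        [:: [:: 42; 86; 64; 43; 18; 36; 45; 2; 71; 60; 65; 8; 49; 5;
    96; 7; 39; 10; 1; 17; 30; 95]];
        [:: [:: 64; 65; 69; 17; 90; 55; 50; 5; 63; 45; 7; 23; 81; 36; 34; 79;
    68; 62; 88; 19; 66; 42]]; [:: [:: 96; 67; 55; 41; 35; 30; 12; 65; 46; 79; 18; 10; 89; 16; 95; 3; 77;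
    63; 9; 84; 37; 76]];
        [:: [:: 11; 49; 12; 96; 59; 72; 80; 65; 13; 70; 25; 67; 78; 58; 77; 87; 0; 71; 8;
    27; 40; 28]];
        [:: [:: 23; 12; 93; 76; 10; 98; 38; 31; 15; 66; 44; 32; 69; 18; 67; 40; 87; 73; 94; 19;
    0; 2]];
        [:: [:: 16; 69; 35; 20; 86; 17; 7; 30; 78; 31; 42; 19; 57; 41; 5; 13; 12; 91; 81; 79; 23; 89]];
    [:: [:: 17; 37; 57; 16; 93; 59; 22; 55; 78; 9; 79; 28; 71; 33; 95; 41; 56; 36; 61; 1; 74; 27]];
        [:: [::
    28; 26; 74; 6; 40; 51; 25; 82; 92; 2; 45; 59; 22; 89; 48; 36; 9; 72; 5; 91; 20; 73]];
        [:: [:: 80; 67;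
    9; 13; 15; 57; 46; 82; 83; 47; 98; 20; 76; 7; 29; 86; 93; 45; 12; 96; 43; 1]];
        [:: [:: 56; 46; 75; 24;
    38; 20; 22; 61; 58; 2; 54; 94; 69; 15; 39; 51; 41; 59; 16; 8; 4; 18]];
        [:: [:: 66; 32; 85; 19; 55; 24;
    29; 26; 9; 57; 33; 11; 82; 7; 31; 40; 96; 13; 44; 6; 93; 80]]] in
  locate_blocks orb_k33_3 raw.

Lemma base_k33_3_ok : data_ok orb_k33_3 99 1 base_k33_3.
Proof. by vm_cast_no_check (erefl true). Qed.

Definition orb_k22_4 : seq (nat * nat) :=
  [:: (88, 4)].

Definition base_k22_4 : seq (seq (seq point)) := Eval vm_compute in
  let raw := [::
    [:: [:: 29; 11; 31; 34; 65; 58; 37; 1; 41; 44; 26; 32; 51; 24; 77; 67; 80; 70; 74; 4; 47; 69]];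
        [:: [::
    36; 54; 79; 77; 19; 16; 52; 2; 20; 28; 32; 75; 62; 30; 74; 58; 56; 59; 67; 49; 37; 44]]; [:: [:: 47;
    44; 21; 85; 39; 25; 23; 58; 79; 12; 28; 72; 5; 33; 50; 41; 45; 59; 11; 2; 27; 10]];
        [:: [:: 55; 37; 68;
    40; 84; 16; 67; 77; 26; 23; 65; 57; 62; 50; 4; 8; 15; 28; 59; 73; 71; 5]];
        [:: [:: 69; 16; 75; 55; 45;
    33; 85; 24; 6; 70; 27; 11; 4; 19; 8; 25; 52; 47; 44; 77; 14; 46]];
        [:: [:: 35; 65; 41; 72; 66; 32; 20;
    10; 18; 57; 31; 73; 63; 81; 60; 56; 24; 61; 62; 70; 33; 0]];
        [:: [:: 68; 19; 66; 50; 4; 22; 85; 36; 81;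
    27; 57; 75; 79; 24; 35; 32; 38; 53; 72; 48; 31; 10]];
        [:: [:: 35; 46; 76; 21; 23; 11; 49; 77; 78; 58;
    81; 38; 59; 56; 84; 5; 72; 14; 73; 66; 34; 68]]; [:: [:: 21; 36; 20; 48; 70; 10; 66; 13; 59; 42; 27;
    65; 84; 29; 28; 25; 49; 55; 37; 64; 62; 14]];
        [:: [:: 57; 59; 62; 22; 5; 48; 47; 87; 21; 77; 24; 46; 1;
    2; 15; 63; 54; 83; 28; 18; 85; 4]];
        [:: [:: 65; 58; 52; 38; 20; 3; 6; 26; 57; 24; 73; 67; 49; 43; 28;
    2; 62; 74; 79; 68; 69; 59]];
        [:: [:: 0; 66; 33; 38; 80; 49; 2; 12; 48; 9; 53; 1; 72; 4; 73; 14; 6; 7;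
    87; 30; 76; 60]]; [:: [:: 83; 38; 61; 20; 8; 37; 30; 52; 26; 62; 11; 41; 80; 84; 77; 85; 13; 46; 53;
    59; 18; 72]];
        [:: [:: 4; 11; 47; 46; 38; 81; 60; 62; 72; 79; 68; 39; 66; 1; 15; 41; 3; 29; 69; 55; 80;
    8]];
        [:: [:: 29; 20; 84; 80; 62; 15; 11; 81; 86; 67; 52; 4; 13; 36; 5; 34; 23; 2; 9; 58; 27; 68]]; [::
    [:: 58; 8; 81; 80; 25; 27; 83; 82; 22; 5; 52; 60; 46; 9; 61; 26; 3; 85; 12; 0; 2; 43]];
        [:: [:: 78; 44;
    72; 85; 13; 41; 11; 25; 8; 48; 22; 52; 67; 55; 74; 49; 30; 86; 9; 29; 27; 51]];
        [:: [:: 40; 39; 3; 17;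
    5; 32; 66; 21; 60; 23; 63; 55; 65; 41; 83; 31; 26; 33; 42; 6; 68; 47]];
        [:: [:: 22; 39; 33; 21; 52; 2;
    8; 6; 28; 47; 38; 74; 55; 72; 53; 3; 64; 77; 0; 51; 18; 31]];
        [:: [:: 10; 28; 0; 7; 85; 67; 82; 1; 66;
    84; 35; 72; 30; 20; 17; 80; 55; 5; 11; 3; 18; 40]]] in
  locate_blocks orb_k22_4 raw.

Lemma base_k22_4_ok : data_ok orb_k22_4 88 1 base_k22_4.
Proof. by vm_cast_no_check (erefl true). Qed.

Definition orb_k11_4 : seq (nat * nat) :=
  [:: (11, 1); (11, 1); (11, 1); (11, 1)].

Definition base_k11_4 : seq (seq (seq point)) := Eval vm_compute in
  let raw := [::
    [:: [:: 3; 18; 30; 17; 0; 27; 7; 6; 29; 28; 37; 36; 39; 33; 25; 2; 14; 11; 20; 12; 24; 38];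
        [:: 33; 23;
    4; 28; 34; 42; 30; 29; 10; 9; 11; 21; 16; 19; 41; 39; 22; 0; 2; 8; 15; 35]];
        [:: [:: 42; 4; 23; 29; 43;
    33; 8; 11; 39; 9; 14; 32; 27; 31; 25; 37; 36; 2; 21; 17; 6; 34];
        [:: 15; 3; 29; 4; 20; 11; 16; 8; 14;
    41; 36; 37; 7; 25; 30; 12; 23; 43; 21; 6; 5; 28]]; [:: [:: 5; 28; 17; 37; 38; 18; 24; 33; 7; 16; 25;
    41; 21; 43; 31; 14; 20; 3; 1; 26; 6; 22];
        [:: 15; 9; 23; 40; 35; 36; 19; 7; 4; 16; 2; 18; 3; 8; 22; 28;
    41; 13; 43; 30; 42; 25]];
        [:: [:: 7; 33; 26; 11; 16; 12; 43; 34; 5; 40; 4; 38; 31; 23; 19; 32; 29; 0;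
    41; 1; 22; 36]; [:: 24; 15; 9; 1; 42; 6; 12; 16; 29; 14; 32; 0; 11; 33; 25; 2; 41; 31; 13; 34; 10;
    18]];
        [:: [:: 3; 29; 18; 24; 39; 14; 6; 37; 43; 13; 5; 19; 35; 15; 26; 12; 8; 22; 42; 10; 31; 38]; [::
    10; 32; 34; 16; 38; 8; 30; 13; 28; 3; 29; 26; 1; 14; 17; 19; 7; 43; 6; 39; 33; 25]]; [:: [:: 21; 42;
    23; 25; 15; 26; 0; 35; 16; 17; 39; 43; 41; 4; 6; 32; 19; 8; 24; 22; 3; 37];
        [:: 8; 40; 42; 16; 32; 30;
    12; 0; 36; 28; 6; 39; 37; 21; 3; 25; 10; 14; 26; 17; 19; 4]];
        [:: [:: 2; 15; 26; 42; 35; 34; 40; 0; 6;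
    20; 11; 27; 28; 3; 36; 4; 16; 5; 39; 32; 21; 37]; [:: 7; 25; 26; 23; 18; 8; 16; 12; 19; 2; 6; 4; 42;
    41; 32; 33; 29; 24; 21; 20; 27; 37]];
        [:: [:: 26; 2; 19; 1; 31; 42; 10; 28; 22; 39; 43; 33; 17; 16; 11;
    7; 30; 38; 32; 0; 37; 15];
        [:: 37; 1; 2; 17; 33; 11; 28; 30; 32; 3; 18; 15; 8; 6; 26; 34; 16; 21; 39;
    41; 0; 22]]; [:: [:: 42; 27; 8; 9; 20; 17; 40; 39; 30; 26; 3; 2; 21; 13; 36; 38; 22; 12; 25; 29; 10;
    7]; [:: 40; 15; 32; 24; 38; 33; 18; 12; 13; 10; 8; 14; 3; 6; 25; 35; 17; 9; 23; 22; 34; 43]];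
        [:: [::
    24; 40; 2; 21; 32; 22; 35; 43; 34; 29; 38; 9; 1; 0; 12; 11; 6; 20; 14; 37; 8; 26];
        [:: 13; 36; 39; 40;
    8; 15; 20; 24; 31; 11; 26; 18; 37; 30; 19; 4; 0; 3; 38; 6; 25; 28]];
        [:: [:: 43; 16; 11; 9; 31; 42; 32;
    7; 22; 28; 37; 8; 36; 1; 15; 20; 12; 25; 6; 33; 39; 23];
        [:: 17; 26; 35; 40; 21; 33; 15; 11; 4; 9; 1;
    5; 43; 28; 16; 19; 38; 29; 27; 3; 0; 25]]; [:: [:: 31; 40; 3; 20; 30; 10; 24; 21; 37; 1; 17; 35; 16;
    41; 18; 27; 4; 32; 22; 25; 13; 36];
        [:: 38; 31; 11; 2; 4; 21; 7; 5; 35; 25; 18; 28; 42; 36; 23; 6; 8;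
    3; 20; 19; 40; 34]];
        [:: [:: 21; 5; 30; 0; 34; 23; 35; 38; 19; 31; 6; 13; 2; 17; 27; 37; 43; 29; 14; 1;
    26; 8];
        [:: 26; 36; 7; 13; 24; 16; 41; 23; 9; 10; 38; 21; 32; 3; 39; 19; 25; 34; 15; 17; 42; 2]]; [::
    [:: 39; 16; 18; 28; 36; 25; 2; 10; 8; 40; 1; 20; 11; 38; 31; 32; 14; 26; 24; 13; 3; 42]; [:: 24; 16;
    21; 13; 9; 23; 43; 40; 10; 2; 15; 42; 6; 29; 39; 27; 3; 22; 37; 7; 11; 35]]; [:: [:: 23; 41; 34; 11;
    13; 2; 15; 21; 28; 32; 31; 0; 40; 5; 17; 10; 27; 19; 30; 8; 39; 43];
        [:: 27; 37; 36; 14; 10; 0; 30; 28;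
    41; 43; 33; 35; 21; 9; 20; 32; 13; 3; 22; 4; 18; 2]];
        [:: [:: 23; 11; 5; 4; 29; 24; 22; 16; 14; 43; 7;
    2; 18; 13; 37; 31; 27; 20; 33; 36; 0; 15];
        [:: 17; 42; 34; 8; 31; 6; 5; 27; 40; 43; 39; 35; 13; 21; 26;
    22; 9; 16; 10; 29; 41; 3]];
        [:: [:: 0; 31; 30; 29; 43; 8; 13; 36; 20; 17; 2; 4; 35; 18; 6; 38; 22; 5;
    26; 32; 19; 41]; [:: 28; 20; 14; 13; 30; 1; 40; 37; 4; 42; 9; 5; 18; 38; 16; 8; 24; 15; 25; 27; 43;
    35]];
        [:: [:: 12; 36; 23; 1; 11; 16; 13; 10; 20; 24; 7; 34; 9; 37; 29; 28; 33; 38; 39; 42; 17; 26]; [::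
    36; 23; 5; 20; 15; 3; 18; 43; 26; 35; 34; 10; 24; 31; 4; 25; 6; 12; 7; 2; 16; 32]];
        [:: [:: 20; 8; 43;
    4; 23; 16; 10; 15; 35; 29; 17; 33; 9; 42; 13; 32; 26; 11; 38; 31; 5; 2];
        [:: 3; 33; 26; 23; 6; 14; 34;
    40; 4; 13; 17; 21; 29; 27; 25; 30; 20; 38; 42; 43; 9; 10]];
        [:: [:: 32; 42; 21; 17; 5; 23; 27; 43; 6;
    10; 26; 25; 38; 11; 18; 3; 7; 40; 35; 8; 19; 22];
        [:: 7; 16; 25; 32; 35; 39; 12; 3; 11; 38; 24; 21; 9;
    19; 10; 40; 41; 5; 37; 26; 28; 20]]] in
  locate_blocks orb_k11_4 raw.

Lemma base_k11_4_ok : data_ok orb_k11_4 11 2 base_k11_4.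
Proof. by vm_cast_no_check (erefl true). Qed.

(** The two parts of size 66 are the classes modulo 2 of one long orbit; the part of size 33 is a
    short orbit of the same group of order 132. *)
Definition orb_k66_2_33 : seq (nat * nat) :=
  [:: (132, 2); (33, 1)].

Definition base_k66_2_33 : seq (seq (seq point)) := Eval vm_compute in
  let raw := [::
    [:: [:: 139; 86; 35; 30; 67; 25; 84; 24; 21; 147; 132; 150; 55; 148; 11; 47; 42; 22; 102; 122; 49;
    138];
        [:: 120; 145; 162; 93; 17; 110; 131; 55; 46; 124; 2; 23; 72; 29; 99; 134; 35; 149; 135; 34; 116;
    77]];
        [:: [:: 56; 113; 157; 9; 160; 128; 5; 1; 58; 68; 93; 99; 152; 153; 137; 48; 16; 57; 80; 115; 3;
    146];
        [:: 55; 66; 52; 146; 101; 164; 31; 77; 96; 108; 100; 113; 58; 139; 57; 60; 143; 129; 78; 34; 41;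
    141]];
        [:: [:: 120; 129; 115; 99; 136; 72; 74; 144; 32; 26; 54; 79; 150; 158; 101; 5; 157; 76; 110; 33;
    104; 127];
        [:: 65; 132; 154; 66; 46; 77; 89; 100; 37; 145; 27; 22; 149; 58; 26; 114; 40; 69; 21; 148;
    79; 137]]; [:: [:: 92; 153; 129; 81; 77; 38; 98; 62; 143; 58; 144; 20; 43; 73; 156; 85; 69; 37; 56;
    157; 46; 152];
        [:: 25; 148; 22; 150; 84; 71; 61; 73; 97; 33; 101; 11; 164; 72; 116; 18; 64; 120; 139;
    155; 86; 23]];
        [:: [:: 120; 67; 143; 157; 151; 30; 107; 57; 29; 70; 73; 46; 14; 36; 15; 134; 91; 135;
    133; 84; 108; 87]; [:: 155; 121; 39; 92; 74; 161; 130; 60; 87; 49; 9; 99; 140; 139; 16; 122; 70; 61;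
    82; 67; 47; 160]];
        [:: [:: 43; 164; 159; 116; 80; 105; 118; 78; 147; 75; 63; 47; 148; 62; 112; 72; 90;
    37; 33; 99; 134; 18]; [:: 147; 42; 110; 53; 63; 99; 153; 156; 92; 102; 40; 10; 16; 29; 41; 142; 151;
    11; 114; 84; 69; 137]]; [:: [:: 151; 127; 90; 41; 100; 114; 111; 61; 143; 24; 107; 95; 145; 96; 129;
    139; 148; 52; 93; 16; 48; 157];
        [:: 1; 26; 32; 141; 107; 89; 35; 162; 4; 40; 152; 58; 74; 36; 101; 115;
    137; 129; 83; 78; 42; 159]];
        [:: [:: 123; 54; 26; 146; 93; 133; 7; 75; 131; 62; 153; 16; 138; 58; 41;
    107; 1; 122; 15; 126; 110; 150]; [:: 98; 93; 19; 150; 92; 140; 122; 86; 106; 113; 75; 31; 155; 134;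
    104; 147; 49; 83; 125; 145; 38; 26]];
        [:: [:: 105; 135; 96; 140; 16; 65; 7; 156; 24; 127; 164; 73; 4;
    30; 13; 110; 26; 148; 39; 35; 137; 116]; [:: 154; 111; 73; 120; 74; 80; 54; 146; 35; 87; 89; 159; 5;
    75; 102; 28; 158; 3; 132; 128; 114; 101]];
        [:: [:: 16; 41; 87; 159; 76; 145; 78; 14; 106; 45; 97; 131;
    147; 152; 123; 96; 140; 52; 118; 18; 81; 55];
        [:: 26; 141; 93; 19; 49; 73; 46; 112; 146; 145; 44; 72;
    89; 45; 34; 75; 133; 162; 121; 164; 18; 42]]; [:: [:: 45; 60; 4; 84; 89; 97; 134; 147; 142; 53; 135;
    136; 16; 41; 28; 100; 0; 95; 5; 98; 163; 123]; [:: 14; 156; 75; 15; 117; 91; 142; 42; 126; 163; 155;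
    124; 47; 10; 37; 60; 131; 114; 64; 63; 1; 149]];
        [:: [:: 27; 68; 164; 34; 45; 59; 87; 62; 159; 97; 74;
    120; 44; 144; 112; 138; 75; 69; 150; 137; 18; 106]; [:: 115; 126; 54; 88; 13; 161; 71; 109; 49; 137;
    26; 98; 4; 154; 94; 131; 5; 83; 159; 157; 48; 10]];
        [:: [:: 163; 42; 92; 17; 51; 156; 57; 115; 88; 140;
    6; 94; 144; 54; 127; 113; 23; 79; 93; 158; 30; 28];
        [:: 51; 145; 40; 106; 122; 36; 41; 146; 3; 27; 138;
    109; 4; 144; 78; 20; 66; 88; 137; 147; 105; 107]];
        [:: [:: 155; 95; 30; 107; 142; 10; 15; 59; 161; 32;
    58; 8; 112; 86; 131; 148; 135; 11; 5; 69; 70; 16]; [:: 161; 82; 105; 34; 151; 155; 116; 98; 123; 85;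
    96; 9; 79; 47; 162; 30; 154; 146; 112; 8; 121; 117]];
        [:: [:: 59; 78; 151; 158; 75; 95; 3; 74; 24; 115;
    164; 138; 76; 129; 32; 125; 120; 63; 82; 71; 8; 147];
        [:: 50; 93; 152; 75; 64; 48; 100; 15; 139; 8; 95;
    143; 63; 86; 131; 44; 40; 153; 85; 146; 79; 160]];
        [:: [:: 134; 14; 59; 126; 136; 47; 24; 52; 156; 81;
    103; 72; 77; 140; 10; 62; 1; 45; 138; 22; 102; 19]; [:: 130; 63; 115; 162; 151; 140; 90; 92; 37; 29;
    105; 89; 5; 53; 118; 104; 138; 157; 106; 48; 164; 59]];
        [:: [:: 161; 49; 46; 22; 24; 150; 25; 149; 41;
    131; 153; 155; 15; 39; 152; 74; 126; 72; 66; 64; 31; 1]; [:: 112; 155; 115; 73; 131; 126; 146; 116;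
    150; 88; 58; 96; 109; 5; 60; 41; 125; 67; 142; 33; 159; 38]];
        [:: [:: 4; 146; 127; 105; 22; 107; 157;
    162; 88; 40; 3; 83; 110; 120; 113; 18; 35; 43; 73; 147; 133; 14];
        [:: 40; 81; 138; 113; 132; 92; 129;
    107; 38; 16; 118; 78; 147; 9; 134; 76; 164; 127; 161; 33; 39; 32]]; [:: [:: 121; 141; 10; 34; 54; 9;
    59; 139; 93; 17; 132; 41; 48; 118; 84; 154; 89; 148; 119; 155; 57; 120];
        [:: 35; 152; 26; 20; 13; 37;
    77; 149; 39; 47; 102; 92; 144; 32; 80; 124; 3; 76; 27; 157; 21; 136]];
        [:: [:: 103; 34; 112; 158; 63;
    163; 159; 77; 73; 28; 161; 120; 11; 31; 105; 49; 26; 0; 72; 148; 164; 125]; [:: 98; 13; 59; 115; 10;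
    32; 86; 162; 139; 102; 132; 117; 134; 143; 15; 65; 28; 124; 101; 52; 70; 81]]] in
  locate_blocks orb_k66_2_33 raw.

Lemma base_k66_2_33_ok : data_ok orb_k66_2_33 132 2 base_k66_2_33.
Proof. by vm_cast_no_check (erefl true). Qed.

Definition orb_k66_3_33 : seq (nat * nat) :=
  [:: (198, 3); (33, 1)].

Definition base_k66_3_33 : seq (seq (seq point)) := Eval vm_compute in
  let raw := [::
    [:: [:: 115; 132; 164; 128; 65; 148; 102; 227; 220; 63; 213; 51; 4; 136; 56; 205; 111; 165; 177; 96;
    143; 82]; [:: 158; 108; 210; 88; 196; 179; 58; 106; 226; 62; 78; 60; 111; 47; 172; 213; 83; 55; 220;
    120; 48; 17];
        [:: 181; 159; 38; 174; 70; 158; 130; 227; 164; 128; 225; 169; 213; 96; 18; 126; 79; 37;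
    22; 41; 98; 123]];
        [:: [:: 227; 59; 126; 87; 72; 132; 207; 185; 37; 49; 211; 95; 140; 75; 36; 175; 6;
    219; 107; 50; 224; 42];
        [:: 18; 47; 127; 43; 218; 28; 176; 56; 201; 90; 11; 45; 156; 109; 112; 76; 116;
    182; 185; 168; 30; 61]; [:: 29; 108; 192; 123; 176; 202; 213; 76; 145; 206; 66; 84; 49; 56; 161; 88;
    104; 47; 169; 208; 99; 54]]; [:: [:: 121; 96; 230; 167; 203; 170; 163; 162; 226; 100; 159; 73; 150;
    123; 41; 219; 160; 34; 47; 53; 64; 3]; [:: 113; 168; 15; 21; 142; 73; 100; 227; 68; 71; 110; 39; 20;
    80; 229; 54; 193; 34; 118; 141; 158; 197];
        [:: 168; 229; 110; 207; 52; 84; 218; 82; 143; 191; 185; 133;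
    170; 167; 208; 210; 73; 175; 42; 57; 125; 20]];
        [:: [:: 108; 230; 227; 182; 133; 94; 37; 67; 190; 124;
    188; 56; 105; 66; 228; 223; 159; 89; 171; 194; 174; 79];
        [:: 180; 121; 228; 50; 126; 80; 144; 146; 172;
    57; 151; 193; 42; 159; 197; 107; 206; 225; 60; 157; 174; 130]; [:: 150; 176; 118; 205; 30; 215; 182;
    11; 142; 104; 203; 95; 33; 135; 94; 78; 57; 153; 80; 175; 191; 200]];
        [:: [:: 158; 88; 216; 211; 143;
    228; 197; 180; 50; 133; 203; 120; 57; 159; 47; 170; 160; 152; 131; 115; 126; 21];
        [:: 160; 3; 95; 203;
    172; 194; 63; 141; 192; 142; 24; 96; 211; 77; 155; 13; 25; 29; 15; 214; 35; 150];
        [:: 97; 171; 140; 33;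
    29; 210; 123; 21; 7; 58; 145; 48; 229; 92; 158; 38; 149; 43; 214; 40; 184; 207]];
        [:: [:: 69; 130; 107;
    112; 98; 113; 132; 148; 186; 117; 187; 3; 49; 173; 37; 62; 99; 211; 216; 143; 163; 90]; [:: 131; 82;
    31; 129; 134; 229; 108; 101; 13; 201; 198; 174; 100; 146; 4; 158; 194; 90; 150; 15; 219; 14];
        [:: 193;
    204; 214; 206; 100; 159; 16; 113; 166; 192; 126; 137; 72; 208; 79; 115; 163; 95; 53; 12; 222; 124]];
    [:: [:: 126; 137; 53; 215; 208; 60; 21; 19; 46; 36; 48; 70; 88; 130; 195; 182; 183; 32; 205; 133; 184;
    177];
        [:: 162; 107; 181; 170; 153; 129; 194; 71; 109; 75; 47; 201; 123; 72; 224; 215; 85; 23; 182; 90;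
    21; 219]; [:: 208; 77; 166; 49; 7; 202; 197; 3; 129; 173; 179; 215; 222; 85; 86; 189; 26; 137; 145;
    109; 98; 69]]; [:: [:: 46; 186; 59; 191; 58; 104; 203; 37; 40; 99; 213; 15; 146; 161; 179; 163; 175;
    177; 75; 21; 207; 76]; [:: 169; 161; 176; 134; 133; 225; 30; 72; 175; 13; 38; 200; 115; 49; 128; 97;
    153; 8; 105; 151; 170; 198];
        [:: 50; 45; 30; 225; 194; 155; 213; 109; 57; 146; 67; 178; 151; 191; 227;
    48; 212; 210; 69; 75; 73; 43]];
        [:: [:: 223; 133; 120; 173; 113; 182; 53; 209; 84; 34; 37; 6; 49; 109;
    118; 98; 66; 213; 165; 183; 77; 38]; [:: 217; 87; 0; 31; 224; 25; 163; 95; 69; 214; 33; 11; 84; 140;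
    28; 47; 83; 42; 229; 218; 168; 105];
        [:: 123; 181; 160; 26; 215; 69; 186; 201; 94; 132; 54; 11; 208; 7;
    101; 38; 100; 196; 168; 188; 17; 166]];
        [:: [:: 168; 65; 67; 206; 193; 105; 42; 74; 139; 195; 194; 39;
    198; 169; 137; 143; 204; 119; 53; 7; 24; 138];
        [:: 111; 1; 223; 20; 74; 50; 4; 132; 76; 200; 214; 174;
    117; 42; 29; 139; 159; 151; 196; 212; 81; 47];
        [:: 199; 61; 113; 119; 114; 107; 39; 117; 127; 160; 52;
    178; 201; 100; 155; 209; 207; 111; 15; 90; 74; 35]];
        [:: [:: 204; 12; 102; 179; 197; 136; 230; 11; 81;
    165; 189; 219; 158; 108; 41; 46; 223; 47; 181; 16; 222; 5]; [:: 153; 4; 155; 202; 74; 119; 218; 209;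
    25; 176; 48; 171; 112; 100; 110; 207; 217; 85; 137; 35; 90; 169]; [:: 12; 65; 40; 175; 81; 61; 167;
    129; 225; 95; 191; 197; 121; 138; 190; 37; 79; 159; 78; 176; 56; 99]];
        [:: [:: 145; 223; 99; 155; 116;
    66; 151; 133; 85; 120; 90; 33; 195; 29; 203; 65; 182; 83; 166; 74; 200; 111];
        [:: 83; 24; 114; 85; 121;
    160; 14; 230; 20; 44; 11; 125; 156; 195; 175; 133; 22; 220; 222; 226; 132; 45]; [:: 91; 129; 6; 98;
    176; 217; 83; 46; 103; 120; 60; 72; 30; 163; 201; 47; 205; 218; 179; 190; 111; 99]];
        [:: [:: 225; 108;
    90; 4; 122; 80; 204; 200; 168; 81; 54; 102; 79; 105; 175; 139; 140; 56; 221; 96; 113; 6];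
        [:: 172; 12;
    191; 113; 157; 167; 94; 84; 189; 109; 165; 158; 222; 215; 133; 65; 4; 103; 86; 92; 159; 192];
        [:: 182;
    206; 64; 108; 126; 1; 93; 198; 204; 157; 217; 158; 22; 32; 27; 24; 84; 156; 69; 143; 228; 53]];
        [:: [::
    182; 16; 69; 211; 128; 62; 221; 67; 0; 126; 139; 48; 34; 9; 125; 79; 230; 217; 33; 204; 143; 148]; [::
    12; 170; 47; 5; 227; 1; 3; 57; 108; 220; 87; 53; 58; 19; 219; 111; 201; 150; 134; 194; 172; 175]; [::
    171; 104; 209; 143; 117; 87; 83; 137; 19; 100; 76; 40; 172; 49; 147; 92; 50; 119; 226; 182; 186; 99]];
    [:: [:: 203; 146; 66; 59; 54; 223; 137; 8; 160; 48; 213; 170; 145; 90; 169; 93; 25; 72; 151; 215; 65;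
    161]; [:: 17; 221; 42; 103; 8; 193; 59; 207; 15; 66; 57; 51; 21; 130; 218; 214; 82; 47; 11; 133; 81;
    78];
        [:: 134; 84; 0; 60; 149; 79; 103; 23; 173; 214; 135; 136; 201; 66; 152; 55; 158; 112; 95; 54; 227;
    114]];
        [:: [:: 30; 181; 163; 44; 141; 156; 134; 113; 70; 218; 148; 62; 180; 93; 14; 149; 121; 111; 212;
    230; 89; 193]; [:: 2; 220; 138; 34; 77; 187; 53; 50; 214; 105; 61; 46; 177; 9; 24; 227; 200; 48; 68;
    155; 79; 219]; [:: 37; 113; 114; 129; 103; 60; 46; 199; 95; 112; 215; 20; 128; 23; 87; 32; 118; 213;
    76; 27; 81; 14]];
        [:: [:: 188; 228; 61; 124; 197; 17; 153; 212; 137; 120; 1; 190; 225; 39; 91; 59; 53;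
    12; 129; 6; 43; 103]; [:: 224; 8; 119; 165; 172; 189; 168; 208; 47; 164; 144; 93; 214; 169; 68; 109;
    22; 123; 91; 220; 14; 80];
        [:: 118; 165; 183; 195; 210; 203; 164; 97; 107; 80; 163; 78; 122; 192; 229;
    196; 57; 207; 117; 113; 39; 125]];
        [:: [:: 166; 18; 174; 98; 110; 214; 225; 134; 63; 141; 64; 34; 143;
    179; 148; 162; 196; 181; 211; 66; 23; 83];
        [:: 58; 84; 229; 128; 107; 10; 181; 117; 204; 165; 82; 102;
    122; 3; 140; 32; 61; 172; 70; 135; 209; 71];
        [:: 114; 166; 196; 179; 223; 2; 174; 182; 135; 208; 65; 6;
    172; 69; 221; 219; 181; 119; 153; 214; 94; 90]];
        [:: [:: 55; 212; 62; 153; 143; 155; 7; 48; 198; 184;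
    82; 114; 25; 220; 135; 227; 219; 59; 140; 194; 42; 142];
        [:: 11; 15; 90; 12; 2; 37; 82; 146; 47; 172;
    52; 216; 164; 220; 38; 72; 58; 10; 149; 57; 185; 165];
        [:: 23; 222; 148; 34; 119; 80; 96; 26; 87; 54;
    227; 200; 40; 39; 178; 209; 192; 190; 171; 5; 143; 59]]; [:: [:: 230; 186; 11; 12; 70; 56; 203; 159;
    209; 107; 108; 164; 102; 48; 111; 148; 225; 181; 58; 97; 93; 122];
        [:: 111; 127; 88; 23; 180; 38; 132;
    83; 224; 6; 218; 14; 226; 112; 179; 106; 183; 74; 42; 192; 5; 16];
        [:: 43; 84; 119; 150; 198; 83; 220;
    54; 64; 225; 124; 125; 189; 85; 26; 195; 76; 143; 92; 168; 58; 206]]] in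
  locate_blocks orb_k66_3_33 raw.

Lemma base_k66_3_33_ok : data_ok orb_k66_3_33 198 3 base_k66_3_33.
Proof. by vm_cast_no_check (erefl true). Qed.

Definition orb_k66_4_33 : seq (nat * nat) :=
  [:: (264, 4); (33, 1)].

Definition base_k66_4_33 : seq (seq (seq point)) := Eval vm_compute in
  let raw := [::
    [:: [:: 161; 99; 43; 111; 206; 22; 165; 197; 280; 12; 116; 181; 96; 147; 250; 291; 33; 106; 109; 179;
    75; 92]; [:: 279; 175; 112; 157; 82; 92; 11; 178; 176; 251; 36; 123; 290; 33; 45; 69; 204; 200; 100;
    34; 55; 261];
        [:: 211; 216; 188; 78; 217; 114; 61; 293; 51; 0; 100; 29; 281; 58; 113; 59; 74; 84; 264;
    116; 224; 222];
        [:: 72; 280; 217; 146; 250; 164; 104; 135; 152; 37; 169; 131; 122; 279; 284; 174; 233;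
    261; 187; 83; 278; 158]];
        [:: [:: 140; 55; 7; 280; 70; 17; 80; 78; 202; 259; 41; 184; 13; 50; 0; 177;
    260; 226; 44; 237; 292; 183];
        [:: 35; 266; 209; 140; 137; 21; 39; 26; 250; 203; 90; 281; 272; 116; 205;
    262; 263; 163; 127; 58; 249; 161]; [:: 156; 263; 280; 230; 77; 2; 76; 224; 195; 191; 250; 196; 229;
    107; 149; 14; 54; 51; 234; 199; 253; 177]; [:: 44; 173; 276; 102; 226; 242; 190; 73; 253; 274; 296;
    119; 19; 72; 10; 174; 277; 268; 234; 0; 68; 79]]; [:: [:: 34; 129; 282; 220; 188; 219; 37; 218; 127;
    133; 213; 26; 281; 288; 266; 107; 290; 113; 81; 53; 254; 96];
        [:: 263; 13; 133; 30; 60; 207; 280; 104;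
    36; 296; 82; 25; 254; 59; 33; 61; 147; 231; 150; 205; 24; 137];
        [:: 8; 123; 195; 87; 221; 280; 293; 60;
    200; 26; 3; 63; 184; 95; 43; 158; 148; 62; 233; 262; 25; 23];
        [:: 2; 215; 192; 45; 217; 260; 245; 276;
    252; 15; 55; 211; 14; 279; 202; 233; 13; 19; 7; 86; 79; 118]]; [:: [:: 125; 199; 246; 146; 50; 205;
    175; 204; 277; 249; 167; 292; 271; 52; 18; 270; 263; 46; 31; 150; 141; 90];
        [:: 22; 273; 112; 35; 124;
    14; 111; 95; 132; 264; 113; 213; 36; 183; 174; 269; 266; 41; 134; 81; 131; 64];
        [:: 135; 140; 8; 200;
    30; 5; 61; 178; 2; 119; 3; 163; 232; 118; 289; 14; 263; 296; 196; 244; 26; 40];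
        [:: 50; 227; 212; 239;
    256; 118; 107; 111; 246; 73; 114; 231; 35; 176; 97; 156; 292; 54; 123; 187; 41; 219]];
        [:: [:: 188; 93;
    218; 214; 186; 40; 31; 89; 185; 256; 155; 64; 190; 194; 246; 74; 288; 132; 240; 61; 79; 263];
        [:: 197;
    279; 295; 87; 231; 128; 124; 13; 90; 260; 177; 250; 183; 211; 293; 40; 284; 117; 271; 33; 3; 285]; [::
    5; 3; 130; 163; 200; 158; 4; 285; 56; 145; 263; 159; 98; 266; 76; 89; 193; 171; 191; 262; 136; 292];
    [:: 11; 100; 288; 4; 86; 143; 235; 32; 122; 257; 200; 53; 250; 57; 187; 227; 104; 127; 174; 113; 129;
    114]];
        [:: [:: 230; 245; 273; 281; 44; 268; 177; 161; 22; 36; 269; 39; 220; 125; 74; 236; 129; 91; 234;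
    111; 135; 276];
        [:: 202; 195; 251; 264; 77; 295; 173; 172; 93; 146; 43; 80; 20; 66; 51; 157; 141; 267;
    49; 271; 198; 4];
        [:: 167; 109; 153; 189; 56; 215; 87; 234; 240; 187; 158; 25; 253; 51; 118; 156; 50;
    243; 205; 173; 135; 68]; [:: 91; 26; 165; 124; 164; 25; 211; 281; 115; 111; 265; 223; 64; 126; 253;
    169; 114; 255; 188; 156; 75; 74]]; [:: [:: 29; 282; 151; 174; 9; 35; 110; 295; 121; 4; 47; 170; 279;
    96; 179; 268; 21; 136; 46; 291; 152; 62];
        [:: 224; 246; 29; 67; 95; 266; 228; 131; 100; 213; 106; 230;
    117; 185; 231; 243; 83; 47; 178; 17; 245; 40];
        [:: 152; 162; 253; 89; 19; 217; 160; 155; 264; 186; 22;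
    282; 50; 145; 7; 31; 27; 56; 288; 84; 170; 85];
        [:: 138; 243; 24; 87; 216; 113; 69; 270; 126; 252; 251;
    169; 272; 74; 55; 234; 244; 132; 218; 1; 145; 223]];
        [:: [:: 270; 61; 140; 246; 18; 119; 50; 272; 280;
    32; 208; 28; 211; 5; 285; 163; 94; 142; 190; 85; 212; 223]; [:: 198; 271; 157; 156; 58; 69; 80; 126;
    167; 179; 180; 173; 189; 9; 72; 251; 215; 98; 243; 70; 26; 4]; [:: 105; 191; 269; 38; 184; 205; 257;
    30; 171; 239; 34; 147; 280; 80; 129; 48; 250; 161; 247; 286; 264; 126]; [:: 282; 170; 112; 101; 199;
    36; 117; 177; 39; 95; 218; 145; 212; 79; 94; 228; 229; 288; 64; 67; 123; 137]];
        [:: [:: 181; 289; 110;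
    269; 133; 63; 247; 267; 177; 97; 156; 46; 248; 10; 168; 123; 122; 172; 231; 21; 261; 130]; [:: 149;
    208; 255; 283; 142; 129; 233; 132; 86; 117; 289; 11; 194; 58; 260; 22; 163; 105; 213; 7; 128; 98]; [::
    149; 294; 156; 107; 78; 47; 272; 177; 121; 242; 264; 33; 243; 63; 28; 260; 3; 150; 36; 8; 5; 231]; [::
    64; 217; 207; 27; 56; 222; 121; 140; 145; 146; 277; 268; 194; 16; 116; 224; 69; 117; 244; 280; 79;
    169]];
        [:: [:: 257; 144; 280; 247; 150; 201; 129; 67; 194; 132; 217; 47; 222; 175; 256; 87; 127; 153;
    80; 185; 106; 254];
        [:: 268; 83; 145; 144; 266; 216; 22; 175; 143; 49; 113; 164; 31; 261; 88; 243; 171;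
    10; 258; 279; 21; 157];
        [:: 1; 190; 51; 144; 264; 253; 100; 287; 55; 175; 257; 227; 22; 85; 220; 164;
    27; 192; 293; 81; 79; 50];
        [:: 166; 187; 89; 105; 34; 241; 15; 46; 122; 7; 215; 37; 53; 268; 173; 269;
    233; 192; 280; 283; 43; 74]];
        [:: [:: 34; 144; 155; 55; 265; 49; 260; 275; 10; 204; 120; 22; 115; 153;
    95; 281; 33; 282; 90; 259; 1; 24];
        [:: 212; 195; 138; 288; 34; 22; 48; 0; 103; 203; 176; 28; 90; 273;
    242; 205; 293; 225; 120; 171; 206; 20]; [:: 150; 9; 13; 191; 75; 288; 80; 88; 57; 74; 287; 245; 194;
    261; 256; 143; 131; 156; 267; 159; 110; 96];
        [:: 172; 159; 203; 149; 61; 116; 241; 193; 90; 227; 214;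
    158; 140; 170; 143; 266; 68; 221; 31; 39; 166; 138]];
        [:: [:: 246; 124; 241; 103; 93; 35; 30; 234; 102;
    76; 132; 242; 175; 287; 143; 278; 23; 152; 244; 108; 141; 86];
        [:: 284; 0; 230; 26; 234; 207; 155; 16;
    196; 209; 269; 121; 273; 38; 25; 95; 46; 259; 175; 23; 156; 225];
        [:: 208; 282; 54; 225; 62; 233; 191;
    68; 39; 273; 17; 231; 6; 142; 244; 14; 2; 113; 31; 139; 240; 284]; [:: 240; 186; 106; 99; 269; 100;
    180; 109; 182; 12; 128; 139; 7; 290; 124; 267; 122; 118; 173; 201; 191; 164]]; [:: [:: 183; 238; 40;
    116; 44; 165; 59; 39; 274; 283; 199; 98; 291; 158; 160; 110; 184; 89; 94; 202; 175; 135];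
        [:: 19; 233;
    113; 176; 48; 151; 91; 214; 58; 237; 179; 1; 84; 78; 195; 18; 20; 190; 81; 265; 56; 51];
        [:: 251; 281;
    274; 282; 132; 232; 22; 102; 117; 112; 230; 111; 208; 257; 64; 25; 269; 26; 146; 155; 36; 77];
        [:: 248;
    146; 174; 98; 281; 69; 192; 287; 12; 32; 153; 229; 280; 157; 46; 259; 196; 215; 57; 220; 226; 74]]; [::
    [:: 249; 72; 28; 111; 66; 74; 286; 221; 261; 293; 267; 53; 239; 182; 116; 228; 234; 134; 257; 192; 183;
    295];
        [:: 107; 145; 16; 295; 52; 59; 110; 225; 214; 23; 174; 263; 105; 25; 28; 181; 137; 74; 22; 120;
    51; 227]; [:: 225; 10; 199; 63; 40; 215; 216; 148; 9; 291; 292; 143; 280; 283; 72; 213; 118; 14; 99;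
    164; 289; 243]; [:: 70; 59; 221; 120; 275; 224; 235; 199; 93; 153; 119; 202; 162; 174; 140; 195; 22;
    161; 123; 53; 260; 176]]; [:: [:: 203; 286; 146; 222; 51; 179; 143; 132; 145; 53; 101; 193; 276; 12;
    150; 47; 182; 195; 45; 156; 65; 108];
        [:: 156; 287; 121; 222; 174; 61; 292; 66; 39; 169; 48; 184; 224;
    77; 63; 93; 49; 266; 195; 262; 23; 283];
        [:: 205; 269; 214; 268; 152; 75; 8; 296; 224; 110; 38; 58; 91;
    42; 109; 100; 249; 70; 199; 4; 159; 98];
        [:: 142; 279; 217; 23; 226; 57; 290; 234; 94; 188; 148; 249;
    98; 235; 159; 117; 71; 237; 220; 118; 144; 110]];
        [:: [:: 14; 36; 197; 223; 29; 186; 31; 228; 97; 33;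
    122; 216; 196; 10; 83; 111; 9; 254; 276; 19; 59; 1];
        [:: 97; 290; 30; 123; 13; 254; 273; 145; 279; 294;
    275; 226; 31; 10; 180; 26; 221; 163; 58; 289; 155; 174];
        [:: 146; 55; 200; 219; 145; 89; 90; 114; 206;
    85; 3; 274; 105; 229; 161; 276; 94; 203; 142; 293; 282; 8]; [:: 244; 39; 42; 75; 30; 185; 204; 231;
    256; 188; 53; 253; 101; 169; 223; 123; 68; 120; 54; 118; 84; 225]]; [:: [:: 181; 82; 120; 224; 269;
    204; 34; 1; 70; 214; 111; 48; 43; 229; 108; 76; 265; 36; 248; 67; 268; 47];
        [:: 120; 253; 99; 249; 103;
    40; 182; 105; 159; 94; 226; 274; 147; 275; 263; 125; 123; 48; 288; 8; 70; 25];
        [:: 114; 292; 39; 151;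
    211; 162; 201; 89; 154; 73; 287; 226; 256; 257; 26; 188; 160; 20; 9; 224; 111; 67];
        [:: 295; 224; 208;
    72; 274; 61; 243; 155; 117; 177; 189; 101; 22; 143; 76; 170; 30; 223; 259; 75; 280; 44]];
        [:: [:: 295;
    241; 63; 16; 108; 111; 1; 208; 109; 37; 99; 43; 180; 5; 0; 287; 223; 214; 152; 234; 169; 164];
        [:: 278;
    206; 61; 249; 177; 192; 218; 94; 124; 3; 15; 292; 146; 125; 275; 129; 279; 246; 104; 25; 18; 180]; [::
    201; 50; 128; 259; 69; 72; 287; 115; 270; 198; 148; 18; 99; 103; 48; 124; 141; 209; 247; 146; 284;
    135];
        [:: 55; 146; 173; 283; 75; 112; 226; 271; 225; 101; 172; 150; 109; 89; 187; 5; 64; 43; 108; 19;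
    73; 106]]; [:: [:: 43; 204; 253; 242; 147; 207; 8; 167; 112; 287; 193; 206; 197; 186; 243; 162; 28;
    126; 284; 24; 49; 115];
        [:: 224; 139; 265; 155; 61; 162; 45; 169; 57; 194; 91; 34; 127; 167; 163; 103;
    258; 128; 158; 275; 141; 284];
        [:: 18; 284; 135; 19; 33; 81; 229; 12; 286; 234; 186; 86; 244; 230; 212;
    295; 293; 57; 116; 39; 164; 55];
        [:: 115; 18; 53; 41; 144; 25; 238; 2; 287; 183; 159; 187; 66; 88; 201;
    73; 216; 28; 277; 82; 163; 61]];
        [:: [:: 196; 195; 291; 141; 277; 58; 169; 181; 170; 224; 85; 22; 292;
    108; 50; 46; 35; 39; 177; 286; 160; 245];
        [:: 259; 281; 6; 134; 184; 170; 195; 271; 21; 231; 243; 13;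
    60; 189; 193; 65; 122; 258; 270; 148; 207; 45]; [:: 56; 241; 77; 119; 207; 80; 176; 35; 12; 276; 48;
    60; 158; 175; 103; 154; 5; 101; 245; 93; 136; 202];
        [:: 178; 63; 279; 183; 14; 236; 77; 160; 177; 186;
    51; 140; 165; 223; 260; 270; 174; 116; 275; 53; 30; 151]]] in
  locate_blocks orb_k66_4_33 raw.

Lemma base_k66_4_33_ok : data_ok orb_k66_4_33 264 4 base_k66_4_33.
Proof. by vm_cast_no_check (erefl true). Qed.

(** * Designs of all orders *)

Lemma snarks_cubic : all (fun g => [&& size g == 22, esum g == 66 & all (fun l => size l == 3) g]) snarks.
Proof. by vm_cast_no_check (erefl true). Qed.

Lemma gdds_ok : [&& masterb (7 * 2) (fun p => p %/ 2) gdd14_4, masterb (4 * 3) (fun p => p %/ 3) td12,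
  masterb (5 * 3) (fun p => p %/ 3) gdd15, masterb (3 * 2) (fun p => p %/ 2) gdd6 &
  masterb (4 * 2) (fun p => p %/ 2) gdd8 && masterb (5 * 2) (fun p => p %/ 2) gdd10].
Proof. by vm_compute. Qed.

Lemma gdds_size : [&& all (fun b => size b == 4) (gdd14_4 ++ td12 ++ gdd15),
  all (fun b => size b == 3) (gdd6 ++ gdd8) & all (fun b => (size b == 3) || (size b == 5)) gdd10].
Proof. by vm_compute. Qed.

Opaque base_k22 base_k34 base_k55 base_k67 base_k121 base_k33_3 base_k22_4 base_k11_4 base_k66_2_33.
Opaque base_k66_3_33 base_k66_4_33 snarks others hints.

Section Orders.

Variable i : nat.
Hypothesis i20 : i < 20.

Definition nth_snark : graph := nth [::] snarks i.

Let g : graph := nth_snark.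

Let isz : i < size snarks. Proof. by rewrite size_snarks. Qed.

Let gP : [&& size g == 22, esum g == 66 & all (fun l => size l == 3) g].
Proof. exact: (allP snarks_cubic _ (mem_nth [::] isz)). Qed.

Lemma snark_wf : wf nth_snark.
Proof.
apply: wfP; apply: (allP reps_wf); rewrite mem_cat; apply/orP; left; exact: (mem_nth [::] isz).
Qed.

Lemma snark_size : size nth_snark = 22. Proof. by have /and3P[/eqP] := gP. Qed.

Lemma snark_esum : esum nth_snark = 66. Proof. by have /and3P[_ /eqP] := gP. Qed.

Lemma snark_deg u : u < 22 -> size (nb nth_snark u) = 3.
Proof.
move=> u22; have /and3P[/eqP sz _ /allP al] := gP.
by apply/eqP; apply: al; apply: mem_nth; rewrite sz.
Qed.

Lemma base_MD orb N k d : data_ok orb N k d -> MD g (part_sizes orb).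
Proof.
move=> /andP[so al].
exact: (MD_cyclic snark_wf snark_size snark_deg so (all2_nth [::] [::] al isz)).
Qed.

Let toKD n orb N k d : part_sizes orb = nseq n 1 -> data_ok orb N k d -> KD g n.
Proof. by move=> eqs /base_MD; rewrite eqs; apply: (MD1_KD snark_wf snark_size snark_deg). Qed.

Let kd22 : KD g 22. Proof. exact: toKD base_k22_ok. Qed.
Let kd34 : KD g 34. Proof. exact: toKD base_k34_ok. Qed.
Let kd55 : KD g 55. Proof. exact: toKD base_k55_ok. Qed.
Let kd67 : KD g 67. Proof. exact: toKD base_k67_ok. Qed.
Let kd121 : KD g 121. Proof. exact: toKD base_k121_ok. Qed.
Let md33_3 : MD g (nseq 3 33). Proof. exact: base_MD base_k33_3_ok. Qed.
Let md22_4 : MD g (nseq 4 22). Proof. exact: base_MD base_k22_4_ok. Qed.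
Let md11_4 : MD g (nseq 4 11). Proof. exact: base_MD base_k11_4_ok. Qed.
Let md66_2_33 : MD g (rcons (nseq 2 66) 33). Proof. exact: base_MD base_k66_2_33_ok. Qed.
Let md66_3_33 : MD g (rcons (nseq 3 66) 33). Proof. exact: base_MD base_k66_3_33_ok. Qed.
Let md66_4_33 : MD g (rcons (nseq 4 66) 33). Proof. exact: base_MD base_k66_4_33_ok. Qed.

Let size4 b : b \in gdd14_4 ++ td12 ++ gdd15 -> MD g (nseq (size b) 11).
Proof. by have /and3P[/allP al _ _] := gdds_size; move=> /al/eqP->. Qed.

Let md22_7 : MD g (nseq 7 22).
Proof.
have /and5P[ok _ _ _ _] := gdds_ok.
apply: (inflate snark_wf snark_size snark_deg (w := 11) _ ok) => // b bb.
by apply: size4; rewrite mem_cat bb.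
Qed.

Let md33_4 : MD g (nseq 4 33).
Proof.
have /and5P[_ ok _ _ _] := gdds_ok.
apply: (inflate snark_wf snark_size snark_deg (w := 11) _ ok) => // b bb.
by apply: size4; rewrite !mem_cat bb orbT.
Qed.

Let md33_5 : MD g (nseq 5 33).
Proof.
have /and5P[_ _ ok _ _] := gdds_ok.
apply: (inflate snark_wf snark_size snark_deg (w := 11) _ ok) => // b bb.
by apply: size4; rewrite !mem_cat bb !orbT.
Qed.

Let size3 b : b \in gdd6 ++ gdd8 -> MD g (nseq (size b) 33).
Proof. by have /and3P[_ /allP al _] := gdds_size; move=> /al/eqP->. Qed.

Let md66_3 : MD g (nseq 3 66).
Proof.
have /and5P[_ _ _ ok _] := gdds_ok.
apply: (inflate snark_wf snark_size snark_deg (w := 33) _ ok) => // b bb.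
by apply: size3; rewrite mem_cat bb.
Qed.

Let md66_4 : MD g (nseq 4 66).
Proof.
have /and5P[_ _ _ _ /andP[ok _]] := gdds_ok.
apply: (inflate snark_wf snark_size snark_deg (w := 33) _ ok) => // b bb.
by apply: size3; rewrite mem_cat bb orbT.
Qed.

Let md66_5 : MD g (nseq 5 66).
Proof.
have /and5P[_ _ _ _ /andP[_ ok]] := gdds_ok.
apply: (inflate snark_wf snark_size snark_deg (w := 33) _ ok) => // b bb.
have /and3P[_ _ /allP/(_ b bb)] := gdds_size.
by move=> /orP[]/eqP->.
Qed.

(** A single hole point and uniform weight; these levels yield the orders congruent to 1 modulo
    33. *)
Lemma levels33 T : 0 < T -> level g 33 33 1 T.
Proof.
have md c : 2 <= c <= 4 -> MD g (rcons (nseq c 33) 33) by case: c => [|[|[|[|[|c]]]]].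
apply: (levels snark_wf snark_size snark_deg md md); split.
- exact: (KD_HD1 kd34).
- exact: kd34.
- exact: (KD_HD1 kd67).
- exact: kd67.
Qed.

(** These levels yield the orders [66 * T + 22], after filling the hole, and [66 * T.-1 + 55]. The
    base levels are 88 and 154 points with a hole of size 22, cut out of parts of size 22, and the
    complete graphs on 55 and 121 points. *)
Lemma levels66 T : 0 < T -> level g 66 33 22 T.
Proof.
have md c : 2 <= c <= 4 -> MD g (rcons (nseq c 66) 66) by case: c => [|[|[|[|[|c]]]]].
have md' c : 2 <= c <= 4 -> MD g (rcons (nseq c 66) 33) by case: c => [|[|[|[|[|c]]]]].
apply: (levels snark_wf snark_size snark_deg md md'); split.
- exact: (HD_groups snark_wf snark_size snark_deg (k := 3) md22_4 kd22).
- exact: kd55.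
- exact: (HD_groups snark_wf snark_size snark_deg (k := 6) md22_7 kd22).
- exact: kd121.
Qed.

Lemma KD1 : KD g 1.
Proof.
move=> [//|x [|//]] [|//] _ _ _; exists [::]; split=> // u v; rewrite /holed /= !inE andbT.
by case: eqVneq => //= ->; case: eqVneq => //= ->; rewrite eqxx.
Qed.

Theorem KD_exists n : 0 < n -> n %% 33 = 1 \/ n %% 33 = 22 -> KD nth_snark n.
Proof.
move=> n0 [n1|n22].
  have [q0|q0] := posnP (n %/ 33); first by rewrite (divn_eq n 33) n1 q0; exact: KD1.
  have [hd _] := levels33 q0; rewrite (divn_eq n 33) n1 mulnC addn1.
  exact: HD1_KD.
pose q := n %/ 33; have nq : n = 33 * q + 22 by rewrite {1}(divn_eq n 33) n22 mulnC.
(* For odd [q] the order is [66 * q./2 + 55], the second half of a level; for even [q] it is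
   [66 * q./2 + 22], the first half with its hole filled. *)
have [od|ev] := boolP (odd q).
  have [_ kd] := levels66 (ltn0Sn q./2).
  suff -> : n = 66 * q./2.+1.-1 + 33 + 22 by [].
  by rewrite nq -{1}(odd_double_half q) od; clear; lia.
have [q0|q0] := posnP q./2.
  suff -> : n = 22 by exact: kd22.
  by rewrite nq -{1}(odd_double_half q) (negbTE ev) q0.
have [hd _] := levels66 q0.
suff -> : n = 66 * q./2 + 22 by exact: (HD_KD hd kd22).
by rewrite nq -{1}(odd_double_half q) (negbTE ev); clear; lia.
Qed.

End Orders.

Lemma uniq_flatten_inj (A B : eqType) (F : A -> seq B) s x y z :
  uniq (flatten (map F s)) -> x \in s -> y \in s -> z \in F x -> z \in F y -> x = y.
Proof.
elim: s => [//|a s IH] /=; rewrite cat_uniq => /and3P[_ /hasPn dis un].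
rewrite !inE => /predU1P[->|xs] /predU1P[->|ys] // zx zy.
- have zs : z \in flatten (map F s) by apply/flatten_mapP; exists y.
  by have := dis z zs; rewrite zx.
- have zs : z \in flatten (map F s) by apply/flatten_mapP; exists x.
  by have := dis z zs; rewrite zy.
- exact: IH.
Qed.

(** * From decompositions of lists of points to designs *)

Section Realisation.

Variables (T : finType) (e : rel T) (g : graph) (f : nat -> T) (n : nat).
Hypothesis esym : symmetric e.
Hypothesis eirr : irreflexive e.
Hypothesis cubic : forall x, #|[set y | e x y]| = 3.
Hypothesis card22 : #|T| = 22.
Hypothesis em : emb e g f.
Hypothesis size22 : size g = 22.
Hypothesis esum66 : esum g = 66.
Hypothesis deg3 : forall u, u < 22 -> size (nb g u) = 3.

Let wg : wf g. Proof. by case: em. Qed.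

Let imgT : img g f = setT.
Proof. by apply/eqP; rewrite eqEcard subsetT cardsT card22 (card_img em) size22. Qed.

(** The 22 labels and 66 half-edges of [g] use up all vertices and edges of the graph, so the
    embedding is an isomorphism. *)
Let adj u v : u < 22 -> v < 22 -> e (f u) (f v) = (v \in nb g u).
Proof.
rewrite -size22 => ug vg; apply/idP/idP; last exact: (emb_e em ug).
by apply: (emb_adj em) => //; rewrite imgT degsumT // card22 esum66.
Qed.

Let pl : T -> nat := place g f.

Let plP x : pl x < 22 /\ f (pl x) = x.
Proof. by rewrite -size22; apply: placeP; rewrite imgT inE. Qed.

Let plf u : u < 22 -> pl (f u) = u.
Proof.
move=> u22; have [lt eqf] := plP (f u); have [_ _ inj] := em.
by apply: inj; rewrite ?size22.
Qed.

Lemma KD_design : KD g n.+1 -> design_exists e n.+1.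
Proof.
move=> kd; pose L := [seq (0, x) | x <- iota 0 n.+1] : seq point.
have uL : uniq (L ++ [::]) by rewrite cats0 map_inj_uniq ?iota_uniq // => ? ? [].
have sL : size L = n.+1 by rewrite size_map size_iota.
have [B [/allP bB uB hB]] := kd L [::] uL sL erefl.
have memL u : (u \in L) = (u.1 == 0) && (u.2 < n.+1).
  apply/mapP/andP => [[x + ->]|[/eqP u0 un]]; first by rewrite mem_iota.
  by exists u.2; rewrite ?mem_iota //; case: u u0 {un} => ? ? /= ->.
have hB' u v : ((u, v) \in traces g B) = [&& u \in L, v \in L & u != v].
  by rewrite hB /holed cats0 !in_nil andbT.
pose io (u : point) : 'I_n.+1 := inord u.2.
pose pt (a : 'I_n.+1) : point := (0, val a).
have ioK u : u \in L -> pt (io u) = u.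
  by rewrite memL => /andP[/eqP u0 un]; rewrite /pt /io /= inordK //; case: u u0 {un} => ? ? /= ->.
have ptL a : pt a \in L by rewrite memL /= ltn_ord.
have pt_inj a c : pt a = pt c -> a = c by move=> [] /val_inj.
have szb b : b \in B -> size b = 22 by move=> /bB/andP[/eqP].
have inL b x : b \in B -> x \in b -> x \in L.
  move=> bb xb; have [y xy] := block_point size22 deg3 (szb _ bb) xb.
  have : (x, y) \in traces g B by apply/flatten_mapP; exists b.
  by rewrite hB' => /and3P[].
pose ph b x := io (nth (0, 0) b (pl x)).
have phK b x : b \in B -> pt (ph b x) = nth (0, 0) b (pl x).
  by move=> bb; apply: ioK; apply: (inL b) => //; apply: mem_nth; rewrite szb //; case: (plP x).
have ph_inj b : b \in B -> injective (ph b).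
  move=> bb x y eqp; have := phK b x bb; rewrite eqp phK // => /eqP.
  have /andP[_ ub] := bB _ bb; have [lx fx] := plP x; have [ly fy] := plP y.
  by rewrite nth_uniq ?szb // => /eqP eqpl; rewrite -fx -fy eqpl.
pose Bs b : {set {set 'I_n.+1}} := [set [set ph b p.1; ph b p.2] | p : T * T & e p.1 p.2].
have trE b x y : b \in B -> e x y -> (pt (ph b x), pt (ph b y)) \in trace g b.
  move=> bb xy; rewrite !phK //; apply/mapP; exists (pl x, pl y) => //.
  have [lx fx] := plP x; have [ly fy] := plP y.
  by rewrite (mem_half_edges size22) lx -adj // fx fy.
(* An edge determines the ordered pair only up to reversal; by symmetry of [e] the trace contains
   both orders. *)
have BsP b a c : b \in B -> [set a; c] \in Bs b -> (pt a, pt c) \in trace g b.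
  move=> bb /imsetP[[x y] + eqs]; rewrite inE /= => xy.
  have ne : ph b x != ph b y by apply: contraTneq xy => /(ph_inj b bb) ->; rewrite eirr.
  have ain : a \in [set ph b x; ph b y] by rewrite -eqs set21.
  have cin : c \in [set ph b x; ph b y] by rewrite -eqs set22.
  have xin : ph b x \in [set a; c] by rewrite eqs set21.
  have yin : ph b y \in [set a; c] by rewrite eqs set22.
  have yx : e y x by rewrite esym.
  move: ain cin xin yin; rewrite !inE => /orP[]/eqP-> /orP[]/eqP->; rewrite ?orbb => /eqP + /eqP.
  - by move=> _ h; rewrite h eqxx in ne.
  - by move=> *; apply: trE.
  - by move=> *; apply: trE.
  - by move=> h; rewrite h eqxx in ne.
have Bs_of b a c : b \in B -> (pt a, pt c) \in trace g b -> [set a; c] \in Bs b.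
  move=> bb /mapP[[u v] + [e1 e2]].
  rewrite (mem_half_edges size22) => /andP[u22 vu].
  have v22 : v < 22 by have [_ /(_ v vu)[]] := wg (u := u) (eq_ind_r (fun k => u < k) u22 size22); rewrite size22.
  have pa : a = ph b (f u) by apply: pt_inj; rewrite phK // plf //; rewrite -surjective_pairing in e1 *.
  have pc : c = ph b (f v) by apply: pt_inj; rewrite phK // plf //.
  by apply/imsetP; exists (f u, f v); rewrite ?inE /= ?adj // pa pc.
exists [set:: map Bs B]; split; last first.
  move=> S; rewrite inE => /mapP[b bb ->]; exists (ph b @: [set: T]); split.
    split.
      apply/subsetP => _ /imsetP[[x y] + ->]; rewrite inE /= => xy.
      apply/imsetP; exists (ph b x, ph b y) => //; rewrite inE /=.
      by apply: contraTneq xy => /(ph_inj b bb) ->; rewrite eirr.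
    move=> _ /imsetP[[x y] _ ->] /=; rewrite subUset !sub1set.
    by rewrite !imset_f ?inE.
  exists (ph b); split=> //; first exact: ph_inj.
  move=> x y; apply/idP/idP => [/(BsP b _ _ bb)|xy]; last by apply/imsetP; exists (x, y); rewrite ?inE.
  rewrite !phK // => /mapP[[u v] + [e1 e2]].
  rewrite (mem_half_edges size22) => /andP[u22 vu].
  have v22 : v < 22 by have [_ /(_ v vu)[]] := wg (u := u) (eq_ind_r (fun k => u < k) u22 size22); rewrite size22.
  have /andP[_ ub] := bB _ bb; have [lx fx] := plP x; have [ly fy] := plP y.
  have /eqP eu : pl x == u by rewrite -(nth_uniq (0, 0) _ _ ub) ?szb // e1.
  have /eqP ev : pl y == v by rewrite -(nth_uniq (0, 0) _ _ ub) ?szb // e2.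
  by rewrite -fx -fy adj // eu ev.
apply/and3P; split.
- rewrite eqEsubset; apply/andP; split; apply/subsetP => E.
    move=> /bigcupP[S]; rewrite inE => /mapP[b bb ->] /imsetP[[x y] + ->]; rewrite inE /= => xy.
    apply/imsetP; exists (ph b x, ph b y) => //; rewrite inE /=.
    by apply: contraTneq xy => /(ph_inj b bb) ->; rewrite eirr.
  move=> /imsetP[[a c] + ->]; rewrite inE /= => ac.
  have : (pt a, pt c) \in traces g B by rewrite hB' !ptL /=; apply: contra ac => /eqP/pt_inj ->.
  move=> /flatten_mapP[b bb tb]; apply/bigcupP; exists (Bs b); last exact: Bs_of.
  by rewrite inE map_f.
- apply/trivIsetP => S S'; rewrite !inE => /mapP[b bb ->] /mapP[b' bb' ->]; apply: contraR.
  move=> /pred0Pn[E /andP[/= Eb Eb']]; have /imsetP[[x y] _ eqE] := Eb; rewrite eqE /= in Eb Eb'.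
  by rewrite (uniq_flatten_inj uB bb bb' (BsP _ _ _ bb Eb) (BsP _ _ _ bb' Eb')).
- rewrite inE; apply/mapP => -[b bb eq0].
  have x : T by apply: (f 0).
  have : 0 < #|[set y | e x y]| by rewrite cubic.
  move=> /card_gt0P[y]; rewrite inE => xy.
  have : [set ph b x; ph b y] \in Bs b by apply/imsetP; exists (x, y); rewrite ?inE.
  by rewrite -eq0 inE.
Qed.

End Realisation.

(** * The divisibility conditions *)

Section Necessity.

Variables (T : finType) (e : rel T) (n : nat) (D : {set {set {set 'I_n}}}).
Hypothesis eirr : irreflexive e.
Hypothesis cubic : forall x, #|[set y | e x y]| = 3.
Hypothesis card22 : #|T| = 22.
Hypothesis dsgn : is_design e D.

Lemma block_degree B v : B \in D ->
  \sum_(u : 'I_n) ([set v; u] \in B : nat) = (if v \in cover B then 3 else 0).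
Proof.
move=> BD; have [_ /(_ B BD)[V [[BE BV] [f [inj fV fB]]]]] := dsgn.
rewrite -big_mkcond sum1dep_card.
have [/bigcupP[E EB vE]|vn] := boolP (v \in cover B); last first.
  apply: eq_card0 => u; rewrite inE; apply: contraNF vn => h.
  by apply/bigcupP; exists [set v; u]; rewrite ?set21.
have /imsetP[x _ vx] : v \in f @: [set: T] by rewrite fV; apply: (subsetP (BV _ EB)).
rewrite -(cubic x) -(card_imset _ inj); apply: eq_card => u; rewrite inE.
apply/idP/imsetP => [uB|[y + ->]]; last by rewrite inE vx fB.
have /imsetP[y _ uy] : u \in f @: [set: T].
  by rewrite fV; apply: (subsetP (BV _ uB)); rewrite set22.
by exists y; rewrite // inE -fB -vx -uy.
Qed.

(** A cubic graph has no isolated vertex, so the edges of a block cover its whole vertex set. *)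
Lemma block_cover B : B \in D -> #|cover B| = 22.
Proof.
move=> BD; have [_ /(_ B BD)[V [[BE BV] [f [inj fV fB]]]]] := dsgn.
rewrite -card22 -cardsT -(card_imset _ inj); apply: eq_card => v; apply/bigcupP/imsetP.
  move=> [E EB vE]; have /imsetP[x _ vx] : v \in f @: [set: T] by rewrite fV; apply: (subsetP (BV _ EB)).
  by exists x.
move=> [x _ ->]; have : 0 < #|[set y | e x y]| by rewrite cubic.
by move=> /card_gt0P[y]; rewrite inE => xy; exists [set f x; f y]; rewrite ?fB ?set21.
Qed.

(** The edges at [v] are counted by the unique block that contains each of them. *)
Lemma vertex_degree (v : 'I_n) : n.-1 = \sum_(B in D) (if v \in cover B then 3 else 0).
Proof.
have [/and3P[/eqP cov tri _] _] := dsgn.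
rewrite -(eq_bigr _ (fun B BD => block_degree v BD)) exchange_big /=.
have one u : \sum_(B in D) ([set v; u] \in B : nat) = (u != v).
  have [->|uv] := eqVneq u v.
    apply: big1 => B BD; apply/eqP; rewrite eqb0; apply/negP => h.
    have : [set v; v] \in cover D by apply/bigcupP; exists B.
    rewrite cov => /imsetP[[a c]]; rewrite inE /= => ac eqs.
    have : a \in [set v; v] by rewrite eqs set21.
    have : c \in [set v; v] by rewrite eqs set22.
    by rewrite !inE !orbb => /eqP cv /eqP av; move: ac; rewrite /complete_graph /= cv av eqxx.
  have : [set v; u] \in cover D by rewrite cov; apply/imsetP; exists (v, u); rewrite // inE /complete_graph /= eq_sym.
  move=> /bigcupP[B BD vuB]; rewrite (bigD1 B) //= vuB big1 // => B' /andP[BD' ne].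
  apply/eqP; rewrite eqb0; apply/negP => h.
  have /trivIsetP/(_ B' B BD' BD ne)/pred0P/(_ [set v; u]) := tri.
  by rewrite /= h vuB.
rewrite (eq_bigr _ (fun u _ => one u)) -big_mkcond sum1dep_card.
by have := cardC1 v; rewrite card_ord => <-; apply: eq_card => u; rewrite !inE.
Qed.

Lemma design_order : 0 < n -> n = 1 %[mod 33] \/ n = 22 %[mod 33].
Proof.
move=> n0; have v0 : 'I_n by apply: Ordinal n0.
have d3 : 3 %| n.-1.
  by rewrite (vertex_degree v0); apply: dvdn_sum => B _; case: ifP.
have d66 : n * n.-1 = #|D| * 66.
  have -> : n * n.-1 = \sum_(v : 'I_n) \sum_(B in D) (if v \in cover B then 3 else 0).
    rewrite -(eq_bigr _ (fun v _ => vertex_degree v)) sum_nat_const card_ord //.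
  rewrite exchange_big /= -sum_nat_const; apply: eq_bigr => B BD.
  by rewrite -big_mkcond sum_nat_const block_cover.
(* As 3 divides [n.-1], the residue modulo 33 is 22 if 11 divides [n], and 1 if 11 divides
   [n.-1]. *)
have d11 : 11 %| n * n.-1 by rewrite d66 dvdn_mull.
rewrite (Euclid_dvdM _ _ (isT : prime 11)) in d11.
by move: d3 n0; case/orP: d11; clear; lia.
Qed.

End Necessity.

Theorem theorem4 (T : finType) (e : rel T) (n : nat)
    (hT : #|T| = 22) (he : nontrivial_snark e) (hn : 0 < n) :
  design_exists e n <-> (n = 1 %[mod 33] \/ n = 22 %[mod 33]).
Proof.
have [[[esym eirr] _ _ cubic _] _ _] := he.
split=> [[D dsgn]|ord]; first exact: (design_order cubic hT dsgn hn).
have [i i20 [f em]] := snark_known hT he.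
have kd : KD (nth_snark i) n by apply: KD_exists.
case: n hn kd {ord} => // n _ kd.
exact: (KD_design esym eirr cubic hT em (snark_size i20) (snark_esum i20) (snark_deg i20) kd).
Qed.
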